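(* For $z \in \mathbf{No}$ define $\phi^a_{z \dotplus 1} = \varepsilon_{\flat \tau_{a \dotplus 1 \dotplus z \dotplus 1}}$ and $\phi^a_{z \dotplus (- 1)} = - \dot{\varepsilon}_{\mathord{\flat} \tau_{a \dotplus 1 \dotplus z}}^{\omega}$. Let $\Phi^a$ be the function defined on $\mathbf{No}$ by $\Phi^a (z) = \dot{\sum}_{\beta < \ell (z)} \phi^a_{z \upharpoonleft (\beta + 1)}$. For all $z \in \mathbf{No}$, we have \[ \Xi_{\mathbf{V}_a}^{\omega} z = V (a) \dotplus \Phi^a (z) . \]
   Context: Surreal numbers are sign sequences $x:\ell(x)\to\{-1,1\}$; $x\dotplus y$ is concatenation, $x\upharpoonleft\beta$ is the restriction to the first $\beta$ signs, $\dot{\sum}_{\beta<\alpha} f(\beta)$ is the transfinite concatenation $f(0)\dotplus f(1)\dotplus\cdots$, and $x\mathbin{\dot{\times}}y$ extends ordinal product; $\dot{\alpha}^{\beta}$ denotes ordinal exponentiation, so $\dot{\varepsilon}_{\gamma}^{\omega}$ is the ordinal $(\varepsilon_\gamma)$ raised to the ordinal power $\omega$. $z\mapsto\dot{\omega}^z$ is Conway's $\omega$-map parametrising the monomials $\mathbf{Mo}$, and $z\mapsto\varepsilon_z$ parametrises the class of fixed points of the $\omega$-map (extending ordinal $\varepsilon$-numbers). $\tau_z$ is the ordinal number of signs $1$ in the sign sequence of $z$. For $z\in\mathbf{No}$, $\flat z$ is the number with $z=1\dotplus\flat z$ if $z>0$, and $\flat z=-\infty$ if $z\le 0$, with conventions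 $\tau_{-\infty}=-\infty$, $\varepsilon_{-\infty}=0$. A surreal substructure is a class isomorphic to $(\mathbf{No},<,\sqsubset)$ via a unique parametrisation $\Xi$. Fix $a\in\mathbf{No}$; let $\lambda_z=\dot{\omega}^{\dot{\omega}^{\rho_z}}$ parametrise the log-atomic numbers, $\varsigma_a:=\tau_{\rho_{\omega\mathbin{\dot{\times}}a}}$, $\delta_a:=\dot{\omega}^{\varsigma_a\dotplus 1}$, and $\mathbf{V}_a := \delta_a \dotplus (- \delta_a \mathbin{\dot{\times}} \omega \mathbin{\dot{\times}} \delta_a) \dotplus \mathbf{Mo}$, the closed surreal substructure with parametrisation $\Xi_{\mathbf{V}_a}: z\mapsto \delta_a \dotplus (- \delta_a \mathbin{\dot{\times}} \omega \mathbin{\dot{\times}} \delta_a) \dotplus \dot{\omega}^z$. The class of $\mathbf{V}_a$-fixed numbers $\{v:\Xi_{\mathbf{V}_a}v=v\}$ is a surreal substructure with parametrisation $\Xi_{\mathbf{V}_a}^{\omega}$, and $V(a) := \sup_{\sqsubset} \{\Xi_{\mathbf{V}_a}^n 0 : n\in\mathbb{N}\} = \Xi_{\mathbf{V}_a}^{\omega} 0$. *)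

(* Defs.v *)
From Stdlib Require Import Arith Classical ClassicalEpsilon
  FunctionalExtensionality PropExtensionality.

(** * Well-founded recursion with a default value

    [wfrec wf d F] satisfies [wfrec_eq]: the body [F g x] may apply [g]
    everywhere, but [g] is the recursive function only below [x]. *)

Definition restr_below {A T : Type} (R : A -> A -> Prop) (d : T)
    (x : A) (g : A -> T) : A -> T :=
  fun y => if excluded_middle_informative (R y x) then g y else d.

Definition wfrec {A T : Type} {R : A -> A -> Prop} (wf : well_founded R)
    (d : T) (F : (A -> T) -> A -> T) : A -> T :=
  Fix wf (fun _ => T) (fun x rec => F (fun y =>
    match excluded_middle_informative (R y x) with
    | left h => rec y h
    | right _ => d
    end) x).

Lemma wfrec_eq {A T : Type} {R : A -> A -> Prop} (wf : well_founded R)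
    (d : T) (F : (A -> T) -> A -> T) (x : A) :
  wfrec wf d F x = F (restr_below R d x (wfrec wf d F)) x.
Proof.
unfold wfrec at 1; rewrite Fix_eq; [reflexivity|].
intros y f g Hfg; f_equal; apply functional_extensionality; intro z.
destruct excluded_middle_informative; auto.
Qed.

Lemma restr_belowE {A T : Type} (R : A -> A -> Prop) (d : T) x g y :
  R y x -> restr_below R d x g y = g y.
Proof.
intro H; unfold restr_below.
destruct excluded_middle_informative; tauto.
Qed.

(** * Ordinals

    A tree [node A f] stands for the ordinal [sup_a (f a + 1)]; [Ord] is the
    quotient of trees by equality of these ordinals.  It is closed under
    suprema of families indexed by types of the universe of [A], and plays the
    role of the class of all ordinals. *)

Inductive tree : Type := node (A : Type) (f : A -> tree).

Fixpoint tle (s t : tree) : Prop :=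
  match s, t with
  | node A f, node B g => forall a, exists b, tle (f a) (g b)
  end.

Definition tlt (s t : tree) : Prop :=
  match t with node B g => exists b, tle s (g b) end.

Definition teq (s t : tree) : Prop := tle s t /\ tle t s.

Definition Ord : Type := {C : tree -> Prop | exists t, C = teq t}.

Definition ocls (t : tree) : Ord := exist _ (teq t) (ex_intro _ t eq_refl).

Definition orepr (a : Ord) : tree :=
  proj1_sig (constructive_indefinite_description _ (proj2_sig a)).

Definition ole (a b : Ord) : Prop := tle (orepr a) (orepr b).
Definition olt (a b : Ord) : Prop := tlt (orepr a) (orepr b).

Lemma tle_refl t : tle t t.
Proof. induction t as [A f IH]; simpl; intro a; exists a; auto. Qed.

Lemma tle_trans s : forall t u, tle s t -> tle t u -> tle s u.
Proof.
induction s as [A f IH]; intros [B g] [C h] H1 H2; simpl in *; intro a.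
destruct (H1 a) as [b Hb]; destruct (H2 b) as [c Hc]; exists c; eauto.
Qed.

Lemma tlt_le_trans s t u : tlt s t -> tle t u -> tlt s u.
Proof.
destruct t as [B g], u as [C h]; simpl; intros [b Hb] H.
destruct (H b) as [c Hc]; exists c; eapply tle_trans; eauto.
Qed.

Lemma tle_lt_trans s t u : tle s t -> tlt t u -> tlt s u.
Proof.
destruct u as [C h]; intros H [c Hc].
exists c; eapply tle_trans; eauto.
Qed.

Lemma tle_child A f a : tlt (f a) (node A f).
Proof. exists a; apply tle_refl. Qed.

Lemma tle_intro A f t : (forall a, tlt (f a) t) -> tle (node A f) t.
Proof. destruct t as [B g]; intros H a; exact (H a). Qed.

Lemma tlt_le s : forall t, tlt s t -> tle s t.
Proof.
induction s as [A f IH]; intros [B g] [b Hb]; simpl; intro a; exists b.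
apply IH; eapply tlt_le_trans; [apply tle_child | exact Hb].
Qed.

Lemma tlt_wf : well_founded tlt.
Proof.
assert (H : forall t s, tle s t -> Acc tlt s).
{ induction t as [B g IH]; intros s Hs; constructor; intros r Hr.
  destruct (tlt_le_trans _ _ _ Hr Hs) as [b Hb]; eauto. }
intro t; apply (H t), tle_refl.
Qed.

Lemma tlt_irrefl t : ~ tlt t t.
Proof.
induction (tlt_wf t) as [t _ IH]; intro H; exact (IH t H H).
Qed.

Lemma tle_or_tlt s : forall t, tle s t \/ tlt t s.
Proof.
induction s as [A f IH]; intro t.
destruct (classic (forall a, tlt (f a) t)) as [H|H];
  [left; now apply tle_intro | right].
apply not_all_ex_not in H; destruct H as [a Ha]; exists a.
destruct t as [B g]; apply tle_intro; intro b.
destruct (IH a (g b)) as [K|K]; [|exact K].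
exfalso; apply Ha; exists b; exact K.
Qed.

Lemma teq_ocls s t : teq s t -> ocls s = ocls t.
Proof.
intros [H1 H2].
assert (E : teq s = teq t).
{ apply functional_extensionality; intro u; apply propositional_extensionality.
  unfold teq; split; intros [K1 K2]; split; eapply tle_trans; eauto. }
unfold ocls; apply eq_sig_hprop; [intros; apply proof_irrelevance | exact E].
Qed.

Lemma orepr_spec a : proj1_sig a = teq (orepr a).
Proof.
exact (proj2_sig (constructive_indefinite_description _ (proj2_sig a))).
Qed.

Lemma orepr_ocls t : teq (orepr (ocls t)) t.
Proof.
generalize (orepr_spec (ocls t)); simpl; intro E.
assert (H : teq t t) by (split; apply tle_refl).
rewrite E in H; exact H.
Qed.

Lemma ocls_orepr a : ocls (orepr a) = a.
Proof.
apply eq_sig_hprop; [intros; apply proof_irrelevance|].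
symmetry; apply orepr_spec.
Qed.

Lemma olt_ocls s t : olt (ocls s) (ocls t) <-> tlt s t.
Proof.
unfold olt; destruct (orepr_ocls s), (orepr_ocls t).
split; intro K; eapply tlt_le_trans; try (eapply tle_lt_trans; [|exact K]); auto.
Qed.

Lemma ole_ocls s t : ole (ocls s) (ocls t) <-> tle s t.
Proof.
unfold ole; destruct (orepr_ocls s), (orepr_ocls t).
split; intro K; eapply tle_trans; try (eapply tle_trans; [|exact K]); auto.
Qed.

Lemma olt_wf : well_founded olt.
Proof.
assert (H : forall t a, orepr a = t -> Acc olt a).
{ intro t; induction (tlt_wf t) as [t _ IH]; intros a <-.
  constructor; intros b Hb; exact (IH _ Hb b eq_refl). }
intro a; exact (H _ a eq_refl).
Qed.

Lemma olt_irrefl a : ~ olt a a.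
Proof. apply tlt_irrefl. Qed.

Lemma ole_refl a : ole a a.
Proof. apply tle_refl. Qed.

Lemma ole_trans a b c : ole a b -> ole b c -> ole a c.
Proof. apply tle_trans. Qed.

Lemma olt_le a b : olt a b -> ole a b.
Proof. apply tlt_le. Qed.

Lemma olt_le_trans a b c : olt a b -> ole b c -> olt a c.
Proof. apply tlt_le_trans. Qed.

Lemma ole_lt_trans a b c : ole a b -> olt b c -> olt a c.
Proof. apply tle_lt_trans. Qed.

Lemma olt_trans a b c : olt a b -> olt b c -> olt a c.
Proof. intros H K; eapply olt_le_trans; [exact H | now apply olt_le]. Qed.

Lemma ole_or_olt a b : ole a b \/ olt b a.
Proof. apply tle_or_tlt. Qed.

Lemma ole_antisym a b : ole a b -> ole b a -> a = b.
Proof.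
intros H K; rewrite <- (ocls_orepr a), <- (ocls_orepr b).
apply teq_ocls; now split.
Qed.

Fixpoint ntree (n : nat) : tree :=
  match n with
  | 0 => node Empty_set (fun e => match e with end)
  | S n => node unit (fun _ => ntree n)
  end.

Definition onat (n : nat) : Ord := ocls (ntree n).
Definition oomega : Ord := ocls (node nat ntree).
Definition osucc (a : Ord) : Ord := ocls (node unit (fun _ => orepr a)).

(* [s + sup_b (g b + 1)] is the larger of [s] and [sup_b (s + g b + 1)]. *)
Fixpoint tadd (s t : tree) : tree :=
  match t with
  | node B g =>
      match s with
      | node A f => node (A + B) (fun i =>
          match i with inl a => f a | inr b => tadd s (g b) end)
      end
  end.

Definition oadd (a b : Ord) : Ord := ocls (tadd (orepr a) (orepr b)).
Definition omin (a b : Ord) : Ord :=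
  if excluded_middle_informative (ole a b) then a else b.

(* [osub b a] is the [c] with [b = a + c], for [a <= b]. *)
Definition osub (b a : Ord) : Ord :=
  epsilon (inhabits (onat 0)) (fun c => oadd a c = b).

(* The order type of a class of ordinals (when it is bounded). *)
Definition order_type (P : Ord -> Prop) : Ord :=
  epsilon (inhabits (onat 0)) (fun a => exists f : Ord -> Ord,
    (forall c, olt c a -> P (f c)) /\
    (forall c d, olt d a -> olt c d -> olt (f c) (f d)) /\
    (forall b, P b -> exists c, olt c a /\ f c = b)).

Lemma tadd_le_l s t : tle s (tadd s t).
Proof.
destruct s as [A f], t as [B g]; simpl; intro a; exists (inl a); apply tle_refl.
Qed.

Lemma tadd_le s t : forall t', tle t t' -> tle (tadd s t) (tadd s t').
Proof.
induction t as [B g IH]; intros [B' g'] H; destruct s as [A f].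
intros [a|b]; [exists (inl a); apply tle_refl|].
destruct (H b) as [b' Hb']; exists (inr b'); exact (IH b _ Hb').
Qed.

Lemma tadd_lt s t t' : tlt t t' -> tlt (tadd s t) (tadd s t').
Proof.
destruct t' as [B g], s as [A f]; intros [b Hb]; exists (inr b).
now apply tadd_le.
Qed.

Lemma tadd_surj s t : tle s t -> exists u, teq (tadd s u) t.
Proof.
induction t as [B g IH]; intro H.
set (I := {b : B | tle s (g b)}).
assert (K : forall i : I, exists u, teq (tadd s u) (g (proj1_sig i)))
  by (intros [b Hb]; exact (IH b Hb)).
set (u := fun i : I => proj1_sig (constructive_indefinite_description _ (K i))).
assert (Hu : forall i, teq (tadd s (u i)) (g (proj1_sig i)))
  by (intro i; unfold u; apply proj2_sig).
exists (node I u); destruct s as [A f]; split.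
- intros [a|i]; [exact (H a)|exists (proj1_sig i); exact (proj1 (Hu i))].
- intro b; destruct (tle_or_tlt (node A f) (g b)) as [L|[a L]].
  + exists (inr (exist _ b L)); exact (proj2 (Hu (exist _ b L))).
  + exists (inl a); exact L.
Qed.

Lemma oadd_le_l a b : ole a (oadd a b).
Proof.
unfold oadd; rewrite <- (ocls_orepr a) at 1; apply ole_ocls, tadd_le_l.
Qed.

Lemma oadd_lt a b c : olt b c -> olt (oadd a b) (oadd a c).
Proof. intro H; apply olt_ocls, tadd_lt, H. Qed.

Lemma oadd_lt_iff a b c : olt (oadd a b) (oadd a c) <-> olt b c.
Proof.
split; [intro H|apply oadd_lt].
destruct (ole_or_olt c b) as [K|K]; [exfalso|exact K].
apply (olt_irrefl (oadd a b)); eapply olt_le_trans; [exact H|].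
apply ole_ocls, tadd_le, K.
Qed.

Lemma oadd_osub a b : ole a b -> oadd a (osub b a) = b.
Proof.
intro H; unfold osub; apply epsilon_spec.
destruct (tadd_surj _ _ H) as [u Hu]; exists (ocls u).
rewrite <- (ocls_orepr b); apply teq_ocls.
destruct Hu as [H1 H2], (orepr_ocls u) as [K1 K2].
split.
- eapply tle_trans; [apply tadd_le, K1 | exact H1].
- eapply tle_trans; [exact H2 | apply tadd_le, K2].
Qed.

(** * Surreal numbers as sign sequences

    [sgn x b] is the sign number [b] of [x], and [None] from the length of [x]
    on. *)

Inductive sign : Type := minus | plus.

Definition opp_sign (s : sign) : sign :=
  match s with minus => plus | plus => minus end.

Record No : Type := MkNo {
  len : Ord;
  sgn : Ord -> option sign;
  sgn_dom : forall b, sgn b <> None <-> olt b len }.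

Lemma No_ext (x y : No) : (forall b, sgn x b = sgn y b) -> x = y.
Proof.
destruct x as [l f Hf], y as [m g Hg]; simpl; intro H.
assert (E : f = g) by now apply functional_extensionality.
subst g.
assert (E : l = m).
{ apply ole_antisym.
  - destruct (ole_or_olt l m) as [K|K]; [exact K|].
    exfalso; apply (olt_irrefl m), Hg, Hf, K.
  - destruct (ole_or_olt m l) as [K|K]; [exact K|].
    exfalso; apply (olt_irrefl l), Hf, Hg, K. }
subst m; f_equal; apply proof_irrelevance.
Qed.

Lemma sgn_None (x : No) b : ole (len x) b -> sgn x b = None.
Proof.
intro H; apply NNPP; intro K; apply sgn_dom in K.
apply (olt_irrefl b); eapply olt_le_trans; eauto.
Qed.

Declare Scope surreal_scope.
Delimit Scope surreal_scope with S.
Bind Scope surreal_scope with No.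
Local Open Scope surreal_scope.

(* Ordinals are the sequences of signs 1. *)
Program Definition of_ord (a : Ord) : No := {|
  len := a;
  sgn := fun b =>
    if excluded_middle_informative (olt b a) then Some plus else None |}.
Next Obligation.
destruct excluded_middle_informative; split; auto; try discriminate; tauto.
Qed.

Definition of_nat (n : nat) : No := of_ord (onat n).
Notation "0" := (of_nat 0) : surreal_scope.
Notation "1" := (of_nat 1) : surreal_scope.
Definition omega : No := of_ord oomega.

Program Definition neg (x : No) : No := {|
  len := len x;
  sgn := fun b => option_map opp_sign (sgn x b) |}.
Next Obligation.
rewrite <- (sgn_dom x b); destruct (sgn x b); simpl; split; auto; discriminate.
Qed.
Notation "- x" := (neg x) : surreal_scope.

(* The restriction of [x] to its first [a] signs. *)
Program Definition restrict (x : No) (a : Ord) : No := {|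
  len := omin (len x) a;
  sgn := fun b =>
    if excluded_middle_informative (olt b a) then sgn x b else None |}.
Next Obligation.
unfold omin; destruct (excluded_middle_informative (olt b a)) as [H|H];
  destruct excluded_middle_informative as [K|K]; rewrite ?sgn_dom.
- tauto.
- split; [tauto|]; intros _; destruct (ole_or_olt (len x) a); [tauto|].
  eapply olt_trans; eauto.
- split; [tauto|]; intro L; exfalso; apply H; eapply olt_le_trans; eauto.
- tauto.
Qed.

Program Definition concat (x y : No) : No := {|
  len := oadd (len x) (len y);
  sgn := fun b =>
    if excluded_middle_informative (olt b (len x)) then sgn x b
    else sgn y (osub b (len x)) |}.
Next Obligation.
destruct excluded_middle_informative as [H|H]; rewrite sgn_dom.
- split; [intros _|tauto]; eapply olt_le_trans; [exact H|apply oadd_le_l].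
- destruct (ole_or_olt (len x) b) as [K|K]; [|tauto].
  rewrite <- (oadd_lt_iff (len x)), oadd_osub by exact K; tauto.
Qed.
Notation "x ∔ y" := (concat x y) (at level 50, left associativity) : surreal_scope.

(* Lexicographic order, with [- 1 < None < 1]. *)
Definition sgn_lt (s t : option sign) : Prop :=
  match s, t with
  | Some minus, None | Some minus, Some plus | None, Some plus => True
  | _, _ => False
  end.

Definition lt (x y : No) : Prop :=
  exists b, (forall c, olt c b -> sgn x c = sgn y c) /\ sgn_lt (sgn x b) (sgn y b).
Notation "x < y" := (lt x y) : surreal_scope.

(* [x] is (strictly) simpler than [y]: an initial segment of [y]. *)
Definition simpler_eq (x y : No) : Prop :=
  forall b, olt b (len x) -> sgn y b = sgn x b.
Notation "x ⊑ y" := (simpler_eq x y) (at level 70, no associativity) : surreal_scope.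
Definition simpler (x y : No) : Prop := x ⊑ y /\ x <> y.
Notation "x ⊏ y" := (simpler x y) (at level 70, no associativity) : surreal_scope.

Lemma simpler_len x y : x ⊏ y -> olt (len x) (len y).
Proof.
intros [H N].
destruct (ole_or_olt (len y) (len x)) as [K|K]; [exfalso|exact K].
apply N, No_ext; intro b; destruct (ole_or_olt (len x) b) as [L|L].
- rewrite !sgn_None; auto; eapply ole_trans; eauto.
- symmetry; auto.
Qed.

Lemma simpler_wf : well_founded simpler.
Proof.
assert (H : forall a x, len x = a -> Acc simpler x).
{ intro a; induction (olt_wf a) as [a _ IH]; intros x <-.
  constructor; intros y Hy; exact (IH _ (simpler_len _ _ Hy) y eq_refl). }
intro x; exact (H _ x eq_refl).
Qed.

(* The supremum of a class for [⊑] (meaningful for set-sized chains). *)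
Definition sup_simpler (C : No -> Prop) : No :=
  epsilon (inhabits 0) (fun s =>
    (forall x, C x -> x ⊑ s) /\
    (forall t, (forall x, C x -> x ⊑ t) -> s ⊑ t)).

(* [f 0 ∔ f 1 ∔ ...], the concatenation of the [f b] for [b < a]. *)
Definition concat_sum (f : Ord -> No) : Ord -> No :=
  wfrec olt_wf 0 (fun rec a =>
    sup_simpler (fun x => exists b, olt b a /\ x = rec b ∔ f b)).

Lemma concat_sum_eq f a : concat_sum f a =
  sup_simpler (fun x => exists b, olt b a /\ x = concat_sum f b ∔ f b).
Proof.
unfold concat_sum at 1; rewrite wfrec_eq; fold (concat_sum f); f_equal.
apply functional_extensionality; intro z;
  apply propositional_extensionality; split; intros [b [H ->]]; exists b;
  rewrite restr_belowE; auto.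
Qed.

(* [x] concatenated along [y], with [- x] in place of [x] at the signs - 1. *)
Definition dot_mul (x y : No) : No :=
  concat_sum (fun b =>
    match sgn y b with
    | Some plus => x
    | Some minus => - x
    | None => 0
    end) (len y).
Notation "x ⨰ y" := (dot_mul x y) (at level 40, left associativity) : surreal_scope.

(* Ordinal exponentiation; [x] is meant to be an ordinal. *)
Definition dot_pow (x : No) : Ord -> No :=
  wfrec olt_wf 0 (fun rec a =>
    match excluded_middle_informative (exists b, a = osucc b) with
    | left h => rec (proj1_sig (constructive_indefinite_description _ h)) ⨰ x
    | right _ =>
        if excluded_middle_informative (a = onat 0) then 1
        else sup_simpler (fun y => exists b, olt b a /\ y = rec b)
    end).

(* The ordinal number of signs 1 in [z]. *)
Definition tau (z : No) : No := of_ord (order_type (fun b => sgn z b = Some plus)).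

(* [None] stands for [-oo]. *)
Definition flat (z : No) : option No :=
  if excluded_middle_informative (0 < z)
  then Some (epsilon (inhabits 0) (fun w => z = 1 ∔ w))
  else None.

(** * Arithmetic *)

(* The simplest number between [L] and [R]. *)
Definition cut (L R : No -> Prop) : No :=
  epsilon (inhabits 0) (fun x =>
    ((forall l, L l -> l < x) /\ (forall r, R r -> x < r)) /\
    (forall y, (forall l, L l -> l < y) -> (forall r, R r -> y < r) -> x ⊑ y)).

Definition lopt (x' x : No) : Prop := x' ⊏ x /\ x' < x.
Definition ropt (x' x : No) : Prop := x' ⊏ x /\ x < x'.

Definition add : No -> No -> No :=
  wfrec simpler_wf (fun _ => 0) (fun addx' x =>
  wfrec simpler_wf 0 (fun addx y =>
    cut
      (fun z => (exists x', lopt x' x /\ z = addx' x' y) \/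
                (exists y', lopt y' y /\ z = addx y'))
      (fun z => (exists x', ropt x' x /\ z = addx' x' y) \/
                (exists y', ropt y' y /\ z = addx y')))).
Notation "x + y" := (add x y) : surreal_scope.
Notation "x - y" := (add x (neg y)) : surreal_scope.

Definition mul : No -> No -> No :=
  wfrec simpler_wf (fun _ => 0) (fun mulx' x =>
  wfrec simpler_wf 0 (fun mulx y =>
    let opt x' y' := mulx' x' y + mulx y' - mulx' x' y' in
    cut
      (fun z => exists x' y',
         (lopt x' x /\ lopt y' y \/ ropt x' x /\ ropt y' y) /\ z = opt x' y')
      (fun z => exists x' y',
         (lopt x' x /\ ropt y' y \/ ropt x' x /\ lopt y' y) /\ z = opt x' y'))).
Notation "x * y" := (mul x y) : surreal_scope.

Lemma add_eq x y : x + y =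
  cut (fun z => (exists x', lopt x' x /\ z = x' + y) \/
                (exists y', lopt y' y /\ z = x + y'))
      (fun z => (exists x', ropt x' x /\ z = x' + y) \/
                (exists y', ropt y' y /\ z = x + y')).
Proof.
unfold add at 1; rewrite wfrec_eq, wfrec_eq; fold add.
assert (E : wfrec simpler_wf 0 (fun addx y0 => cut
      (fun z => (exists x', lopt x' x /\
          z = restr_below simpler (fun _ => 0) x add x' y0) \/
                (exists y', lopt y' y0 /\ z = addx y'))
      (fun z => (exists x', ropt x' x /\
          z = restr_below simpler (fun _ => 0) x add x' y0) \/
                (exists y', ropt y' y0 /\ z = addx y'))) = add x).
{ symmetry; unfold add at 1; rewrite wfrec_eq; reflexivity. }
rewrite E; f_equal; apply functional_extensionality; intro z;
  apply propositional_extensionality; split;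
  intros [[v [Hv ->]]|[v [Hv ->]]]; [left|right|left|right|left|right|left|right];
  exists v; split; auto; rewrite restr_belowE; auto; apply Hv.
Qed.

Lemma mul_eq x y : x * y =
  cut (fun z => exists x' y',
         (lopt x' x /\ lopt y' y \/ ropt x' x /\ ropt y' y) /\
         z = x' * y + x * y' - x' * y')
      (fun z => exists x' y',
         (lopt x' x /\ ropt y' y \/ ropt x' x /\ lopt y' y) /\
         z = x' * y + x * y' - x' * y').
Proof.
unfold mul at 1; rewrite wfrec_eq, wfrec_eq; fold mul.
match goal with |- context [restr_below simpler 0 y ?g] =>
  assert (E : g = mul x) by
    (symmetry; unfold mul at 1; rewrite wfrec_eq; reflexivity) end.
rewrite E; cbv zeta; f_equal; apply functional_extensionality; intro z;
  apply propositional_extensionality; split;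
  intros [u [v [H ->]]]; exists u, v; split; auto;
  assert (Hu : u ⊏ x) by (destruct H as [[H K]|[H K]]; apply H);
  assert (Hv : v ⊏ y) by (destruct H as [[H K]|[H K]]; apply K);
  rewrite !restr_belowE; auto.
Qed.

Definition inv (x : No) : No := epsilon (inhabits 0) (fun y => x * y = 1).
Notation "x / y" := (mul x (inv y)) : surreal_scope.

Fixpoint pow (x : No) (n : nat) : No :=
  match n with O => 1 | S n => pow x n * x end.

(* [taylor x n] is the Taylor polynomial of degree [n] of [exp] at [x]. *)
Fixpoint taylor (x : No) (n : nat) : No :=
  match n with
  | O => 1
  | S m => taylor x m + pow x n / of_nat (fact n)
  end.

(* Conway's definition of the real numbers. *)
Definition is_real (r : No) : Prop :=
  (exists n, - of_nat n < r /\ r < of_nat n) /\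
  r = cut (fun z => exists n, z = r - 1 / of_nat (S n))
          (fun z => exists n, z = r + 1 / of_nat (S n)).

(* Conway's omega-map. *)
Definition omega_map : No -> No :=
  wfrec simpler_wf 0 (fun W x => cut
    (fun z => z = 0 \/
       exists r x', is_real r /\ 0 < r /\ lopt x' x /\ z = r * W x')
    (fun z => exists r x', is_real r /\ 0 < r /\ ropt x' x /\ z = r * W x')).

Lemma omega_map_eq x : omega_map x = cut
    (fun z => z = 0 \/
       exists r x', is_real r /\ 0 < r /\ lopt x' x /\ z = r * omega_map x')
    (fun z => exists r x', is_real r /\ 0 < r /\ ropt x' x /\ z = r * omega_map x').
Proof.
unfold omega_map at 1; rewrite wfrec_eq; fold omega_map; f_equal;
  apply functional_extensionality; intro z; apply propositional_extensionality;
  [apply or_iff_compat_l|]; split; intros [r [x' [Hr [H0 [H ->]]]]];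
  exists r, x'; rewrite restr_belowE by apply H; auto.
Qed.

Definition monomial (x : No) : Prop := exists z, x = omega_map z.

(* Gonshor's exponential: the terms involving [taylor _ (2 * n + 1)] are only
   considered when that factor is positive. *)
Definition exp : No -> No :=
  wfrec simpler_wf 0 (fun E x => cut
    (fun z => z = 0 \/
       (exists x' n, lopt x' x /\ z = E x' * taylor (x - x') n) \/
       (exists x' n, ropt x' x /\ 0 < taylor (x - x') (2 * n + 1) /\
          z = E x' * taylor (x - x') (2 * n + 1)))
    (fun z =>
       (exists x' n, ropt x' x /\ z = E x' / taylor (x' - x) n) \/
       (exists x' n, lopt x' x /\ 0 < taylor (x' - x) (2 * n + 1) /\
          z = E x' / taylor (x' - x) (2 * n + 1)))).

Lemma exp_eq x : exp x = cut
    (fun z => z = 0 \/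
       (exists x' n, lopt x' x /\ z = exp x' * taylor (x - x') n) \/
       (exists x' n, ropt x' x /\ 0 < taylor (x - x') (2 * n + 1) /\
          z = exp x' * taylor (x - x') (2 * n + 1)))
    (fun z =>
       (exists x' n, ropt x' x /\ z = exp x' / taylor (x' - x) n) \/
       (exists x' n, lopt x' x /\ 0 < taylor (x' - x) (2 * n + 1) /\
          z = exp x' / taylor (x' - x) (2 * n + 1))).
Proof.
unfold exp at 1; rewrite wfrec_eq; fold exp; f_equal;
  apply functional_extensionality; intro z; apply propositional_extensionality;
  [apply or_iff_compat_l|];
  (apply Morphisms_Prop.or_iff_morphism; split; intros [x' [n H]]; exists x', n;
   assert (K : x' ⊏ x) by apply H; rewrite restr_belowE in * by exact K; exact H).
Qed.

Definition log (x : No) : No := epsilon (inhabits 0) (fun y => exp y = x).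

Definition log_atomic (x : No) : Prop :=
  (forall r, is_real r -> r < x) /\ forall n, monomial (Nat.iter n log x).

(** * Surreal substructures *)

(* [Xi] is an isomorphism from [(No, <, ⊏)] onto [(C, <, ⊏)]; the substructure
   [C] determines [Xi]. *)
Definition parametrises (Xi : No -> No) (C : No -> Prop) : Prop :=
  (forall y, C y <-> exists x, y = Xi x) /\
  (forall x y, Xi x < Xi y <-> x < y) /\
  (forall x y, Xi x ⊏ Xi y <-> x ⊏ y).

Definition fixed (f : No -> No) (x : No) : Prop := f x = x.

(** * The substructures [V_a]

    [rho] is such that [z => omega_map (omega_map (rho z))] parametrises the
    log-atomic numbers, and [eps] parametrises the fixed points of
    [omega_map]. *)

Definition sigma (rho : No -> No) (a : No) : No := tau (rho (omega ⨰ a)).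

Definition delta (rho : No -> No) (a : No) : No := omega_map (sigma rho a ∔ 1).

Definition Xi_V (rho : No -> No) (a z : No) : No :=
  delta rho a ∔ - (delta rho a ⨰ omega ⨰ delta rho a) ∔ omega_map z.

Definition V (rho : No -> No) (a : No) : No :=
  sup_simpler (fun x => exists n, x = Nat.iter n (Xi_V rho a) 0).

Definition eps_ext (eps : No -> No) (z : option No) : No :=
  match z with Some z => eps z | None => 0 end.

(* [phi eps a z s] is the number attached to the sequence [z ∔ 1] or
   [z ∔ - 1], according to the sign [s]. *)
Definition phi (eps : No -> No) (a z : No) (s : sign) : No :=
  match s with
  | plus => eps_ext eps (flat (tau (a ∔ 1 ∔ z ∔ 1)))
  | minus => - dot_pow (eps_ext eps (flat (tau (a ∔ 1 ∔ z)))) oomega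
  end.

(* The restriction of [z] to its first [b + 1] signs is [restrict z b]
   followed by the sign [sgn z b]. *)
Definition Phi (eps : No -> No) (a z : No) : No :=
  concat_sum (fun b =>
    match sgn z b with
    | Some s => phi eps a (restrict z b) s
    | None => 0
    end) (len z).

(* Main.v *)
(* The sign sequence of w^x is computed along x: passing from x to x ∔ 1 or x ∔ -1
   appends w^(tau x + 1) signs 1 or -1 to that of w^x, and w^x is continuous for ⊑.

   Let g be the function with exp (w^x) = w^(w^(g x)) and G y = g (w^y). The range of
   rho is invariant under G and its inverse. The number wmap a is obtained from a by
   replacing each sign 1 after a' by the least epsilon number above tau (wmap a') and
   each sign -1 by -omega. It satisfies G (wmap a ∔ -(n+1)) = wmap a ∔ -n, and the G-iterates of
   wmap a are wmap a ∔ t with t = 1, w^(tau + 1), w^(tau + w^(tau + 1)), ...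
   Nothing of the range of rho lies between these iterates on the branch
   above wmap a, whence rho (omega ⨰ a) = wmap a and sigma rho a is the ordinal
   epsilon_(flat (tau a)).

   Let x be fixed by Xi_V, with T = tau x. Then x ∔ c is fixed if and only if
   c = w^(T + c), and x ∔ -c if and only if c = w^(T + 1) c; the least such c > 0 are
   the epsilon number after T and T^omega, which are the blocks of Phi. *)

From HB Require Import structures.
From mathcomp Require Import all_boot all_order all_algebra zify ring lra.
From mathcomp Require Import boolp.
From Stdlib Require Import Classical ClassicalEpsilon FunctionalExtensionality PropExtensionality.
Require Import Defs.
Set Implicit Arguments. Unset Strict Implicit. Unset Printing Implicit Defensive.
Local Open Scope surreal_scope.

(** * Ordinals *)

(** The range of [rho] is given only through [log_atomic], hence through Gonshor's [exp]; so the
    ordered field and [exp] are built up here from the bare recursions. What is used of [exp] is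
    that its cut is non-empty, that it is additive on purely infinite numbers, and that it sends
    [W x] with x > 0 to some [W (W y)].

    The values of [eps], [rho] and [Xi] are identified by the same argument. A parametrisation is
    governed by simplicity, so a member of the class lying between the images of the options of x
    prolongs the image of x. This bounds the image by the candidate. Conversely the image is a
    member of the class, and leastness of the candidate or a gap in the class forces equality.

    Why these blocks are least: c = w^(T + c) with c > 0 gives c > T and w^c = c, and conversely an
    epsilon number above T absorbs T. If T = w^T, then w^(T + 1) is T times omega; starting from c
    >= 1, the equation c = w^(T + 1) c yields c >= T^n for all n. *)

Lemma oltW a b : olt a b -> ole a b. Proof. exact: olt_le. Qed.

Lemma not_olt a b : ~ olt a b <-> ole b a.
Proof.
split=> H; first by case: (ole_or_olt b a).
by move=> K; apply: (olt_irrefl a); apply: olt_le_trans K H.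
Qed.

Lemma not_ole a b : ~ ole a b <-> olt b a.
Proof.
split=> H; first by case: (ole_or_olt a b).
by move=> K; apply: (olt_irrefl b); apply: olt_le_trans H K.
Qed.

Lemma ole_eqVlt a b : ole a b <-> a = b \/ olt a b.
Proof.
split=> [H|[->|/oltW //]]; last exact: ole_refl.
case: (ole_or_olt b a) => K; [left; exact: ole_antisym | by right].
Qed.

Lemma olt_total a b : olt a b \/ a = b \/ olt b a.
Proof.
case: (ole_or_olt b a) => [/ole_eqVlt [->|]|]; [by right; left | by right; right | by left].
Qed.

Lemma ole_all a b : (forall c, olt c a -> olt c b) -> ole a b.
Proof. by move=> H; apply/not_olt => /H /olt_irrefl. Qed.

Lemma ord_ext a b : (forall c, olt c a <-> olt c b) -> a = b.
Proof. by move=> H; apply: ole_antisym; apply: ole_all => c /H. Qed.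

Lemma ex_least (P : Ord -> Prop) : (exists a, P a) ->
  exists a, P a /\ forall b, olt b a -> ~ P b.
Proof.
case=> a; elim/(well_founded_ind olt_wf): a => a IH Pa.
case: (classic (exists b, olt b a /\ P b)) => [[b [/IH]]|H]; first exact.
by exists a; split=> // b Hb Pb; apply: H; exists b.
Qed.

(** The size condition for suprema and cuts: the indexing type has to lie in the universe of the
    branching types of [tree], so that the elements of an indexed class can become the branches of
    one tree. The class of all ordinals is not small. *)
Definition small (T : Type) (P : T -> Prop) : Prop :=
  exists (A : Type) (f : A -> T), forall x, P x -> exists a, x = f a.

Lemma small_sub T (P Q : T -> Prop) :
  small Q -> (forall x, P x -> Q x) -> small P.
Proof. by move=> [A [f H]] K; exists A, f => x /K /H. Qed.

Lemma small_image S T (P : S -> Prop) (Q : T -> Prop) (f : S -> T) :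
  small P -> (forall y, Q y -> exists x, P x /\ y = f x) -> small Q.
Proof.
move=> [A [g H]] K; exists A, (fun a => f (g a)) => y /K [x [/H [a ->] ->]].
by exists a.
Qed.

Lemma small_image2 S S' T (P : S -> Prop) (P' : S' -> Prop) (Q : T -> Prop)
    (f : S -> S' -> T) :
  small P -> small P' ->
  (forall y, Q y -> exists x x', P x /\ P' x' /\ y = f x x') -> small Q.
Proof.
move=> [A [g H]] [B [h H']] K.
exists (A * B)%type, (fun a => f (g (fst a)) (h (snd a))) => y.
by case/K=> x [x' [/H [a ->] [/H' [b ->] ->]]]; exists (a, b).
Qed.

Lemma small_or T (P Q : T -> Prop) :
  small P -> small Q -> small (fun x => P x \/ Q x).
Proof.
move=> [A [g H]] [B [h K]].
exists (A + B)%type, (fun a => match a with inl a => g a | inr b => h b end).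
by move=> x [/H [a ->]|/K [b ->]]; [exists (inl a)|exists (inr b)].
Qed.

Lemma small_nat : small (fun _ : nat => True).
Proof. by exists nat, (fun n => n) => n _; exists n. Qed.

Lemma small_eq T (y : T) : small (fun x => x = y).
Proof. by exists unit, (fun _ => y) => x ->; exists tt. Qed.

Lemma small_bool : small (fun _ : bool => True).
Proof. by exists bool, (fun n => n) => n _; exists n. Qed.

Lemma small_union S T (P : S -> Prop) (Q : S -> T -> Prop) :
  small P -> (forall x, P x -> small (Q x)) ->
  small (fun y => exists x, P x /\ Q x y).
Proof.
move=> [A [g H]] K.
have D a : exists B : Type, exists h : B -> T,
    forall y, P (g a) /\ Q (g a) y -> exists b, y = h b.
  case: (classic (P (g a))) => [/K [B [h L]]|N].
    by exists B, h => y [_ /L].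
  by exists Empty_set, (fun e : Empty_set => match e with end) => y [].
pose B a := proj1_sig (constructive_indefinite_description _ (D a)).
have E a : exists h : B a -> T,
    forall y, P (g a) /\ Q (g a) y -> exists b, y = h b.
  exact: (proj2_sig (constructive_indefinite_description _ (D a))).
pose h a := proj1_sig (constructive_indefinite_description _ (E a)).
exists {a : A & B a}, (fun s => h (projT1 s) (projT2 s)) => y [x [Px Qy]].
case: (H x Px) => a Ea; rewrite Ea in Px Qy.
case: (proj2_sig (constructive_indefinite_description _ (E a)) y (conj Px Qy)).
by move=> b ->; exists (existT _ a b).
Qed.

(** Positions of the proper subtrees, at every depth. They index the ordinals below a tree: such an
    ordinal is either equal to a branch or below a branch, and the latter case recurs. *)
Fixpoint tpos (t : tree) : Type :=
  match t with node A f => {a : A & option (tpos (f a))} end.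

Fixpoint tpos_ord (t : tree) : tpos t -> Ord :=
  match t with node A f => fun p =>
    match p with
    | existT a None => ocls (f a)
    | existT a (Some q) => tpos_ord q
    end
  end.

Lemma small_below a : small (fun b => olt b a).
Proof.
exists (tpos (orepr a)), (@tpos_ord (orepr a)) => b.
rewrite -{1}(ocls_orepr a) -(ocls_orepr b) olt_ocls.
elim: (orepr a) (orepr b) => A f IH s [i Hi].
case: (classic (tle (f i) s)) => H.
  by exists (existT _ i None) => /=; apply: teq_ocls; split.
have {}H : tlt s (f i) by case: (tle_or_tlt (f i) s).
by case: (IH i s H) => p ->; exists (existT _ i (Some p)).
Qed.

(** The supremum of the successors of the elements of [P], specified by the ordinals below it so
    that [ord_ext] applies. *)
Definition ossup (P : Ord -> Prop) : Ord :=
  epsilon (inhabits (onat O)) (fun a => forall c, olt c a <-> exists b, P b /\ ole c b).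

Lemma ossupP (P : Ord -> Prop) : small P ->
  forall c, olt c (ossup P) <-> exists b, P b /\ ole c b.
Proof.
move=> [A [f H]]; rewrite /ossup; apply epsilon_spec.
exists (ocls (node {a : A | P (f a)} (fun s => orepr (f (proj1_sig s))))) => c.
rewrite -(ocls_orepr c) olt_ocls; split.
  case=> -[a Pa] /= K; exists (f a); split=> //.
  by rewrite -(ocls_orepr (f a)) ole_ocls.
case=> b [Pb K]; case: (H b Pb) => a E; rewrite {b}E in Pb K *.
by exists (exist _ a Pb) => /=; rewrite -(ocls_orepr (f a)) ole_ocls in K.
Qed.

Lemma ossup_lt P b : small P -> P b -> olt b (ossup P).
Proof. by move=> S Pb; apply/ossupP=> //; exists b; split=> //; exact: ole_refl. Qed.

(** * Successors, finite ordinals and addition *)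

Lemma olt_osucc c a : olt c (osucc a) <-> ole c a.
Proof.
rewrite -{1}(ocls_orepr c) /osucc olt_ocls /ole; split; first by case.
by move=> H; exists tt.
Qed.

Lemma osucc_gt a : olt a (osucc a).
Proof. by apply/olt_osucc/ole_refl. Qed.

Lemma osucc_le a b : ole (osucc a) b <-> olt a b.
Proof.
split=> [H|H]; first exact: olt_le_trans (osucc_gt a) H.
by apply: ole_all => c /olt_osucc K; apply: ole_lt_trans K H.
Qed.

Lemma osucc_inj a b : osucc a = osucc b -> a = b.
Proof.
by move=> H; apply: ole_antisym; apply/olt_osucc; [rewrite -H|rewrite H]; exact: osucc_gt.
Qed.

Lemma osucc_lt a b : olt (osucc a) (osucc b) <-> olt a b.
Proof. by rewrite olt_osucc osucc_le. Qed.

Lemma olt_0 c : ~ olt c (onat O).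
Proof. by rewrite -(ocls_orepr c) /onat olt_ocls => -[[]]. Qed.

Lemma ole_0 c : ole (onat O) c.
Proof. by apply/not_olt/olt_0. Qed.

Lemma ole_0_eq c : ole c (onat O) -> c = onat O.
Proof. by move=> H; apply: ole_antisym H (ole_0 _). Qed.

Lemma opos c : c <> onat O -> olt (onat O) c.
Proof. by case: (olt_total (onat O) c) => [//|[->|/olt_0]]. Qed.

Lemma onatS n : onat (S n) = osucc (onat n).
Proof.
apply: teq_ocls; split; case=> /=; exists tt; by case: (orepr_ocls (ntree n)).
Qed.

Lemma olt_omega c : olt c oomega <-> exists n, c = onat n.
Proof.
split=> [|[n ->]]; last by apply/olt_ocls; exists n; exact: tle_refl.
rewrite -{1}(ocls_orepr c) /oomega olt_ocls => -[n].
rewrite -ole_ocls -/(onat n) ocls_orepr.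
elim: n c => [|n IH] c; first by move/ole_0_eq ->; exists O.
case/ole_eqVlt => [->|]; first by exists (S n).
by rewrite onatS => /olt_osucc /IH.
Qed.

(** Addition described by the ordinals below the sum. Together with [ord_ext] this replaces trees in
    the arithmetic that follows. *)
Lemma oaddP a b c : olt c (oadd a b) <->
  olt c a \/ exists d, olt d b /\ ole c (oadd a d).
Proof.
split.
  move=> H; case: (ole_or_olt a c) => K; [right|by left].
  exists (osub c a); rewrite -(oadd_lt_iff a) oadd_osub //; split=> //.
  exact: ole_refl.
case=> [H|[d [H K]]]; first exact: olt_le_trans H (oadd_le_l _ _).
by apply: ole_lt_trans K _; apply: oadd_lt.
Qed.

Lemma oadd_le_iff a b c : ole (oadd a b) (oadd a c) <-> ole b c.
Proof. by rewrite -!not_olt oadd_lt_iff. Qed.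

Lemma oadd_inj a b c : oadd a b = oadd a c -> b = c.
Proof.
by move=> H; apply: ole_antisym; apply/(oadd_le_iff a); rewrite H; exact: ole_refl.
Qed.

Lemma osub_oadd a b : osub (oadd a b) a = b.
Proof. by apply: (@oadd_inj a); rewrite oadd_osub //; exact: oadd_le_l. Qed.

Lemma oadd0 a : oadd a (onat O) = a.
Proof.
apply: ord_ext => c; rewrite oaddP; split; last by left.
by case=> // -[d [/olt_0]].
Qed.

Lemma oadd_succ a b : oadd a (osucc b) = osucc (oadd a b).
Proof.
apply: ord_ext => c; rewrite oaddP olt_osucc; split.
  case=> [/oltW H|[d [/olt_osucc /(oadd_le_iff a) K L]]].
    exact: ole_trans H (oadd_le_l _ _).
  exact: ole_trans L K.
by move=> H; right; exists b; split=> //; exact: osucc_gt.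
Qed.

Lemma oaddA a b c : oadd a (oadd b c) = oadd (oadd a b) c.
Proof.
elim/(well_founded_ind olt_wf): c => c IH.
apply: ord_ext => d; rewrite !oaddP; split.
- case=> [|[e [/oaddP [H|[f [Hf K]]] L]]]; first by left; left.
    by left; right; exists e.
  right; exists f; split=> //; rewrite -IH //.
  by apply: ole_trans L _; apply/oadd_le_iff.
- case=> [[|[e [H K]]]|[e [H K]]]; first by left.
    right; exists e; split=> //; exact: olt_le_trans H (oadd_le_l _ _).
  right; exists (oadd b e); rewrite oadd_lt_iff IH //.
Qed.

Lemma oadd_0l b : oadd (onat O) b = b.
Proof.
elim/(well_founded_ind olt_wf): b => b IH.
apply: ord_ext => c; rewrite oaddP; split.
  by case=> [/olt_0 //|[d [H]]]; rewrite IH // => K; apply: ole_lt_trans K H.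
by move=> H; right; exists c; rewrite IH //; split=> //; exact: ole_refl.
Qed.

Lemma oadd_le_mono a a' b : ole a a' -> ole (oadd a b) (oadd a' b).
Proof.
move=> H; elim/(well_founded_ind olt_wf): b => b IH.
apply: ole_all => c /oaddP [K|[d [K L]]]; apply/oaddP.
  by left; apply: olt_le_trans K H.
by right; exists d; split=> //; apply: ole_trans L (IH _ K).
Qed.

Lemma oadd_le_r a b : ole b (oadd a b).
Proof. by rewrite -{1}(oadd_0l b); apply/oadd_le_mono/ole_0. Qed.

Lemma osucc_oadd1 a : osucc a = oadd a (onat (S O)).
Proof. by rewrite onatS oadd_succ oadd0. Qed.

(** Zero counts as a limit, so it is split off wherever it matters. *)
Definition olimit (a : Ord) : Prop := forall b, olt b a -> olt (osucc b) a.

Lemma ord_case a : (exists b, a = osucc b) \/ olimit a.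
Proof.
case: (classic (exists b, a = osucc b)); first by left.
move=> H; right=> b /osucc_le /ole_eqVlt [E|//].
by case: H; exists b.
Qed.

Lemma ominE a b : olt a b -> omin a b = a /\ omin b a = a.
Proof.
move=> H; rewrite /omin; have N : ~ ole b a by apply/not_ole.
case: excluded_middle_informative => K; case: excluded_middle_informative => L //.
by case: K; apply: oltW.
Qed.

Lemma olt_omin c a b : olt c (omin a b) <-> olt c a /\ olt c b.
Proof.
rewrite /omin; case: excluded_middle_informative => K.
  by split=> [H|[]//]; split=> //; apply: olt_le_trans H K.
move/not_ole in K.
by split=> [H|[]//]; split=> //; apply: olt_le_trans H (oltW K).
Qed.

(** * Sign sequences and cuts *)

Arguments simpler_len {x y} _.
Arguments olt_irrefl {a} _.
Arguments sgn_dom {n b}.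
Arguments No_ext {x y} _.
Arguments sgn_None {x b} _.
Arguments ole_trans {a b c} _ _.
Arguments olt_trans {a b c} _ _.
Arguments ole_lt_trans {a b c} _ _.
Arguments olt_le_trans {a b c} _ _.
Arguments ole_antisym {a b} _ _.

Definition nle (x y : No) : Prop := x = y \/ x < y.
Notation "x <= y" := (nle x y) : surreal_scope.

Lemma sgn_lt_irrefl s : ~ sgn_lt s s. Proof. by case: s => [[]|]. Qed.

Lemma sgn_lt_trans s t u : sgn_lt s t -> sgn_lt t u -> sgn_lt s u.
Proof. by case: s t u => [[]|] [[]|] [[]|]. Qed.

Lemma sgn_lt_total s t : s <> t -> sgn_lt s t \/ sgn_lt t s.
Proof. by case: s t => [[]|] [[]|] //=; auto. Qed.

Lemma lt_irrefl x : ~ x < x. Proof. by case=> b [_ /sgn_lt_irrefl]. Qed.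

Lemma lt_trans x y z : x < y -> y < z -> x < z.
Proof.
move=> [b [Hb Kb]] [c [Hc Kc]].
case: (olt_total b c) => [L|[E|L]].
- exists b; split; last by rewrite -(Hc b L).
  by move=> d Hd; rewrite Hb // Hc //; apply: olt_trans L.
- rewrite -E in Hc Kc; exists b; split; last exact: sgn_lt_trans Kc.
  by move=> d Hd; rewrite Hb // Hc.
- exists c; split; last by rewrite (Hb c L).
  by move=> d Hd; rewrite Hb ?Hc //; apply: olt_trans L.
Qed.

Lemma first_diff x y : x <> y ->
  exists b, (forall c, olt c b -> sgn x c = sgn y c) /\ sgn x b <> sgn y b.
Proof.
move=> H; have [b [Hb Kb]] : exists b, sgn x b <> sgn y b /\
    forall c, olt c b -> ~ (sgn x c <> sgn y c).
  apply: ex_least; apply: NNPP => K; apply: H; apply: No_ext => b.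
  by apply: NNPP => L; apply: K; exists b.
by exists b; split=> // c /Kb /NNPP.
Qed.

Lemma lt_total x y : x < y \/ x = y \/ y < x.
Proof.
case: (classic (x = y)) => [->|/first_diff [b [H K]]]; first by right; left.
case: (sgn_lt_total K) => L; [left|right; right]; exists b; split=> // c /H //.
Qed.

Lemma lt_asym x y : x < y -> ~ y < x.
Proof. by move=> H /(lt_trans H) /lt_irrefl. Qed.

Lemma leW x y : x < y -> x <= y. Proof. by right. Qed.
Lemma not_lt x y : ~ x < y <-> y <= x.
Proof.
split; first by case: (lt_total x y) => [//|[->|]]; [left|right].
by case=> [->|/lt_asym //]; exact: lt_irrefl.
Qed.

Lemma not_le x y : ~ x <= y <-> y < x.
Proof.
split; last by move=> H [E|/lt_asym //]; rewrite E in H; case: (lt_irrefl H).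
by move=> H; apply: NNPP => /not_lt.
Qed.

Lemma le_or_lt x y : x <= y \/ y < x.
Proof. by case: (classic (x <= y)) => [|/not_le]; [left|right]. Qed.

Lemma le_lt_trans x y z : x <= y -> y < z -> x < z.
Proof. by case=> [->//|/lt_trans]; apply. Qed.

Lemma lt_le_trans x y z : x < y -> y <= z -> x < z.
Proof. by move=> H [<-//|]; apply: lt_trans. Qed.

Lemma le_trans x y z : x <= y -> y <= z -> x <= z.
Proof. by case=> [->//|H K]; right; apply: lt_le_trans K. Qed.

Lemma le_antisym x y : x <= y -> y <= x -> x = y.
Proof. by move=> H [//|/not_le]. Qed.

Lemma simpler_refl x : x ⊑ x. Proof. by []. Qed.

Lemma simpler_len_le x y : x ⊑ y -> ole (len x) (len y).
Proof.
move=> H; apply: ole_all => b Hb; apply/sgn_dom; rewrite H //; exact/sgn_dom.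
Qed.

Lemma simpler_eq_trans x y z : x ⊑ y -> y ⊑ z -> x ⊑ z.
Proof.
move=> H K b Hb; rewrite K ?H //.
by apply: olt_le_trans Hb _; apply: simpler_len_le.
Qed.

Lemma simpler_eq_len x y : x ⊑ y -> ole (len y) (len x) -> x = y.
Proof.
move=> H K; apply: NNPP => N.
have /not_ole //: olt (len x) (len y) by exact: simpler_len.
Qed.

Lemma simpler_antisym x y : x ⊑ y -> y ⊑ x -> x = y.
Proof. by move=> H /simpler_len_le; apply: simpler_eq_len. Qed.

Lemma simpler_chain x y z : x ⊑ z -> y ⊑ z -> x ⊑ y \/ y ⊑ x.
Proof.
move=> H K; case: (ole_or_olt (len x) (len y)) => L; [left|right] => b Hb.
  by rewrite -H // -K //; apply: olt_le_trans L.
by rewrite -H ?K //; apply: olt_trans L.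
Qed.

Lemma simpler_eqVlt x y : x ⊑ y -> x = y \/ x ⊏ y.
Proof. by move=> H; case: (classic (x = y)); [left|right]. Qed.

Lemma simplerW x y : x ⊏ y -> x ⊑ y. Proof. by case. Qed.

Lemma simpler_le_lt x y z : x ⊑ y -> y ⊏ z -> x ⊏ z.
Proof.
move=> H K; split; first exact: simpler_eq_trans (simplerW K).
move=> E; have := simpler_len K; rewrite -E => /not_ole; apply; exact: simpler_len_le.
Qed.

Lemma simpler_lt_le x y z : x ⊏ y -> y ⊑ z -> x ⊏ z.
Proof.
move=> H K; split; first exact: simpler_eq_trans (simplerW H) K.
move=> E; have := simpler_len H; rewrite E => /not_ole; apply; exact: simpler_len_le.
Qed.

Lemma len_restrict x a : ole a (len x) -> len (restrict x a) = a.
Proof.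
by case/ole_eqVlt => [->|/ominE [_ //]]; rewrite /= /omin; case: excluded_middle_informative.
Qed.

Lemma sgn_restrict x a b : olt b a -> sgn (restrict x a) b = sgn x b.
Proof. by move=> H /=; case: excluded_middle_informative. Qed.

Lemma restrict_simpler x a : restrict x a ⊑ x.
Proof. by move=> b /= /olt_omin [_ H]; case: excluded_middle_informative. Qed.

Lemma restrict_len x y : y ⊑ x -> restrict x (len y) = y.
Proof.
move=> H; apply: No_ext => b /=; case: excluded_middle_informative; first exact: H.
by move/not_olt/sgn_None.
Qed.

Lemma restrict_lt x a : olt a (len x) -> restrict x a ⊏ x.
Proof.
move=> H; split; first exact: restrict_simpler.
by move=> E; have := len_restrict (oltW H); rewrite E => K; rewrite K in H; case: (olt_irrefl H).
Qed.

Lemma simpler_lt_iff m x : m ⊏ x -> (m < x <-> sgn x (len m) = Some plus).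
Proof.
move=> H; have L := simpler_len H.
have N : sgn m (len m) = None by apply/sgn_None/ole_refl.
have : sgn x (len m) <> None by apply/sgn_dom.
case E : (sgn x (len m)) => [[]|] // _; split=> // K; last first.
  exists (len m); split; last by rewrite N E.
  by move=> c /(simplerW H).
suff : x < m by move/lt_asym.
by exists (len m); split; [move=> c /(simplerW H) | rewrite N E].
Qed.

Lemma simpler_gt_iff m x : m ⊏ x -> (x < m <-> sgn x (len m) = Some minus).
Proof.
move=> H; have L := simpler_len H.
have : sgn x (len m) <> None by apply/sgn_dom.
case E : (sgn x (len m)) => [[]|] // _; split=> // K.
  have : ~ m < x by move/(simpler_lt_iff H); rewrite E.
  by move/not_lt => [K'|//]; case: H => _ [].
by move/(simpler_lt_iff H)/lt_asym: E.
Qed.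

Lemma ext_gt m x y : m ⊏ x -> m < x -> x ⊑ y -> m < y.
Proof.
move=> H /(simpler_lt_iff H) E K; apply/simpler_lt_iff; first exact: simpler_lt_le K.
by rewrite K //; exact: simpler_len.
Qed.

Lemma ext_lt m x y : m ⊏ x -> x < m -> x ⊑ y -> y < m.
Proof.
move=> H /(simpler_gt_iff H) E K; apply/simpler_gt_iff; first exact: simpler_lt_le K.
by rewrite K //; exact: simpler_len.
Qed.

(** m is the longest common initial segment; it lies between x and y because a missing sign ranks
    between the two signs. It reduces inequalities between arbitrary numbers to inequalities between
    a number and one of its initial segments. *)
Lemma lt_meet x y : x < y -> exists m, m ⊑ x /\ m ⊑ y /\ x <= m /\ m <= y.
Proof.
case=> b [H K]; pose m := restrict x b.
have Hb c : olt c b -> sgn m c = sgn x c by exact: sgn_restrict.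
have Nb : sgn m b = None.
  by rewrite /m /=; case: excluded_middle_informative => // /olt_irrefl.
have mx : m ⊑ x by exact: restrict_simpler.
have my : m ⊑ y.
  by move=> c /olt_omin [_ L]; rewrite -H // Hb.
exists m; split=> //; split=> //.
case E : (sgn x b) (K) => [[]|]; case F : (sgn y b) => [[]|] // _.
- by split; right; exists b; (split; [move=> c L; rewrite Hb // H|rewrite Nb ?E ?F]).
- split; first by right; exists b; (split; [move=> c L; rewrite Hb //|rewrite Nb ?E ?F]).
  left; apply: No_ext => c; case: (ole_or_olt b c) => [L|L]; last by rewrite Hb // H.
  have Ny : ole (len y) b by apply/not_olt => /sgn_dom.
  rewrite [RHS]sgn_None; last exact: ole_trans L.
  by rewrite /m /=; case: excluded_middle_informative => // /not_ole.
- split; last by right; exists b; (split; [move=> c L; rewrite Hb // H|rewrite Nb ?E ?F]).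
  left; apply: No_ext => c; case: (ole_or_olt b c) => [L|L]; last by rewrite Hb.
  have Ny : ole (len x) b by apply/not_olt => /sgn_dom; rewrite E.
  rewrite [LHS]sgn_None; last exact: ole_trans L.
  by rewrite /m /=; case: excluded_middle_informative => // /not_ole.
Qed.

(** A first disagreement of y with m would put y on the same side of both x and z. *)
Lemma simpler_convex m x y z : m ⊑ x -> m ⊑ z -> x <= y -> y <= z -> m ⊑ y.
Proof.
move=> mx mz [<- //|xy] [-> //|yz].
case: (classic (m ⊑ y)) => // N.
have E : exists b, olt b (len m) /\ sgn y b <> sgn m b.
  by apply: NNPP => K; apply: N => b Hb; apply: NNPP => L; apply: K; exists b.
case: (ex_least E) => b [[Hb Nb] L].
have Lb c : olt c b -> sgn y c = sgn m c.
  move=> Hc; apply: NNPP => K; apply: (L c) => //; split=> //; exact: olt_trans Hb.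
case: (sgn_lt_total Nb) => K.
  suff /lt_asym: y < x by [].
  exists b; split; last by rewrite mx.
  by move=> c Hc; rewrite Lb // mx //; apply: olt_trans Hb.
suff /lt_asym: z < y by [].
exists b; split; last by rewrite mz.
by move=> c Hc; rewrite Lb // mz //; apply: olt_trans Hb.
Qed.

(** * Cuts *)

Definition sep (L R : No -> Prop) (y : No) : Prop :=
  (forall l, L l -> l < y) /\ (forall r, R r -> y < r).
(** Relational form of [cut]. One number is a cut for many pairs of classes, and the arithmetic
    proofs consist in exchanging these pairs. It also records that a separating number exists, which
    the choice in [cut] does not guarantee. *)
Definition is_cut (L R : No -> Prop) (x : No) : Prop :=
  sep L R x /\ forall y, sep L R y -> x ⊑ y.

Lemma cut_is_cut L R : (exists y, sep L R y) -> is_cut L R (cut L R).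
Proof.
move=> [y0 H0]; rewrite /cut /is_cut /sep.
match goal with |- context [epsilon ?i ?P] => have: P (epsilon i P) end; last first.
  by case=> H K; split=> // y [??]; apply: K.
apply epsilon_spec.
(* A separating number of least length is simplest: its meet with any other separating number also
   separates and is not longer. *)
have [a [[x [Hx Ex]] Hmin]] : exists a, (exists x, sep L R x /\ len x = a) /\
    forall b, olt b a -> ~ exists x, sep L R x /\ len x = b.
  by apply: ex_least; exists (len y0), y0.
exists x; split=> // y Ly yR; case: (lt_total x y) => [|[->//|]].
  case/lt_meet=> m [mx [my [xm m_y]]].
  case: (simpler_eqVlt mx) => [<-//|/simpler_len K]; rewrite Ex in K.
  case: (Hmin _ K); exists m; split=> //; split=> [l /(proj1 Hx)|r /yR].
    by move/lt_le_trans; apply.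
  exact: le_lt_trans.
case/lt_meet=> m [my [mx [ym m_x]]].
case: (simpler_eqVlt mx) => [<-//|/simpler_len K]; rewrite Ex in K.
case: (Hmin _ K); exists m; split=> //; split=> [l /Ly|r /(proj2 Hx)].
  by move/lt_le_trans; apply.
exact: le_lt_trans.
Qed.

(** The usual way of proving equalities below: when each number lies between the options of the
    other, each is an initial segment of the other. *)
Lemma is_cut_eq L R L' R' x y :
  is_cut L R x -> is_cut L' R' y -> sep L R y -> sep L' R' x -> x = y.
Proof. by move=> [_ H] [_ K] /H ? /K ?; apply: simpler_antisym. Qed.

(** Otherwise x' would separate [L] from [R], and x would be an initial segment of its own proper
    initial segment. So the options of any cut of x dominate the canonical ones. *)
Lemma is_cut_lopt L R x x' : is_cut L R x -> lopt x' x -> exists l, L l /\ x' <= l.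
Proof.
move=> [[H1 H2] K] [S Lt]; apply: NNPP => N.
have /K : sep L R x'.
  split=> [l Ll|r /H2]; last exact: lt_trans.
  by apply/not_le => ?; apply: N; exists l.
by move=> /simpler_antisym E; case: S => /E <- [].
Qed.

Lemma is_cut_ropt L R x x' : is_cut L R x -> ropt x' x -> exists r, R r /\ r <= x'.
Proof.
move=> [[H1 H2] K] [S Lt]; apply: NNPP => N.
have /K : sep L R x'.
  split=> [l /H1 ?|r Rr]; first exact: lt_trans Lt.
  by apply/not_le => ?; apply: N; exists r.
by move=> /simpler_antisym E; case: S => /E <- [].
Qed.

Lemma is_cut_opts x : is_cut (fun l => lopt l x) (fun r => ropt r x) x.
Proof.
split; first by split=> ? [].
move=> y [H K]; case: (lt_total x y) => [|[->//|]].
  case/lt_meet=> m [mx [my [xm m_y]]].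
  case: (simpler_eqVlt mx) => [<-//|S].
  case: xm => [->//|xm]; have /K /lt_le_trans /(_ m_y) /lt_irrefl //: ropt m x by [].
case/lt_meet=> m [my [mx [ym m_x]]].
case: (simpler_eqVlt mx) => [<-//|S].
case: m_x => [<-//|xm]; have /H /(le_lt_trans ym) /lt_irrefl //: lopt m x by [].
Qed.

Lemma is_cut_cofinal L R L' R' x : is_cut L R x -> sep L' R' x ->
  (forall l, L l -> exists l', L' l' /\ l <= l') ->
  (forall r, R r -> exists r', R' r' /\ r' <= r) -> is_cut L' R' x.
Proof.
move=> [_ K] S HL HR; split=> // y [Sl Sr]; apply: K; split.
  by move=> l /HL [l' [/Sl H /le_lt_trans]]; apply.
by move=> r /HR [l' [/Sr H /(lt_le_trans H)]].
Qed.

Lemma small_simpler x : small (fun y => y ⊏ x).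
Proof.
apply: (small_image (f := fun b => restrict x b) (small_below (len x))) => y H.
exists (len y); split; first exact: simpler_len.
by rewrite restrict_len //; exact: simplerW.
Qed.

Lemma small_lopt x : small (fun y => lopt y x).
Proof. by apply: small_sub (small_simpler x) _ => y []. Qed.
Lemma small_ropt x : small (fun y => ropt y x).
Proof. by apply: small_sub (small_simpler x) _ => y []. Qed.

Lemma small_bounded (P : No -> Prop) : small P -> exists a, forall x, P x -> olt (len x) a.
Proof.
move=> S; exists (ossup (fun b => exists x, P x /\ b = len x)) => x Px.
apply: ossup_lt; last by exists x.
by apply: (small_image (f := len) S) => b [y [Py ->]]; exists y.
Qed.

(** * Suprema of chains of sign sequences *)

Section ChainSup.
Variable C : No -> Prop.
Hypothesis smallC : small C.
Hypothesis chainC : forall x y, C x -> C y -> x ⊑ y \/ y ⊑ x.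

Let lenC := ossup (fun b => exists x, C x /\ olt b (len x)).

Lemma lenC_lt b : olt b lenC <-> exists x, C x /\ olt b (len x).
Proof.
rewrite /lenC ossupP; last by apply: small_union => // x _; exact: small_below.
split=> [[c [[x [Cx H]] K]]|[x [Cx H]]].
  by exists x; split=> //; apply: ole_lt_trans H.
by exists b; split; [exists x|exact: ole_refl].
Qed.

Let sgnC b := if excluded_middle_informative (olt b lenC)
  then sgn (epsilon (inhabits (of_nat O)) (fun x => C x /\ olt b (len x))) b else None.

Lemma sgnCE x b : C x -> olt b (len x) -> sgnC b = sgn x b.
Proof.
move=> Cx H; rewrite /sgnC; case: (excluded_middle_informative (olt b lenC)) => [L|[]]; last first.
  by apply/lenC_lt; exists x.
set e := epsilon _ _.
have [Ce K] : C e /\ olt b (len e) by rewrite /e; apply epsilon_spec; exists x.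
by case: (chainC Cx Ce) => S; rewrite S.
Qed.

Lemma sgnC_dom b : sgnC b <> None <-> olt b lenC.
Proof.
split; first by rewrite /sgnC; case: (excluded_middle_informative (olt b lenC)).
by case/lenC_lt => x [Cx H]; rewrite (sgnCE Cx H); apply/sgn_dom.
Qed.

Lemma chain_sup : exists s, (forall x, C x -> x ⊑ s) /\
  (forall t, (forall x, C x -> x ⊑ t) -> s ⊑ t) /\
  (forall b, olt b (len s) -> exists x, C x /\ olt b (len x)).
Proof.
exists (@MkNo lenC sgnC sgnC_dom); split; first by move=> x Cx b Hb /=; exact: sgnCE.
split=> [t H b /lenC_lt [x [Cx K]] /=|b /lenC_lt //].
by rewrite (sgnCE Cx K) (H x Cx).
Qed.
End ChainSup.

Lemma sup_simplerP C : small C -> (forall x y, C x -> C y -> x ⊑ y \/ y ⊑ x) ->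
  (forall x, C x -> x ⊑ sup_simpler C) /\
  (forall t, (forall x, C x -> x ⊑ t) -> sup_simpler C ⊑ t).
Proof.
move=> S H; rewrite /sup_simpler; apply epsilon_spec.
by case: (chain_sup S H) => s [? [? _]]; exists s.
Qed.

Lemma sup_simpler_eq C s : (forall x, C x -> x ⊑ s) ->
  (forall t, (forall x, C x -> x ⊑ t) -> s ⊑ t) -> sup_simpler C = s.
Proof.
move=> H K; have [H' K'] : (forall x, C x -> x ⊑ sup_simpler C) /\
  (forall t, (forall x, C x -> x ⊑ t) -> sup_simpler C ⊑ t).
  by rewrite /sup_simpler; apply epsilon_spec; exists s.
by apply: simpler_antisym; [apply: K' | apply: K].
Qed.

(** * Concatenation and negation of sign sequences *)

Lemma sgn_concat_l x y b : olt b (len x) -> sgn (x ∔ y) b = sgn x b.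
Proof. by move=> H /=; case: excluded_middle_informative. Qed.

Lemma sgn_concat_r x y b : sgn (x ∔ y) (oadd (len x) b) = sgn y b.
Proof.
move=> /=; case: excluded_middle_informative => [/not_ole []|_].
  exact: oadd_le_l.
by rewrite osub_oadd.
Qed.

Lemma len_concat x y : len (x ∔ y) = oadd (len x) (len y). Proof. by []. Qed.

Lemma ord_split a b : olt b a \/ exists c, b = oadd a c.
Proof.
case: (ole_or_olt a b) => H; [right|by left].
by exists (osub b a); rewrite oadd_osub.
Qed.

Lemma concatA x y z : x ∔ (y ∔ z) = x ∔ y ∔ z.
Proof.
apply: No_ext => b; case: (ord_split (len x) b) => [H|[c ->]].
  rewrite !sgn_concat_l //; exact: olt_le_trans H (oadd_le_l _ _).
rewrite sgn_concat_r; case: (ord_split (len y) c) => [H|[d ->]].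
  have K : olt (oadd (len x) c) (len (x ∔ y)) by rewrite len_concat oadd_lt_iff.
  by rewrite (sgn_concat_l z H) (sgn_concat_l z K) sgn_concat_r.
by rewrite sgn_concat_r oaddA -len_concat sgn_concat_r.
Qed.

Lemma len0 : len 0 = onat O. Proof. by []. Qed.

Lemma len_eq0 x : len x = onat O -> x = 0.
Proof.
by move=> H; apply: No_ext => b; rewrite !sgn_None ?H //; exact: ole_0.
Qed.

Lemma simpler_0 x : 0 ⊑ x.
Proof. by move=> b; rewrite len0 => /olt_0. Qed.

Lemma concat0 x : x ∔ 0 = x.
Proof.
apply: No_ext => b; case: (ord_split (len x) b) => [H|[c ->]].
  by rewrite sgn_concat_l.
by rewrite sgn_concat_r !sgn_None //; [exact: oadd_le_l|exact: ole_0].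
Qed.

Lemma concat_0l x : 0 ∔ x = x.
Proof.
by apply: No_ext => b; rewrite -{1}(oadd_0l b) -len0 sgn_concat_r.
Qed.

Lemma concat_simpler x y : x ⊑ x ∔ y.
Proof. by move=> b; exact: sgn_concat_l. Qed.

Lemma simpler_concat x y z : x ∔ y ⊑ x ∔ z <-> y ⊑ z.
Proof.
split=> H b Hb.
  by rewrite -(sgn_concat_r x z) H ?sgn_concat_r // len_concat oadd_lt_iff.
case: (ord_split (len x) b) => [K|[c E]]; first by rewrite !sgn_concat_l.
rewrite {b}E in Hb *; rewrite !sgn_concat_r; apply: H; move: Hb.
by rewrite len_concat oadd_lt_iff.
Qed.

Lemma concat_inj x y z : x ∔ y = x ∔ z -> y = z.
Proof.
by move=> H; apply: simpler_antisym; apply/(simpler_concat x); rewrite H.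
Qed.

Lemma concat_eq_self x y : x ∔ y = x -> y = 0.
Proof. by rewrite -{2}(concat0 x) => /concat_inj. Qed.

Lemma concat_strict x y : y <> 0 -> x ⊏ x ∔ y.
Proof. by move=> H; split; [exact: concat_simpler|move=> /esym /concat_eq_self]. Qed.

Lemma simpler_strict_concat x y z : x ∔ y ⊏ x ∔ z <-> y ⊏ z.
Proof.
split=> -[H K]; split; try exact/(simpler_concat x).
- by move=> E; apply: K; rewrite E.
- by move/concat_inj.
Qed.

Lemma lt_concat x y z : y < z -> x ∔ y < x ∔ z.
Proof.
move=> [b [H K]]; exists (oadd (len x) b); rewrite !sgn_concat_r; split=> //.
move=> c Hc; case: (ord_split (len x) c) => [L|[d E]]; first by rewrite !sgn_concat_l.
rewrite {c}E in Hc *; rewrite !sgn_concat_r; apply: H; move: Hc.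
by rewrite oadd_lt_iff.
Qed.

Lemma lt_concat_iff x y z : x ∔ y < x ∔ z <-> y < z.
Proof.
split; last exact: lt_concat.
move=> H; case: (lt_total y z) => [//|[E|/(lt_concat x) /(lt_asym H) //]].
by rewrite E in H; case: (lt_irrefl H).
Qed.

Program Definition drop (x : No) (a : Ord) : No := {|
  len := if excluded_middle_informative (ole a (len x)) then osub (len x) a else onat O;
  sgn := fun b => sgn x (oadd a b) |}.
Next Obligation.
rewrite sgn_dom; case: excluded_middle_informative => H.
  by rewrite -{1}(oadd_osub _ _ H) oadd_lt_iff.
split=> [K|/olt_0 //]; case: H; apply: oltW.
exact: ole_lt_trans (oadd_le_l _ _) K.
Qed.

Lemma simpler_ex x y : x ⊑ y -> exists s, y = x ∔ s.
Proof.
move=> H; exists (drop y (len x)); apply: No_ext => b.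
case: (ord_split (len x) b) => [K|[c ->]]; first by rewrite sgn_concat_l // H.
by rewrite sgn_concat_r.
Qed.

Lemma negK x : - - x = x.
Proof. by apply: No_ext => b /=; case: (sgn x b) => [[]|]. Qed.

Lemma neg_concat x y : - (x ∔ y) = - x ∔ - y.
Proof.
apply: No_ext => b; case: (ord_split (len x) b) => [H|[c ->]].
  by rewrite (sgn_concat_l (x := - x)) //= ; case: excluded_middle_informative.
rewrite (sgn_concat_r (- x)) /=; case: excluded_middle_informative => [/not_ole []|_].
  exact: oadd_le_l.
by rewrite osub_oadd.
Qed.

Lemma neg0 : - 0 = 0. Proof. exact: len_eq0. Qed.

Lemma neg_inj x y : - x = - y -> x = y.
Proof. by move=> H; rewrite -(negK x) H negK. Qed.

Lemma lt_neg x y : x < y -> - y < - x.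
Proof.
case=> b [H K]; exists b; split=> [c /H /= -> //|/=].
by case: (sgn x b) (sgn y b) K => [[]|] [[]|].
Qed.

Lemma simpler_neg x y : x ⊑ y -> - x ⊑ - y.
Proof. by move=> H b /H /= ->. Qed.

Lemma simpler_strict_neg x y : x ⊏ y -> - x ⊏ - y.
Proof. by case=> /simpler_neg H K; split=> // /neg_inj. Qed.

Lemma sgn_ord a b : olt b a -> sgn (of_ord a) b = Some plus.
Proof. by move=> H /=; case: excluded_middle_informative. Qed.

Lemma of_ord_add a b : of_ord (oadd a b) = of_ord a ∔ of_ord b.
Proof.
apply: No_ext => c; case: (ord_split a c) => [H|[d ->]].
  rewrite sgn_concat_l // !sgn_ord //; exact: olt_le_trans H (oadd_le_l _ _).
rewrite (sgn_concat_r (of_ord a)) /=.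
case: excluded_middle_informative; rewrite oadd_lt_iff;
  by case: excluded_middle_informative.
Qed.

Lemma of_ord_simpler a b : of_ord a ⊑ of_ord b <-> ole a b.
Proof.
split=> [/simpler_len_le //|H c K]; rewrite !sgn_ord //.
exact: olt_le_trans K H.
Qed.

Arguments concat_simpler x y : clear implicits.
Arguments restrict_simpler x a : clear implicits.
Arguments simpler_0 x : clear implicits.
Arguments simpler_refl x : clear implicits.

Opaque add mul omega_map exp concat_sum dot_pow cut sup_simpler inv log.

Lemma of_ord_inj a b : of_ord a = of_ord b -> a = b.
Proof. by move=> H; have := f_equal len H. Qed.

Lemma simpler_of_ord x a : x ⊑ of_ord a -> x = of_ord (len x).
Proof.
move=> H; apply: No_ext => b; case: (ole_or_olt (len x) b) => K.
  by rewrite !sgn_None.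
rewrite -H // !sgn_ord //; apply: olt_le_trans K _.
exact: (simpler_len_le H).
Qed.

(** * Last signs and limits *)

Definition sig (s : sign) : No := match s with plus => 1 | minus => neg 1 end.

Lemma len1 : len 1 = osucc (onat O). Proof. exact: onatS. Qed.

Lemma len_sig s : len (sig s) = osucc (onat O).
Proof. by case: s; exact: len1. Qed.

Lemma len_concat_sig x s : len (x ∔ sig s) = osucc (len x).
Proof. by rewrite len_concat len_sig oadd_succ oadd0. Qed.

Lemma sgn_sig s : sgn (sig s) (onat O) = Some s.
Proof.
have H : sgn 1 (onat O) = Some plus by apply: sgn_ord; rewrite onatS; exact: osucc_gt.
by case: s => //; rewrite /sig /neg; cbn [sgn]; rewrite -/(sgn 1 _) H.
Qed.

Lemma sgn_concat_sig x s : sgn (x ∔ sig s) (len x) = Some s.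
Proof. by rewrite -{1}(oadd0 (len x)) sgn_concat_r sgn_sig. Qed.

Lemma concat_sig_strict x s : x ⊏ x ∔ sig s.
Proof.
by apply: concat_strict => E; have := sgn_sig s; rewrite E sgn_None //; exact: ole_refl.
Qed.

Lemma simpler_sig x y s : x ⊑ y -> sgn y (len x) = Some s -> x ∔ sig s ⊑ y.
Proof.
move=> H K b; rewrite len_concat_sig => /olt_osucc /ole_eqVlt [->|L].
  by rewrite sgn_concat_sig.
by rewrite sgn_concat_l // H.
Qed.

Lemma simpler_next x y : x ⊏ y -> exists s, x ∔ sig s ⊑ y.
Proof.
move=> H; have : sgn y (len x) <> None by apply/sgn_dom/simpler_len.
by case E : (sgn y (len x)) => [s|] // _; exists s; apply: simpler_sig => //; case: H.
Qed.

Lemma lt_plus x : x < x ∔ 1.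
Proof. by apply/(simpler_lt_iff (concat_sig_strict x plus)); exact: (sgn_concat_sig x plus). Qed.

Lemma lt_minus x : x ∔ neg 1 < x.
Proof. by apply/(simpler_gt_iff (concat_sig_strict x minus)); exact: (sgn_concat_sig x minus). Qed.

Lemma lt_simpler_plus x y : x ∔ 1 ⊑ y -> x < y.
Proof. by apply: ext_gt (lt_plus x); exact: (concat_sig_strict x plus). Qed.

Lemma gt_simpler_minus x y : x ∔ neg 1 ⊑ y -> y < x.
Proof. by apply: ext_lt (lt_minus x); exact: (concat_sig_strict x minus). Qed.

Lemma lopt_plus x y : lopt x y <-> x ∔ 1 ⊑ y.
Proof.
split=> [[H /(simpler_lt_iff H) K]|H].
  by apply: (simpler_sig (s := plus)) => //; case: H.
by split; [apply: simpler_lt_le H; exact: (concat_sig_strict x plus)|exact: lt_simpler_plus].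
Qed.

Lemma ropt_minus x y : ropt x y <-> x ∔ neg 1 ⊑ y.
Proof.
split=> [[H /(simpler_gt_iff H) K]|H].
  by apply: (simpler_sig (s := minus)) => //; case: H.
by split; [apply: simpler_lt_le H; exact: (concat_sig_strict x minus)|exact: gt_simpler_minus].
Qed.

Lemma strict_sig x y s : x ⊏ y ∔ sig s <-> x ⊑ y.
Proof.
split=> [H|H]; last exact: simpler_le_lt H (concat_sig_strict y s).
have := simpler_len H; rewrite len_concat_sig => /olt_osucc K.
case: (simpler_chain (simplerW H) (concat_simpler y (sig s))) => // L.
by rewrite (simpler_eq_len L).
Qed.

(** Numbers without a last sign. The number 0 is one of them, so the limit case of [No_ind] includes
    it. *)
Definition is_limit (x : No) : Prop := forall y s, y ∔ sig s ⊑ x -> y ∔ sig s ⊏ x.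

Lemma No_case x : (exists y s, x = y ∔ sig s) \/ is_limit x.
Proof.
case: (classic (exists y s, x = y ∔ sig s)) => H; [by left|right] => y s K.
by split=> // E; apply: H; exists y, s.
Qed.

Lemma No_ind (P : No -> Prop) :
  (forall x s, P x -> P (x ∔ sig s)) ->
  (forall x, is_limit x -> (forall y, y ⊏ x -> P y) -> P x) -> forall x, P x.
Proof.
move=> H1 H2; elim/(well_founded_ind simpler_wf) => x IH.
case: (No_case x) => [[y [s E]]|L]; last exact: H2.
rewrite E; apply/H1/IH; rewrite E; exact: concat_sig_strict.
Qed.

(** * A number between two small classes *)

Section ExistsSep.
Variables L R : No -> Prop.
Hypotheses (smallL : small L) (smallR : small R).
Hypothesis LR : forall l r, L l -> R r -> l < r.

(* The initial segments of the path which moves up below an element of [L],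
   and down above an element of [R]. *)
Let onpath p := (forall l, L l -> l < p \/ p ⊑ l) /\ (forall r, R r -> p < r \/ p ⊑ r) /\
  (forall q, q ⊏ p -> (q < p /\ exists l, L l /\ q <= l) \/ (p < q /\ exists r, R r /\ r <= q)).

(** At the meet m of two incomparable members one path goes down because of some r <= m and the
    other goes up because of some l >= m, contradicting l < r. *)
Lemma onpath_chain p q : onpath p -> onpath q -> p ⊑ q \/ q ⊑ p.
Proof.
move=> Hp Hq; case: (lt_total p q) => [|[->|]]; [|by left|].
- case/lt_meet=> m [mp [mq [pm m_q]]].
  case: (simpler_eqVlt mp) => [<-|Sp]; first by left.
  case: (simpler_eqVlt mq) => [<-|Sq]; first by right.
  case: Hp Hq => _ [_ /(_ m Sp) rho_class] [_ [_ /(_ m Sq) Kq]].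
  case: rho_class => [[/lt_le_trans /(_ pm) /lt_irrefl //]|[_ [r [Rr Hr]]]].
  case: Kq => [[_ [l [Ll Hl]]]|[/le_lt_trans]]; last by move/(_ m m_q)/lt_irrefl.
  by case: (lt_irrefl (le_lt_trans (le_trans Hr Hl) (LR Ll Rr))).
- case/lt_meet=> m [mq [mp [qm m_p]]].
  case: (simpler_eqVlt mp) => [<-|Sp]; first by left.
  case: (simpler_eqVlt mq) => [<-|Sq]; first by right.
  case: Hp Hq => _ [_ /(_ m Sp) rho_class] [_ [_ /(_ m Sq) Kq]].
  case: Kq => [[/lt_le_trans /(_ qm) /lt_irrefl //]|[_ [r [Rr Hr]]]].
  case: rho_class => [[_ [l [Ll Hl]]]|[/le_lt_trans]]; last by move/(_ m m_p)/lt_irrefl.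
  by case: (lt_irrefl (le_lt_trans (le_trans Hr Hl) (LR Ll Rr))).
Qed.

(** A longer member would have turned at its initial segment q of length a because of an option on
    the far side of q. By convexity that option would prolong q and have length at least a. *)
Lemma onpath_len a : (forall x, L x -> olt (len x) a) -> (forall x, R x -> olt (len x) a) ->
  forall p, onpath p -> ole (len p) a.
Proof.
move=> HL HR p Hp; apply/not_olt => H; pose q := restrict p a.
have Eq : len q = a by apply/len_restrict/oltW.
have Sq : q ⊏ p by exact: restrict_lt.
case: Hp => Hp1 [Hp2 /(_ q Sq) [[K [l [Ll]]]|[K [r [Rr]]]]].
  have Nq : ~ q ⊑ l by move/simpler_len_le; rewrite Eq; apply/not_ole/HL.
  case: (Hp1 l Ll) => [Hl [E|ql]|].
  - by apply: Nq; rewrite E; exact: simpler_refl.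
  - by apply: Nq; apply: simpler_convex (leW ql) (leW Hl) => //; exact: simplerW.
  - by move/(simpler_eq_trans (simplerW Sq)).
have Nq : ~ q ⊑ r by move/simpler_len_le; rewrite Eq; apply/not_ole/HR.
case: (Hp2 r Rr) => [Hr [E|qr]|].
- by apply: Nq; rewrite E; exact: simpler_refl.
- by apply: Nq; apply: simpler_convex (leW Hr) (leW qr) => //; exact: simplerW.
- by move/(simpler_eq_trans (simplerW Sq)).
Qed.

Lemma ext_cases p x : p ⊑ x -> p ∔ neg 1 ⊑ x \/ p = x \/ p ∔ 1 ⊑ x.
Proof.
case/simpler_eqVlt=> [->|/simpler_next [[|] ?]]; by [right; left|left|right; right].
Qed.

Lemma onpath_plus p l : onpath p -> L l -> p <= l -> onpath (p ∔ 1).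
Proof.
move=> [Hp1 [Hp2 Hp3]] Ll Hl; split; [|split].
- move=> x /Hp1 [H|/ext_cases [H|[<-|]]]; last by right.
  + by left; apply: lt_trans H (lt_plus p).
  + by left; apply: lt_trans (gt_simpler_minus H) (lt_plus p).
  + by left; exact: lt_plus.
- move=> r Rr; have pr : p < r by apply: le_lt_trans Hl _; exact: LR.
  case: (lt_total (p ∔ 1) r) => [|[->|K]]; [by left|by right|right].
  have : p ⊑ r by apply: simpler_convex (leW pr) (leW K) => //; exact: concat_simpler.
  case/ext_cases=> [/gt_simpler_minus /(lt_asym pr) //|[E|//]].
  by rewrite E in pr; case: (lt_irrefl pr).
- move=> q /(strict_sig _ _ plus) /simpler_eqVlt [->|S].
    by left; split; [exact: lt_plus|exists l].
  case: (Hp3 q S) => [[K ?]|[K ?]]; [left|right]; split=> //.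
    exact: lt_trans (lt_plus p).
  by apply: ext_lt S K _; exact: concat_simpler.
Qed.

Lemma onpath_minus p r : onpath p -> R r -> r <= p -> onpath (p ∔ neg 1).
Proof.
move=> [Hp1 [Hp2 Hp3]] Rr Hr; split; [|split].
- move=> l Ll; have lp : l < p by apply: lt_le_trans Hr; exact: LR.
  case: (lt_total l (p ∔ neg 1)) => [|[->|K]]; [by left|by right|right].
  have : p ⊑ l by apply: simpler_convex (leW K) (leW lp) => //; exact: concat_simpler.
  case/ext_cases=> [//|[E|/lt_simpler_plus /(lt_asym lp) //]].
  by rewrite E in lp; case: (lt_irrefl lp).
- move=> x /Hp2 [H|/ext_cases [H|[<-|H]]].
  + by left; apply: lt_trans (lt_minus p) H.
  + by right.
  + by left; exact: lt_minus.
  + by left; apply: lt_trans (lt_minus p) (lt_simpler_plus H).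
- move=> q /(strict_sig _ _ minus) /simpler_eqVlt [->|S].
    by right; split; [exact: lt_minus|exists r].
  case: (Hp3 q S) => [[K ?]|[K ?]]; [left|right]; split=> //.
    by apply: ext_gt S K _; exact: concat_simpler.
  exact: lt_trans (lt_minus p) K.
Qed.

Lemma small_onpath : small onpath.
Proof.
case: (small_bounded (small_or smallL smallR)) => a Ha.
have Sa : small (fun b => olt b (osucc a)) by exact: small_below.
pose f b := epsilon (inhabits 0) (fun p => onpath p /\ len p = b).
apply: (small_image (f := f) Sa) => p Hp; exists (len p); split.
  by apply/olt_osucc; apply: onpath_len Hp => x ?; apply: Ha; [left|right].
have [K E] : onpath (f (len p)) /\ len (f (len p)) = len p.
  by rewrite /f; apply epsilon_spec; exists p.
case: (onpath_chain Hp K) => /simpler_eq_len; rewrite E => H; last symmetry;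
  by apply: H; exact: ole_refl.
Qed.

(** The union s of the path belongs to the path. An element of [L] not below s, or of [R] not above
    s, would prolong the path by one more sign. *)
Lemma exists_sep : exists y, sep L R y.
Proof.
have [s [H1 [H2 H3]]] := chain_sup small_onpath onpath_chain.
have Hs : onpath s.
  split; [|split].
  - move=> l Ll; case: (classic (forall p, onpath p -> p ⊑ l)) => [/H2|N]; first by right.
    left; apply/not_le => K; apply: N => p Hp.
    case: Hp (H1 p Hp) => /(_ l Ll) [lp|//] _ ps.
    exact: simpler_convex ps (simpler_refl _) K (leW lp).
  - move=> r Rr; case: (classic (forall p, onpath p -> p ⊑ r)) => [/H2|N]; first by right.
    left; apply/not_le => K; apply: N => p Hp.
    case: Hp (H1 p Hp) => _ [/(_ r Rr) [lp|//] _] ps.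
    exact: simpler_convex (simpler_refl _) ps (leW lp) K.
  - move=> q S; case: (H3 _ (simpler_len S)) => p [Hp K].
    have Sp : q ⊏ p.
      case: (simpler_chain (simplerW S) (H1 p Hp)) => [/simpler_eqVlt [E|//]|].
        by rewrite E in K; case: (olt_irrefl K).
      by move/simpler_len_le/not_olt.
    case: Hp (H1 p Hp) => _ [_ /(_ q Sp) [[A ?]|[A ?]]] ps; [left|right]; split=> //.
      exact: ext_gt A ps.
    exact: ext_lt A ps.
exists s; split=> [l Ll|r Rr]; apply/not_le => K.
  have := H1 _ (onpath_plus Hs Ll K) => /simpler_len_le.
  by rewrite (len_concat_sig s plus) => /osucc_le /olt_irrefl.
have := H1 _ (onpath_minus Hs Rr K) => /simpler_len_le.
by rewrite (len_concat_sig s minus) => /osucc_le /olt_irrefl.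
Qed.
End ExistsSep.

Lemma cut_sep L R : small L -> small R -> (forall l r, L l -> R r -> l < r) ->
  is_cut L R (cut L R).
Proof. by move=> SL SR LR; apply/cut_is_cut/exists_sep. Qed.

(** * Addition and multiplication *)

Definition addL x y z := (exists x', lopt x' x /\ z = x' + y) \/
                         (exists y', lopt y' y /\ z = x + y').
Definition addR x y z := (exists x', ropt x' x /\ z = x' + y) \/
                         (exists y', ropt y' y /\ z = x + y').

Lemma opt_comparable x x1 x2 : lopt x1 x -> ropt x2 x -> lopt x1 x2 \/ ropt x2 x1.
Proof.
move=> [S1 H1] [S2 H2]; have L := lt_trans H1 H2.
have N : x1 <> x2 by move=> E; rewrite E in L; case: (lt_irrefl L).
case: (simpler_chain (simplerW S1) (simplerW S2)) => S; [left|right]; split=> //.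
by split=> // /esym.
Qed.

(** Non-emptiness of Conway's cut, by induction on both arguments. When two options of the same
    argument are compared, one of them is an option of the other, so a cut known by induction
    decides. *)
Lemma add_is_cut x y : is_cut (addL x y) (addR x y) (x + y).
Proof.
elim/(well_founded_ind simpler_wf): x y => x IHx.
elim/(well_founded_ind simpler_wf) => y IHy.
rewrite add_eq; apply: cut_sep.
- apply: small_or.
    by apply: (small_image (f := fun x' => x' + y) (small_lopt x)) => z [x' [? ->]]; exists x'.
  by apply: (small_image (f := fun y' => x + y') (small_lopt y)) => z [y' [? ->]]; exists y'.
- apply: small_or.
    by apply: (small_image (f := fun x' => x' + y) (small_ropt x)) => z [x' [? ->]]; exists x'.
  by apply: (small_image (f := fun y' => x + y') (small_ropt y)) => z [y' [? ->]]; exists y'.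
move=> l r [[x1 [H1 ->]]|[y1 [H1 ->]]] [[x2 [H2 ->]]|[y2 [H2 ->]]].
- case: (opt_comparable H1 H2) => K.
    have [[Hl _] _] := IHx _ (proj1 H2) y; apply: Hl; left; by exists x1.
  have [[_ Hr] _] := IHx _ (proj1 H1) y; apply: Hr; left; by exists x2.
- have [[_ Hr] _] := IHx _ (proj1 H1) y; apply: (@lt_trans _ (x1 + y2)).
    by apply: Hr; right; exists y2.
  by have [[Hl _] _] := IHy _ (proj1 H2); apply: Hl; left; exists x1.
- have [[Hr _] _] := IHx _ (proj1 H2) y; apply: (@lt_trans _ (x2 + y1)).
    by have [[_ Hl] _] := IHy _ (proj1 H1); apply: Hl; left; exists x2.
  by apply: Hr; right; exists y1.
- case: (opt_comparable H1 H2) => K.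
    have [[Hl _] _] := IHy _ (proj1 H2); apply: Hl; right; by exists y1.
  have [[_ Hr] _] := IHy _ (proj1 H1); apply: Hr; right; by exists y2.
Qed.

Lemma lt_opts x1 x2 : x1 < x2 ->
  exists m, (x1 = m \/ ropt m x1) /\ (x2 = m \/ lopt m x2).
Proof.
case/lt_meet=> m [H1 [H2 [K1 K2]]]; exists m; split.
- case: K1 => [->|K]; [by left|right]; split=> //; split=> // E.
  by rewrite E in K; case: (lt_irrefl K).
- case: K2 => [->|K]; [by left|right]; split=> //; split=> // E.
  by rewrite E in K; case: (lt_irrefl K).
Qed.

Lemma cut_ext L R L' R' x : is_cut L R x ->
  (forall z, L z <-> L' z) -> (forall z, R z <-> R' z) -> is_cut L' R' x.
Proof.
move=> H EL ER; apply: (is_cut_cofinal H) => [|l /EL|l /ER].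
- by case: H => [[H1 H2] _]; split=> z; [move/EL; apply: H1|move/ER; apply: H2].
- by exists l; split=> //; left.
- by exists l; split=> //; left.
Qed.

Lemma is_cut_uniq L R x y : is_cut L R x -> is_cut L R y -> x = y.
Proof. by move=> H K; apply: (is_cut_eq H K); [case: K|case: H]. Qed.

Lemma addC x y : x + y = y + x.
Proof.
elim/(well_founded_ind simpler_wf): x y => x IHx.
elim/(well_founded_ind simpler_wf) => y IHy.
apply: is_cut_uniq (add_is_cut x y) _.
apply: cut_ext (add_is_cut y x) _ _ => z; split=> -[[v [H ->]]|[v [H ->]]];
  by [right; exists v; rewrite (IHy v (proj1 H)) | left; exists v; rewrite (IHx v (proj1 H))
     |right; exists v; rewrite (IHx v (proj1 H)) | left; exists v; rewrite (IHy v (proj1 H))].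
Qed.

Lemma lt_add2r y x1 x2 : x1 < x2 -> x1 + y < x2 + y.
Proof.
move=> H; case: (lt_opts H) => m [H1 H2].
have K1 : ropt m x1 -> x1 + y < m + y.
  by move=> K; have [[_ Hr] _] := add_is_cut x1 y; apply: Hr; left; exists m.
have K2 : lopt m x2 -> m + y < x2 + y.
  by move=> K; have [[Hr _] _] := add_is_cut x2 y; apply: Hr; left; exists m.
case: H1 H2 => [E1|/K1 L1] [E2|/K2 L2].
- by move: H; rewrite E1 E2 => /lt_irrefl.
- by rewrite E1.
- by rewrite E2.
- exact: lt_trans L2.
Qed.

Lemma lt_add2l y x1 x2 : x1 < x2 -> y + x1 < y + x2.
Proof. by rewrite !(addC y); exact: lt_add2r. Qed.

Lemma le_add2r y x1 x2 : x1 <= x2 -> x1 + y <= x2 + y.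
Proof. by case=> [->|/(lt_add2r y)]; [left|right]. Qed.

Lemma le_add2l y x1 x2 : x1 <= x2 -> y + x1 <= y + x2.
Proof. by rewrite !(addC y); exact: le_add2r. Qed.

(** Uniformity: by cofinality the options may come from any cuts of x and y. Associativity relies on
    it, since there a summand is itself a sum. *)
Lemma add_cut L R L' R' x y : is_cut L R x -> is_cut L' R' y ->
  is_cut (fun z => (exists x', L x' /\ z = x' + y) \/ (exists y', L' y' /\ z = x + y'))
         (fun z => (exists x', R x' /\ z = x' + y) \/ (exists y', R' y' /\ z = x + y'))
         (x + y).
Proof.
move=> Hx Hy; apply: is_cut_cofinal (add_is_cut x y) _ _ _.
- case: Hx Hy => [[H1 H2] _] [[H3 H4] _].
  split=> z [[v [H ->]]|[v [H ->]]].
  + exact/lt_add2r/H1.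
  + exact/lt_add2l/H3.
  + exact/lt_add2r/H2.
  + exact/lt_add2l/H4.
- move=> l [[v [/(is_cut_lopt Hx) [w [Hw K]] ->]]|[v [/(is_cut_lopt Hy) [w [Hw K]] ->]]].
    by exists (w + y); split; [left; exists w|exact: le_add2r].
  by exists (x + w); split; [right; exists w|exact: le_add2l].
- move=> l [[v [/(is_cut_ropt Hx) [w [Hw K]] ->]]|[v [/(is_cut_ropt Hy) [w [Hw K]] ->]]].
    by exists (w + y); split; [left; exists w|exact: le_add2r].
  by exists (x + w); split; [right; exists w|exact: le_add2l].
Qed.

Lemma lopt_0 x : ~ lopt x 0.
Proof. by case=> /simpler_len; rewrite len0 => /olt_0. Qed.
Lemma ropt_0 x : ~ ropt x 0.
Proof. by case=> /simpler_len; rewrite len0 => /olt_0. Qed.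

Lemma addx0 x : x + 0 = x.
Proof.
elim/(well_founded_ind simpler_wf): x => x IH.
apply: is_cut_uniq (add_is_cut x 0) _; apply: cut_ext (is_cut_opts x) _ _ => z; split.
- by move=> H; left; exists z; rewrite IH //; case: H.
- by case=> -[v [H ->]]; [rewrite IH //; case: H|case: (lopt_0 H)].
- by move=> H; left; exists z; rewrite IH //; case: H.
- by case=> -[v [H ->]]; [rewrite IH //; case: H|case: (ropt_0 H)].
Qed.

Lemma addA x y z : x + (y + z) = x + y + z.
Proof.
elim/(well_founded_ind simpler_wf): x y z => x IHx.
elim/(well_founded_ind simpler_wf) => y IHy.
elim/(well_founded_ind simpler_wf) => z IHz.
apply: is_cut_uniq (add_cut (is_cut_opts x) (add_is_cut y z)) _.
apply: cut_ext (add_cut (add_is_cut x y) (is_cut_opts z)) _ _ => w; split.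
- case=> -[v [H ->]].
    case: H => -[u [H ->]]; [left; exists u|right; exists (u + z)].
      by rewrite (IHx u (proj1 H)).
    by rewrite (IHy u (proj1 H)); split=> //; left; exists u.
  by right; exists (y + v); rewrite (IHz v (proj1 H)); split=> //; right; exists v.
- case=> -[v [H ->]].
    by left; exists (v + y); rewrite (IHx v (proj1 H)); split=> //; left; exists v.
  case: H => -[u [H ->]].
    by left; exists (x + u); rewrite (IHy u (proj1 H)); split=> //; right; exists u.
  by right; exists u; rewrite (IHz u (proj1 H)).
- case=> -[v [H ->]].
    case: H => -[u [H ->]]; [left; exists u|right; exists (u + z)].
      by rewrite (IHx u (proj1 H)).
    by rewrite (IHy u (proj1 H)); split=> //; left; exists u.
  by right; exists (y + v); rewrite (IHz v (proj1 H)); split=> //; right; exists v.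
- case=> -[v [H ->]].
    by left; exists (v + y); rewrite (IHx v (proj1 H)); split=> //; left; exists v.
  case: H => -[u [H ->]].
    by left; exists (x + u); rewrite (IHy u (proj1 H)); split=> //; right; exists u.
  by right; exists u; rewrite (IHz u (proj1 H)).
Qed.

Lemma lopt_neg x y : lopt x (- y) <-> ropt (- x) y.
Proof.
by split=> -[/simpler_strict_neg H /lt_neg K]; split; rewrite ?negK // in H K *.
Qed.
Lemma ropt_neg x y : ropt x (- y) <-> lopt (- x) y.
Proof.
by split=> -[/simpler_strict_neg H /lt_neg K]; split; rewrite ?negK // in H K *.
Qed.

Lemma addxN x : x - x = 0.
Proof.
elim/(well_founded_ind simpler_wf): x => x IH.
symmetry; apply: simpler_antisym; first exact: simpler_0.
have [_] := add_is_cut x (- x); apply; split=> z [[v [H ->]]|[v [H ->]]].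
- rewrite -(IH v (proj1 H)); apply/lt_add2l/lt_neg; by case: H.
- move/lopt_neg: H => H; rewrite -(IH _ (proj1 H)) negK; apply/lt_add2r; by case: H.
- rewrite -(IH v (proj1 H)); apply/lt_add2l/lt_neg; by case: H.
- move/ropt_neg: H => H; rewrite -(IH _ (proj1 H)) negK; apply/lt_add2r; by case: H.
Qed.

Lemma add0x x : 0 + x = x. Proof. by rewrite addC addx0. Qed.

Lemma neg_uniq x y : x + y = 0 -> y = - x.
Proof. by move=> H; rewrite -(add0x y) -(addxN x) (addC x) -addA H addx0. Qed.

Lemma lt_sub x y : x < y <-> 0 < y - x.
Proof.
split=> [/(lt_add2r (- x))|/(lt_add2r x)]; first by rewrite addxN.
by rewrite addC addx0 -addA (addC (- x)) addxN addx0.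
Qed.

Lemma addNx x : - x + x = 0. Proof. by rewrite addC addxN. Qed.

HB.instance Definition _ := gen_eqMixin No.
HB.instance Definition _ := gen_choiceMixin No.
HB.instance Definition _ := GRing.isZmodule.Build No addA addC add0x addNx.

(* A reflexive tactic for identities in the abelian group [No], needed before [No]
   is known to be a ring. *)
Inductive gexp := GV of nat | G0 | GA of gexp & gexp | GN of gexp.

Fixpoint gev (f : nat -> No) e : No :=
  match e with
  | GV n => f n | G0 => 0 | GA a b => gev f a + gev f b | GN a => - gev f a
  end.

Fixpoint gpn e : seq nat * seq nat :=
  match e with
  | GV n => ([:: n], [::])
  | G0 => ([::], [::])
  | GA a b => ((gpn a).1 ++ (gpn b).1, (gpn a).2 ++ (gpn b).2)
  | GN a => ((gpn a).2, (gpn a).1)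
  end.

Lemma gevE f e :
  gev f e = (\sum_(i <- (gpn e).1) f i - \sum_(i <- (gpn e).2) f i)%R.
Proof.
elim: e => [n||a IHa b IHb|a IHa] /=.
- by rewrite big_seq1 big_nil GRing.subr0.
- by rewrite !big_nil GRing.subr0.
- rewrite !big_cat /= IHa IHb; rewrite GRing.opprD; exact: GRing.addrACA.
- by rewrite IHa; exact: GRing.opprB.
Qed.

Lemma gev_eq f a b :
  perm_eq ((gpn a).1 ++ (gpn b).2) ((gpn b).1 ++ (gpn a).2) -> gev f a = gev f b.
Proof.
move=> H; rewrite !gevE; apply/eqP; rewrite GRing.subr_eq GRing.addrAC.
rewrite -GRing.subr_eq GRing.opprK -!big_cat /=; exact/eqP/perm_big.
Qed.

Ltac gmem a l := match l with nil => constr:(false) | a :: _ => constr:(true) | _ :: ?l' => gmem a l' end.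
Ltac gadd a l := let b := gmem a l in match b with true => l | false => constr:(a :: l) end.
Ltac gidx a l := match l with a :: _ => constr:(O) | _ :: ?l' => let n := gidx a l' in constr:(S n) end.
Ltac gatoms e l :=
  match e with
  | add ?a ?b => let l1 := gatoms a l in gatoms b l1
  | neg ?a => gatoms a l
  | of_nat O => l
  | _ => gadd e l
  end.
Ltac greify e l :=
  match e with
  | add ?a ?b => let x := greify a l in let y := greify b l in constr:(GA x y)
  | neg ?a => let x := greify a l in constr:(GN x)
  | of_nat O => constr:(G0)
  | _ => let n := gidx e l in constr:(GV n)
  end.
Ltac abel :=
  match goal with |- ?a = ?b =>
    let l := gatoms a (@nil No) in let l := gatoms b l in
    let x := greify a l in let y := greify b l in
    exact (@gev_eq (nth (of_nat O) l) x y isT)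
  end.

(** * Multiplication *)

Lemma lt_by a b c d : a < b -> d - c = b - a -> c < d.
Proof. by move=> /lt_sub H E; apply/lt_sub; rewrite E. Qed.

Lemma lt_add2 a b c d : a < b -> c < d -> a + c < b + d.
Proof. by move=> H K; apply: lt_trans (lt_add2r _ H) (lt_add2l _ K). Qed.

(** A boolean for the side, true for left, merges the four families of options of a product into
    one: options from sides s and t give an option on the side [s == t]. *)
Definition sd (s : bool) x y := if s then x < y else y < x.
Definition opt s x' x := x' ⊏ x /\ sd s x' x.
Definition mo x y x' y' := x' * y + x * y' - x' * y'.
Definition mulS t x y z := exists s x' y', opt s x' x /\ opt (s == t) y' y /\ z = mo x y x' y'.
Definition bcut (S : bool -> No -> Prop) x := is_cut (S true) (S false) x.

Lemma bcut_ext S S' x : bcut S x -> (forall t z, S t z <-> S' t z) -> bcut S' x.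
Proof. by move=> H E; apply: cut_ext H _ _. Qed.

Lemma bcut_uniq S x y : bcut S x -> bcut S y -> x = y.
Proof. exact: is_cut_uniq. Qed.

Lemma bcut_opts x : bcut (fun s x' => opt s x' x) x. Proof. exact: is_cut_opts. Qed.

Lemma mul_eqS x y : x * y = cut (mulS true x y) (mulS false x y).
Proof.
rewrite mul_eq; congr cut; apply: functional_extensionality => z;
  apply: propositional_extensionality; split.
- by move=> [x' [y' [[[Hx Hy]|[Hx Hy]] ->]]]; [exists true|exists false]; exists x', y'.
- by move=> [[] [x' [y' [Hx [Hy ->]]]]]; exists x', y'; split=> //; [left|right].
- by move=> [x' [y' [[[Hx Hy]|[Hx Hy]] ->]]]; [exists true|exists false]; exists x', y'.
- by move=> [[] [x' [y' [Hx [Hy ->]]]]]; exists x', y'; split=> //; [left|right].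
Qed.

Lemma mulC x y : x * y = y * x.
Proof.
elim/(well_founded_ind simpler_wf): x y => x IHx.
elim/(well_founded_ind simpler_wf) => y IHy.
have E x' y' s t : opt s x' x -> opt t y' y -> mo x y x' y' = mo y x y' x'.
  move=> Hx Hy; rewrite /mo (IHx x' (proj1 Hx) y) (IHx x' (proj1 Hx) y').
  by rewrite (IHy y' (proj1 Hy)); abel.
rewrite !mul_eqS; congr cut; apply: functional_extensionality => z;
  apply: propositional_extensionality;
  split=> -[[] [x' [y' [Hx [Hy ->]]]]]; eexists; exists y', x'; split; try exact: Hy;
  split; try exact: Hx; rewrite (E _ _ _ _ Hx Hy) || rewrite -(E _ _ _ _ Hy Hx); done.
Qed.

(** The inequality (x2 - x1) (y2 - y1) > 0 in expanded form; distributivity is proved only later,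
    from [mul_cut], which rests on [D]. *)
Definition D x1 x2 y1 y2 := x1 * y2 + x2 * y1 < x1 * y1 + x2 * y2.

Lemma D_sym x1 x2 y1 y2 : D x1 x2 y1 y2 -> D x2 x1 y2 y1.
Proof. by rewrite /D => H; apply: lt_by H _; abel. Qed.

Lemma D_swap x1 x2 y1 y2 : D x1 x2 y1 y2 -> D y1 y2 x1 x2.
Proof.
rewrite /D (mulC y1 x2) (mulC y2 x1) (mulC y1 x1) (mulC y2 x2) => H; apply: lt_by H _; abel.
Qed.

Lemma D_trans x1 x2 x3 y1 y2 : D x1 x2 y1 y2 -> D x2 x3 y1 y2 -> D x1 x3 y1 y2.
Proof. by rewrite /D => H K; apply: lt_by (lt_add2 H K) _; abel. Qed.

Definition MC x y := bcut (fun t => mulS t x y) (x * y).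

Lemma moC x y x' y' : mo x y x' y' = mo y x y' x'.
Proof. by rewrite /mo (mulC x' y) (mulC x y') (mulC x' y'); abel. Qed.

Lemma MC_sym x y : MC x y -> MC y x.
Proof.
move=> H; rewrite /MC mulC; apply: bcut_ext H _ => t z.
split=> -[s [x' [y' [Hx [Hy ->]]]]]; exists (s == t), y', x'; split=> //;
  (split; last exact: moC); by case: (s) (t) Hx {Hy} => [] [].
Qed.

Lemma MC_D x y s x' y' t : MC x y -> opt s x' x -> opt t y' y ->
  if s == t then D x' x y' y else D x' x y y'.
Proof.
move=> [[H K] _] Hx Hy; case E : (s == t).
  have /H : mulS true x y (mo x y x' y').
    by exists s, x', y'; split=> //; rewrite (eqP E) in Hx *; rewrite (_ : (t == true) = t); case: (t) Hy.
  by rewrite /D /mo => L; apply: lt_by L _; abel.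
have /K : mulS false x y (mo x y x' y').
  by exists s, x', y'; split=> //; case: s t E Hx Hy => [] [].
by rewrite /D /mo => L; apply: lt_by L _; abel.
Qed.

Definition cmp x1 x2 := x1 ⊏ x2 \/ x2 ⊏ x1.

Lemma MC_Dcmp x x' y1 y2 s : x' ⊏ x -> cmp y1 y2 -> MC x y1 -> MC x y2 ->
  sd s x' x -> sd s y1 y2 -> D x' x y1 y2.
Proof.
move=> Sx [Sy|Sy] M1 M2 Hx Hy.
  by have := @MC_D x y2 s x' y1 s M2 (conj Sx Hx) (conj Sy Hy); rewrite eqxx.
have := @MC_D x y1 s x' y2 (~~ s) M1 (conj Sx Hx).
by case: s Hx Hy => /= Hx Hy; apply.
Qed.

Lemma opt_cmp s t x1 x2 x : opt s x1 x -> opt t x2 x -> x1 = x2 \/ cmp x1 x2.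
Proof.
move=> [S1 _] [S2 _]; case: (simpler_chain (simplerW S1) (simplerW S2)) =>
  /simpler_eqVlt [->|S]; by [left|left|right; left|right; right].
Qed.

(** A left option against a right one, with x1 and x2 on the same side of x. One coordinate is
    changed at a time, and the order of x1 and x2 decides which goes first, so that [X] is applied
    at a y' on the side it requires. *)
Lemma mo_lt x y x1 y1 x2 y2 :
  (forall x', x' ⊏ x -> MC x' y) -> (forall y', y' ⊏ y -> MC x y') ->
  forall s, opt s x1 x -> opt s y1 y -> opt s x2 x -> opt (~~ s) y2 y ->
  mo x y x1 y1 < mo x y x2 y2.
Proof.
move=> IHx IHy s Hx1 Hy1 Hx2 Hy2.
have Cy : cmp y1 y2.
  case: (opt_cmp Hy1 Hy2) => // E; rewrite E in Hy1.
  by case: (s) Hy1 Hy2 => -[_ /= A] [_ /= B]; case: (lt_asym A).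
have Y x' : opt s x' x -> mo x y x' y1 < mo x y x' y2.
  move=> Hx'; have : D x' x y1 y2.
    apply: (@MC_Dcmp _ _ _ _ s) Cy (IHy _ (proj1 Hy1)) (IHy _ (proj1 Hy2)) (proj2 Hx') _.
      by case: Hx'.
    by case: (s) Hy1 Hy2 => -[_ /= A] [_ /= B]; [exact: lt_trans A B|exact: lt_trans B A].
  by rewrite /D /mo => L; apply: lt_by L _; abel.
have X (t : bool) y' : opt t y' y -> sd t x1 x2 -> mo x y x1 y' < mo x y x2 y'.
  move=> Hy' L; have Cx : cmp x1 x2.
    case: (opt_cmp Hx1 Hx2) => // E; rewrite E in L.
    by case: (t) L => /lt_irrefl.
  have : D y' y x1 x2.
    apply: (@MC_Dcmp _ _ _ _ t) Cx _ _ (proj2 Hy') L; first by case: Hy'.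
    - exact/MC_sym/(IHx _ (proj1 Hx1)).
    - exact/MC_sym/(IHx _ (proj1 Hx2)).
  move/D_swap; rewrite /D /mo => K; apply: lt_by K _; abel.
case: (lt_total x1 x2) => [L|[->|L]]; last 2 first.
- exact: Y.
- case: s Hx1 Hy1 Hx2 Hy2 Y X => Hx1 Hy1 Hx2 Hy2 Y X.
    by apply: lt_trans (Y _ Hx1) (X false _ Hy2 L).
  by apply: lt_trans (X false _ Hy1 L) (Y _ Hx2).
case: s Hx1 Hy1 Hx2 Hy2 Y X => Hx1 Hy1 Hx2 Hy2 Y X.
  by apply: lt_trans (X true _ Hy1 L) (Y _ Hx2).
by apply: lt_trans (Y _ Hx1) (X true _ Hy2 L).
Qed.

Lemma small_opt s x : small (fun x' => opt s x' x).
Proof. by apply: small_sub (small_simpler x) _ => y []. Qed.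

Lemma small_mulS t x y : small (mulS t x y).
Proof.
apply: (small_sub (Q := fun z => exists s, True /\ exists x' y',
   x' ⊏ x /\ y' ⊏ y /\ z = mo x y x' y')).
  apply: small_union => [|s _]; first exact: small_bool.
  by apply: (small_image2 (small_simpler x) (small_simpler y)) => z; exact.
by move=> z [s [x' [y' [[Hx _] [[Hy _] ->]]]]]; exists s; split=> //; exists x', y'.
Qed.

Lemma mul_is_cut x y : MC x y.
Proof.
elim/(well_founded_ind simpler_wf): x y => x IHx.
elim/(well_founded_ind simpler_wf) => y IHy.
rewrite /MC mul_eqS /bcut; apply: cut_sep; try exact: small_mulS.
move=> l r [s [x1 [y1 [Hx1 [Hy1 ->]]]]] [t [x2 [y2 [Hx2 [Hy2 ->]]]]].
case E : (s == t).
  rewrite -(eqP E) in Hx2 Hy2; apply: (mo_lt _ IHy Hx1 _ Hx2) => [x' /IHx //||].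
    by case: (s) Hy1.
  by case: (s) Hy2.
have Et : t = ~~ s by case: (s) (t) E => [] [].
rewrite Et in Hx2 Hy2.
rewrite (moC _ _ x1) (moC _ _ x2).
apply: (@mo_lt y x y1 x1 y2 x2 _ _ s) => [y' /IHy /MC_sym //|x' /IHx /(_ y) /MC_sym //||||//].
- by case: (s) Hy1.
- by [].
- by case: (s) Hy2.
Qed.

Lemma D_opt a1 a2 b1 b2 s t : opt s a1 a2 -> opt t b1 b2 ->
  if s == t then D a1 a2 b1 b2 else D a1 a2 b2 b1.
Proof. by move=> Ha Hb; exact: MC_D (mul_is_cut _ _) Ha Hb. Qed.

(** Both intervals are subdivided at the meets given by [lt_opts]; [D_opt] treats the pieces and
    [D_trans] adds them up. *)
Lemma D_lt x1 x2 y1 y2 : x1 < x2 -> y1 < y2 -> D x1 x2 y1 y2.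
Proof.
have K a1 a2 s b1 b2 : opt s a1 a2 -> b1 < b2 -> if s then D a1 a2 b1 b2 else D a2 a1 b1 b2.
  move=> Ha L; case: (lt_opts L) => m [H1 H2].
  have K1 : ropt m b1 -> if s then D a1 a2 b1 m else D a2 a1 b1 m.
    by move=> /(@D_opt _ _ _ _ _ false Ha); case: (s) => //= /D_sym.
  have K2 : lopt m b2 -> if s then D a1 a2 m b2 else D a2 a1 m b2.
    by move=> /(@D_opt _ _ _ _ _ true Ha); case: (s) => //= /D_sym.
  case: H1 H2 => [E1|/K1 L1] [E2|/K2 L2]; rewrite ?E1 ?E2 //.
  - by move: L; rewrite E1 E2 => /lt_irrefl.
  - by case: (s) L1 L2 => /D_swap L1 /D_swap L2; apply: D_swap; apply: D_trans L1 L2.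
move=> Hx Hy; case: (lt_opts Hx) => m [H1 H2].
case: H1 H2 => [E1|H1] [E2|H2].
- by move: Hx; rewrite E1 E2 => /lt_irrefl.
- by rewrite E1; exact: (K _ _ true).
- by rewrite E2; exact: (K _ _ false).
- by apply: (D_trans (x2 := m)); [exact: (K _ _ false)|exact: (K _ _ true)].
Qed.

Lemma mulx0 x : x * 0 = 0.
Proof.
symmetry; apply: simpler_antisym; first exact: simpler_0.
have [_ H] := mul_is_cut x 0; apply: H; split=> z [s [x' [y' [_ [[/simpler_len]]]]]];
  by rewrite len0 => /olt_0.
Qed.

Lemma mul_gt0 x y : 0 < x -> 0 < y -> 0 < x * y.
Proof.
move=> Hx Hy; have := D_lt Hx Hy; rewrite /D (mulC 0 y) !mulx0 => H.
by apply: lt_by H _; abel.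
Qed.

Definition sel s (L R : No -> Prop) := if s then L else R.

Lemma is_cut_sel L R x s x' : is_cut L R x -> opt s x' x ->
  exists l, sel s L R l /\ (x' = l \/ sd s x' l).
Proof.
move=> H; case: s => [/(is_cut_lopt H)|/(is_cut_ropt H)] [l [? K]]; exists l; split=> //.
by case: K => [->|]; [left|right].
Qed.

Lemma sel_sd L R x s l : is_cut L R x -> sel s L R l -> sd s l x.
Proof. by move=> [[H K] _]; case: s => [/H|/K]. Qed.

(** Uniformity of multiplication: moving a towards x, or b towards y, moves the option [mo x y a b]
    towards x * y ([S3] and [S2]), whence cofinality. *)
Lemma mul_cut L R L' R' x y : is_cut L R x -> is_cut L' R' y ->
  bcut (fun t z => exists s a b, sel s L R a /\ sel (s == t) L' R' b /\ z = mo x y a b) (x * y).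
Proof.
move=> Hx Hy.
have S1 s t a b : sd s a x -> sd t b y -> sd (s == t) (mo x y a b) (x * y).
  move=> Ha Hb; have : if s == t then D a x b y else D a x y b.
    by case: (s) (t) Ha Hb => [] [] /= Ha Hb; try (exact: D_lt); apply: D_sym; exact: D_lt.
  by case: (s == t); rewrite /D /= /mo => H; apply: lt_by H _; abel.
have S2 s t a b b' : sd s a x -> sd t b b' -> sd (s == t) (mo x y a b) (mo x y a b').
  move=> Ha Hb; have : if s == t then D a x b b' else D a x b' b.
    by case: (s) (t) Ha Hb => [] [] /= Ha Hb; try (exact: D_lt); apply: D_sym; exact: D_lt.
  by case: (s == t); rewrite /D /= /mo => H; apply: lt_by H _; abel.
have S3 s t a a' b : sd s a a' -> sd t b y -> sd (s == t) (mo x y a b) (mo x y a' b).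
  move=> Ha Hb; have : if s == t then D a a' b y else D a a' y b.
    by case: (s) (t) Ha Hb => [] [] /= Ha Hb; try (exact: D_lt); apply: D_sym; exact: D_lt.
  by case: (s == t); rewrite /D /= /mo => H; apply: lt_by H _; abel.
have C t z : mulS t x y z -> exists w,
    (exists s a b, sel s L R a /\ sel (s == t) L' R' b /\ w = mo x y a b) /\ (z = w \/ sd t z w).
  move=> [s [x' [y' [Ox [Oy ->]]]]].
  have [a [Ha Ka]] := is_cut_sel Hx Ox; have [b [Hb Kb]] := is_cut_sel Hy Oy.
  exists (mo x y a b); split; first by exists s, a, b.
  have E : (s == (s == t)) = t by case: (s) (t) => [] [].
  have L1 : mo x y x' y' = mo x y a y' \/ sd t (mo x y x' y') (mo x y a y').
    case: Ka => [->|Ka]; [by left|right]; rewrite -{1}E; apply: S3 Ka _; exact: (proj2 Oy).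
  have L2 : mo x y a y' = mo x y a b \/ sd t (mo x y a y') (mo x y a b).
    case: Kb => [->|Kb]; [by left|right]; rewrite -{1}E; apply: S2 Kb; exact: sel_sd Ha.
  case: L1 L2 => [->|L1] [<-|L2]; auto; right.
  by case: (t) L1 L2 => /= L1 L2; [exact: lt_trans L2|exact: lt_trans L1].
apply: (is_cut_cofinal (mul_is_cut x y)).
- split=> z [s [a [b [Ha [Hb ->]]]]].
    have := S1 _ _ _ _ (sel_sd Hx Ha) (sel_sd Hy Hb).
    by rewrite (_ : (s == (s == true)) = true) //; case: (s).
  have := S1 _ _ _ _ (sel_sd Hx Ha) (sel_sd Hy Hb).
  by rewrite (_ : (s == (s == false)) = false) //; case: (s).
- by move=> l /C [w [H K]]; exists w.
- by move=> l /C [w [H K]]; exists w; split=> //; case: K => [->|]; [left|right].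
Qed.

Lemma lt01 : 0 < 1. Proof. by rewrite -(concat_0l 1); exact: lt_plus. Qed.

Lemma opt_1 s x : opt s x 1 -> x = 0 /\ s = true.
Proof.
case=> S; have : x ⊑ 0 by apply/(strict_sig x 0 plus); rewrite concat_0l.
move=> /simpler_antisym /(_ (simpler_0 x)) ->; case: s => // /lt_asym []; exact: lt01.
Qed.

Lemma opt_10 : opt true 0 1.
Proof.
split; last exact: lt01.
by rewrite -(concat_0l 1); exact: (concat_sig_strict 0 plus).
Qed.

Lemma mulx1 x : x * 1 = x.
Proof.
elim/(well_founded_ind simpler_wf): x => x IH.
apply: bcut_uniq (mul_is_cut x 1) _; apply: bcut_ext (bcut_opts x) _ => t z; split.
- move=> H; exists t, z, 0; split=> //; split; first by case: (t) => //; exact: opt_10.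
  by rewrite /mo (IH z (proj1 H)) !mulx0; abel.
- case=> s [x' [y' [H [/opt_1 [-> E] ->]]]].
  have -> : mo x 1 x' 0 = x' by rewrite /mo (IH x' (proj1 H)) !mulx0; abel.
  by case: s t E H => [] [].
Qed.

Definition addS t x y z := (exists x', opt t x' x /\ z = x' + y) \/
                           (exists y', opt t y' y /\ z = x + y').

Lemma add_bcut x y : bcut (fun t => addS t x y) (x + y).
Proof. exact: add_is_cut. Qed.

Lemma sel_bool (S : bool -> No -> Prop) s z : sel s (S true) (S false) z <-> S s z.
Proof. by case: s. Qed.

Lemma mulDl x y z : (x + y) * z = x * z + y * z.
Proof.
elim/(well_founded_ind simpler_wf): x y z => x IHx.
elim/(well_founded_ind simpler_wf) => y IHy.
elim/(well_founded_ind simpler_wf) => z IHz.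
have E1 x' z' : x' ⊏ x -> z' ⊏ z -> mo (x + y) z (x' + y) z' = mo x z x' z' + y * z.
  by move=> Hx Hz; rewrite /mo (IHx x' Hx y z) (IHx x' Hx y z') (IHz z' Hz); abel.
have E2 y' z' : y' ⊏ y -> z' ⊏ z -> mo (x + y) z (x + y') z' = x * z + mo y z y' z'.
  by move=> Hy Hz; rewrite /mo (IHy y' Hy z) (IHy y' Hy z') (IHz z' Hz); abel.
apply: bcut_uniq (mul_cut (add_bcut x y) (bcut_opts z)) _.
apply: (@bcut_ext (fun t w => (exists x', mulS t x z x' /\ w = x' + y * z) \/
   (exists y', mulS t y z y' /\ w = x * z + y'))) => [|t w].
  exact: add_cut (mul_is_cut x z) (mul_is_cut y z).
split.
- case=> -[v [[s [x' [z' [Hx [Hz ->]]]]] ->]].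
    exists s, (x' + y), z'; split; first by apply/(sel_bool (fun s => addS s x y)); left; exists x'.
    by split; [apply/(sel_bool (fun s v => opt s v z))|rewrite E1 //; [case: Hx|case: Hz]].
  exists s, (x + x'), z'; split; first by apply/(sel_bool (fun s => addS s x y)); right; exists x'.
  by split; [apply/(sel_bool (fun s v => opt s v z))|rewrite E2 //; [case: Hx|case: Hz]].
- case=> s [v [z' [/(sel_bool (fun s => addS s x y)) Hv [/(sel_bool (fun s v => opt s v z)) Hz ->]]]].
  case: Hv => -[u [Hu ->]]; [left|right].
    exists (mo x z u z'); split; last by rewrite E1 //; [case: Hu|case: Hz].
    by exists s, u, z'.
  exists (mo y z u z'); split; last by rewrite E2 //; [case: Hu|case: Hz].
  by exists s, u, z'.
Qed.

Lemma mulDr x y z : x * (y + z) = x * y + x * z.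
Proof. by rewrite mulC mulDl (mulC y) (mulC z). Qed.

Lemma mulNl x y : - x * y = - (x * y).
Proof. by apply: neg_uniq; rewrite -mulDl addxN mulC mulx0. Qed.

Lemma mulNr x y : x * - y = - (x * y).
Proof. by rewrite mulC mulNl mulC. Qed.

Lemma mulA x y z : x * (y * z) = x * y * z.
Proof.
elim/(well_founded_ind simpler_wf): x y z => x IHx.
elim/(well_founded_ind simpler_wf) => y IHy.
elim/(well_founded_ind simpler_wf) => z IHz.
have E x' y' z' : x' ⊏ x -> y' ⊏ y -> z' ⊏ z ->
    mo (x * y) z (mo x y x' y') z' = mo x (y * z) x' (mo y z y' z').
  move=> Hx Hy Hz; rewrite /mo !mulDl !mulDr !mulNl !mulNr.
  rewrite (IHx x' Hx y z) (IHx x' Hx y' z) (IHx x' Hx y z') (IHx x' Hx y' z').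
  by rewrite (IHy y' Hy z) (IHy y' Hy z') (IHz z' Hz); abel.
have B (r s t : bool) : ((r == s) == (r == t)) = (s == t) by case: r s t => [] [] [].
apply: bcut_uniq (mul_cut (bcut_opts x) (mul_is_cut y z)) _.
apply: (@bcut_ext (fun t w => exists s a b, sel s (mulS true x y) (mulS false x y) a /\
  sel (s == t) (fun v => opt true v z) (fun v => opt false v z) b /\ w = mo (x * y) z a b)) => [|t w].
  exact: mul_cut (mul_is_cut x y) (bcut_opts z).
split.
- case=> s [v [z' [/(sel_bool (fun s => mulS s x y)) Hv [/(sel_bool (fun s v => opt s v z)) Hz ->]]]].
  case: Hv => r [x' [y' [Hx [Hy ->]]]]; exists r, x', (mo y z y' z').
  split; first by apply/(sel_bool (fun s v => opt s v x)).
  split; last by rewrite E //; [case: Hx|case: Hy|case: Hz].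
  by apply/(sel_bool (fun s => mulS s y z)); exists (r == s), y', z'; rewrite B.
- case=> r [x' [v [/(sel_bool (fun s v => opt s v x)) Hx [/(sel_bool (fun s => mulS s y z)) Hv ->]]]].
  case: Hv => q [y' [z' [Hy [Hz ->]]]]; exists (r == q), (mo x y x' y'), z'.
  split.
    apply/(sel_bool (fun s => mulS s x y)); exists r, x', y'; split=> //; split=> //.
    by rewrite (_ : (r == (r == q)) = q) //; case: (r) (q) => [] [].
  split; last by rewrite E //; [case: Hx|case: Hy|case: Hz].
  apply/(sel_bool (fun s v => opt s v z)).
  by rewrite (_ : ((r == q) == t) = (q == (r == t))) //; case: (r) (q) (t) => [] [] [].
Qed.

Lemma neq01 : 1 <> 0. Proof. by move=> E; have := lt01; rewrite E => /lt_irrefl. Qed.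

HB.instance Definition _ := GRing.Zmodule_isComNzRing.Build No mulA mulC
  (fun x => eq_trans (mulC _ _) (mulx1 x)) mulDl (introN eqP neq01).

(** * The ordered field of surreal numbers *)

Lemma addE x y : x + y = (x + y)%R. Proof. by []. Qed.
Lemma mulE x y : x * y = (x * y)%R. Proof. by []. Qed.
Lemma negE x : - x = (- x)%R. Proof. by []. Qed.
Lemma zeroE : of_nat O = 0%R. Proof. by []. Qed.
Lemma oneE : of_nat (S O) = 1%R. Proof. by []. Qed.
Definition ringE := (addE, mulE, negE, zeroE, oneE).

Lemma one_simpler x : 0 < x -> 1 ⊑ x.
Proof.
move=> H; rewrite -(concat_0l 1); apply/lopt_plus; split=> //; split; first exact: simpler_0.
by move=> E; rewrite E in H; case: (lt_irrefl H).
Qed.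

Lemma sd_sub s x y : sd s x y <-> sd s 0 (y - x).
Proof.
case: s => /=; first exact: lt_sub.
split=> [/lt_sub H|H]; first by apply: lt_by H _; abel.
by apply: lt_by H _; abel.
Qed.

Lemma sd0_mul s t x y : sd s 0 x -> sd t 0 y -> sd (s == t) 0 (x * y).
Proof.
have N z : z < 0 -> 0 < - z by move/lt_neg; rewrite neg0.
have N' z : 0 < - z -> z < 0 by move/lt_neg; rewrite neg0 negK.
case: s t => [] [] /= Hx Hy; first exact: mul_gt0.
- by apply: N'; rewrite -mulNr; apply: mul_gt0 => //; exact: N.
- by apply: N'; rewrite -mulNl; apply: mul_gt0 => //; exact: N.
- by rewrite -(negK y) mulNr -mulNl; apply: mul_gt0; exact: N.
Qed.

(** * Inverses *)

Lemma inv_pos a b : 0 < a -> a * b = 1 -> 0 < b.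
Proof.
move=> Ha E; case: (lt_total 0 b) => [//|[E0|Hb]].
  by move: E; rewrite -E0 mulx0 => /esym /neq01.
by have := @sd0_mul true false _ _ Ha Hb; rewrite E /= => /(lt_asym lt01).
Qed.

Section Inverse.
Variable x : No.
Hypothesis x_gt0 : 0 < x.
Hypothesis IH : forall x', x' ⊏ x -> 0 < x' -> x' * inv x' = 1.

Let good a := a ⊏ x /\ 0 < a.
(** Conway's approximations of 1/x: the map sending b to (1 + (a - x) b) / a, iterated from 0 over
    positive proper initial segments a of x. By [approx_cons] it multiplies the error 1 - x b by (a
    - x) / a. *)
Fixpoint approx (l : list No) : No :=
  match l with nil => 0 | cons a l => (1 + (a - x) * approx l) * inv a end.
Let goodl l := forall a, List.In a l -> good a.
Let I t z := exists l, goodl l /\ z = approx l /\ sd t (x * z) 1.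

Lemma approx_cons a b : good a ->
  x * ((1 + (a - x) * b) * inv a) - 1 = (x - a) * (1 - x * b) * inv a.
Proof.
move=> [S Ha]; have E := IH S Ha; rewrite !ringE in E *.
rewrite -{2}E; ring.
Qed.

Lemma approx_step a b s t : good a -> sd s a x -> sd (s == t) (x * b) 1 ->
  sd t 1 (x * ((1 + (a - x) * b) * inv a)).
Proof.
move=> Ga Ha Hb; apply/sd_sub; rewrite approx_cons //.
have Hi : sd true 0 (inv a) by case: Ga => S Ha'; exact: inv_pos (IH S Ha').
have := sd0_mul (sd0_mul (proj1 (sd_sub _ _ _) Ha) (proj1 (sd_sub _ _ _) Hb)) Hi.
by case: (s) (t) => [] [].
Qed.

Lemma approx_small t : small (I t).
Proof.
have [A [f H]] : small good by apply: small_sub (small_simpler x) _ => a [].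
apply: (small_sub (Q := fun z => exists l, True /\ z = approx (List.map f l))).
  by exists (list A), (fun l => approx (List.map f l)) => z [l [_ ->]]; exists l.
move=> z [l [Hl [-> _]]]; clear - Hl H.
suff [k ->] : exists k, l = List.map f k by exists k.
elim: l Hl => [|a l IHl] Hl; first by exists nil.
have [k ->] : exists k, l = List.map f k by apply: IHl => b Hb; apply: Hl; right.
have [b ->] := H a (Hl a (or_introl erefl)).
by exists (b :: k).
Qed.

(** The number y between the approximations b with x b < 1 and those with x b > 1 works: 1 is
    simpler than the positive number x y, and conversely 1 lies between the options of x y. *)
Lemma inverse_exists : exists y, x * y = 1.
Proof.
have I0 : I true 0 by exists nil; split=> [a []|]; split=> //=; rewrite mulx0; exact: lt01.
have C : is_cut (I true) (I false) (cut (I true) (I false)).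
  apply: cut_sep => [||l r [_ [_ [_ Hl]]] [_ [_ [_ Hr]]]]; try exact: approx_small.
  case: (lt_total l r) => [//|[E|H]]; first by move: Hl; rewrite E => /lt_asym.
  exfalso; have := lt_trans Hl Hr; have := D_lt x_gt0 H.
  rewrite /D !(mulC 0) !mulx0 => K /(lt_asym) []; apply: lt_by K _; abel.
set y := cut _ _ in C; exists y.
(* Left options that are not positive are replaced by 0, because approximations are built from
   positive a only. *)
have Cx : is_cut (fun a => a = 0 \/ lopt a x /\ 0 < a) (fun a => ropt a x) x.
  apply: (is_cut_cofinal (is_cut_opts x)) => [|l Hl|r Hr].
  - by split=> [l [->//|[[]]]|r []].
  - case: (le_or_lt l 0) => H; first by exists 0; split; [left|].
    by exists l; split; [right|left].
  - by exists r; split=> //; left.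
apply: simpler_antisym; last first.
  apply/one_simpler/mul_gt0 => //; by case: C => [[H _] _]; exact: H I0.
have [_] := mul_cut Cx C; apply.
suff H t z : (exists s a b, sel s (fun a => a = 0 \/ lopt a x /\ 0 < a) (fun a => ropt a x) a /\
   sel (s == t) (I true) (I false) b /\ z = mo x y a b) -> sd t z 1.
  by split=> z; [exact: (H true)|exact: (H false)].
case=> s [a [b [Ha [/(sel_bool I) [l [Hl [Eb Hb]]] ->]]]].
have [[-> Es]|[Ga Hs]] : (a = 0 /\ s = true) \/ (good a /\ sd s a x).
- case: s Ha {Hb} => [[->|[[S L] P]]|[S L]] /=; [by left|by right|right].
  by split=> //; split=> //; apply: lt_trans x_gt0 L.
- rewrite /mo (mulC 0 b) (mulC 0 y) !mulx0 (_ : 0 + x * b - 0 = x * b); last by abel.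
  by move: Hb; rewrite Es; case: (t).
- have Hy2 := approx_step Ga Hs Hb; set y2 := (1 + (a - x) * b) * inv a in Hy2.
  have I2 : I (~~ t) y2.
    exists (cons a l); rewrite /y2 Eb; split=> [c [<-//|/Hl //]|]; split=> //.
    by move: Hy2; rewrite /y2 Eb; case: (t).
  have {}I2 : sd t y y2 by case: C => [[C1 C2] _]; case: (t) I2 => /=; [exact: C2|exact: C1].
  (* The distance of the product option from 1 is a times the distance from y to the next
     approximation y2, whose side of y is known. *)
  apply/sd_sub; have -> : 1 - mo x y a b = a * (y2 - y).
    have E := IH (proj1 Ga) (proj2 Ga).
    by rewrite /mo /y2 !ringE in E *; rewrite -{1}E; ring: E.
  have := sd0_mul (s := true) (proj2 Ga) (proj1 (sd_sub _ _ _) I2).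
  by case: (t).
Qed.
End Inverse.

Lemma mulxV_gt0 x : 0 < x -> x * inv x = 1.
Proof.
elim/(well_founded_ind simpler_wf): x => x IH Hx.
have [y Hy] := inverse_exists Hx IH.
apply: (epsilon_spec (inhabits (of_nat O)) (fun y => x * y = 1)); by exists y.
Qed.

(** The field structure asks for the value 0 at 0, where the choice made by [inv] is arbitrary. *)
Definition invr x := if excluded_middle_informative (x = 0) then 0 else inv x.

Lemma mulxV x : x <> 0 -> x * inv x = 1.
Proof.
move=> H; apply: (epsilon_spec (inhabits (of_nat O)) (fun y => x * y = 1)).
case: (lt_total x 0) => [L|[//|L]]; last by exists (inv x); exact: mulxV_gt0.
exists (- inv (- x)); rewrite mulNr -mulNl; apply: mulxV_gt0.
by rewrite -neg0; exact: lt_neg.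
Qed.

Lemma mulVx x : x != 0%R -> invr x * x = 1.
Proof.
move=> /eqP H; rewrite mulC /invr; case: excluded_middle_informative => // K.
exact: mulxV.
Qed.

Lemma invr0 : invr 0 = 0.
Proof. by rewrite /invr; case: excluded_middle_informative. Qed.

HB.instance Definition _ := GRing.ComNzRing_isField.Build No mulVx invr0.

Definition lt_bool x y : bool := `[< x < y >].
Definition le_bool x y : bool := `[< x <= y >].
Definition normx x : No := if `[< 0 <= x >] then x else - x.

Lemma le_sub x y : x <= y <-> 0 <= y - x.
Proof.
split=> [[->|/lt_sub H]|[E|H]]; [by left; rewrite addxN|by right| |by right; apply/lt_sub].
by left; rewrite -(addx0 x) E; abel.
Qed.

Fact le0_add_b x y : le_bool 0 x -> le_bool 0 y -> le_bool 0 (x + y)%R.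
Proof.
move=> /asboolP H /asboolP K; apply/asboolP; apply: le_trans H _.
by rewrite -{1}(addx0 x); exact: le_add2l.
Qed.
Fact le0_mul_b x y : le_bool 0 x -> le_bool 0 y -> le_bool 0 (x * y)%R.
Proof.
move=> /asboolP [<-|H] /asboolP [<-|K]; apply/asboolP; rewrite -?mulE; try (by left; rewrite ?mulx0 // mulC mulx0).
by right; exact: mul_gt0.
Qed.
Fact le0_anti_b x : le_bool 0 x -> le_bool x 0 -> x = 0.
Proof. by move=> /asboolP H /asboolP K; exact: le_antisym. Qed.
Fact sub_ge0_b x y : le_bool 0 (y - x)%R = le_bool x y.
Proof. by apply/asboolP/asboolP => /(le_sub x y). Qed.
Fact le0_total_b x : le_bool 0 x || le_bool x 0.
Proof. by apply/orP; case: (le_or_lt 0 x) => H; [left|right]; apply/asboolP => //; right. Qed.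
Fact normN_b x : normx (- x)%R = normx x.
Proof.
have N : 0 <= - x <-> x <= 0.
  by rewrite (le_sub x) (le_sub 0 (- x)) (_ : - x - 0 = 0 - x); [split|abel].
rewrite /normx; case: asboolP => [/N H|H]; case: asboolP => K.
- by rewrite (le_antisym H K) -negE neg0.
- by [].
- exact: negK.
- by case: (le_or_lt 0 x) => [//|/leW /N].
Qed.
Fact ge0_norm_b x : le_bool 0 x -> normx x = x.
Proof. by rewrite /normx /le_bool => ->. Qed.
Fact lt_def_b x y : lt_bool x y = (y != x) && le_bool x y.
Proof.
apply/asboolP/andP => [H|[/eqP N /asboolP [E|//]]]; last by rewrite E in N.
split; last by apply/asboolP; right.
by apply/eqP => E; rewrite E in H; case: (lt_irrefl H).
Qed.

HB.instance Definition _ := Num.IntegralDomain_isLeReal.Build No le0_add_b le0_mul_b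
  le0_anti_b sub_ge0_b le0_total_b normN_b ge0_norm_b lt_def_b.

Lemma ltE x y : x < y <-> (x < y)%R.
Proof. by split=> [H|/asboolP //]; apply/asboolP. Qed.
Lemma leE x y : x <= y <-> (x <= y)%R.
Proof. by split=> [H|/asboolP //]; apply/asboolP. Qed.

Lemma invE x : x <> 0 -> inv x = (x^-1)%R.
Proof.
by move=> H; rewrite /GRing.inv /= /invr; case: excluded_middle_informative.
Qed.

Import Order.TTheory GRing.Theory Num.Theory.
Local Open Scope ring_scope.
Bind Scope ring_scope with No.
Arguments omega_map _%_ring_scope.
Arguments exp _%_ring_scope.
Arguments taylor _%_ring_scope _%_nat_scope.
Arguments tau _%_ring_scope.
Arguments is_real _%_ring_scope.

Lemma cut_ltl L R x l : is_cut L R x -> L l -> l < x.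
Proof. by move=> [[H _] _] /H /ltE. Qed.
Lemma cut_ltr L R x r : is_cut L R x -> R r -> x < r.
Proof. by move=> [[_ H] _] /H /ltE. Qed.
Lemma cut_simpler L R (x y : No) : is_cut L R x -> (forall l, L l -> l < y) ->
  (forall r, R r -> y < r) -> x ⊑ y.
Proof. by move=> [_ K] Hl Hr; apply: K; split=> [l /Hl|r /Hr] /ltE. Qed.
Lemma cut_intro (L R : No -> Prop) (x : No) : (forall l, L l -> l < x) -> (forall r, R r -> x < r) ->
  (forall y : No, (forall l, L l -> l < y) -> (forall r, R r -> y < r) -> x ⊑ y) -> is_cut L R x.
Proof.
move=> Hl Hr K; split; first by split=> [l /Hl|r /Hr] /ltE.
by move=> y [A B]; apply: K => [l /A|r /B] /ltE.
Qed.
Lemma cut_cofinal (L R L' R' : No -> Prop) (x : No) : is_cut L R x ->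
  (forall l, L' l -> l < x) -> (forall r, R' r -> x < r) ->
  (forall l, L l -> exists l', L' l' /\ l <= l') ->
  (forall r, R r -> exists r', R' r' /\ r' <= r) -> is_cut L' R' x.
Proof.
move=> H Hl Hr Kl Kr; apply: is_cut_cofinal H _ _ _.
- by split=> [l /Hl|r /Hr] /ltE.
- by move=> l /Kl [l' [? /leE ?]]; exists l'.
- by move=> l /Kr [l' [? /leE ?]]; exists l'.
Qed.
Lemma add_cutR (L R L' R' : No -> Prop) x y : is_cut L R x -> is_cut L' R' y ->
  is_cut (fun z => (exists x', L x' /\ z = x' + y) \/ (exists y', L' y' /\ z = x + y'))
         (fun z => (exists x', R x' /\ z = x' + y) \/ (exists y', R' y' /\ z = x + y'))
         (x + y).
Proof. exact: add_cut. Qed.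

Lemma mul_cutR (L R L' R' : No -> Prop) x y : is_cut L R x -> is_cut L' R' y ->
  let S t z := exists s a b, sel s L R a /\ sel (s == t) L' R' b /\ z = a * y + x * b - a * b in
  is_cut (S true) (S false) (x * y).
Proof. exact: mul_cut. Qed.

Lemma lopt_lt (x y : No) : lopt x y -> x < y. Proof. by case=> _ /ltE. Qed.
Lemma ropt_lt (x y : No) : ropt x y -> y < x. Proof. by case=> _ /ltE. Qed.

(** * Natural numbers, real numbers and dyadic fractions *)

Lemma ord_le_simpler a (y : No) : of_ord a <= y -> of_ord a ⊑ y.
Proof.
move=> H; have [_ K] := is_cut_opts (of_ord a); apply: K; split=> [l [_ Hl]|r [S /(simpler_gt_iff S)]].
  by apply/ltE; apply: lt_le_trans H; apply/ltE.
by rewrite (sgn_ord (simpler_len S)).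
Qed.

Lemma of_nat_cut n : is_cut (fun z => z = of_nat n) (fun _ => False) (of_nat n.+1).
Proof.
have E : of_nat n.+1 = (of_nat n ∔ 1)%S.
  by rewrite /of_nat onatS osucc_oadd1 of_ord_add.
apply: cut_intro => [l ->|//|y H _]; first by rewrite E; apply/ltE; exact: lt_plus.
rewrite E; apply/lopt_plus; split; last exact/ltE/H.
split; first by apply: ord_le_simpler; apply/ltW/H.
by move=> K; have := H _ erefl; rewrite -K ltxx.
Qed.

Lemma of_natE n : of_nat n = n%:R.
Proof.
elim/ltn_ind: n => -[//|n] IH; rewrite -addn1 natrD -(IH n) //.
have C1 := of_nat_cut 0; case: n IH => [|n] IH; first by rewrite add0r.
rewrite addn1; apply: is_cut_eq (of_nat_cut _) (add_cut (of_nat_cut n) C1) _ _.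
  split=> // l ->; apply/ltE; change (of_nat n.+1 < of_nat n.+1 + 1). by rewrite ltrDl ltr01.
have L : of_nat n.+1 < of_nat n.+2 by exact: cut_ltl (of_nat_cut _) _.
split=> [z [[? [-> ->]]|[? [-> ->]]]|z [[? [[]]]|[? [[]]]]]; apply/ltE.
  have -> : (of_nat n + 1)%S = of_nat n.+1 by rewrite (IH n) // (IH n.+1) // -natr1.
  by [].
by change (of_nat n.+1 + 0 < of_nat n.+2); rewrite addr0.
Qed.

Lemma real_bounded (r : No) : is_real r -> exists n : nat, r < n%:R.
Proof. by case=> -[n [_ /ltE H]] _; exists n; rewrite -of_natE. Qed.

Lemma natS_gt0 n : (0 : No) < n.+1%:R. Proof. exact: ltr0Sn. Qed.

Lemma div_of_nat n : (1 / of_nat n.+1)%S = n.+1%:R^-1.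
Proof.
rewrite (of_natE n.+1); change (1 * inv n.+1%:R = n.+1%:R^-1); rewrite mul1r invE //.
by move=> E; have := natS_gt0 n; rewrite E ltxx.
Qed.

Definition realL (r : No) z := exists n, z = r - n.+1%:R^-1.
Definition realR (r : No) z := exists n, z = r + n.+1%:R^-1.

Lemma is_realE (r : No) : is_real r <-> (exists n : nat, - n%:R < r < n%:R) /\ is_cut (realL r) (realR r) r.
Proof.
have EL : (fun z => exists n : nat, z = (r - 1 / of_nat (S n))%S) = realL r.
  by apply: functional_extensionality => z; apply: propositional_extensionality;
     split=> -[n ->]; exists n; rewrite div_of_nat.
have ER : (fun z => exists n : nat, z = (r + 1 / of_nat (S n))%S) = realR r.
  by apply: functional_extensionality => z; apply: propositional_extensionality;
     split=> -[n ->]; exists n; rewrite div_of_nat.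
rewrite /is_real EL ER; split=> -[[n H] K]; split.
- by exists n; rewrite -of_natE; case: H => /ltE -> /ltE ->.
- rewrite {3}K; apply: cut_is_cut; exists r; split=> _ [m ->]; apply/ltE.
    by rewrite gtrDl oppr_lt0 invr_gt0 natS_gt0.
  by rewrite ltrDl invr_gt0 natS_gt0.
- by exists n; rewrite of_natE; case/andP: H => /ltE ? /ltE ?.
- by apply: (is_cut_uniq K); apply: cut_is_cut; exists r; case: K.
Qed.

(** Otherwise r <= 1/k for all k, so 0 lies between the defining options of r, and r is simpler than
    0. *)
Lemma real_gt_inv (r : No) : is_real r -> 0 < r -> exists k : nat, k.+1%:R^-1 < r.
Proof.
move=> /is_realE [_ C] H; apply: NNPP => N.
have K k : r <= k.+1%:R^-1 by rewrite leNgt; apply/negP => ?; apply: N; exists k.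
have S : r ⊑ 0.
  apply: cut_simpler C _ _ => _ [n ->]; last first.
    by apply: addr_gt0 => //; rewrite invr_gt0 natS_gt0.
  rewrite subr_lt0; apply: le_lt_trans (K n.+1) _.
  by rewrite ltf_pV2 ?posrE ?natS_gt0 // ltr_nat.
by have := simpler_antisym S (simpler_0 r) => E; rewrite E ltxx in H.
Qed.

Lemma real_nat n : is_real n%:R.
Proof.
apply/is_realE; split; first by exists n.+1; rewrite ltr_nat ltnSn andbT; have := ler0n No n; have := natS_gt0 n; lra.
apply: cut_intro => [_ [m ->]|_ [m ->]|y H _].
- by rewrite gtrDl oppr_lt0 invr_gt0 natS_gt0.
- by rewrite ltrDl invr_gt0 natS_gt0.
case: n H => [|n] H; first exact: simpler_0.
rewrite -of_natE; apply: cut_simpler (of_nat_cut n) _ _ => // _ ->.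
rewrite of_natE; have := H (n.+1%:R - 1) ; rewrite -addn1 natrD addrK; apply.
by exists 0%N; rewrite invr1 addrK.
Qed.

Lemma half_gt0 j : (0 : No) < (2 ^+ j)^-1. Proof. by rewrite invr_gt0 exprn_gt0. Qed.

Lemma half_double j : ((2 ^+ j)^-1 : No) = (2 ^+ j.+1)^-1 + (2 ^+ j.+1)^-1.
Proof. by rewrite exprS; field; rewrite expf_neq0 // pnatr_eq0. Qed.

(** Let z0 be the simplest number between 0 and 2^-k. Comparing the options of z0 + z0 with the
    given cut of 2^-k shows z0 + z0 = 2^-k. *)
Lemma half_cut_step k (R : No -> Prop) : is_cut (fun z => z = 0) R ((2 ^+ k)^-1 : No) ->
  (forall r, R r -> r = (2 ^+ k)^-1 + (2 ^+ k)^-1) ->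
  is_cut (fun z => z = 0) (fun z => z = (2 ^+ k)^-1) ((2 ^+ k.+1)^-1 : No).
Proof.
move=> C K; have E := half_double k; have P := half_gt0 k.+1.
have Cz : is_cut (fun z => z = 0) (fun z => z = (2 ^+ k)^-1) (cut (fun z => z = 0%R) (fun z => z = (2 ^+ k)^-1)).
  by apply: cut_is_cut; exists (2 ^+ k.+1)^-1; split=> _ ->; apply/ltE; lra.
set z0 := cut _ _ in Cz; have z0l := cut_ltl Cz erefl; have z0r := cut_ltr Cz erefl.
suff -> : (2 ^+ k.+1)^-1 = z0 by [].
suff : z0 + z0 = (2 ^+ k)^-1 by rewrite E; lra.
apply: is_cut_eq (add_cut Cz Cz) C _ _.
  split=> z [[v [-> ->]]|[v [-> ->]]]; apply/ltE.
  - by change (0 + z0 < (2 ^+ k)^-1); rewrite add0r.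
  - by change (z0 + 0 < (2 ^+ k)^-1); rewrite addr0.
  - by change ((2 ^+ k)^-1 < (2 ^+ k)^-1 + z0); lra.
  - by change ((2 ^+ k)^-1 < z0 + (2 ^+ k)^-1); lra.
by split=> [_ ->|r /K ->]; apply/ltE; rewrite addE; lra.
Qed.

Lemma half_cut k : is_cut (fun z => z = 0) (fun z => z = (2 ^+ k)^-1) ((2 ^+ k.+1)^-1 : No).
Proof.
elim: k => [|k IH]; last by apply: half_cut_step IH _ => _ ->; exact: half_double.
apply: (@half_cut_step _ (fun _ => False)) => //; rewrite expr0 invr1.
exact: (of_nat_cut 0).
Qed.

Lemma real_half k : is_real (2 ^+ k)^-1.
Proof.
case: k => [|k]; first by rewrite expr0 invr1; exact: (real_nat 1).
have E := half_double k.
have [m Hm] : exists m, (m.+1%:R^-1 : No) < (2 ^+ k.+1)^-1.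
  exists (2 ^ k.+1)%N; have L : (2 ^+ k.+1 : No) < (2 ^ k.+1).+1%:R by rewrite -natrX ltr_nat.
  by rewrite ltf_pV2 // posrE ?natS_gt0 // exprn_gt0.
apply/is_realE; split.
  exists 1%N; have L : ((2 ^+ k.+1)^-1 : No) < 1 by rewrite invf_lt1 ?exprn_gt0 //; apply: exprn_egt1; rewrite ?ltr1n.
  have := half_gt0 k.+1; move=> ?; apply/andP; split; lra.
apply: cut_intro => [_ [n ->]|_ [n ->]|y H1 H2].
- by rewrite gtrDl oppr_lt0 invr_gt0 natS_gt0.
- by rewrite ltrDl invr_gt0 natS_gt0.
apply: cut_simpler (half_cut k) _ _ => _ ->.
  have L1 : (2 ^+ k.+1)^-1 - m.+1%:R^-1 < y by apply: H1; exists m.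
  by move: (m.+1%:R^-1) Hm L1 => u; lra.
have L2 : y < (2 ^+ k.+1)^-1 + m.+1%:R^-1 by apply: H2; exists m.
by move: (m.+1%:R^-1) Hm L2 => u; lra.
Qed.

Lemma small_ex S T (P : S -> T -> Prop) : (forall n : S, small (P n)) -> small (fun _ : S => True) ->
  small (fun z => exists n, P n z).
Proof.
move=> H K; apply: small_sub (small_union K (fun n _ => H n)) _ => z [n Hn].
by exists n.
Qed.

(** * The omega-map *)

Notation W := omega_map.

(** Natural multiples and dyadic fractions are cofinal among the positive real multiples in the
    definition of [omega_map], so cuts of monomials can be handled without real coefficients. *)
Definition WL (L : No -> Prop) z := z = 0 \/ exists (n : nat) x', L x' /\ z = n%:R * W x'.
Definition WR (R : No -> Prop) z := exists (k : nat) x', R x' /\ z = W x' / 2 ^+ k.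

Lemma small_WL L : small L -> small (WL L).
Proof.
move=> S; apply: small_or; first exact: small_eq.
by apply: small_ex small_nat => n; apply: (small_image (f := fun x => n%:R * W x) S).
Qed.

Lemma small_WR R : small R -> small (WR R).
Proof.
move=> S; apply: small_ex small_nat => k.
by apply: (small_image (f := fun x => W x / 2 ^+ k) S).
Qed.

Lemma lt_expn2 (n : nat) : exists k : nat, forall x : No, 0 < x -> n%:R * x < 2 ^+ k * x.
Proof.
by exists n => x Hx; rewrite ltr_pM2r // -natrX ltr_nat ltn_expl.
Qed.

Lemma omega_map_cut x : is_cut (WL (fun l => lopt l x)) (WR (fun r => ropt r x)) (W x).
Proof.
elim/(well_founded_ind simpler_wf): x => x IH.
have W0 y : y ⊏ x -> 0 < W y by move=> /IH H; apply: (cut_ltl H); left.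
have P2 k : 0 < 2 ^+ k :> No by exact: exprn_gt0.
have [y [Hl Hr]] : exists y, sep (WL (fun l => lopt l x)) (WR (fun r => ropt r x)) y.
  apply: exists_sep; [exact/small_WL/small_lopt|exact/small_WR/small_ropt|].
  move=> l r Hl [k [x2 [H2 ->]]]; apply/ltE; rewrite ltr_pdivlMr //.
  case: Hl => [->|[n [x1 [H1 ->]]]]; first by rewrite mul0r; apply/W0/(proj1 H2).
  case: (opt_comparable H1 H2) => K.
    apply: (cut_ltl (IH _ (proj1 H2))); right; exists (n * 2 ^ k)%N, x1; split=> //.
    by rewrite natrM natrX mulrAC.
  have [j Hj] := lt_expn2 (n * 2 ^ k); have /Hj := W0 _ (proj1 H1); rewrite natrM natrX.
  have := cut_ltr (IH _ (proj1 H1)) (ex_intro _ j (ex_intro _ x2 (conj K erefl))).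
  rewrite ltr_pdivlMr // => A B; apply: le_lt_trans _ A.
  by rewrite mulrAC (mulrC (W x1)); exact: ltW.
have C : is_cut (fun z => z = 0 \/ exists r x', is_real r /\ (0 < r)%S /\ lopt x' x /\ z = r * W x')
    (fun z => exists r x', is_real r /\ (0 < r)%S /\ ropt x' x /\ z = r * W x') (W x).
  rewrite omega_map_eq; apply: cut_is_cut; exists y; split.
    move=> l [->|[r [x' [Hr1 [Hr2 [Hx ->]]]]]]; apply/ltE; first by apply/ltE/Hl; left.
    have [n Hn] := real_bounded Hr1.
    have /Hl /ltE : WL (fun l => lopt l x) (n%:R * W x') by right; exists n, x'.
    by apply: lt_trans; rewrite ltr_pM2r //; apply/W0/(proj1 Hx).
  move=> r' [r [x' [Hr1 [/ltE Hr2 [Hx ->]]]]]; apply/ltE.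
  have [n Hn] := real_gt_inv Hr1 Hr2.
  have /Hr /ltE : WR (fun l => ropt l x) (W x' / 2 ^+ n.+1) by exists n.+1, x'.
  move/lt_trans; apply; rewrite mulrC ltr_pM2r; last by apply/W0/(proj1 Hx).
  apply: lt_trans Hn; rewrite ltf_pV2 ?posrE ?natS_gt0 ?P2 // -natrX ltr_nat ltn_expl //.
apply: (cut_cofinal C).
- move=> l [->|[n [x' [Hx ->]]]]; first by apply: (cut_ltl C); left.
  case: n => [|n]; first by rewrite mul0r; apply: (cut_ltl C); left.
  apply: (cut_ltl C); right; exists n.+1%:R, x'; split; first exact: real_nat.
  by split=> //; apply/ltE; exact: natS_gt0.
- move=> r [k [x' [Hx ->]]]; apply: (cut_ltr C); exists (2 ^+ k)^-1, x'.
  split; first exact: real_half.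
  by split; [apply/ltE; rewrite invr_gt0|rewrite mulrC].
- move=> l [->|[r [x' [Hr1 [Hr2 [Hx ->]]]]]]; first by exists 0; split=> //; left.
  have [n Hn] := real_bounded Hr1; exists (n%:R * W x'); split; first by right; exists n, x'.
  by apply: ltW; rewrite ltr_pM2r //; apply/W0/(proj1 Hx).
- move=> r' [r [x' [Hr1 [/ltE Hr2 [Hx ->]]]]].
  have [n Hn] := real_gt_inv Hr1 Hr2; exists (W x' / 2 ^+ n.+1); split; first by exists n.+1, x'.
  rewrite mulrC ler_pM2r; last by apply/W0/(proj1 Hx).
  apply: ltW; apply: lt_trans Hn; rewrite ltf_pV2 ?posrE ?natS_gt0 ?P2 // -natrX ltr_nat ltn_expl //.
Qed.

Lemma omega_gt0 x : 0 < W x.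
Proof. by apply: (cut_ltl (omega_map_cut x)); left. Qed.

Lemma omega_lopt x y n : lopt x y -> n%:R * W x < W y.
Proof. by move=> H; apply: (cut_ltl (omega_map_cut y)); right; exists n, x. Qed.

Lemma omega_ropt x y n : ropt x y -> n%:R * W y < W x.
Proof.
move=> H; have [k /(_ _ (omega_gt0 y)) Hk] := lt_expn2 n; apply: lt_trans Hk _.
have := cut_ltr (omega_map_cut y) (ex_intro _ k (ex_intro _ x (conj H erefl))).
by rewrite ltr_pdivlMr ?exprn_gt0 // mulrC.
Qed.

Lemma lt_optsR (x y : No) : x < y -> exists m : No, (x = m \/ ropt m x) /\ (y = m \/ lopt m y).
Proof. by move/ltE/lt_opts. Qed.

Lemma omega_lt n (x y : No) : x < y -> n%:R * W x < W y.
Proof.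
move=> H; case: (lt_optsR H) => m [[E1|H1] [E2|H2]].
- by move: H; rewrite E1 E2 ltxx.
- by rewrite E1; exact: omega_lopt.
- by rewrite E2; exact: omega_ropt.
- apply: lt_trans (omega_ropt n H1) _.
  by have := omega_lopt 1 H2; rewrite mul1r.
Qed.

Lemma omega_mono (x y : No) : (W x < W y) = (x < y).
Proof.
have K (a b : No) : a < b -> W a < W b by move/(omega_lt 1); rewrite mul1r.
case: (ltgtP x y) => [/K //|/K /lt_gtF //|->]; exact: ltxx.
Qed.

Lemma omega_inj (x y : No) : W x = W y -> x = y.
Proof.
by move=> H; case: (ltgtP x y) => //; rewrite -omega_mono H ltxx.
Qed.

Lemma omega_le (x y : No) : (W x <= W y) = (x <= y).
Proof. by rewrite !leNgt omega_mono. Qed.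

Lemma omega_lt_half k (x y : No) : x < y -> W x < W y / 2 ^+ k.
Proof.
move=> H; rewrite ltr_pdivlMr ?exprn_gt0 // mulrC -natrX; exact: omega_lt.
Qed.

Lemma omega_cut L R (x : No) : is_cut L R x -> is_cut (WL L) (WR R) (W x).
Proof.
move=> C; apply: (cut_cofinal (omega_map_cut x)).
- move=> l [->|[n [x' [Hx ->]]]]; first exact: omega_gt0.
  exact/omega_lt/(cut_ltl C).
- by move=> r [k [x' [Hx ->]]]; exact/omega_lt_half/(cut_ltr C).
- move=> l [->|[n [x' [Hx ->]]]]; first by exists 0; split=> //; left.
  case: (is_cut_lopt C Hx) => y [Ly /leE Hy]; exists (n%:R * W y).
  split; first by right; exists n, y.
  by rewrite ler_wpM2l ?ler0n // omega_le.
- move=> r [k [x' [Hx ->]]]; case: (is_cut_ropt C Hx) => y [Ly /leE Hy].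
  exists (W y / 2 ^+ k); split; first by exists k, y.
  by rewrite ler_pM2r ?invr_gt0 ?exprn_gt0 // omega_le.
Qed.

(* The options of the factors are far away from them, so the options of the
   product need not be considered individually. *)
Lemma mul_cut_coarse LA RA LB RB (A B q : No) : is_cut LA RA A -> is_cut LB RB B ->
  0 < A -> 0 < B -> 0 < q ->
  (forall l, LA l -> 0 <= l /\ l * 2%:R <= A) -> (forall l, LB l -> 0 <= l /\ l * 2%:R <= B) ->
  (forall r, RA r -> A * 2%:R <= r) -> (forall r, RB r -> B * 2%:R <= r) ->
  (forall l, LA l -> l * B * 2%:R < q) -> (forall l, LB l -> A * l * 2%:R < q) ->
  (forall r, RA r -> q * 4%:R < r * B) -> (forall r, RB r -> q * 4%:R < A * r) -> A * B ⊑ q.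
Proof.
move=> CA CB A0 B0 q0 HLA HLB HRA HRB KLA KLB KRA KRB.
apply: (cut_simpler (mul_cutR CA CB)) => z [[] [a [b [/= Ha [/= Hb ->]]]]].
- have [a0 a2] := HLA _ Ha; have [b0 b2] := HLB _ Hb.
  have := KLA _ Ha; have := KLB _ Hb; have := mulr_ge0 a0 b0; lra.
- have a2 := HRA _ Ha; have b2 := HRB _ Hb.
  have : A * B <= (a - A) * (b - B) by apply: ler_pM; lra.
  by rewrite mulrBl !mulrBr; lra.
- have [a0 a2] := HLA _ Ha; have b2 := HRB _ Hb.
  have K := KRB _ Hb; have : (A / 2%:R) * (b / 2%:R) <= (A - a) * (b - B).
    by apply: ler_pM; lra.
  rewrite mulrBl !mulrBr; have := mulr_gt0 A0 B0; lra.
- have [b0 b2] := HLB _ Hb; have a2 := HRA _ Ha.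
  have K := KRA _ Ha; have : (a / 2%:R) * (B / 2%:R) <= (a - A) * (B - b).
    by apply: ler_pM; lra.
  rewrite mulrBl !mulrBr; have := mulr_gt0 A0 B0; lra.
Qed.

Lemma WL_ge0 L l : WL L l -> 0 <= l.
Proof. by case=> [->//|[n [x' [_ ->]]]]; rewrite mulr_ge0 ?ler0n // ltW // omega_gt0. Qed.

Lemma omegaD (x y : No) : W (x + y) = W x * W y.
Proof.
elim/(well_founded_ind simpler_wf): x y => x IHx.
elim/(well_founded_ind simpler_wf) => y IHy.
have Ex x' : x' ⊏ x -> W x' * W y = W (x' + y) by move=> H; rewrite (IHx _ H).
have Ey y' : y' ⊏ y -> W x * W y' = W (x + y') by move=> H; rewrite (IHy _ H).
have P2 k : 0 < 2 ^+ k :> No by exact: exprn_gt0.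
apply: simpler_antisym.
  apply: (cut_simpler (omega_cut (add_cutR (is_cut_opts x) (is_cut_opts y)))).
    move=> l [->|[n [v [Hv ->]]]]; first by rewrite mulr_gt0 ?omega_gt0.
    case: Hv => -[u [Hu ->]].
      rewrite -(Ex _ (proj1 Hu)) mulrA ltr_pM2r ?omega_gt0 //.
      exact/omega_lt/lopt_lt.
    rewrite -(Ey _ (proj1 Hu)) mulrCA ltr_pM2l ?omega_gt0 //.
    exact/omega_lt/lopt_lt.
  move=> r [k [v [Hv ->]]]; case: Hv => -[u [Hu ->]].
    rewrite -(Ex _ (proj1 Hu)) mulrAC ltr_pM2r ?omega_gt0 //.
    exact/omega_lt_half/ropt_lt.
  rewrite -(Ey _ (proj1 Hu)) -mulrA ltr_pM2l ?omega_gt0 //.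
  exact/omega_lt_half/ropt_lt.
have L2 z l : WL (fun l => lopt l z) l -> 0 <= l /\ l * 2%:R <= W z.
  move=> H; split; first exact: WL_ge0 H.
  case: H => [->|[n [v [Hv ->]]]]; first by rewrite mul0r ltW // omega_gt0.
  by rewrite mulrAC -natrM; apply/ltW/omega_lt/lopt_lt.
have R2 z r : WR (fun l => ropt l z) r -> W z * 2%:R <= r.
  move=> [k [v [Hv ->]]]; rewrite ler_pdivlMr // -mulrA mulrC -natrX -natrM.
  by apply/ltW/omega_lt/ropt_lt.
apply: (mul_cut_coarse (omega_map_cut x) (omega_map_cut y)); try exact: omega_gt0.
- exact: L2.
- exact: L2.
- exact: R2.
- exact: R2.
- move=> l [->|[n [v [Hv ->]]]]; first by rewrite !mul0r omega_gt0.
  rewrite -(mulrA n%:R) (Ex _ (proj1 Hv)) mulrAC -natrM; apply: omega_lt.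
  by rewrite ltrD2r; exact: lopt_lt.
- move=> l [->|[n [v [Hv ->]]]]; first by rewrite mulr0 mul0r omega_gt0.
  rewrite mulrCA (Ey _ (proj1 Hv)) mulrAC -natrM; apply: omega_lt.
  by rewrite ltrD2l; exact: lopt_lt.
- move=> r [k [v [Hv ->]]].
  rewrite mulrAC (Ex _ (proj1 Hv)) ltr_pdivlMr // -mulrA mulrC -natrX -natrM; apply: omega_lt.
  by rewrite ltrD2r; exact: ropt_lt.
- move=> r [k [v [Hv ->]]].
  rewrite mulrA (Ey _ (proj1 Hv)) ltr_pdivlMr // -mulrA mulrC -natrX -natrM; apply: omega_lt.
  by rewrite ltrD2l; exact: ropt_lt.
Qed.

Lemma omega0 : W 0 = 1.
Proof.
apply: (@mulIf _ (W 0)); first by rewrite gt_eqF // omega_gt0.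
by rewrite -omegaD addr0 mul1r.
Qed.

Lemma omega_natmul n (x : No) : W (x *+ n) = W x ^+ n.
Proof. by elim: n => [|n IH]; [rewrite mulr0n omega0|rewrite mulrS omegaD IH exprS]. Qed.

(** For the converse, W of the meet of x and y lies between W x and W y and therefore prolongs W x,
    although the meet is an initial segment of x; so the meet is x. *)
Lemma omega_simpler (x y : No) : W x ⊑ W y <-> x ⊑ y.
Proof.
have K (a b : No) : a ⊑ b -> W a ⊑ W b.
  move=> S; apply: (cut_simpler (omega_map_cut a)).
    move=> l [->|[n [v [Hv ->]]]]; first exact: omega_gt0.
    by apply: omega_lt; apply/ltE; case: Hv => Sv Lv; exact: ext_gt S.
  move=> r [k [v [Hv ->]]]; apply: omega_lt_half; apply/ltE; case: Hv => Sv Lv; exact: ext_lt S.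
split; last exact: K.
have C (a b m : No) : a ⊏ m -> W m ⊑ W a -> False.
  move=> S H; have := simpler_antisym H (K _ _ (simplerW S)) => /omega_inj E.
  by case: S => _; rewrite E.
move=> H; case: (ltgtP x y) => [L|L|->//].
  have [m [S1 [S2 [/leE L1 /leE L2]]]] := lt_meet (proj2 (ltE _ _) L).
  case: (simpler_eqVlt S1) => [<-//|S].
  exfalso; apply: (C m m x S); apply: simpler_convex (simpler_refl _) H _ _; apply/leE; by rewrite omega_le.
have [m [S1 [S2 [/leE L1 /leE L2]]]] := lt_meet (proj2 (ltE _ _) L).
case: (simpler_eqVlt S2) => [<-//|S].
exfalso; apply: (C m m x S); apply: simpler_convex H (simpler_refl _) _ _; apply/leE; by rewrite omega_le.
Qed.

(** * Archimedean classes *)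

Definition arch (x y : No) := exists n : nat, x <= n%:R * y /\ y <= n%:R * x.

Lemma arch_trans (x y z : No) : arch x y -> arch y z -> arch x z.
Proof.
move=> [n [H1 H2]] [m [K1 K2]]; exists (n * m)%N; rewrite natrM; split.
  by apply: le_trans H1 _; rewrite -mulrA ler_wpM2l.
by apply: le_trans K2 _; rewrite -mulrA mulrCA ler_wpM2l.
Qed.

Lemma arch_sym (x y : No) : arch x y -> arch y x.
Proof. by case=> n [? ?]; exists n. Qed.

Lemma not_arch (x y : No) : 0 < x -> x <= y -> ~ arch x y -> forall n : nat, n%:R * x < y.
Proof.
move=> x0 xy N n; have xy0 := xy; rewrite ltNge; apply/negP => K; apply: N; exists n.+1.
rewrite -natr1 !mulrDl !mul1r; split; last by rewrite (le_trans K) // lerDl ltW.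
apply: le_trans xy _; rewrite lerDr; apply: mulr_ge0; [exact: ler0n|exact: le_trans (ltW x0) xy0].
Qed.

(** If a simpler positive number has the class of x, induction applies. Otherwise x differs in class
    from all its positive options, and x equals W c for the c cut out by the classes of these
    options. *)
Lemma arch_class (x : No) : 0 < x -> exists c, arch x (W c).
Proof.
elim/(well_founded_ind simpler_wf): x => x IH x0.
case: (classic (exists y, y ⊏ x /\ 0 < y /\ arch x y)) => [[y [S [y0 Ay]]]|N].
  by case: (IH y S y0) => c Ac; exists c; exact: arch_trans Ay Ac.
pose cl y := epsilon (inhabits 0) (fun c => arch y (W c)).
have clP y : y ⊏ x -> 0 < y -> arch y (W (cl y)).
  by move=> S y0; apply: (epsilon_spec (inhabits 0) (fun c => arch y (W c))); exact: IH.
have Nl y : lopt y x -> 0 < y -> forall n : nat, n%:R * y < x.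
  move=> H y0; apply: not_arch => //; first by apply/ltW/lopt_lt.
  by move/arch_sym => A; apply: N; exists y; split; [case: H|].
have Nr y : ropt y x -> forall n : nat, n%:R * x < y.
  move=> H; apply: not_arch => //; first by apply/ltW/ropt_lt.
  move=> A; apply: N; exists y; split; [by case: H|split=> //].
  by apply: lt_trans x0 _; exact: ropt_lt.
pose L c := exists y, lopt y x /\ 0 < y /\ c = cl y.
pose R c := exists y, ropt y x /\ c = cl y.
have C : is_cut L R (cut L R).
  apply: cut_sep => [||l r [y1 [H1 [P1 ->]]] [y2 [H2 ->]]].
  - by apply: (small_image (f := cl) (small_lopt x)) => z [y [? [_ ->]]]; exists y.
  - by apply: (small_image (f := cl) (small_ropt x)) => z [y [? ->]]; exists y.
  apply/ltE; rewrite -omega_mono.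
  have P2 : 0 < y2 by apply: lt_trans x0 _; exact: ropt_lt.
  case: (clP _ (proj1 H1) P1) => n [A1 A2]; case: (clP _ (proj1 H2) P2) => m [B1 B2].
  rewrite ltNge; apply/negP => K.
  have : y2 <= (m * n)%:R * y1.
    apply: le_trans B1 _; rewrite natrM -mulrA ler_wpM2l //; exact: le_trans K A2.
  by apply/negP; rewrite -ltNge; apply: lt_trans (Nl _ H1 P1 _) _; exact: ropt_lt.
exists (cut L R); set c := cut L R in C *.
suff -> : x = W c by exists 1%N; rewrite mul1r.
apply: is_cut_eq (is_cut_opts x) (omega_cut C) _ _; last first.
  split=> [l [->|[n [d [[y [Hy [y0 ->]]] ->]]]]|r [k [d [[y [Hy ->]] ->]]]]; apply/ltE => //.
    case: (clP _ (proj1 Hy) y0) => m [A1 A2].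
    by apply: le_lt_trans (Nl _ Hy y0 (n * m)%N); rewrite natrM -mulrA ler_wpM2l.
  have y0 : 0 < y by apply: lt_trans x0 _; exact: ropt_lt.
  case: (clP _ (proj1 Hy) y0) => m [A1 A2]; rewrite ltr_pdivlMr ?exprn_gt0 //.
  have E : m.+1%:R * (x * 2 ^+ k) = (m.+1 * 2 ^ k)%:R * x by rewrite natrM natrX -mulrA (mulrC x).
  rewrite -(ltr_pM2l (natS_gt0 m)) E; apply: (lt_le_trans (lt_le_trans (Nr _ Hy _) A1)).
  by rewrite ler_pM2r ?omega_gt0 // ler_nat.
split=> [l Hl|r Hr]; apply/ltE.
  case: (leP l 0) => [l0|l0]; first exact: le_lt_trans l0 (omega_gt0 _).
  case: (clP _ (proj1 Hl) l0) => n [A1 A2]; apply: le_lt_trans A1 _.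
  by apply: omega_lt; apply: (cut_ltl C); exists l.
have r0 : 0 < r by apply: lt_trans x0 _; exact: ropt_lt.
case: (clP _ (proj1 Hr) r0) => n [A1 A2].
have : W c < W (cl r) / 2 ^+ n by apply/omega_lt_half/(cut_ltr C); exists r.
rewrite ltr_pdivlMr ?exprn_gt0 // => K.
have n0 : (0 : No) < n%:R.
  case: n A1 {A2 K} => [|n]; last by rewrite ltr0n.
  by rewrite mul0r leNgt r0.
rewrite -(ltr_pM2l n0); apply: lt_le_trans A2; apply: le_lt_trans K.
rewrite mulrC ler_wpM2l ?(ltW (omega_gt0 _)) // -natrX ler_nat; exact/ltnW/ltn_expl.
Qed.

Lemma arch_omega (x y : No) : arch (W x) (W y) -> x = y.
Proof.
have H (a b : No) : arch (W a) (W b) -> ~ a < b.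
  by move=> [n [_ K]] /(omega_lt n); rewrite ltNge K.
by case: (ltgtP x y) => // L A; [case: (H _ _ A)|case: (H _ _ (arch_sym A))].
Qed.

(** * Taylor polynomials *)

Notation T := taylor.
Arguments taylor _%_ring_scope _%_nat_scope : simpl never.
Definition te i (x : No) : No := x ^+ i / i`!%:R.

Lemma powE (x : No) n : pow x n = x ^+ n.
Proof. by elim: n => [//|n IH]; rewrite exprSr -IH. Qed.

Lemma factE n : Factorial.fact n = n`!.
Proof. by elim: n => [//|n IH]; rewrite factS -IH mulSn. Qed.

Lemma fact_neq0 n : n`!%:R != 0 :> No.
Proof. by rewrite pnatr_eq0 -lt0n fact_gt0. Qed.

Lemma taylor0 (x : No) : T x 0 = 1. Proof. by []. Qed.

Lemma taylorS (x : No) n : T x n.+1 = T x n + te n.+1 x.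
Proof.
rewrite /te -powE -invE; last by apply/eqP; exact: fact_neq0.
by rewrite -of_natE -factE.
Qed.

Lemma taylor_sum (x : No) n : T x n = \sum_(i < n.+1) te i x.
Proof.
elim: n => [|n IH]; first by rewrite big_ord_recr big_ord0 /te /= fact0 invr1 mulr1 expr0 add0r.
by rewrite taylorS IH [RHS]big_ord_recr.
Qed.

Lemma te0 (x : No) : te 0 x = 1. Proof. by rewrite /te expr0 mul1r invr1. Qed.

Lemma te_ge0 i (x : No) : 0 <= x -> 0 <= te i x.
Proof. by move=> H; rewrite mulr_ge0 ?exprn_ge0 // invr_ge0. Qed.

Lemma teS i (x : No) : te i.+1 x = te i x * (x / i.+1%:R).
Proof.
by rewrite /te factS natrM invfM exprSr [_^-1 * _^-1]mulrC mulrACA.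
Qed.

Lemma teN i (x : No) : te i (- x) = if odd i then - te i x else te i x.
Proof. by rewrite /te exprNn -signr_odd; case: odd; rewrite ?expr1 ?expr0 ?mulN1r ?mulNr ?mul1r. Qed.

Lemma te_norm i (x : No) : `|te i x| = te i `|x|.
Proof. by rewrite normrM normrX [X in _ * X]ger0_norm // invr_ge0. Qed.

Lemma te_add k N (s t : No) : (k < N)%N ->
  te k (s + t) = \sum_(i < N) \sum_(j < N | (i + j)%N == k) te i s * te j t.
Proof.
move=> kN.
have E (i : 'I_N) : \sum_(j < N | (i + j)%N == k) te i s * te j t =
   if (i <= k)%N then te i s * te (k - i) t else 0.
  case: leqP => H; last by apply: big1 => j /eqP E; rewrite -E ltnNge leq_addr in H.
  have Hk : (k - i < N)%N by apply: leq_ltn_trans kN; exact: leq_subr.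
  rewrite (big_pred1 (Ordinal Hk)) // => j /=; rewrite -val_eqE /=.
  by rewrite -[in RHS](eqn_add2l i) subnKC.
rewrite (eq_bigr _ (fun i _ => E i)) -big_mkcond /=.
rewrite {1}/te addrC exprDn mulr_suml.
rewrite (big_ord_widen_cond N xpredT (fun i : nat => (t ^+ (k - i) * s ^+ i *+ 'C(k, i)) / k`!%:R)) //.
apply: eq_big => [i|i]; first by rewrite /= ltnS.
rewrite /= ltnS => ik; rewrite /te -(bin_fact ik) !natrM -mulr_natl.
have C0 : 'C(k, i)%:R != 0 :> No by rewrite pnatr_eq0 -lt0n bin_gt0.
by have := fact_neq0 i; have := fact_neq0 (k - i) => ? ?; field; apply/and3P.
Qed.

Lemma taylor_add n N (s t : No) : (n < N)%N ->
  T (s + t) n = \sum_(i < N) \sum_(j < N | (i + j <= n)%N) te i s * te j t.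
Proof.
move=> nN; rewrite taylor_sum.
rewrite (eq_bigr (fun k : 'I_n.+1 => \sum_(i < N) \sum_(j < N | (i + j)%N == k) te i s * te j t)); last first.
  by move=> k _; apply: te_add; apply: leq_trans nN; exact: ltn_ord.
rewrite exchange_big /=; apply: eq_bigr => i _.
rewrite (exchange_big_dep xpredT) //= [RHS]big_mkcond /=; apply: eq_bigr => j _.
case: leqP => H.
  rewrite (big_pred1 (Ordinal (H : (i + j < n.+1)%N))) //.
by apply: big1 => k /eqP E; have := ltn_ord k; rewrite -E ltnS leqNgt H.
Qed.

Lemma taylor_mul n m (s t : No) :
  T s n * T t m = \sum_(i < n.+1) \sum_(j < m.+1) te i s * te j t.
Proof.
rewrite !taylor_sum mulr_suml; apply: eq_bigr => i _.
by rewrite mulr_sumr.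
Qed.

Definition rest K (s t : No) := \sum_(i < K.+1) \sum_(j < K.+1 | (K < i + j)%N) te i s * te j t.

Lemma taylor_rest K (s t : No) : T s K * T t K = T (s + t) K + rest K s t.
Proof.
rewrite taylor_mul (taylor_add _ _ (ltnSn K)) -big_split /=; apply: eq_bigr => i _.
rewrite (bigID (fun j : 'I_K.+1 => (i + j <= K)%N)) /=; congr (_ + _).
by apply: eq_bigl => j; rewrite ltnNge.
Qed.

Lemma rest_norm K (s t : No) : `|rest K s t| <= rest K `|s| `|t|.
Proof.
apply: le_trans (ler_norm_sum _ _ _) _; apply: ler_sum => i _.
apply: le_trans (ler_norm_sum _ _ _) _; apply: ler_sum => j _.
by rewrite normrM !te_norm.
Qed.

Lemma rest_ge0 K (s t : No) : 0 <= s -> 0 <= t -> 0 <= rest K s t.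
Proof.
move=> Hs Ht; apply: sumr_ge0 => i _; apply: sumr_ge0 => j _.
by rewrite mulr_ge0 // te_ge0.
Qed.

Lemma taylor_add_le n (s t : No) : 0 <= s -> 0 <= t -> T (s + t) n <= T s n * T t n.
Proof. by move=> Hs Ht; rewrite taylor_rest lerDl rest_ge0. Qed.

Lemma taylor_mul_le n m (s t : No) : 0 <= s -> 0 <= t -> T s n * T t m <= T (s + t) (n + m).
Proof.
move=> Hs Ht; rewrite (taylor_add _ _ (ltnSn (n + m))) taylor_mul.
have Hn : (n < (n + m).+1)%N by rewrite ltnS leq_addr.
have Hm : (m < (n + m).+1)%N by rewrite ltnS leq_addl.
have P i j : 0 <= te i s * te j t by rewrite mulr_ge0 // te_ge0.
rewrite (big_ord_widen _ (fun i => \sum_(j < m.+1) te i s * te j t) Hn) big_mkcond /=.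
apply: ler_sum => i _; case: ifP => [Hi|_]; last by apply: sumr_ge0.
rewrite (big_ord_widen _ (fun j => te i s * te j t) Hm) big_mkcond [X in _ <= X]big_mkcond /=.
apply: ler_sum => j _; case: ifP => [Hj|_]; last by case: ifP.
by rewrite leq_add.
Qed.

Lemma taylor_ge1 n (s : No) : 0 <= s -> 1 <= T s n.
Proof.
by move=> H; elim: n => [//|n IH]; rewrite taylorS (le_trans IH) // lerDl te_ge0.
Qed.

Lemma taylor_gt0 n (s : No) : 0 <= s -> 0 < T s n.
Proof. by move=> H; apply: lt_le_trans (taylor_ge1 n H). Qed.

Lemma taylor_mono n m (s : No) : 0 <= s -> (n <= m)%N -> T s n <= T s m.
Proof.
move=> H; elim: m => [|m IH]; first by rewrite leqn0 => /eqP ->.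
rewrite leq_eqVlt => /orP [/eqP -> //|]; rewrite ltnS => /IH K.
by rewrite taylorS (le_trans K) // lerDl te_ge0.
Qed.

(** Beyond K each term is at most half of the previous one. Subtracting the last term on the right
    makes the geometric bound inductive. *)
Lemma taylor_tail K j (u : No) : 0 <= u -> u * 2%:R <= K.+1%:R ->
  T u (K + j.+1) - T u K <= te K.+1 u * 2%:R - te (K + j.+1) u.
Proof.
move=> u0 uK; elim: j => [|j IH]; first by rewrite addn1 taylorS; lra.
rewrite addnS taylorS; apply: le_trans (_ : te K.+1 u * 2%:R - te (K + j.+1) u + te (K + j.+1).+1 u <= _).
  by move: IH; lra.
suff : te (K + j.+1).+1 u * 2%:R <= te (K + j.+1) u by lra.
rewrite teS -mulrA ler_piMr ?te_ge0 // mulrAC ler_pdivrMr ?natS_gt0 // mul1r.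
by apply: le_trans uK _; rewrite ler_nat ltnS leq_addr.
Qed.

Lemma rest_small K (s t : No) : (`|s| + `|t|) * 2%:R <= K.+1%:R ->
  `|rest K s t| <= te K.+1 (`|s| + `|t|) * 2%:R.
Proof.
move=> H; apply: le_trans (rest_norm _ _ _) _.
have u0 : 0 <= `|s| + `|t| by rewrite addr_ge0.
case: K H => [|K] H.
  have -> : rest 0 `|s| `|t| = 0 by rewrite /rest big_ord1 big_mkcond big_ord1.
  by apply: mulr_ge0; [exact: te_ge0|exact: ler0n].
have := taylor_rest K.+1 `|s| `|t|; have := @taylor_mul_le K.+1 K.+1 `|s| `|t| (normr_ge0 _) (normr_ge0 _).
by have := @taylor_tail K.+1 K _ u0 H; have := te_ge0 (K.+1 + K.+1) u0; lra.
Qed.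

(** * Products of lower Taylor bounds *)

Lemma fact_dominates (c d : nat) : exists K0, forall K, (K0 <= K)%N -> (c * d ^ K < K`!)%N.
Proof.
suff [K0 H] : exists K0, (c * d ^ K0 < K0`!)%N /\ (d <= K0)%N.
  exists K0 => K /subnKC <-; elim: (K - K0)%N => [|j IH]; first by rewrite addn0; case: H.
  rewrite addnS expnS factS mulnCA; case: H => _ Hd.
  apply: (@leq_ltn_trans ((K0 + j).+1 * (c * d ^ (K0 + j)))); last by rewrite ltn_pmul2l.
  by rewrite leq_mul2r (leq_trans Hd) ?orbT // leqW // leq_addr.
(* The choice of e and j gives (e + j)! >= e^j = 2^j (d + 1)^j, while c d^(e + j) is at most j (d +
   1)^j. *)
pose e := (2 * d.+1)%N; pose j := (c * d.+1 ^ e)%N.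
have F i : (e ^ i <= (e + i)`!)%N.
  elim: i => [|i IH]; first by rewrite expn0 fact_gt0.
  by rewrite addnS expnS factS leq_mul // leqW // leq_addr.
exists (e + j)%N; split; last by rewrite /e mul2n -addnn; apply: leq_trans (leqnSn d) _; rewrite -addnA leq_addr.
apply: leq_trans (F j); apply: (@leq_ltn_trans (c * d.+1 ^ (e + j))).
  by rewrite leq_mul2l leq_exp2r ?leqnSn ?orbT // addn_gt0 muln_gt0.
rewrite expnD mulnA -/j /e expnMn ltn_pmul2r ?expn_gt0 //; exact: ltn_expl.
Qed.

(** The Taylor values that serve as lower bounds in the cut of [exp]: they are positive, and of odd
    order at negative arguments. At s = 0 raising the order gains nothing, so 0 is excluded. *)
Definition low n (s : No) := 0 < T s n /\ s <> 0 /\ (s < 0 -> odd n).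

(** Each odd term is paired with the even term before it; once s >= m, every pair contributes at
    most 0. Hence an admissible bound at a negative argument forces that argument to be bounded by
    its order. *)
Lemma taylor_neg_le0 m (s : No) : odd m -> m%:R <= s -> T (- s) m <= 0.
Proof.
move=> Om; rewrite -(odd_double_half m) Om add1n; move: m./2 => {m Om} j H.
have s0 : 0 <= s by apply: le_trans H.
elim: {-2}j (leqnn j) => [|i IH] Hi.
  have s1 : 1 <= s by apply: le_trans H; rewrite ler1n.
  by rewrite double0 taylorS taylor0 teN /= teS te0 invr1 mulr1 mul1r; lra.
rewrite doubleS taylorS taylorS !teN /= odd_double /=.
have := IH (ltnW Hi); suff : te (i.*2).+2 s <= te (i.*2).+3 s by lra.
rewrite [te (_.+3) _]teS ler_peMr ?te_ge0 // ler_pdivlMr ?natS_gt0 // mul1r.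
by apply: le_trans H; rewrite ler_nat; lia.
Qed.

Lemma low_bound n (s : No) : low n s -> s < 0 -> - n%:R < s.
Proof.
move=> [H [_ K]] s0; rewrite ltNge; apply/negP => L.
have L' : n%:R <= - s by lra.
by have := taylor_neg_le0 (K s0) L'; rewrite opprK leNgt H.
Qed.

Lemma taylor_alt n j (s : No) : 0 <= s -> s <= n.+1%:R -> odd n ->
  T (- s) n <= T (- s) (n + j).
Proof.
move=> s0 sn On; have step i : T (- s) n <= T (- s) (n + i.*2).
  elim: i => [|i IH]; first by rewrite double0 addn0.
  rewrite doubleS !addnS !taylorS !teN /= oddD On odd_double /=.
  suff : te (n + i.*2).+2 s <= te (n + i.*2).+1 s by lra.
  rewrite teS ler_piMr ?te_ge0 // ler_pdivrMr ?natS_gt0 // mul1r.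
  by apply: le_trans sn _; rewrite ler_nat !ltnS leqW // leq_addr.
rewrite -(odd_double_half j) [(odd j + _)%N]addnC; case: (odd j); last by rewrite addn0.
rewrite addn1 addnS taylorS teN /= oddD On odd_double /=.
by have := step j./2; have := te_ge0 (n + j./2.*2).+1 s0; lra.
Qed.

Lemma gainE n (p : No) : p ^+ n.+1 / (n.+2)`!%:R = te n.+1 p / n.+2%:R.
Proof. by rewrite /te [(n.+2)`!]factS natrM invfM mulrA mulrAC. Qed.

Lemma low_gain_neg n (p : No) K : odd n -> 0 <= p -> p <= n%:R -> (n.+2 <= K)%N ->
  T (- p) n + p ^+ n.+1 / (n.+2)`!%:R <= T (- p) K.
Proof.
move=> On p0 pn HK.
have K1 : T (- p) n.+2 <= T (- p) K.
  rewrite -(subnKC HK); apply: taylor_alt => //; last by rewrite /= negbK.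
  by apply: le_trans pn _; rewrite ler_nat; lia.
apply: le_trans K1; rewrite !taylorS !teN /= On /= gainE [te n.+2 _]teS.
have P := te_ge0 n.+1 p0.
suff : te n.+1 p / n.+2%:R + te n.+1 p * (p / n.+2%:R) <= te n.+1 p.
  by move: (n.+2%:R^-1) => q; lra.
rewrite -mulrDr ler_piMr // -[X in X + _]mul1r -mulrDl ler_pdivrMr ?natS_gt0 // mul1r.
by rewrite -addn2 natrD; lra.
Qed.

(** Any order K >= n + 2 gains a positive amount explicit in |s|. For s < 0 this rests on the
    alternation of the terms, which [low_bound] makes available. *)
Lemma low_gain n (s : No) K : low n s -> (n.+2 <= K)%N ->
  T s n + `|s| ^+ n.+1 / (n.+2)`!%:R <= T s K.
Proof.
move=> Ls HK; case: (ltgtP s 0) => s0; last by case: Ls => _ [].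
  have On : odd n by case: Ls => _ [_]; apply.
  have sn := low_bound Ls s0; rewrite ltr0_norm //.
  have := @low_gain_neg n (- s) K On; rewrite opprK; apply => //; lra.
rewrite (ger0_norm (ltW s0)) gainE; have := @taylor_mono n.+1 K s (ltW s0) (ltnW HK).
rewrite taylorS => H1; apply: le_trans _ H1; rewrite lerD2l ler_pdivrMr ?natS_gt0 //.
by rewrite ler_peMr ?ler1n //; exact/te_ge0/ltW.
Qed.

(** Keeps the factor [v + b] in [low_mul] away from 0: either the value itself is large, or |t| is,
    and then so is the gain. *)
Lemma low_half m (t : No) : low m t -> 2%:R^-1 <= T t m \/ 2%:R^-1 <= `|t|.
Proof.
move=> Lt; case: (ltgtP t 0) => t0; last by case: Lt => _ [].
  rewrite ltr0_norm //; case: (leP 2%:R^-1 (- t)) => H; [by right|left].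
  have Om : odd m by case: Lt => _ [_]; apply.
  have := @taylor_alt 1 m.-1 (- t) _ _ isT; rewrite opprK add1n prednK ?odd_gt0 //.
  rewrite taylorS taylor0 teS te0 invr1 mulr1 mul1r.
  have h : 2%:R^-1 * 2%:R = 1 :> No by rewrite mulVf // pnatr_eq0.
  by move: (2%:R^-1) h H => h h2 H A; have := A (ltac:(lra)) (ltac:(lra)); lra.
left; apply: le_trans (taylor_ge1 m (ltW t0)).
by rewrite invf_le1 ?ler1n ?ltr0n.
Qed.

Lemma cancel5 (A B C D1 D2 : No) : D1 != 0 -> D2 != 0 -> A != 0 ->
  A^-1 / D2 * (C / D1) * (A * B * (D1 * D2)) = C * B.
Proof. by move=> H1 H2 H3; field; rewrite H1 H2 H3. Qed.

(* Lower Taylor bounds multiply: the gain of raising the order dominates the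
   terms of the product which are missing in the Taylor polynomial of the sum. *)
Lemma low_mul n m N : exists K0, forall K, (K0 <= K)%N -> forall s t : No,
  low n s -> low m t -> `|s| <= N%:R -> `|t| <= N%:R -> T s n * T t m < T (s + t) K.
Proof.
(* D collects the factorials and powers of 2 from the lower bound [G] for the gain of the
   product. *)
pose D := (2 ^ (n + m).+2 * ((n.+2)`! * (m.+2)`!))%N.
have D0 : (0 < D)%N by rewrite /D muln_gt0 [in X in _ && X]muln_gt0 !fact_gt0 expn_gt0.
have [K1 HK1] := fact_dominates (2 * D) (2 * N.+1).
exists (K1 + n.+2 + m.+2 + 4 * N.+1)%N => K HK.
have [KA KB KC KD] : [/\ K1 <= K.+1, n.+2 <= K, m.+2 <= K & 4 * N <= K.+1]%N by clear - HK; split; lia.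
(* By symmetry |t| <= |s|, so |s| + |t| <= 2 |s| and the error is controlled by |s| alone. The
   constant D is symmetric in n and m. *)
suff W s t n' m' : low n' s -> low m' t -> `|s| <= N%:R -> `|t| <= `|s| ->
    (n'.+2 <= K)%N -> (m'.+2 <= K)%N ->
    (2 ^ (n' + m').+2 * ((n'.+2)`! * (m'.+2)`!) = D)%N -> T s n' * T t m' < T (s + t) K.
  move=> s t Ls Lt Hs Ht; case: (leP `|t| `|s|) => H; first by apply: W.
  by rewrite mulrC addrC; apply: W => //; rewrite ?(ltW H) //; rewrite (addnC m) [((m.+2)`! * _)%N]mulnC.
move=> Ls Lt HsN Hts Hn Hm ED; set u := T s n'; set v := T t m'.
have gs := low_gain Ls Hn; have gt := low_gain Lt Hm.
have s0 : 0 < `|s| by rewrite normr_gt0; apply/eqP; case: Ls => _ [].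
have t0 : 0 < `|t| by rewrite normr_gt0; apply/eqP; case: Lt => _ [].
have u0 : 0 < u by case: Ls. have v0 : 0 < v by case: Lt.
set a := `|s| ^+ n'.+1 / (n'.+2)`!%:R in gs; set b := `|t| ^+ m'.+1 / (m'.+2)`!%:R in gt.
have F k : 0 < k`!%:R :> No by rewrite ltr0n fact_gt0.
have a0 : 0 < a by rewrite divr_gt0 // exprn_gt0.
have b0 : 0 < b by rewrite divr_gt0 // exprn_gt0.
have P : u * v + (v + b) * a <= T s K * T t K.
  have : (u + a) * (v + b) <= T s K * T t K by apply: ler_pM => //; lra.
  by have := mulr_gt0 u0 b0; rewrite !mulrDl !mulrDr (mulrC v a) (mulrC b a); lra.
have G : `|s| ^+ n'.+1 <= (v + b) * a * D%:R.
  have H1 : (2 ^+ m'.+1)^-1 / (m'.+2)`!%:R <= v + b.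
    case: (low_half Lt) => H.
      apply: le_trans (_ : v <= _); last by lra.
      apply: le_trans H; rewrite ler_pdivrMr //; apply: le_trans (_ : 2%:R^-1 <= _).
        rewrite lef_pV2 ?posrE ?exprn_gt0 // exprS ler_peMr //; apply: exprn_ege1; by rewrite ler1n.
      by rewrite ler_peMr ?invr_ge0 // ler1n fact_gt0.
    apply: le_trans (_ : b <= _); last by lra.
    by rewrite ler_pM2r ?invr_gt0 // -exprVn; apply: lerXn2r => //; rewrite ?nnegrE ?invr_ge0.
  have H2 : (2 ^+ m'.+1)^-1 / (m'.+2)`!%:R * a * D%:R <= (v + b) * a * D%:R.
    by rewrite ler_wpM2r // ler_wpM2r // ltW.
  apply: le_trans H2; rewrite -ED natrM natrX natrM /a.
  have -> : (2 ^+ m'.+1)^-1 / (m'.+2)`!%:R * (`|s| ^+ n'.+1 / (n'.+2)`!%:R) *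
     (2 ^+ (n' + m').+2 * ((n'.+2)`!%:R * (m'.+2)`!%:R)) = `|s| ^+ n'.+1 * 2 ^+ n'.+1.
    have -> : ((n' + m').+2 = m'.+1 + n'.+1)%N by rewrite addSn addnS addnC.
    rewrite exprD; have := lt0r_neq0 (F m'.+2); have := lt0r_neq0 (F n'.+2) => ? ?.
    have : 2 ^+ m'.+1 != 0 :> No by rewrite expf_neq0 // pnatr_eq0.
    by move=> ?; apply: cancel5.
  rewrite ler_peMr ?exprn_ge0 ?normr_ge0 //; apply: exprn_ege1; by rewrite ler1n.
have u2 : (`|s| + `|t|) * 2%:R <= K.+1%:R.
  apply: (@le_trans _ _ (4 * N)%:R); last by rewrite ler_nat.
  by rewrite natrM; lra.
have R := rest_small u2; set w := `|s| + `|t| in R.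
(* Of the K + 1 factors |s|, n' + 1 are kept and the others are bounded by N + 1; the factorial
   beats the resulting power by the choice of K1. *)
have Wb : te K.+1 w * 2%:R * D%:R < `|s| ^+ n'.+1.
  have Hw : w ^+ K.+1 <= `|s| ^+ n'.+1 * (2 * N.+1)%:R ^+ K.+1.
    have -> : (2 * N.+1)%:R ^+ K.+1 = (2%:R ^+ K.+1 * N.+1%:R ^+ K.+1) :> No by rewrite natrM exprMn.
    apply: le_trans (_ : (2%:R * `|s|) ^+ K.+1 <= _).
      by apply: lerXn2r; rewrite ?nnegrE /w; lra.
    rewrite exprMn mulrCA ler_wpM2l ?exprn_ge0 //.
    have -> : (K.+1 = n'.+1 + (K - n'))%N by rewrite addSn subnKC // ltnW // ltnW.
    rewrite !exprD ler_wpM2l ?exprn_ge0 //.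
    apply: le_trans (_ : N.+1%:R ^+ (K - n') <= _).
      apply: lerXn2r; rewrite ?nnegrE //; apply: le_trans HsN _; by rewrite ler_nat.
    by rewrite ler_peMl ?exprn_ge0 //; apply: exprn_ege1; rewrite ler1n.
  have HF := HK1 K.+1 KA.
  rewrite /te -!mulrA mulrCA [X in X < _]mulrCA; rewrite mulrA [X in X < _]mulrC mulrA ltr_pdivrMr //.
  apply: le_lt_trans (ler_wpM2l _ Hw) _; first by rewrite mulr_ge0.
  rewrite mulrCA ltr_pM2l ?exprn_gt0 // -natrX -!natrM ltr_nat; exact: HF.
have D0' : 0 < D%:R :> No by rewrite ltr0n.
have : te K.+1 w * 2%:R < (v + b) * a.
  by rewrite -(ltr_pM2r D0'); apply: lt_le_trans Wb G.
have := taylor_rest K s t; have := ler_norm (rest K s t); lra.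
Qed.

(** * The exponential function *)

(** Positivity bounds s by m, but t may be infinite. If t > m, it is split as (t - m) + m: [low_mul]
    treats m against -s, and the remainder t - m enters only inequalities for nonnegative
    arguments. *)
Lemma taylor_ineq_mixed n m (t s : No) : 0 < t -> 0 < s -> odd m -> 0 < T (- s) m ->
  exists K, odd K /\ T t n * T (- s) m < T (t - s) K.
Proof.
move=> t0 s0 Om Ts.
have Ls : low m (- s) by split=> //; split=> // E; move: s0; rewrite -(opprK s) E oppr0 ltxx.
have Nm0 : - s < 0 by rewrite oppr_lt0.
have sm : `|- s| <= m%:R by rewrite normrN gtr0_norm //; have := low_bound Ls Nm0; lra.
have [K0 HK] := low_mul n m m.
have KK : (K0 <= K0.*2.+1)%N by rewrite -addnn leqW // leq_addr.
have Lp (u : No) : 0 < u -> low n u.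
  by move=> u0; split; [exact/taylor_gt0/ltW|split=> [E|/lt_gtF]; [move: u0; rewrite E ltxx|rewrite u0]].
case: (leP t m%:R) => tm.
  exists K0.*2.+1; split; first by rewrite /= odd_double.
  by apply: HK => //; [exact: Lp|rewrite gtr0_norm].
have m0 : (0 : No) < m%:R by rewrite ltr0n odd_gt0.
exists (n + K0).*2.+1; split; first by rewrite /= odd_double.
have H := HK K0 (leqnn _) m%:R (- s) (Lp _ m0) Ls.
have {}H : T m%:R n * T (- s) m < T (m%:R - s) K0 by apply: H => //; rewrite ger0_norm ?ler0n.
have ms : 0 <= m%:R - s by move: sm; rewrite normrN gtr0_norm //; lra.
have tm0 : 0 < T (t - m%:R) n by apply: taylor_gt0; lra.
have -> : t - s = (t - m%:R) + (m%:R - s) by lra.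
apply: lt_le_trans (_ : T (t - m%:R + (m%:R - s)) (n + K0) <= _); last first.
  by apply: taylor_mono; [lra|rewrite -addnn leqW // leq_addr].
apply: lt_le_trans (taylor_mul_le _ _ _ _); [|lra|by []].
apply: le_lt_trans (_ : T (t - m%:R) n * (T m%:R n * T (- s) m) < _); last by rewrite ltr_pM2l.
rewrite mulrA ler_pM2r //; have := @taylor_add_le n (t - m%:R) m%:R.
by rewrite subrK; apply; [lra|exact: ltW].
Qed.

Lemma taylor_ineq_neg n m (t s : No) : 0 < t -> 0 < s -> odd n -> odd m ->
  0 < T (- t) n -> 0 < T (- s) m ->
  exists K, odd K /\ T (- t) n * T (- s) m < T (- t - s) K.
Proof.
move=> t0 s0 On Om Tt Ts; have [K0 HK] := low_mul n m (n + m).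
have KK : (K0 <= K0.*2.+1)%N by rewrite -addnn leqW // leq_addr.
have L k (u : No) : 0 < u -> odd k -> 0 < T (- u) k -> low k (- u) /\ `|- u| <= k%:R.
  move=> u0 Ok Tu; have Lu : low k (- u).
    by split=> //; split=> // E; move: u0; rewrite -(opprK u) E oppr0 ltxx.
  have Nu : - u < 0 by rewrite oppr_lt0.
  by split=> //; rewrite normrN gtr0_norm //; have := low_bound Lu Nu; lra.
have [Lt Bt] := L n t t0 On Tt; have [Ls Bs] := L m s s0 Om Ts.
exists K0.*2.+1; split; first by rewrite /= odd_double.
apply: HK => //.
  by apply: le_trans Bt _; rewrite ler_nat leq_addr.
by apply: le_trans Bs _; rewrite ler_nat leq_addl.
Qed.

Notation E := exp.

(** The options of [exp] restated with arbitrary odd n in place of 2 n + 1, and with the division of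
    the field. *)
Definition expL x z := z = 0 \/
  (exists x' n, lopt x' x /\ z = E x' * T (x - x') n) \/
  (exists x' n, ropt x' x /\ odd n /\ 0 < T (x - x') n /\ z = E x' * T (x - x') n).
Definition expR x z :=
  (exists x' n, ropt x' x /\ z = E x' / T (x' - x) n) \/
  (exists x' n, lopt x' x /\ odd n /\ 0 < T (x' - x) n /\ z = E x' / T (x' - x) n).

Lemma odd_index n : (2 * n + 1)%coq_nat = n.*2.+1.
Proof. change ((2 * n + 1)%N = n.*2.+1); lia. Qed.

Lemma divE (a b : No) : 0 < b -> (a / b)%S = a / b.
Proof. by move=> H; rewrite -invE // => H0; rewrite H0 ltxx in H. Qed.

Lemma exp_eqS x : E x = cut (expL x) (expR x).
Proof.
rewrite exp_eq; congr cut; apply: functional_extensionality => z;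
  apply: propositional_extensionality; split.
- case=> [->|[[x' [n [H ->]]]|[x' [n [H [/ltE K ->]]]]]]; first by left.
    by right; left; exists x', n.
  right; right; rewrite odd_index in K *; exists x', n.*2.+1; split=> //.
  by rewrite /= odd_double.
- case=> [->|[[x' [n [H ->]]]|[x' [n [H [O [K ->]]]]]]]; first by left.
    by right; left; exists x', n.
  right; right; exists x', n./2; rewrite odd_index.
  have En : n./2.*2.+1 = n by rewrite -[RHS](odd_double_half n) O.
  by rewrite En; split=> //; split=> //; apply/ltE.
- case=> [[x' [n [H ->]]]|[x' [n [H [/ltE K ->]]]]].
    left; exists x', n; split=> //; apply/divE/taylor_gt0; have := ropt_lt H; rewrite -subr_gt0; exact: ltW.
  right; rewrite odd_index in K *; exists x', n.*2.+1; split=> //; split; first by rewrite /= odd_double.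
  by split=> //; exact: divE.
- case=> [[x' [n [H ->]]]|[x' [n [H [O [K ->]]]]]].
    left; exists x', n; split=> //; symmetry; apply/divE/taylor_gt0; have := ropt_lt H; rewrite -subr_gt0; exact: ltW.
  right; exists x', n./2; rewrite odd_index.
  have En : n./2.*2.+1 = n by rewrite -[RHS](odd_double_half n) O.
  rewrite En; split=> //; split; first exact/ltE.
  by symmetry; exact: divE.
Qed.

Definition exp_bounds (y z : No) := 0 < E y /\ 0 < E z /\
  (forall n, E y * T (z - y) n < E z) /\
  (forall n, odd n -> 0 < T (y - z) n -> E z * T (y - z) n < E y).

Definition exp_ok x := is_cut (expL x) (expR x) (E x).

Lemma exp_ok_gt0 x : exp_ok x -> 0 < E x.
Proof. by move=> H; apply: (cut_ltl H); left. Qed.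

Lemma exp_ok_bounds (y z : No) : exp_ok y -> exp_ok z -> lopt y z \/ ropt z y -> exp_bounds y z.
Proof.
move=> Hy Hz H; split; first exact: exp_ok_gt0.
split; first exact: exp_ok_gt0.
case: H => H; split=> n.
- by apply: (cut_ltl Hz); right; left; exists y, n.
- move=> O K; rewrite -ltr_pdivlMr //; apply: (cut_ltr Hz); right; by exists y, n.
- have K : 0 < T (z - y) n by apply: taylor_gt0; have := ropt_lt H; rewrite -subr_gt0; exact: ltW.
  by rewrite -ltr_pdivlMr //; apply: (cut_ltr Hy); left; exists z, n.
- by move=> O K; apply: (cut_ltl Hy); right; right; exists z, n.
Qed.

Lemma small_expL x : small (expL x).
Proof.
have S s : small (fun x' => opt s x' x) by exact: small_opt.
apply: small_or; first exact: small_eq.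
apply: small_or.
  by apply: (small_image2 (f := fun x' n => E x' * T (x - x') n) (S true) small_nat) => z [x' [n [? ->]]]; exists x', n.
by apply: (small_image2 (f := fun x' n => E x' * T (x - x') n) (S false) small_nat) => z [x' [n [? [_ [_ ->]]]]]; exists x', n.
Qed.

Lemma small_expR x : small (expR x).
Proof.
have S s : small (fun x' => opt s x' x) by exact: small_opt.
apply: small_or.
  by apply: (small_image2 (f := fun x' n => E x' / T (x' - x) n) (S false) small_nat) => z [x' [n [? ->]]]; exists x', n.
by apply: (small_image2 (f := fun x' n => E x' / T (x' - x) n) (S true) small_nat) => z [x' [n [? [_ [_ ->]]]]]; exists x', n.
Qed.

Lemma taylor_at0 n : T 0 n = 1.
Proof. by elim: n => [//|n IH]; rewrite taylorS IH /te expr0n /= mul0r addr0. Qed.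

(** A left option at x1 and a right option at x2 are compared through exp x1 and exp x2, which are
    related by induction unless x1 = x2. What remains is that the product of the two Taylor values
    is below a single Taylor value at x2 - x1. *)
Lemma exp_is_cut x : exp_ok x.
Proof.
elim/(well_founded_ind simpler_wf): x => x IH.
have B (y z : No) : y ⊏ x -> z ⊏ x -> y < z -> exp_bounds y z.
  move=> Sy Sz L; apply: exp_ok_bounds; [exact: IH|exact: IH|].
  case: (simpler_chain (simplerW Sy) (simplerW Sz)) => /simpler_eqVlt [E|S].
  - by rewrite E ltxx in L.
  - by left; split=> //; apply/ltE.
  - by rewrite E ltxx in L.
  - by right; split=> //; apply/ltE.
have P (y : No) : y ⊏ x -> 0 < E y by move/IH/exp_ok_gt0.
rewrite /exp_ok exp_eqS; apply: cut_sep; [exact: small_expL|exact: small_expR|].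
have tp (a b : No) n : a < b -> 0 < T (b - a) n by move=> H; apply: taylor_gt0; lra.
move=> l r Hl Hr; apply/ltE.
case: Hl => [->|[[x1 [n [H1 ->]]]|[x1 [n [H1 [O1 [K1 ->]]]]]]].
- by case: Hr => [[x2 [m [H2 ->]]]|[x2 [m [H2 [O2 [K2 ->]]]]]]; rewrite divr_gt0 ?(P _ (proj1 H2)) //; exact/tp/ropt_lt.
- have L1 := lopt_lt H1.
  case: Hr => [[x2 [m [H2 ->]]]|[x2 [m [H2 [O2 [K2 ->]]]]]].
    have L2 := ropt_lt H2; have [_ [_ [H _]]] := B _ _ (proj1 H1) (proj1 H2) (lt_trans L1 L2).
    rewrite ltr_pdivlMr ?tp //; apply: le_lt_trans (H (n + m)%N).
    rewrite -mulrA ler_pM2l ?(P _ (proj1 H1)) //.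
    have -> : x2 - x1 = (x - x1) + (x2 - x) by lra.
    by apply: taylor_mul_le; lra.
  have L2 := lopt_lt H2; rewrite ltr_pdivlMr //.
  (* Both x1 and x2 are left options here, in either order or equal; the odd K serves all three
     cases. *)
  have [K [OK HK]] : exists K, odd K /\ T (x - x1) n * T (- (x - x2)) m < T ((x - x1) - (x - x2)) K.
    by apply: taylor_ineq_mixed; rewrite ?opprB //; lra.
  have E1 : (x - x1) + (x2 - x) = x2 - x1 by lra.
  rewrite !opprB E1 in HK; rewrite -mulrA.
  case: (ltgtP x1 x2) => L.
  + have [_ [_ [H _]]] := B _ _ (proj1 H1) (proj1 H2) L.
    by apply: lt_trans (H K); rewrite ltr_pM2l ?(P _ (proj1 H1)).
  + have [_ [_ [_ H]]] := B _ _ (proj1 H2) (proj1 H1) L.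
    apply: lt_trans (H K OK _); first by rewrite ltr_pM2l ?(P _ (proj1 H1)).
    by apply: lt_trans HK; rewrite mulr_gt0 // tp.
  + rewrite -L subrr taylor_at0 in HK; rewrite -L -[X in _ < X]mulr1 ltr_pM2l //; exact: P (proj1 H1).
- have L1 := ropt_lt H1.
  case: Hr => [[x2 [m [H2 ->]]]|[x2 [m [H2 [O2 [K2 ->]]]]]].
    have L2 := ropt_lt H2; rewrite ltr_pdivlMr ?tp //.
    have [K [OK HK]] : exists K, odd K /\ T (x2 - x) m * T (- (x1 - x)) n < T ((x2 - x) - (x1 - x)) K.
      by apply: taylor_ineq_mixed; rewrite ?opprB //; lra.
    have E1 : (x2 - x) + (x - x1) = x2 - x1 by lra.
    rewrite !opprB E1 in HK; rewrite -mulrA [T _ n * _]mulrC.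
    case: (ltgtP x1 x2) => L.
    + have [_ [_ [H _]]] := B _ _ (proj1 H1) (proj1 H2) L.
      by apply: lt_trans (H K); rewrite ltr_pM2l ?(P _ (proj1 H1)).
    + have [_ [_ [_ H]]] := B _ _ (proj1 H2) (proj1 H1) L.
      apply: lt_trans (H K OK _); first by rewrite ltr_pM2l ?(P _ (proj1 H1)).
      by apply: lt_trans HK; rewrite mulr_gt0 // tp.
    + rewrite -L subrr taylor_at0 in HK; rewrite -L -[X in _ < X]mulr1 ltr_pM2l //; exact: P (proj1 H1).
  have L2 := lopt_lt H2; rewrite ltr_pdivlMr //.
  have [K [OK HK]] : exists K, odd K /\ T (- (x1 - x)) n * T (- (x - x2)) m < T (- (x1 - x) - (x - x2)) K.
    by apply: taylor_ineq_neg; rewrite ?opprB //; lra.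
  have E1 : - (x1 - x) - (x - x2) = x2 - x1 by lra.
  rewrite !opprB in HK; have E2 : x - x1 + (x2 - x) = x2 - x1 by lra.
  rewrite -mulrA; have [_ [_ [_ H]]] := B _ _ (proj1 H2) (proj1 H1) (lt_trans L2 L1).
  rewrite E2 in HK; apply: lt_trans (H K OK _); first by rewrite ltr_pM2l ?(P _ (proj1 H1)).
  by apply: lt_trans HK; rewrite mulr_gt0.
Qed.

Lemma exp_gt0 (x : No) : 0 < E x. Proof. exact/exp_ok_gt0/exp_is_cut. Qed.

Lemma exp_opt_bounds (y z : No) : lopt y z \/ ropt z y -> exp_bounds y z.
Proof. by apply: exp_ok_bounds; exact: exp_is_cut. Qed.

(** The bounds between a number and its options extend to all y < z through the meet, since Taylor
    polynomials are submultiplicative at nonnegative arguments. *)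
Lemma exp_taylor n (y z : No) : y < z -> E y * T (z - y) n < E z.
Proof.
move=> H; case: (lt_optsR H) => m [[E1|H1] [E2|H2]].
- by move: H; rewrite E1 E2 ltxx.
- by rewrite E1; have [_ [_ [K _]]] := exp_opt_bounds (or_introl H2).
- by rewrite E2; have [_ [_ [K _]]] := exp_opt_bounds (or_intror H1).
- have [_ [_ [K1 _]]] := exp_opt_bounds (or_introl H2).
  have [_ [_ [K2 _]]] := exp_opt_bounds (or_intror H1).
  apply: lt_trans (K1 n); apply: le_lt_trans (_ : E y * T (m - y) n * T (z - m) n < _).
    rewrite -mulrA ler_pM2l ?exp_gt0 //.
    have -> : z - y = (m - y) + (z - m) by lra.
    apply: taylor_add_le; [have := ropt_lt H1|have := lopt_lt H2]; lra.
  by rewrite ltr_pM2r // taylor_gt0 //; have := lopt_lt H2; lra.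
Qed.

Lemma exp_lt (y z : No) : y < z -> E y < E z.
Proof. by move/(exp_taylor 0); rewrite taylor0 mulr1. Qed.

Lemma exp_inj (y z : No) : E y = E z -> y = z.
Proof. by move=> H; case: (ltgtP y z) => // /exp_lt; rewrite H ltxx. Qed.

Lemma exp_le (y z : No) : (E y <= E z) = (y <= z).
Proof.
case: (ltgtP y z) => [/exp_lt /ltW //|/exp_lt|->]; last exact: lexx.
by move/lt_geF.
Qed.

(** The first-order polynomial at u - v is 1 - (v - u), which is positive for v - u <= 1/2 and so
    gives an upper bound on exp v. Passing through the meet loses only a nonnegative product. *)
Lemma exp_half (y z : No) : y < z -> z <= y + 2%:R^-1 -> E z <= E y * 2%:R.
Proof.
move=> H K; have h : 2%:R^-1 * 2%:R = 1 :> No by rewrite mulVf // pnatr_eq0.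
have h0 : 0 < 2%:R^-1 :> No by rewrite invr_gt0 ltr0n.
have B (u v : No) : u < v -> v - u <= 2%:R^-1 -> exp_bounds u v -> E v * (1 - (v - u)) <= E u.
  move=> uv d [_ [_ [_ A]]]; have t1 : T (u - v) 1 = 1 - (v - u).
    by rewrite taylorS taylor0 teS te0 invr1 mulr1 mul1r; lra.
  rewrite -t1; apply/ltW/A => //; rewrite t1; move: (2%:R^-1) h h0 d => c *; lra.
suff A : E z * (1 - (z - y)) <= E y.
  have : E z * 2%:R^-1 <= E y.
    apply: le_trans A; rewrite ler_pM2l ?exp_gt0 //; move: (2%:R^-1) h h0 K => c *; lra.
  by move: (2%:R^-1) h h0 => c h _ A2; have := ler_wpM2r (ler0n No 2) A2; rewrite -mulrA h mulr1.
case: (lt_optsR H) => m [[E1|H1] [E2|H2]].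
- by move: H; rewrite E1 E2 ltxx.
- rewrite E1 in H K *; apply: B => //; first by lra.
  by apply: exp_opt_bounds; left.
- rewrite E2 in H K *; apply: B => //; first by lra.
  by apply: exp_opt_bounds; right.
- have L1 := ropt_lt H1; have L2 := lopt_lt H2.
  have A1 : E z * (1 - (z - m)) <= E m by apply: B => //; [lra|apply: exp_opt_bounds; left].
  have A2 : E m * (1 - (m - y)) <= E y by apply: B => //; [lra|apply: exp_opt_bounds; right].
  apply: le_trans A2; have p : 0 <= 1 - (m - y) by move: (2%:R^-1) h h0 K => c *; lra.
  apply: le_trans (ler_wpM2r p A1); rewrite -mulrA ler_pM2l ?exp_gt0 //.
  have q : 0 <= (z - m) * (m - y) by apply: mulr_ge0; lra.
  by rewrite mulrBl !mulrBr in q *; lra.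
Qed.

(** * Finite distance and purely infinite numbers *)

Definition fin (x y : No) := exists n : nat, `|x - y| <= n%:R.

Lemma fin_sym (x y : No) : fin x y -> fin y x.
Proof. by case=> n H; exists n; rewrite distrC. Qed.

Lemma fin_trans (x y z : No) : fin x y -> fin y z -> fin x z.
Proof.
move=> [n H] [m K]; exists (n + m)%N; rewrite natrD.
by apply: le_trans (ler_distD y _ _) _; apply: lerD.
Qed.

Definition infinite (t : No) := forall n : nat, n%:R < t.

(* [x] is purely infinite: no proper initial segment is at finite distance. *)
Definition pinf (x : No) := forall y, y ⊏ x -> ~ fin x y.

Lemma simpler_pinf (x : No) : (forall y, fin x y -> x ⊑ y) -> pinf x.
Proof. by move=> H y [S N] /H /(simpler_antisym S). Qed.

(** j is the shortest initial segment of x at finite distance from x. It stands in for x where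
    additivity of [exp] is known at purely infinite numbers only. *)
Lemma pinf_part (x : No) : exists j, pinf j /\ fin x j /\ j ⊑ x.
Proof.
elim/(well_founded_ind simpler_wf): x => x IH.
case: (classic (pinf x)) => [J|N]; first by exists x; split=> //; split=> //; exists 0%N; rewrite subrr normr0.
have [y [S F]] : exists y, y ⊏ x /\ fin x y.
  by apply: NNPP => K; apply: N => y S F; apply: K; exists y.
have [j [Jj [Fj Sj]]] := IH y S; exists j; split=> //; split; first exact: fin_trans Fj.
exact: simpler_eq_trans Sj (simplerW S).
Qed.

Lemma not_fin_gap (x y : No) : x < y -> ~ fin y x -> infinite (y - x).
Proof.
move=> L N n; rewrite ltNge; apply/negP => K; apply: N; exists n.
by rewrite ger0_norm //; lra.
Qed.

Lemma pinf_gapl (x x' : No) : pinf x -> lopt x' x -> infinite (x - x').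
Proof. by move=> J H; apply: not_fin_gap; [exact: lopt_lt|apply: J; case: H]. Qed.

Lemma pinf_gapr (x x' : No) : pinf x -> ropt x' x -> infinite (x' - x).
Proof. by move=> J H; apply: not_fin_gap; [exact: ropt_lt|move/fin_sym; apply: J; case: H]. Qed.

Lemma fin_lt (x y l : No) : fin x y -> infinite (x - l) -> l < y.
Proof.
move=> [n H] /(_ n) K; have := ler_norm (x - y); lra.
Qed.

Lemma fin_gt (x y r : No) : fin x y -> infinite (r - x) -> y < r.
Proof.
move=> [n H] /(_ n) K; rewrite distrC in H; have := ler_norm (y - x); lra.
Qed.

Lemma pinf_add (x y : No) : pinf x -> pinf y -> pinf (x + y).
Proof.
move=> Jx Jy; apply: simpler_pinf => z F.
apply: (cut_simpler (add_cutR (is_cut_opts x) (is_cut_opts y))) => u [[v [Hv ->]]|[v [Hv ->]]].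
- apply: fin_lt F _ => n; have := pinf_gapl Jx Hv n; lra.
- apply: fin_lt F _ => n; have := pinf_gapl Jy Hv n; lra.
- apply: fin_gt F _ => n; have := pinf_gapr Jx Hv n; lra.
- apply: fin_gt F _ => n; have := pinf_gapr Jy Hv n; lra.
Qed.

Lemma pinf0 : pinf 0.
Proof. by move=> y /simpler_len; rewrite len0 => /olt_0. Qed.

Lemma pinf_natmul n (x : No) : pinf x -> pinf (x *+ n).
Proof. by move=> J; elim: n => [|n IH]; [exact: pinf0|rewrite mulrS; exact: pinf_add]. Qed.

Lemma omega_infinite (a : No) : 0 < a -> infinite (W a).
Proof. by move=> a0 n; have := omega_lt n a0; rewrite omega0 mulr1. Qed.

Lemma pinf_omega (a : No) : 0 < a -> pinf (W a).
Proof.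
move=> a0; apply: simpler_pinf => z [n F].
have I := omega_infinite a0.
have F1 : W a - n%:R <= z by have := ler_norm (W a - z); lra.
have F2 : z <= W a + n%:R by rewrite distrC in F; have := ler_norm (z - W a); lra.
apply: (cut_simpler (omega_map_cut a)).
  move=> l [->|[k [x' [Hx ->]]]]; first by have := I n; lra.
  have A : (2 * k)%:R * W x' < W a by exact/omega_lt/lopt_lt.
  have B := I (2 * n)%N; rewrite !natrM in A B; lra.
move=> r [k [x' [Hx ->]]]; rewrite ltr_pdivlMr ?exprn_gt0 //.
have P : 0 < 2 ^+ k :> No by rewrite exprn_gt0.
have A : (2 * 2 ^ k)%:R * W a < W x' by exact/omega_lt/ropt_lt.
have A0 : (2 * 2 ^ k * n)%:R * W 0 < W x' by apply/omega_lt/(lt_trans a0)/ropt_lt.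
rewrite omega0 mulr1 !natrM natrX in A A0.
by have := ler_wpM2r (ltW P) F2; lra.
Qed.

Lemma exp_add_half k (y : No) : E (y + k%:R * 2%:R^-1) <= 2 ^+ k * E y.
Proof.
have h0 : 0 < 2%:R^-1 :> No by rewrite invr_gt0 ltr0n.
elim: k => [|k IH]; first by rewrite mul0r addr0 expr0 mul1r.
rewrite exprS -mulrA; have H := ler_wpM2l (ler0n No 2) IH; apply: le_trans _ H.
rewrite [X in _ <= X]mulrC; apply: exp_half; rewrite -[k.+1%:R]natr1 mulrDl mul1r addrA; first by rewrite ltrDl.
by [].
Qed.

(** 2 n steps of length 1/2, each of which at most doubles [exp]. *)
Lemma exp_fin (y z : No) : fin y z -> exists c : nat, E z <= c%:R * E y.
Proof.
move=> [n H]; exists (2 ^ (2 * n))%N; rewrite natrX; apply: le_trans (exp_add_half _ _).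
rewrite exp_le mulnC natrM -mulrA mulfV ?pnatr_eq0 // mulr1.
by rewrite distrC in H; have := ler_norm (z - y); lra.
Qed.

Lemma taylor_upper n (s : No) : 1 <= s -> T s n <= n.+1%:R * s ^+ n.
Proof.
move=> s1; have s0 : 0 <= s by lra.
elim: n => [|n IH]; first by rewrite taylor0 mulr1.
have P : 0 <= s ^+ n by apply: exprn_ge0.
rewrite taylorS -[n.+2%:R]natr1 mulrDl mul1r; apply: lerD.
  by apply: le_trans IH _; rewrite ler_wpM2l // exprS ler_peMl.
by rewrite /te ler_pdivrMr ?ltr0n ?fact_gt0 // ler_peMr ?exprn_ge0 // ler1n fact_gt0.
Qed.

(** At an infinite argument the next Taylor term exceeds every natural multiple of the polynomial,
    so raising the order by one absorbs natural factors. *)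
Lemma taylor_slack n (C d : nat) (s t : No) : infinite t -> s <= t + d%:R -> 1 <= s ->
  C%:R * T s n <= T t n.+1.
Proof.
move=> It st s1; have t0 : 0 <= t by have := It 0%N; lra.
have s2 : s <= 2%:R * t by have := It d; lra.
have P : 0 <= t ^+ n by apply: exprn_ge0.
rewrite taylorS; apply: le_trans (_ : te n.+1 t <= _); last by rewrite lerDr; apply: le_trans (taylor_ge1 n t0).
apply: le_trans (ler_wpM2l (ler0n _ C) (taylor_upper n s1)) _.
have H : s ^+ n <= 2 ^+ n * t ^+ n by rewrite -exprMn; apply: lerXn2r; rewrite ?nnegrE; lra.
apply: le_trans (_ : C%:R * (n.+1%:R * (2 ^+ n * t ^+ n)) <= _).
  by rewrite ler_wpM2l // ler_wpM2l.
rewrite /te ler_pdivlMr ?ltr0n ?fact_gt0 //.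
have -> : C%:R * (n.+1%:R * (2 ^+ n * t ^+ n)) * (n.+1)`!%:R = (C * n.+1 * 2 ^ n * (n.+1)`!)%:R * t ^+ n.
  by rewrite (natrM _ _ (n.+1)`!) (natrM _ _ (2 ^ n)) (natrM _ C) natrX; ring.
by rewrite exprS ler_wpM2r // ltW.
Qed.

Lemma exp_taylor_slack n (C : nat) (y z : No) : infinite (z - y) ->
  C%:R * (E y * T (z - y) n) < E z.
Proof.
move=> I; have L : y < z by have := I 0%N; lra.
apply: le_lt_trans (exp_taylor n.+1 L); rewrite mulrCA ler_pM2l ?exp_gt0 //.
apply: (@taylor_slack n C 0) => //; first by rewrite addr0.
by have := I 1%N; lra.
Qed.

Lemma exp_taylor_mono n (w z v : No) : z <= w -> w < v ->
  E z * T (v - z) n <= E w * T (v - w) n.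
Proof.
rewrite le_eqVlt => /orP [/eqP -> //|L] L2.
apply: le_trans (_ : E z * (T (w - z) n * T (v - w) n) <= _).
  rewrite ler_pM2l ?exp_gt0 //; have -> : v - z = (w - z) + (v - w) by lra.
  by apply: taylor_add_le; lra.
rewrite mulrA ler_pM2r; first exact/ltW/exp_taylor.
by apply: taylor_gt0; lra.
Qed.

Lemma exp_taylor_monor n (w z v : No) : v < w -> w <= z ->
  E w * T (z - v) n <= E z * T (w - v) n.
Proof.
move=> L; rewrite le_eqVlt => /orP [/eqP <- //|L2].
apply: le_trans (_ : E w * (T (z - w) n * T (w - v) n) <= _).
  rewrite ler_pM2l ?exp_gt0 //; have -> : z - v = (z - w) + (w - v) by lra.
  by apply: taylor_add_le; lra.
rewrite mulrA ler_pM2r; first exact/ltW/exp_taylor.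
by apply: taylor_gt0; lra.
Qed.

(** * Additivity of the exponential on purely infinite numbers *)

Definition expLJ x z := z = 0 \/ exists x' n, lopt x' x /\ z = E x' * T (x - x') n.
Definition expRJ x z := exists x' n, ropt x' x /\ z = E x' / T (x' - x) n.

Lemma taylor_neg_infinite n (t : No) : infinite t -> odd n -> T (- t) n <= 0.
Proof. by move=> I O; apply: taylor_neg_le0 => //; exact/ltW/I. Qed.

(* Odd Taylor polynomials are negative at infinite negative arguments, so the
   options involving them disappear. *)
Lemma exp_cut_pinf (x : No) : pinf x -> is_cut (expLJ x) (expRJ x) (E x).
Proof.
move=> J; have C := exp_is_cut x; apply: (cut_cofinal C).
- move=> l [->|[x' [n [H ->]]]]; apply: (cut_ltl C); first by left.
  by right; left; exists x', n.
- by move=> r [x' [n [H ->]]]; apply: (cut_ltr C); left; exists x', n.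
- move=> l [->|[[x' [n [H ->]]]|[x' [n [H [O [K _]]]]]]]; first by exists 0; split=> //; left.
    by exists (E x' * T (x - x') n); split=> //; right; exists x', n.
  by have := taylor_neg_infinite (pinf_gapr J H) O; rewrite opprB leNgt K.
- move=> r [[x' [n [H ->]]]|[x' [n [H [O [K _]]]]]].
    by exists (E x' / T (x' - x) n); split=> //; exists x', n.
  by have := taylor_neg_infinite (pinf_gapl J H) O; rewrite opprB leNgt K.
Qed.

(** Inside the induction for [exp_add_pinf], additivity holds at purely infinite initial segments.
    At an arbitrary option it survives up to a natural factor, because its purely infinite part is
    at finite distance. *)
Definition exp_comparable (u v : No) := exists c : nat, E (u + v) <= c%:R * (E u * E v) /\ E u * E v <= c%:R * E (u + v).

Lemma fin_addr (u v w : No) : fin u v -> fin (u + w) (v + w).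
Proof. by case=> n H; exists n; rewrite opprD addrACA subrr addr0. Qed.

Lemma exp_comparable_fin (u j v : No) : fin u j -> E (j + v) = E j * E v -> exp_comparable u v.
Proof.
move=> F D; have [c1 H1] := exp_fin F; have [c2 H2] := exp_fin (fin_sym F).
have [c3 H3] := exp_fin (fin_addr v F); have [c4 H4] := exp_fin (fin_sym (fin_addr v F)).
have P := exp_gt0 v.
exists (c4 * c1 + c2 * c3)%N; rewrite natrD !natrM; split.
  apply: le_trans H4 _; rewrite D; apply: le_trans (_ : c4%:R * (c1%:R * E u * E v) <= _).
    by rewrite ler_wpM2l // ler_pM2r.
  have := mulr_ge0 (mulr_ge0 (ler0n No c2) (ler0n No c3)) (ltW (mulr_gt0 (exp_gt0 u) P)); lra.
apply: le_trans (_ : c2%:R * (E j * E v) <= _); first by rewrite mulrA ler_pM2r.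
rewrite -D; apply: le_trans (_ : c2%:R * (c3%:R * E (u + v)) <= _); first by rewrite ler_wpM2l.
have := mulr_ge0 (mulr_ge0 (ler0n No c4) (ler0n No c1)) (ltW (exp_gt0 (u + v))); lra.
Qed.

Lemma pinf_comparable (x y : No) : (forall j, pinf j -> j ⊏ x -> E (j + y) = E j * E y) ->
  forall x', x' ⊏ x -> exp_comparable x' y.
Proof.
move=> H x' S; have [j [Jj [F Sj]]] := pinf_part x'.
apply: exp_comparable_fin F _; apply: H => //; exact: simpler_le_lt Sj S.
Qed.

Lemma exp_comparable_lopt (x y x' : No) n (C : nat) : pinf x -> lopt x' x -> exp_comparable x' y ->
  C%:R * (E (x' + y) * T (x - x') n) < E x * E y /\ C%:R * (E x' * T (x - x') n * E y) < E (x + y).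
Proof.
move=> J H [c [H1 H2]]; have I := pinf_gapl J H.
have Tp : 0 < T (x - x') n by apply/taylor_gt0/ltW; have := I 0%N.
split.
  have := exp_taylor_slack n (C * c) I; rewrite -(ltr_pM2r (exp_gt0 y)); apply: le_lt_trans.
  have := ler_wpM2l (ler0n No C) (ler_wpM2r (ltW Tp) H1); rewrite natrM; lra.
have I2 : infinite (x + y - (x' + y)) by move=> k; have := I k; lra.
have := exp_taylor_slack n (C * c) I2; apply: le_lt_trans.
have -> : x + y - (x' + y) = x - x' by lra.
have := ler_wpM2l (ler0n No C) (ler_wpM2r (ltW Tp) H2); rewrite natrM; lra.
Qed.

Lemma exp_comparable_ropt (x y x' : No) n (C : nat) : pinf x -> ropt x' x -> exp_comparable x' y ->
  C%:R * (E x * E y * T (x' - x) n) < E (x' + y) /\ C%:R * (E (x + y) * T (x' - x) n) < E x' * E y.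
Proof.
move=> J H [c [H1 H2]]; have I := pinf_gapr J H.
have P1 := exp_gt0 (x' + y); have P2 := mulr_gt0 (exp_gt0 x') (exp_gt0 y).
have c0 : (0 : No) < c%:R.
  case: c H1 {H2} => [|c]; last by rewrite ltr0n.
  by rewrite mul0r leNgt P1.
split; rewrite -(ltr_pM2l c0).
  have A := exp_taylor_slack n (C * c) I; rewrite -(ltr_pM2r (exp_gt0 y)) natrM in A; lra.
have I2 : infinite (x' + y - (x + y)) by move=> k; have := I k; lra.
have := exp_taylor_slack n (C * c) I2.
have -> : x' + y - (x + y) = x' - x by lra.
rewrite natrM => A; lra.
Qed.

Lemma expLJ_ge0 x l : expLJ x l -> 0 <= l.
Proof.
case=> [->//|[x' [n [H ->]]]]; apply: mulr_ge0; first exact/ltW/exp_gt0.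
by apply/ltW/taylor_gt0; have := lopt_lt H; lra.
Qed.

(** The natural factors of [exp_comparable] are harmless: the options of a purely infinite number
    are infinitely far away, where [taylor_slack] absorbs them. The options of the product are
    treated by [mul_cut_coarse]. *)
Lemma exp_add_pinf (x y : No) : pinf x -> pinf y -> E (x + y) = E x * E y.
Proof.
elim/(well_founded_ind simpler_wf): x y => x IHx.
elim/(well_founded_ind simpler_wf) => y IHy Jx Jy.
have Cx x' : x' ⊏ x -> exp_comparable x' y.
  by apply: pinf_comparable => j Jj Sj; exact: IHx.
have Cy y' : y' ⊏ y -> exp_comparable y' x.
  by apply: pinf_comparable => j Jj Sj; rewrite addrC mulrC; exact: IHy.
have Jxy := pinf_add Jx Jy; have Dxy := add_cutR (is_cut_opts x) (is_cut_opts y).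
have Tl (u v : No) n : u < v -> 0 < T (v - u) n by move=> ?; apply: taylor_gt0; lra.
apply: simpler_antisym.
  apply: (cut_simpler (exp_cut_pinf Jxy)).
    move=> l [->|[z [n [Hz ->]]]]; first by rewrite mulr_gt0 ?exp_gt0.
    case: (is_cut_lopt Dxy Hz) => w [[[x' [H ->]]|[y' [H ->]]] /leE zw].
      have [A _] := @exp_comparable_lopt _ _ _ n 1 Jx H (Cx _ (proj1 H)).
      rewrite mul1r in A; apply: le_lt_trans A.
      have -> : x - x' = x + y - (x' + y) by lra.
      by apply: exp_taylor_mono => //; have := lopt_lt H; lra.
    have [A _] := @exp_comparable_lopt _ _ _ n 1 Jy H (Cy _ (proj1 H)).
    rewrite mul1r (addrC y' x) (mulrC (E y)) in A; apply: le_lt_trans A.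
    have -> : y - y' = x + y - (x + y') by lra.
    by apply: exp_taylor_mono => //; have := lopt_lt H; lra.
  move=> r [z [n [Hz ->]]]; rewrite ltr_pdivlMr ?Tl //; last exact: ropt_lt.
  case: (is_cut_ropt Dxy Hz) => w [[[x' [H ->]]|[y' [H ->]]] /leE zw].
    have [A _] := @exp_comparable_ropt _ _ _ n 1 Jx H (Cx _ (proj1 H)).
    have B : E (x' + y) * T (z - (x + y)) n <= E z * T (x' - x) n.
      have -> : x' - x = x' + y - (x + y) by lra.
      by apply: exp_taylor_monor => //; have := ropt_lt H; lra.
    have t1 := Tl _ _ n (ropt_lt H); have t2 := Tl _ _ n (ropt_lt Hz).
    rewrite mul1r in A; rewrite -(ltr_pM2r t1); apply: lt_le_trans B.
    by rewrite mulrAC ltr_pM2r.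
  have [A _] := @exp_comparable_ropt _ _ _ n 1 Jy H (Cy _ (proj1 H)).
  have B : E (x + y') * T (z - (x + y)) n <= E z * T (y' - y) n.
    have -> : y' - y = x + y' - (x + y) by lra.
    by apply: exp_taylor_monor => //; have := ropt_lt H; lra.
  have t1 := Tl _ _ n (ropt_lt H); have t2 := Tl _ _ n (ropt_lt Hz).
  rewrite mul1r (addrC y' x) (mulrC (E y)) in A; rewrite -(ltr_pM2r t1); apply: lt_le_trans B.
  by rewrite mulrAC ltr_pM2r.
have L2 u l : pinf u -> expLJ u l -> 0 <= l /\ l * 2%:R <= E u.
  move=> Ju H; split; first exact: expLJ_ge0 H.
  case: H => [->|[x' [n [H ->]]]]; first by rewrite mul0r ltW ?exp_gt0.
  by rewrite mulrC; apply/ltW/exp_taylor_slack; exact: pinf_gapl.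
have R2 u r : pinf u -> expRJ u r -> E u * 2%:R <= r.
  move=> Ju [x' [n [H ->]]]; rewrite ler_pdivlMr ?Tl //; last exact: ropt_lt.
  by have := @exp_taylor_slack n 2 _ _ (pinf_gapr Ju H); lra.
apply: (mul_cut_coarse (exp_cut_pinf Jx) (exp_cut_pinf Jy)); try exact: exp_gt0.
- by move=> l; exact: L2.
- by move=> l; exact: L2.
- by move=> r; exact: R2.
- by move=> r; exact: R2.
- move=> l [->|[x' [n [H ->]]]]; first by rewrite !mul0r exp_gt0.
  have [_ A] := @exp_comparable_lopt _ _ _ n 2 Jx H (Cx _ (proj1 H)); lra.
- move=> l [->|[x' [n [H ->]]]]; first by rewrite mulr0 mul0r exp_gt0.
  have [_ A] := @exp_comparable_lopt _ _ _ n 2 Jy H (Cy _ (proj1 H)); rewrite (addrC y x) in A; lra.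
- move=> r [x' [n [H ->]]]; rewrite mulrAC ltr_pdivlMr ?Tl //; last exact: ropt_lt.
  have [_ A] := @exp_comparable_ropt _ _ _ n 4 Jx H (Cx _ (proj1 H)); lra.
- move=> r [x' [n [H ->]]]; rewrite mulrA ltr_pdivlMr ?Tl //; last exact: ropt_lt.
  have [_ A] := @exp_comparable_ropt _ _ _ n 4 Jy H (Cy _ (proj1 H)); rewrite (addrC y x) in A; lra.
Qed.

Lemma exp0 : E 0 = 1.
Proof.
have := exp_add_pinf pinf0 pinf0; rewrite addr0 => H.
by apply: (@mulIf _ (E 0)); [rewrite gt_eqF ?exp_gt0|rewrite mul1r].
Qed.

Lemma exp_natmul_pinf n (x : No) : pinf x -> E (x *+ n) = E x ^+ n.
Proof.
move=> J; elim: n => [|n IH]; first by rewrite mulr0n exp0.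
by rewrite mulrS exp_add_pinf // ?IH ?exprS //; exact: pinf_natmul.
Qed.

(* [gmap] is Gonshor's function g, with exp (w^x) = w^(w^(g x)) for x > 0. Its
   cut [gL x], [gR x] also involves the c with w^c in the archimedean class of x. *)
Definition gmap (x : No) : No := epsilon (inhabits 0) (fun y => E (W x) = W (W y)).

Definition gL x l := arch x (W l) \/ exists x', lopt x' x /\ 0 < x' /\ l = gmap x'.
Definition gR x r := exists x', ropt x' x /\ r = gmap x'.
Definition gspec x := E (W x) = W (W (gmap x)) /\ is_cut (gL x) (gR x) (gmap x).

Lemma exp_gt_pow n (u : No) : infinite u -> u ^+ n < E u.
Proof.
move=> I; have u0 : 0 < u by exact: (I 0%N).
have := exp_taylor n.+1 u0; rewrite exp0 mul1r subr0; apply: le_lt_trans.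
rewrite taylorS; apply: le_trans (_ : te n.+1 u <= _); last first.
  by rewrite lerDr; apply: le_trans (taylor_ge1 n (ltW u0)).
rewrite /te exprSr -mulrA ler_peMr ?exprn_ge0 ?(ltW u0) //.
by rewrite ler_pdivlMr ?ltr0n ?fact_gt0 // mul1r ltW // I.
Qed.

Lemma omega_le_mult n (x y : No) : W x <= n%:R * W y -> x <= y.
Proof. by move=> H; rewrite leNgt; apply/negP => /(omega_lt n); rewrite ltNge H. Qed.

Lemma natmul_bound (x c y : No) n : arch x (W c) -> c < y -> n%:R * x < W y.
Proof.
move=> [m [H1 H2]] L; have := ler_wpM2l (ler0n No n) H1; rewrite mulrA -natrM => K.
exact: le_lt_trans K (omega_lt _ L).
Qed.

Lemma taylor_omega_bound n (x u : No) : 0 < x -> u <= W x -> 0 <= u -> T u n <= W (x *+ n.+1).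
Proof.
move=> x0 ux u0; have I := omega_infinite x0; have W1 : 1 <= W x by exact/ltW/(I 1%N).
apply: le_trans (_ : T (W x) n <= _).
  elim: n => [//|n IH]; rewrite !taylorS lerD // /te ler_pM2r ?invr_gt0 ?ltr0n ?fact_gt0 //.
  by apply: lerXn2r; rewrite ?nnegrE //; lra.
apply: le_trans (taylor_upper n W1) _; rewrite omega_natmul exprS ler_wpM2r ?exprn_ge0 //; first lra.
exact/ltW/I.
Qed.

Lemma omega_natl n (x : No) : W (n%:R * x) = W x ^+ n.
Proof. by rewrite mulr_natl omega_natmul. Qed.

(** * The induction step for Gonshor's function g *)

Section GStep.
Variable x : No.
Hypothesis x0 : 0 < x.
Hypothesis IH : forall x', x' ⊏ x -> 0 < x' -> gspec x'.

Let M := E (W x).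
Let M0 : 0 < M. Proof. exact: exp_gt0. Qed.
Let Jx : pinf (W x). Proof. exact: pinf_omega. Qed.

Lemma exp_omega_gt_class n c : arch x (W c) -> W (n%:R * W c) < M.
Proof.
move=> [m [H1 H2]]; have K : n%:R * W c <= (n * m)%:R * x by rewrite natrM -mulrA ler_wpM2l.
apply: (@le_lt_trans _ _ (W ((n * m)%:R * x))); first by rewrite omega_le.
by rewrite omega_natl; apply/exp_gt_pow/omega_infinite.
Qed.

Lemma exp_omega_gt_lopt n x' : lopt x' x -> 0 < x' -> W (n%:R * W (gmap x')) < M.
Proof.
move=> H P; have [Eg _] := IH (proj1 H) P.
rewrite omega_natl -Eg -exp_natmul_pinf; last exact: pinf_omega.
by apply: exp_lt; rewrite -mulr_natl; exact: omega_lopt.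
Qed.

Lemma exp_omega_lt_ropt n x' : ropt x' x -> M ^+ n < W (W (gmap x')).
Proof.
move=> H; have P : 0 < x' by apply: lt_trans x0 _; exact: ropt_lt.
have [<- _] := IH (proj1 H) P.
rewrite /M -exp_natmul_pinf //; apply: exp_lt; rewrite -mulr_natl; exact: omega_ropt.
Qed.

Lemma gL_bound n l : gL x l -> W (n%:R * W l) < M.
Proof.
by case=> [|[x' [H [P ->]]]]; [exact: exp_omega_gt_class|exact: exp_omega_gt_lopt].
Qed.

(** M has the class of some W v, and v that of some W y. Bounds on powers of M become bounds on
    natural multiples of v, and these become strict bounds on y. *)
Lemma gcut_exists : exists y, sep (gL x) (gR x) y.
Proof.
have [v Av] := arch_class M0.
have vl n l : gL x l -> n%:R * W l <= v.
  move=> H; case: Av => k [A _]; apply: (@omega_le_mult k).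
  by apply: le_trans A; exact/ltW/gL_bound.
have [c Ac] := arch_class x0.
have v0 : 0 < v.
  apply: lt_le_trans (vl 1%N c _); last by left.
  by rewrite mul1r omega_gt0.
have [y Ay] := arch_class v0; exists y; split=> [l Hl|r [x' [H ->]]]; apply/ltE.
  rewrite ltNge; apply/negP => K; case: Ay => k [A _].
  have := vl k.+1 l Hl; have : W y <= W l by rewrite omega_le.
  move=> B; have := ler_wpM2l (ler0n No k) B; have := omega_gt0 l; rewrite -natr1 mulrDl mul1r; lra.
rewrite ltNge; apply/negP => K; case: Ay => k [_ A].
have B n : n%:R * v <= W (gmap x').
  case: Av => j [_ A1]; apply: (@omega_le_mult (j ^ n)).
  rewrite omega_natl natrX; apply: le_trans (_ : (j%:R * M) ^+ n <= _).
    by apply: lerXn2r; rewrite ?nnegrE ?mulr_ge0 // ?ltW // ?omega_gt0.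
  by rewrite exprMn ler_wpM2l ?exprn_ge0 // ltW // exp_omega_lt_ropt.
have := B k.+1; have : W (gmap x') <= W y by rewrite omega_le.
by rewrite -natr1 mulrDl mul1r; lra.
Qed.

Lemma prefix_omega_lt z : lopt z (W x) -> (exists k : nat, z <= k%:R) \/
  exists (k : nat) x', lopt x' x /\ 0 < x' /\ z <= k%:R * W x'.
Proof.
move=> /(is_cut_lopt (omega_map_cut x)) [w [[->|[k [x' [H ->]]]] /leE zw]]; first by left; exists 0%N.
case: (ltP 0 x') => P; first by right; exists k, x'.
left; exists k; apply: le_trans zw _; rewrite -[X in _ <= X]mulr1 ler_wpM2l //.
by rewrite -omega0 omega_le.
Qed.

(** The Taylor factor in an option of M is at most a power of some W x' or W x, hence W of a natural
    multiple. Such a multiple of x is below W y only because the class of x is among the left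
    options [gL]. *)
Lemma gspec_half y : is_cut (gL x) (gR x) y -> M ⊑ W (W y).
Proof.
move=> Cy; have I := omega_infinite x0; have [c Ac] := arch_class x0.
have cy : c < y by apply: (cut_ltl Cy); left.
have xy n : n%:R * x < W y := natmul_bound n Ac cy.
apply: (cut_simpler (exp_cut_pinf Jx)).
  move=> l [->|[z [n [Hz ->]]]]; first exact: omega_gt0.
  have zx := lopt_lt Hz.
  have B (u : No) : z <= u -> 0 <= u -> u < W x -> E z * T (W x - z) n <= E u * W (x *+ n.+1).
    move=> zu u0 ux; apply: le_trans (exp_taylor_mono n zu ux) _.
    by rewrite ler_pM2l ?exp_gt0 // taylor_omega_bound //; lra.
  case: (prefix_omega_lt Hz) => [[k zk]|[k [x' [H [P zk]]]]].
    have [C HC] : exists C : nat, E k%:R <= C%:R * E 0.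
      by apply: exp_fin; exists k; rewrite sub0r normrN ger0_norm.
    apply: le_lt_trans (B _ zk (ler0n _ _) (I k)) _; rewrite exp0 mulr1 in HC.
    apply: le_lt_trans (ler_wpM2r (ltW (omega_gt0 _)) HC) _.
    by apply: omega_lt; rewrite -mulr_natl.
  have [Eg _] := IH (proj1 H) P.
  have k0 : 0 <= k%:R * W x' by rewrite mulr_ge0 // ltW // omega_gt0.
  apply: le_lt_trans (B _ zk k0 (omega_lopt _ H)) _.
  rewrite mulr_natl exp_natmul_pinf ?Eg -?omega_natmul; last exact: pinf_omega.
  rewrite -omegaD omega_mono -(mulr_natl (W (gmap x'))) -(mulr_natl x).
  have g1 : (2 * k)%:R * W (gmap x') < W y by apply/omega_lt/(cut_ltl Cy); right; exists x'.
  have g2 := xy (2 * n.+1)%N; rewrite !natrM in g1 g2; lra.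
move=> r [z [n [Hz ->]]]; have xz := ropt_lt Hz.
have [w' [[k [x' [H ->]]] /leE wz]] := is_cut_ropt (omega_map_cut x) Hz.
have P : 0 < x' by apply: lt_trans x0 _; exact: ropt_lt.
have [Eg Cg] := IH (proj1 H) P; have I' := omega_infinite P.
set w := W x' / 2 ^+ k in wz.
have P2 : 0 < 2 ^+ k :> No by rewrite exprn_gt0.
have xw : W x < w by apply: omega_lt_half; exact: ropt_lt.
have wx' : w <= W x' by rewrite ler_pdivrMr // ler_peMr ?(ltW (omega_gt0 _)) //; apply: exprn_ege1; rewrite ler1n.
rewrite ltr_pdivlMr; last by apply: taylor_gt0; lra.
have t1 : 0 < T (w - W x) n by apply: taylor_gt0; lra.
rewrite -(ltr_pM2r t1); apply: lt_le_trans (exp_taylor_monor n xw wz).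
have t2 : 0 < T (z - W x) n by apply: taylor_gt0; lra.
rewrite mulrAC ltr_pM2r //.
have Tw : T (w - W x) n <= W (x' *+ n.+1) by apply: taylor_omega_bound => //; have := omega_gt0 x; lra.
apply: le_lt_trans (ler_wpM2l (ltW (omega_gt0 _)) Tw) _; rewrite -omegaD.
(* compare the 2^k-th powers, since 2^k w is a purely infinite monomial *)
have [C HC] : exists C : nat, E (W x') <= C%:R * E w ^+ (2 ^ k).
  have [j [Jj [Fj _]]] := pinf_part w.
  have [c1 H1] := exp_fin Fj.
  have Fj2 : fin (j *+ 2 ^ k) (W x').
    case: Fj => d Hd; exists (2 ^ k * d)%N.
    have -> : W x' = w *+ 2 ^ k by rewrite -mulr_natr natrX divfK // gt_eqF.
    by rewrite -mulrnBl normrMn -(mulr_natl _ (2 ^ k)) natrM ler_wpM2l // distrC.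
  have [c2 H2] := exp_fin Fj2; exists (c2 * c1 ^ (2 ^ k))%N.
  apply: le_trans H2 _; rewrite natrM natrX -mulrA ler_wpM2l // exp_natmul_pinf //.
  by rewrite -exprMn; apply: lerXn2r; rewrite ?nnegrE ?mulr_ge0 ?(ltW (exp_gt0 _)).
have N0 : (0 < 2 ^ k)%N by rewrite expn_gt0.
rewrite -(ltr_pXn2r N0) ?nnegrE ?(ltW (omega_gt0 _)) ?(ltW (exp_gt0 _)) //.
have C0 : (0 : No) < C%:R.
  case: (C) HC => [|j _]; last by rewrite ltr0n.
  by rewrite mul0r leNgt exp_gt0.
rewrite -(ltr_pM2l C0); apply: lt_le_trans HC.
rewrite Eg -omega_natmul; apply: omega_lt.
rewrite -(mulr_natl _ (2 ^ k)) -(mulr_natl x') mulrDr.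
have [c' Ac'] := arch_class P.
have g1 : (2 * 2 ^ k)%:R * W y < W (gmap x') by apply/omega_lt/(cut_ltr Cy); exists x'.
have cg : c' < gmap x' by apply: (cut_ltl Cg); left.
have g2 := natmul_bound (2 * (2 ^ k * n.+1)) Ac' cg.
rewrite natrM in g1; rewrite natrM (natrM _ (2 ^ k)) in g2; lra.
Qed.

Lemma gspec_half2 y : is_cut (gL x) (gR x) y -> W (W y) ⊑ M.
Proof.
move=> Cy; have I := omega_infinite x0; have [c Ac] := arch_class x0.
have MI : infinite M.
  move=> n; apply: le_lt_trans (exp_gt_pow 1 I); rewrite expr1; exact/ltW/I.
apply: (cut_simpler (omega_cut (omega_map_cut y))).
  move=> l [->|[n [u [[->|[k [y' [Hy ->]]]] ->]]]]; first exact: M0.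
    by rewrite omega0 mulr1.
  case: (is_cut_lopt Cy Hy) => v [Hv /leE yv].
  apply: lt_trans (gL_bound k.+1 Hv); apply: omega_lt.
  apply: le_lt_trans (_ : k%:R * W v < _); first by rewrite ler_wpM2l // omega_le.
  by rewrite ltr_pM2r ?omega_gt0 // ltr_nat.
move=> r [k [u [[j [y' [Hy ->]]] ->]]].
case: (is_cut_ropt Cy Hy) => v [[x' [H ->]] /leE yv].
have P2 i : 0 < 2 ^+ i :> No by rewrite exprn_gt0.
have N0 : (0 < 2 ^ j)%N by rewrite expn_gt0.
(* Raising to the power 2^j clears the dyadic fraction in the exponent. *)
rewrite ltr_pdivlMr // -(ltr_pXn2r N0) ?nnegrE ?mulr_ge0 ?(ltW (omega_gt0 _)) ?(ltW M0) ?(ltW (P2 _)) //.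
rewrite -omega_natmul -(mulr_natr (W y' / 2 ^+ j)) natrX divfK ?gt_eqF //.
apply: lt_le_trans (_ : W (W (gmap x')) <= _); last by rewrite !omega_le.
apply: lt_trans (exp_omega_lt_ropt (2 ^ j).+1 H); rewrite exprMn exprSr ltr_pM2l ?exprn_gt0 //.
by rewrite -!natrX.
Qed.

Lemma gspec_step : gspec x.
Proof.
have Cy := cut_is_cut gcut_exists; set y := cut _ _ in Cy.
have Ey : E (W x) = W (W y) by apply: simpler_antisym; [exact: gspec_half|exact: gspec_half2].
have Eg : E (W x) = W (W (gmap x)).
  by apply: (epsilon_spec (inhabits 0) (fun y => E (W x) = W (W y))); exists y.
split=> //; suff -> : gmap x = y by [].
by apply: omega_inj; apply: omega_inj; rewrite -Eg.
Qed.
End GStep.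

Lemma gmap_spec (x : No) : 0 < x -> gspec x.
Proof. by elim/(well_founded_ind simpler_wf): x => x IH x0; exact: gspec_step. Qed.

Lemma exp_omega (x : No) : 0 < x -> E (W x) = W (W (gmap x)).
Proof. by move/gmap_spec; case. Qed.

Lemma gmap_cut (x : No) : 0 < x -> is_cut (gL x) (gR x) (gmap x).
Proof. by move/gmap_spec; case. Qed.

Lemma gmap_lt (x y : No) : 0 < x -> x < y -> gmap x < gmap y.
Proof.
move=> x0 xy; rewrite -(omega_mono (gmap x)) -(omega_mono (W (gmap x))) -!exp_omega //; last exact: lt_trans xy.
by apply: exp_lt; rewrite omega_mono.
Qed.

(** * Counting signs and ordinal powers of omega *)

Lemma lopt_sig x y : lopt x y <-> x ∔ sig plus ⊑ y.
Proof. exact: lopt_plus. Qed.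
Lemma ropt_sig x y : ropt x y <-> x ∔ sig minus ⊑ y.
Proof. exact: ropt_minus. Qed.

Section OrderType.
Implicit Type P : Ord -> Prop.

(** The Mostowski collapse of [P]: the order type of its elements below b. It makes the ordinal
    chosen in [order_type] explicit. *)
Definition rk P : Ord -> Ord := wfrec olt_wf (onat 0)
  (fun rec b => ossup (fun c => exists d, olt d b /\ P d /\ c = rec d)).

Lemma rkP P b c : olt c (rk P b) <-> exists d, olt d b /\ P d /\ ole c (rk P d).
Proof.
rewrite /rk wfrec_eq -/(rk P) ossupP; last first.
  by apply: (small_image (small_below b)) => d [e [H [_ ->]]]; exists e.
split=> [[d [[e [H [K ->]]]]]|[d [H [K L]]]].
  by rewrite restr_belowE // => ?; exists e.
by exists (rk P d); split=> //; exists d; rewrite restr_belowE.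
Qed.

Lemma rk_lt P b d : olt d b -> P d -> olt (rk P d) (rk P b).
Proof. by move=> H K; apply/rkP; exists d; split=> //; split=> //; exact: ole_refl. Qed.

Lemma rk_ext P Q b : (forall d, olt d b -> (P d <-> Q d)) -> rk P b = rk Q b.
Proof.
elim/(well_founded_ind olt_wf): b => b IH H; apply: ord_ext => c; rewrite !rkP.
by split=> -[d [L [K M]]]; exists d; (split; [|split]) => //; try exact/H => //;
  move: M; rewrite (IH d L) // => e /olt_trans /(_ L); exact: H.
Qed.

Lemma rk_surj P b c : olt c (rk P b) -> exists d, olt d b /\ P d /\ rk P d = c.
Proof.
move/rkP=> H; case: (ex_least H) => d [[L [K M]] N]; exists d; split=> //; split=> //.
case/ole_eqVlt: M => [//|/rkP [e [A [B C]]]]; case: (N e A).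
by split; [exact: olt_trans L|split].
Qed.

Lemma order_typeP P : small P ->
  forall c, olt c (order_type P) <-> exists b, P b /\ rk P b = c.
Proof.
move=> S.
have [a Ha] : exists a, forall b, P b -> olt b a.
  by exists (ossup P) => b Pb; exact: ossup_lt.
have Ea : forall c, olt c (rk P a) <-> exists b, P b /\ rk P b = c.
  move=> c; split=> [/rk_surj [d [? [? ?]]]|[b [Pb <-]]]; first by exists d.
  by apply: rk_lt => //; exact: Ha.
suff -> : order_type P = rk P a by [].
rewrite /order_type.
match goal with |- epsilon ?i ?Q = _ => have : Q (epsilon i Q) end.
  apply epsilon_spec; exists (rk P a).
  pose f c := epsilon (inhabits (onat 0)) (fun b => P b /\ rk P b = c).
  have Hf c : olt c (rk P a) -> P (f c) /\ rk P (f c) = c.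
    by move=> /Ea H; rewrite /f; apply epsilon_spec.
  exists f; split; first by move=> c /Hf [].
  split=> [c d Hd Hcd|b Pb]; last first.
    exists (rk P b); have L : olt (rk P b) (rk P a) by apply/Ea; exists b.
    split=> //; have [K E] := Hf _ L.
    case: (olt_total (f (rk P b)) b) => [/(@rk_lt P)/(_ K)|[//|/(@rk_lt P)/(_ Pb)]];
      by rewrite E => /olt_irrefl.
  have [Pc Ec] := Hf c (olt_trans Hcd Hd); have [Pd Ed] := Hf d Hd.
  case: (olt_total (f c) (f d)) => [//|[E|/(@rk_lt P)/(_ Pd)]].
    by move: Hcd; rewrite -Ec E Ed => /olt_irrefl.
  by rewrite Ec Ed => /(olt_trans Hcd) /olt_irrefl.
set e := epsilon _ _ => -[f [H1 [H2 H3]]].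
have R c : olt c e -> rk P (f c) = c.
  elim/(well_founded_ind olt_wf): c => c IH Hc; apply: ord_ext => d; rewrite rkP; split.
    case=> g [L [/H3 [h [Hh Eh]] M]]; rewrite -Eh in L M.
    have hc : olt h c.
      case: (olt_total h c) => [//|[E|/(H2 _ _ Hh)]]; first by rewrite E in L; case: (olt_irrefl L).
      by move/(olt_trans L)/olt_irrefl.
    by rewrite IH // in M; exact: ole_lt_trans M hc.
  move=> Hd; exists (f d); split; first exact: H2.
  split; first by apply: H1; exact: olt_trans Hc.
  by rewrite IH //; [exact: ole_refl|exact: olt_trans Hc].
apply: ord_ext => c; rewrite Ea; split=> [Hc|[b [/H3 [d [Hd <-]]]]]; last by rewrite R // => <-.
by exists (f c); split; [exact: H1|exact: R].
Qed.
End OrderType.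

Definition tauo (x : No) : Ord := order_type (fun b => sgn x b = Some plus).

Lemma tauE (x : No) : tau x = of_ord (tauo x). Proof. by []. Qed.

Lemma small_plus x : small (fun b => sgn x b = Some plus).
Proof.
apply: small_sub (small_below (len x)) _ => b H; apply/sgn_dom; by rewrite H.
Qed.

Lemma tauo_restrict x b : tauo (restrict x b) = rk (fun c => sgn x c = Some plus) b.
Proof.
apply: ord_ext => c; rewrite (order_typeP (small_plus _)); split.
  move=> [d [Hd <-]].
  have Ld : olt d b by move: Hd => /=; case: excluded_middle_informative.
  rewrite (rk_ext (Q := fun c => sgn x c = Some plus)).
    by apply: rk_lt => //; rewrite -Hd sgn_restrict.
  by move=> e He; rewrite sgn_restrict //; exact: olt_trans Ld.
move/rk_surj=> [d [L [K <-]]]; exists d; rewrite sgn_restrict //; split=> //.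
by apply: rk_ext => e He; rewrite sgn_restrict //; exact: olt_trans L.
Qed.

(** A left option of x is an initial segment followed in x by a sign 1, so the left options
    correspond to the signs 1 in their order. Counting signs is thereby reduced to options. *)
Lemma tauoP x c : olt c (tauo x) <-> exists x', lopt x' x /\ tauo x' = c.
Proof.
rewrite (order_typeP (small_plus _)); split=> [[b [Hb <-]]|[x' [[S /(simpler_lt_iff S) H] <-]]].
  have Lb : olt b (len x) by apply/sgn_dom; rewrite Hb.
  exists (restrict x b); split; last exact: tauo_restrict.
  have S := restrict_lt Lb; split=> //; apply/(simpler_lt_iff S).
  by rewrite len_restrict //; exact: oltW.
exists (len x'); split=> //; rewrite -tauo_restrict restrict_len //; exact: simplerW.
Qed.

Lemma tauo_le x y : x ⊑ y -> ole (tauo x) (tauo y).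
Proof.
move=> S; apply: ole_all => c /tauoP [x' [/lopt_sig H E]]; apply/tauoP; exists x'.
by split=> //; apply/lopt_sig; exact: simpler_eq_trans S.
Qed.

Lemma sig_inj_simpler x s y t : x ∔ sig s ⊑ y ∔ sig t -> x ∔ sig s = y ∔ sig t \/ x ∔ sig s ⊑ y.
Proof. by case/simpler_eqVlt=> [->|/strict_sig]; [left|right]. Qed.

Lemma concat_sig_inj x s y t : x ∔ sig s = y ∔ sig t -> x = y /\ s = t.
Proof.
move=> H; have E : x = y.
  have Sx := concat_simpler x (sig s); have Sy := concat_simpler y (sig t); rewrite -H in Sy.
  have L : len x = len y by apply: osucc_inj; rewrite -!(len_concat_sig _ s) H !len_concat_sig.
  by case: (simpler_chain Sx Sy) => /simpler_eq_len; rewrite L => /(_ (ole_refl _)).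
by split=> //; have := sgn_concat_sig x s; rewrite H E sgn_concat_sig => -[].
Qed.

Lemma tauo_plus x : tauo (x ∔ sig plus) = osucc (tauo x).
Proof.
apply: ord_ext => c; rewrite tauoP olt_osucc; split.
  move=> [x' [/lopt_sig /sig_inj_simpler [/concat_sig_inj [-> _] ->|H <-]]]; first exact: ole_refl.
  by apply: oltW; apply/tauoP; exists x'; split=> //; apply/lopt_sig.
case/ole_eqVlt=> [->|/tauoP [x' [H <-]]]; first by exists x; split=> //; apply/lopt_sig.
exists x'; split=> //; apply/lopt_sig; apply: simpler_eq_trans (concat_simpler _ _); exact/lopt_sig.
Qed.

Lemma tauo_minus x : tauo (x ∔ sig minus) = tauo x.
Proof.
apply: ole_antisym; last by apply: tauo_le; exact: concat_simpler.
apply: ole_all => c /tauoP [x' [/lopt_sig /sig_inj_simpler [/concat_sig_inj [_ //]|H <-]]].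
by apply/tauoP; exists x'; split=> //; apply/lopt_sig.
Qed.

Lemma tauo_limit x c : is_limit x -> (olt c (tauo x) <-> exists y, y ⊏ x /\ olt c (tauo y)).
Proof.
move=> L; split=> [/tauoP [x' [/lopt_sig H <-]]|[y [S H]]]; last first.
  by apply: olt_le_trans H _; apply: tauo_le; exact: simplerW.
by exists (x' ∔ sig plus); rewrite tauo_plus; split; [exact: L|exact: osucc_gt].
Qed.

Lemma limit_concat x y : is_limit y -> y <> 0 -> is_limit (x ∔ y).
Proof.
move=> L N z s H; case: (simpler_chain H (concat_simpler x y)) => [S|/simpler_eqVlt [E|S]].
- apply: simpler_le_lt S _; exact: concat_strict.
- rewrite -E; exact: concat_strict.
have {}S : x ⊑ z by apply/(strict_sig _ _ s).
case: (simpler_ex S) => w E; rewrite E -concatA in H *.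
by apply/simpler_strict_concat/L; exact: (proj1 (simpler_concat _ _ _) H).
Qed.

Lemma tauo0 : tauo 0 = onat 0.
Proof. by apply: ole_0_eq; apply: ole_all => c /tauoP [x' [/lopt_0]]. Qed.

Lemma tauo_concat x y : tauo (x ∔ y) = oadd (tauo x) (tauo y).
Proof.
elim/No_ind: y => [y s IH|y L IH].
  rewrite concatA; case: s.
    by rewrite !tauo_minus.
  by rewrite !tauo_plus oadd_succ IH.
case: (classic (y = 0)) => [->|N]; first by rewrite concat0 tauo0 oadd0.
have L2 := @limit_concat x y L N.
apply: ord_ext => c; rewrite tauo_limit // oaddP; split.
  move=> [z [S H]]; case: (simpler_chain (simplerW S) (concat_simpler x y)) => K.
    by left; apply: olt_le_trans H _; exact: tauo_le.
  case: (simpler_ex K) => w E; rewrite E in S H; move/simpler_strict_concat in S.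
  rewrite IH // in H; case/oaddP: H => [|[d [Hd Kd]]]; first by left.
  right; exists d; split=> //; apply/(tauo_limit d L); by exists w.
case=> [H|[d [/(tauo_limit d L) [z [S H]] K]]].
  by exists x; split=> //; exact: concat_strict.
exists (x ∔ z); split; first exact/simpler_strict_concat.
by rewrite IH //; apply/oaddP; right; exists d.
Qed.

Lemma tauo_ord a : tauo (of_ord a) = a.
Proof.
elim/(well_founded_ind olt_wf): a => a IH; apply: ord_ext => c; rewrite tauoP; split.
  move=> [x' [[S _] <-]]; have L := simpler_len S.
  by rewrite (simpler_of_ord (simplerW S)) IH.
move=> H; exists (of_ord c); split; last exact: IH.
have S : of_ord c ⊏ of_ord a.
  by split; [exact/of_ord_simpler/oltW|move/of_ord_inj => E; rewrite E in H; case: (olt_irrefl H)].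
by split=> //; apply/(simpler_lt_iff S); exact: sgn_ord.
Qed.

Lemma tauo_neg_ord a : tauo (neg (of_ord a)) = onat 0.
Proof.
apply: ole_0_eq; apply: ole_all => c /tauoP [x' [[S /(simpler_lt_iff S) H] _]].
change (option_map opp_sign (sgn (of_ord a) (len x')) = Some plus) in H.
by rewrite sgn_ord // in H; exact: (simpler_len S).
Qed.

(** * Ordinal powers of omega *)

Fixpoint omuln a n := match n with O => onat 0 | S n => oadd (omuln a n) a end.

(** The ordinal w^a. The element 0 is put in to give w^0 = 1; the other elements lie below finite
    multiples of w^b with b < a. *)
Definition oW : Ord -> Ord := wfrec olt_wf (onat 0) (fun rec a =>
  ossup (fun c => c = onat 0 \/ exists b n, olt b a /\ olt c (omuln (rec b) n))).

Lemma oWP a c : olt c (oW a) <-> c = onat 0 \/ exists b n, olt b a /\ olt c (omuln (oW b) n).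
Proof.
rewrite /oW wfrec_eq -/oW ossupP.
  split.
    case=> d [[->|[b [n [H K]]]] L]; first by left; exact: ole_0_eq.
    right; exists b, n; split=> //; rewrite restr_belowE // in K; exact: ole_lt_trans K.
  case=> [->|[b [n [H K]]]]; first by exists (onat 0); split; [left|exact: ole_refl].
  exists c; split; last exact: ole_refl.
  by right; exists b, n; rewrite restr_belowE.
apply: small_or; first exact: small_eq.
apply: (small_sub (Q := fun c => exists b, olt b a /\ exists n : nat, True /\ olt c (omuln (restr_below olt (onat 0) a oW b) n))).
  apply: small_union => [|b _]; first exact: small_below.
  by apply: small_union => [|n _]; [exact: small_nat|exact: small_below].
by move=> d [b [n [H K]]]; exists b; split=> //; exists n.
Qed.

Lemma oW_gt0 a : olt (onat 0) (oW a). Proof. by apply/oWP; left. Qed.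

Lemma omuln_lt_oW a b n : olt b a -> olt (omuln (oW b) n) (oW a).
Proof.
move=> H; apply/oWP; right; exists b, n.+1; split=> //.
by rewrite -{1}(oadd0 (omuln (oW b) n)); apply/oadd_lt_iff/oW_gt0.
Qed.

Lemma oW_lt a b : olt b a -> olt (oW b) (oW a).
Proof. by move=> H; have := omuln_lt_oW 1 H; rewrite /= oadd_0l. Qed.

Lemma oW_le a b : ole b a -> ole (oW b) (oW a).
Proof. by case/ole_eqVlt => [->|/oW_lt /oltW //]; exact: ole_refl. Qed.

Lemma oW_succ a c : olt c (oW (osucc a)) <-> exists n, olt c (omuln (oW a) n).
Proof.
rewrite oWP; split=> [[->|[b [n [/olt_osucc H K]]]]|[n H]].
- by exists 1%N; rewrite /= oadd_0l; exact: oW_gt0.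
- exists n; apply: olt_le_trans K _.
  elim: n => [|n IH]; first exact: ole_refl.
  apply: ole_trans (oadd_le_mono _ IH) _; apply/oadd_le_iff; exact: oW_le.
- by right; exists a, n; split=> //; exact: osucc_gt.
Qed.

Lemma omuln_add a n m : oadd (omuln a n) (omuln a m) = omuln a (n + m).
Proof. by elim: m => [|m IH]; [rewrite addn0 oadd0|rewrite addnS /= oaddA IH]. Qed.

(** Additive indecomposability: both summands are below finite multiples of a common w^e with e < a,
    and these multiples add up. *)
Lemma oW_add_lt a b c : olt b (oW a) -> olt c (oW a) -> olt (oadd b c) (oW a).
Proof.
move=> Hb Hc; case: (classic (a = onat 0)) => [E|N].
  have Z d : olt d (oW a) -> d = onat 0.
    by rewrite E => /oWP [//|[e [n [/olt_0]]]].
  by rewrite (Z _ Hb) (Z _ Hc) oadd0; exact: oW_gt0.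
have H d : olt d (oW a) -> exists e n, olt e a /\ olt d (omuln (oW e) n).
  move/oWP => [->|//]; exists (onat 0), 1%N; rewrite /= oadd_0l; split; [exact: opos|exact: oW_gt0].
case: (H _ Hb) => e1 [n1 [L1 K1]]; case: (H _ Hc) => e2 [n2 [L2 K2]].
have M e e' n : ole e e' -> ole (omuln (oW e) n) (omuln (oW e') n).
  move=> L; elim: n => [|n IH]; first exact: ole_refl.
  by apply: ole_trans (oadd_le_mono _ IH) _; apply/oadd_le_iff; exact: oW_le.
have [e [Le [A1 A2]]] : exists e, olt e a /\ ole e1 e /\ ole e2 e.
  case: (ole_or_olt e1 e2) => L; first by exists e2; split=> //; split=> //; exact: ole_refl.
  by exists e1; split=> //; split; [exact: ole_refl|exact: oltW].
apply: ole_lt_trans (omuln_lt_oW (n1 + n2) Le); rewrite -omuln_add.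
apply: ole_trans (oadd_le_mono _ (ole_trans (oltW K1) (M _ _ _ A1))) _.
apply/oadd_le_iff; exact: ole_trans (oltW K2) (M _ _ _ A2).
Qed.

Lemma oW_absorb a b : olt b (oW a) -> oadd b (oW a) = oW a.
Proof.
move=> H; apply: ole_antisym; last exact: oadd_le_r.
apply: ole_all => c /oaddP [K|[d [K L]]]; first exact: olt_trans H.
exact: ole_lt_trans L (oW_add_lt H K).
Qed.

Lemma oW_ge a : ole a (oW a).
Proof.
elim/(well_founded_ind olt_wf): a => a IH; apply: ole_all => c Hc.
exact: ole_lt_trans (IH c Hc) (oW_lt Hc).
Qed.

Lemma oW0 : oW (onat 0) = onat 1.
Proof.
apply: ord_ext => c; rewrite oWP onatS olt_osucc; split.
  by case=> [->|[b [n [/olt_0]]]] //; exact: ole_refl.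
by move/ole_0_eq; left.
Qed.

(** * Sign sequences of monomials *)

Notation Ow a := (of_ord (oW a)).

Lemma of_ord_succ a : of_ord (osucc a) = of_ord a ∔ sig plus.
Proof. by rewrite osucc_oadd1 of_ord_add. Qed.

Lemma neg_ord_succ a : neg (of_ord (osucc a)) = neg (of_ord a) ∔ sig minus.
Proof. by rewrite of_ord_succ neg_concat. Qed.

Lemma of_ord_lt a b : olt a b -> of_ord a ⊏ of_ord b.
Proof.
move=> H; split; first exact/of_ord_simpler/oltW.
by move/of_ord_inj => E; rewrite E in H; case: (olt_irrefl H).
Qed.

Lemma lopt_concat_ord z a b : olt a b -> lopt (z ∔ of_ord a) (z ∔ of_ord b).
Proof.
move=> H; apply/lopt_sig; rewrite -concatA -of_ord_succ; apply/simpler_concat/of_ord_simpler.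
exact/osucc_le.
Qed.

Lemma ropt_concat_neg z a b : olt a b -> ropt (z ∔ neg (of_ord a)) (z ∔ neg (of_ord b)).
Proof.
move=> H; apply/ropt_sig; rewrite -concatA -neg_ord_succ; apply/simpler_concat/simpler_neg/of_ord_simpler.
exact/osucc_le.
Qed.

(** Prolongation by signs 1 is recognised by inequalities: y need only prolong z and exceed all
    shorter prolongations of z by signs 1. *)
Lemma ord_tail z b (y : No) : z ⊑ y -> (forall a, olt a b -> z ∔ of_ord a < y) -> z ∔ of_ord b ⊑ y.
Proof.
move=> /simpler_ex [w ->] H; apply/simpler_concat.
have [_] := is_cut_opts (of_ord b); apply; split=> [l [S _]|r [S /(simpler_gt_iff S)]].
  have L := simpler_len S; rewrite (simpler_of_ord (simplerW S)).
  by apply/(lt_concat_iff z)/ltE/H.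
by rewrite (sgn_ord (simpler_len S)).
Qed.

Lemma ord_tail_neg z b (y : No) : z ⊑ y -> (forall a, olt a b -> y < z ∔ neg (of_ord a)) -> z ∔ neg (of_ord b) ⊑ y.
Proof.
move=> S H; have := @ord_tail (neg z) b (neg y) (simpler_neg S).
move=> K; rewrite -(negK y) -(negK z) -neg_concat; apply/simpler_neg/K => a /H.
by move/ltE/lt_neg/ltE; rewrite neg_concat negK.
Qed.

Lemma ropt_lopt_trans x y z : ropt x y -> lopt y z -> ropt x z.
Proof.
move=> /ropt_sig H [S _]; apply/ropt_sig; exact: simpler_eq_trans H (simplerW S).
Qed.

Lemma is_cut_neg (L R : No -> Prop) (x : No) : is_cut L R x ->
  is_cut (fun l => R (- l)) (fun r => L (- r)) (- x).
Proof.
move=> C; apply: cut_intro => [l /(cut_ltr C)|r /(cut_ltl C)|y Hl Hr].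
- by rewrite ltrNr.
- by rewrite ltrNl.
suff S : x ⊑ neg y by have := simpler_neg S; rewrite negK negE.
apply: (cut_simpler C) => [l Ll|r Rr]; rewrite negE.
  by rewrite ltrNr; apply: Hr; rewrite opprK.
by rewrite ltrNl; apply: Hl; rewrite opprK.
Qed.

Lemma le_of_eq (x y : No) : x = y -> (x <= y)%R.
Proof. by move=> ->. Qed.

(* The cut of [W x] is determined by its sign sequence alone; this yields the
   prolongations of [W x] in [good_add] and [nice_half], and holds by induction. *)
Definition wclass x := forall y, W x ⊑ y ->
  (forall l, WL (fun l => lopt l x) l -> l < y) /\ (forall r, WR (fun r => ropt r x) r -> y < r).

(* [z] has a cut which allows [z + W x] to be computed with the left options
   z + q W x' and the right options of z, so that z + W x prolongs z by signs 1. *)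
Definition good x z := exists L R, [/\ is_cut L R z,
  forall y, z ⊑ y -> (forall l, L l -> l < y) /\ (forall r, R r -> y < r),
  forall l, L l -> l + W x <= z \/ exists (q : nat) x', lopt x' x /\ l + W x <= z + q%:R * W x',
  forall r, R r -> exists r', R r' /\ r' + W x <= r &
  forall x' k, ropt x' x -> exists r, R r /\ r <= z + W x' / 2 ^+ k].

Lemma lopt_sum_lt x x1 x2 (q1 q2 : nat) : lopt x1 x -> lopt x2 x ->
  q1%:R * W x1 + q2%:R * W x2 < W x.
Proof.
move=> H1 H2; have := omega_lopt (2 * q1) H1; have := omega_lopt (2 * q2) H2.
by rewrite !natrM; lra.
Qed.

Lemma good_down x x' z : good x z -> lopt x' x -> good x' z.
Proof.
move=> [L [R [C X P1 P2 P3]]] H; have W1 := omega_lopt 1 H; rewrite mul1r in W1.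
exists L, R; split=> //.
- move=> l /P1 [K|[q [y [Hy K]]]]; left; first by lra.
  have := @lopt_sum_lt x y x' q 1 Hy H; lra.
- by move=> r /P2 [r' [K1 K2]]; exists r'; split=> //; lra.
- move=> y k Hy; apply: P3; exact: ropt_lopt_trans H.
Qed.

Lemma tauo_opt_lt x x' : lopt x' x -> olt (tauo x') (tauo x).
Proof. by move=> H; apply/tauoP; exists x'. Qed.

(** By induction z + q W x' prolongs z by w^(tau x') q signs 1. As x' varies, tau x' runs through
    the ordinals below tau x, so these lengths are cofinal in w^(tau x), and the cut with these left
    options has exactly that many signs after z. *)
Lemma good_add x z : good x z -> z + W x = z ∔ Ow (tauo x) /\ good x (z + W x).
Proof.
elim/(well_founded_ind simpler_wf): x z => x IH z G.
have IHq x' (q : nat) : lopt x' x -> z + q%:R * W x' = z ∔ of_ord (omuln (oW (tauo x')) q) /\ good x' (z + q%:R * W x').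
  move=> H; elim: q => [|q [E1 G1]].
    by rewrite mul0r addr0 concat0; split=> //; exact: good_down H.
  have E2 : z + q.+1%:R * W x' = (z + q%:R * W x') + W x' by rewrite -natr1 mulrDl mul1r addrA.
  have [E3 G3] := IH _ (proj1 H) _ G1; rewrite E2; split=> //.
  by rewrite E3 E1 -concatA -of_ord_add.
have G0 := G; case: G => L [R [C X P1 P2 P3]].
set s := z ∔ Ow (tauo x).
pose L1 u := u = z \/ exists (q : nat) x', lopt x' x /\ u = z + q%:R * W x'.
have zs : z ⊑ s by exact: concat_simpler.
have L1opt u : L1 u -> lopt u s.
  case=> [->|[q [x' [H ->]]]].
    by rewrite -{1}(concat0 z); apply: lopt_concat_ord; exact: oW_gt0.
  have [-> _] := IHq _ q H; apply/lopt_concat_ord/omuln_lt_oW; exact: tauo_opt_lt.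
have C1 : is_cut L1 R s.
  apply: cut_intro => [u /L1opt /lopt_lt //|r Rr|y Hl Hr]; first by case: (X _ zs) => _; apply.
  have zy : z < y by apply: Hl; left.
  have Sy : z ⊑ y by apply: (cut_simpler C) => // l /(cut_ltl C) /lt_trans; apply.
  apply: ord_tail => // a /oWP [->|[b [q [/tauoP [x' [H <-]] K]]]]; first by rewrite concat0.
  have Lu : L1 (z + q%:R * W x') by right; exists q, x'.
  apply: lt_trans (Hl _ Lu); have [-> _] := IHq _ q H.
  exact/lopt_lt/lopt_concat_ord.
(* The right options of z + W x and those of z are mutually sufficient, by the last two conditions
   in [good]. *)
have Es : z + W x = s.
  apply: (is_cut_eq (add_cutR C (omega_map_cut x)) C1).
    split=> u [[v [Hv ->]]|[v [Hv ->]]]; apply/ltE.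
    - case: (P1 _ Hv) => [K|[q [x' [H K]]]]; apply: le_lt_trans K _; apply: (cut_ltl C1); first by left.
      by right; exists q, x'.
    - case: Hv => [->|[q [x' [H ->]]]]; apply: (cut_ltl C1); first by rewrite addr0; left.
      by right; exists q, x'.
    - apply: lt_trans (cut_ltr C1 Hv) _; rewrite ltrDl; exact: omega_gt0.
    - case: Hv => k [x' [H ->]]; case: (P3 x' k H) => r [Rr K].
      exact: lt_le_trans (cut_ltr C1 Rr) K.
  split=> [u [->|[q [x' [H ->]]]]|r /P2 [r' [Rr K]]]; apply/ltE.
  - by rewrite ltrDl omega_gt0.
  - by rewrite ltrD2l; exact: omega_lopt.
  - by apply: lt_le_trans K; rewrite ltrD2r; exact: (cut_ltr C).
split=> //; rewrite Es; exists L1, R; split=> //.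
- move=> y sy; split=> [u /L1opt [S /ltE K]|r]; last by case: (X y (simpler_eq_trans zs sy)) => _; apply.
  by apply/ltE; apply: ext_gt S _ sy; apply/ltE.
- move=> u [->|[q [x' [H ->]]]]; first by left; rewrite Es.
  by right; exists q, x'; split=> //; rewrite -Es; apply/le_of_eq; ring.
- move=> x' k H; case: (P3 x' k H) => r [Rr K]; exists r; split=> //.
  by rewrite -Es; have := omega_gt0 x; lra.
Qed.

Lemma good_mul x z (q : nat) : good x z ->
  z + q%:R * W x = z ∔ of_ord (omuln (oW (tauo x)) q) /\ good x (z + q%:R * W x).
Proof.
move=> G; elim: q => [|q [E1 G1]]; first by rewrite mul0r addr0 concat0.
have E2 : z + q.+1%:R * W x = (z + q%:R * W x) + W x by rewrite -natr1 mulrDl mul1r addrA.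
have [E3 G3] := good_add G1; rewrite E2; split=> //.
by rewrite E3 E1 -concatA -of_ord_add.
Qed.

Lemma good_base x : wclass x -> good x (W x).
Proof.
move=> Wx; exists (WL (fun l => lopt l x)), (WR (fun r => ropt r x)); split=> //.
- exact: omega_map_cut.
- move=> l [->|[q [x' [H ->]]]]; first by left; rewrite add0r.
  by right; exists q, x'; split=> //; rewrite addrC.
- move=> r [k [x' [H ->]]]; exists (W x' / 2 ^+ k.+1); split; first by exists k.+1, x'.
  have := omega_lt_half k.+1 (ropt_lt H); rewrite exprS invfM mulrCA.
  have h : 2%:R^-1 * 2%:R = 1 :> No by rewrite mulVf // pnatr_eq0.
  move: (2%:R^-1) h (W x' / 2 ^+ k) => a h b; have e : a * b + a * b = b * (a * 2%:R) by ring.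
  by rewrite h mulr1 in e; move: (a * b) e => c e; lra.
- move=> x' k H; exists (W x' / 2 ^+ k); split; first by exists k, x'.
  by have := omega_gt0 x; lra.
Qed.

(* The analogue of [good] for the numbers z = W x / 2^k, where z / 2 has the right
   options z - q W x'; these are computed from the goodness of -z. *)
Definition nice x z := (z <= W x)%R /\ exists R, [/\ is_cut (WL (fun l => lopt l x)) R z,
  forall y, z ⊑ y -> (forall l, WL (fun l => lopt l x) l -> l < y) /\ (forall r, R r -> y < r) &
  forall r, R r -> 2 * z <= r \/ exists (q : nat) x', lopt x' x /\ 2 * z - q%:R * W x' <= r].

Lemma nice_good x x' z : nice x z -> lopt x' x -> good x' (- z).
Proof.
move=> [zW [R [C X P]]] H; exists (fun l => R (- l)), (fun r => WL (fun l => lopt l x) (- r)).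
have Wz (q : nat) y : lopt y x -> q%:R * W y < z.
  by move=> Hy; apply: (cut_ltl C); right; exists q, y.
have z0 : 0 < z by apply: (cut_ltl C); left.
split.
- exact: is_cut_neg.
- move=> y Sy; case: (X (neg y)); first by have := simpler_neg Sy; rewrite -negE negK.
  move=> Xl Xr; split=> [l Rl|r Lr].
    by have := Xr _ Rl; rewrite negE ltrN2.
  by have := Xl _ Lr; rewrite negE ltrN2.
- move=> l /P [K|[q [y [Hy K]]]]; left; first by have := Wz 1%N _ H; rewrite mul1r; lra.
  by have := Wz 2%N _ H; have := Wz (2 * q)%N _ Hy; rewrite natrM; lra.
- move=> r Lr; have [l' [Ll K]] : exists l', WL (fun l => lopt l x) l' /\ - r + W x' <= l'.
    case: Lr => [E|[q [y [Hy E]]]]; first by exists (1%:R * W x'); split; [right; exists 1%N, x'|rewrite E; lra].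
    have Wx0 := omega_gt0 x'; have Wy0 := omega_gt0 y.
    case: (leP y x') => yx.
      exists (q.+1%:R * W x'); split; first by right; exists q.+1, x'.
      rewrite E -natr1 mulrDl mul1r lerD2r; apply: ler_wpM2l; first exact: ler0n.
      by rewrite omega_le.
    exists (q.+1%:R * W y); split; first by right; exists q.+1, y.
    by rewrite E -natr1 mulrDl mul1r lerD2l omega_le ltW.
  by exists (- l'); rewrite opprK; split=> //; lra.
- move=> y k Hy; exists 0; rewrite oppr0; split; first by left.
  by have := omega_lt_half k (ropt_lt (ropt_lopt_trans Hy H)); lra.
Qed.

(** s is the cut whose right options are z and the numbers z - q W x', whose sign sequences are
    known; the options of s + s then show s + s = z. *)
Lemma nice_half x z : nice x z ->
  z / 2 = z ∔ neg (Ow (tauo x)) /\ nice x (z / 2).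
Proof.
move=> N; have [zW [R [C X P]]] := N.
set s := z ∔ neg (Ow (tauo x)).
pose R1 u := u = z \/ exists (q : nat) x', lopt x' x /\ u = z - q%:R * W x'.
have zs : z ⊑ s by exact: concat_simpler.
have z0 : 0 < z by apply: (cut_ltl C); left.
have EQ q x' : lopt x' x -> z - q%:R * W x' = z ∔ neg (of_ord (omuln (oW (tauo x')) q)).
  move=> H; have [] := @good_mul x' (- z) q (nice_good N H).
  have -> : - z + q%:R * W x' = - (z - q%:R * W x') by ring.
  by rewrite -!negE => /(f_equal neg); rewrite neg_concat !negK.
have R1opt u : R1 u -> ropt u s.
  case=> [->|[q [x' [H ->]]]].
    rewrite -{1}(concat0 z); have -> : 0%S = neg (of_ord (onat 0)) by rewrite neg0.
    by apply: ropt_concat_neg; exact: oW_gt0.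
  by rewrite EQ //; apply/ropt_concat_neg/omuln_lt_oW; exact: tauo_opt_lt.
have C1 : is_cut (WL (fun l => lopt l x)) R1 s.
  apply: cut_intro => [l Ll|u /R1opt /ropt_lt //|y Hl Hr]; first by case: (X _ zs) => K _; exact: K.
  have zy : y < z by apply: Hr; left.
  have Sy : z ⊑ y by apply: (cut_simpler C) => // r /(cut_ltr C); apply: lt_trans.
  apply: ord_tail_neg => // a /oWP [->|[b [q [/tauoP [x' [H <-]] K]]]].
    by have -> : of_ord (onat 0) = 0%S by []; rewrite neg0 concat0.
  have Ru : R1 (z - q%:R * W x') by right; exists q, x'.
  by apply: lt_trans (Hr _ Ru) _; rewrite EQ //; exact/ropt_lt/ropt_concat_neg.
have lts l : WL (fun l => lopt l x) l -> l < s by exact: (cut_ltl C1).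
have Wlt (q : nat) x' : lopt x' x -> q%:R * W x' < s by move=> H; apply: lts; right; exists q, x'.
have s0 : 0 < s by apply: lts; left.
have sz : s < z by apply: (cut_ltr C1); left.
have szq (q : nat) x' : lopt x' x -> s < z - q%:R * W x'.
  by move=> H; apply: (cut_ltr C1); right; exists q, x'.
have Es : s + s = z.
  apply: (is_cut_eq (add_cutR C1 C1) C).
    split=> u [[v [Hv ->]]|[v [Hv ->]]]; apply/ltE.
    - by case: Hv => [->|[q [x' [H ->]]]]; [lra|have := szq q _ H; lra].
    - by case: Hv => [->|[q [x' [H ->]]]]; [lra|have := szq q _ H; lra].
    - by case: Hv => [->|[q [x' [H ->]]]]; [lra|have := Wlt q _ H; lra].
    - by case: Hv => [->|[q [x' [H ->]]]]; [lra|have := Wlt q _ H; lra].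
  split=> [l /lts K|r /P [K|[q [x' [H K]]]]]; apply/ltE; [lra|lra|].
  by have := szq q _ H; lra.
have -> : z / 2 = s by rewrite -Es; field.
split=> //; split; first lra.
exists R1; split=> // [y sy|u [->|[q [x' [H ->]]]]]; last 2 first.
- by left; lra.
- by right; exists q, x'; split=> //; lra.
split=> [l Ll|r /R1opt [S /ltE K]]; last by apply/ltE; apply: ext_lt S _ sy; apply/ltE.
by case: (X y (simpler_eq_trans zs sy)) => K _; exact: K.
Qed.

Lemma nice_base x : wclass x -> nice x (W x).
Proof.
move=> Wx; split=> //; exists (WR (fun r => ropt r x)); split=> //; first exact: omega_map_cut.
by move=> r [k [x' [H ->]]]; left; have := omega_lt_half k (ropt_lt H); 
  have := omega_lt_half k.+1 (ropt_lt H); rewrite exprS invfM mulrCA; move: (W x' / _) => b; lra.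
Qed.

Lemma omega_half_pow x k : wclass x ->
  W x / 2 ^+ k = W x ∔ neg (of_ord (omuln (oW (tauo x)) k)) /\ nice x (W x / 2 ^+ k).
Proof.
move=> H; elim: k => [|k [E1 N]].
  have -> : of_ord (omuln (oW (tauo x)) 0) = 0%S by [].
  by rewrite expr0 divr1 neg0 concat0; split=> //; exact: nice_base.
have [E2 N2] := nice_half N.
rewrite exprSr invfM mulrA; split=> //.
by rewrite E2 E1 -concatA -neg_concat -of_ord_add.
Qed.

Lemma lopt_concat_plus x y : lopt y (x ∔ sig plus) -> y = x \/ lopt y x.
Proof. by move=> /lopt_sig /sig_inj_simpler [/concat_sig_inj [-> _]|/lopt_sig]; [left|right]. Qed.
Lemma lopt_concat_minus x y : lopt y (x ∔ sig minus) -> lopt y x.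
Proof. by move=> /lopt_sig /sig_inj_simpler [/concat_sig_inj []|/lopt_sig]. Qed.
Lemma ropt_concat_plus x y : ropt y (x ∔ sig plus) -> ropt y x.
Proof. by move=> /ropt_sig /sig_inj_simpler [/concat_sig_inj []|/ropt_sig]. Qed.
Lemma ropt_concat_minus x y : ropt y (x ∔ sig minus) -> y = x \/ ropt y x.
Proof. by move=> /ropt_sig /sig_inj_simpler [/concat_sig_inj [-> _]|/ropt_sig]; [left|right]. Qed.
Lemma lopt_sig_plus x : lopt x (x ∔ sig plus).
Proof. by apply/lopt_sig. Qed.
Lemma ropt_sig_minus x : ropt x (x ∔ sig minus).
Proof. by apply/ropt_sig. Qed.

(** Among the left options of W (x ∔ 1) the multiples of W x are cofinal. They prolong W x by w^(tau
    x) q signs 1, lengths that are cofinal in w^(tau x + 1). *)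
Lemma omega_plus_good x : wclass x -> W (x ∔ sig plus) = W x ∔ Ow (osucc (tauo x)).
Proof.
move=> Wx; set s := _ ∔ Ow _; pose x1 := x ∔ sig plus.
have xx1 : x < x1 := lopt_lt (lopt_sig_plus x).
have zs : W x ⊑ s by exact: concat_simpler.
have EQ q := proj1 (good_mul q (good_base Wx)).
pose L1 u := exists q : nat, u = W x + q%:R * W x.
have L1lt u : L1 u -> u < s.
  case=> q ->; rewrite EQ; apply/lopt_lt/lopt_concat_ord/omuln_lt_oW; exact: osucc_gt.
have C1 : is_cut L1 (WR (fun r => ropt r x)) s.
  apply: cut_intro => // [r Rr|y Hl Hr]; first by case: (Wx _ zs) => _; apply.
  have zy : W x < y by apply: Hl; exists 0%N; ring.
  have Sy : W x ⊑ y.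
    by apply: (cut_simpler (omega_map_cut x)) => // l /(cut_ltl (omega_map_cut x)) /lt_trans; apply.
  apply: ord_tail => // a /oW_succ [q K].
  apply: (lt_trans _ (Hl (W x + q%:R * W x) _)); last by exists q.
  by rewrite EQ; apply/lopt_lt/lopt_concat_ord.
apply: (is_cut_eq (omega_map_cut x1) C1).
  split=> [l [->|[q [x' [H ->]]]]|r [k [x' [H ->]]]]; apply/ltE.
  - by apply: lt_trans (omega_gt0 x) _; apply: L1lt; exists 0%N; ring.
  - have K : L1 (W x + q%:R * W x) by exists q.
    apply: le_lt_trans (L1lt _ K); have := omega_gt0 x.
    have W1 : W x' <= W x by case: (lopt_concat_plus H) => [->|/lopt_lt /ltW] //; rewrite omega_le.
    have := ler_wpM2l (ler0n No q) W1; lra.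
  - apply: (cut_ltr C1); exists k, x'; split=> //; exact: ropt_concat_plus.
split=> [l [q ->]|r [k [x' [H ->]]]]; apply/ltE.
- by have := omega_lt q.+1 xx1; rewrite -natr1 mulrDl mul1r addrC.
apply: omega_lt_half; apply/ltE; apply: ext_lt (proj1 H) _ _; first by apply: (proj2 H).
exact: concat_simpler.
Qed.

(** Dually, the fractions W x / 2^k are coinitial among the right options and prolong W x by w^(tau
    x) k signs -1. *)
Lemma omega_minus_good x : wclass x -> W (x ∔ sig minus) = W x ∔ neg (Ow (osucc (tauo x))).
Proof.
move=> Wx; set s := _ ∔ neg _; pose x1 := x ∔ sig minus.
have xx1 : x1 < x := ropt_lt (ropt_sig_minus x).
have zs : W x ⊑ s by exact: concat_simpler.
have EQ k := proj1 (omega_half_pow k Wx).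
pose R1 u := exists k : nat, u = W x / 2 ^+ k.
have R1lt u : R1 u -> s < u.
  case=> q ->; rewrite EQ; apply/ropt_lt/ropt_concat_neg/omuln_lt_oW; exact: osucc_gt.
have C1 : is_cut (WL (fun l => lopt l x)) R1 s.
  apply: cut_intro => // [l Ll|y Hl Hr]; first by case: (Wx _ zs) => K _; exact: K.
  have zy : y < W x by apply: Hr; exists 0%N; rewrite expr0 divr1.
  have Sy : W x ⊑ y.
    by apply: (cut_simpler (omega_map_cut x)) => // r /(cut_ltr (omega_map_cut x)); apply: lt_trans.
  apply: ord_tail_neg => // a /oW_succ [k K].
  apply: (lt_trans (Hr (W x / 2 ^+ k) _)); first by exists k.
  by rewrite EQ; apply/ropt_lt/ropt_concat_neg.
apply: (is_cut_eq (omega_map_cut x1) C1).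
  split=> [l [->|[q [x' [H ->]]]]|r [k [x' [H ->]]]]; apply/ltE.
  - by apply: (cut_ltl C1); left.
  - by apply: (cut_ltl C1); right; exists q, x'; split=> //; exact: lopt_concat_minus.
  - have K : R1 (W x / 2 ^+ k) by exists k.
    apply: lt_le_trans (R1lt _ K) _.
    rewrite ler_pM2r ?invr_gt0 ?exprn_gt0 // omega_le.
    by case: (ropt_concat_minus H) => [->|/ropt_lt /ltW].
split=> [l [->|[q [x' [H ->]]]]|r [k ->]]; apply/ltE.
- exact: omega_gt0.
- apply: omega_lt; apply/ltE; apply: ext_gt (proj1 H) _ _; first by apply: (proj2 H).
  exact: concat_simpler.
exact: omega_lt_half.
Qed.

Lemma omega_gt0_ext x y : W x ⊑ y -> 0 < y.
Proof.
move=> S; apply/ltE; apply: ext_gt _ _ S; last by apply/ltE/omega_gt0.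
split; first exact: simpler_0.
by move=> E; have := omega_gt0 x; rewrite -E ltxx.
Qed.

Lemma wclass_lopt x y (q : nat) : wclass x -> W (x ∔ sig plus) ⊑ y -> q%:R * W x < y.
Proof.
move=> Wx; rewrite (omega_plus_good Wx) => S.
have : W x + q%:R * W x < y.
  rewrite (proj1 (good_mul q (good_base Wx))); apply/ltE.
  have [K1 K2] := @lopt_concat_ord (W x) _ _ (omuln_lt_oW q (osucc_gt (tauo x))).
  exact: ext_gt K1 K2 S.
by have := omega_gt0 x; lra.
Qed.

Lemma wclass_ropt x y (k : nat) : wclass x -> W (x ∔ sig minus) ⊑ y -> y < W x / 2 ^+ k.
Proof.
move=> Wx; rewrite (omega_minus_good Wx) => S.
rewrite (proj1 (omega_half_pow k Wx)); apply/ltE.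
have [K1 K2] := @ropt_concat_neg (W x) _ _ (omuln_lt_oW k (osucc_gt (tauo x))).
exact: ext_lt K1 K2 S.
Qed.

(** For an option x' of x, every prolongation of W x prolongs W (x' ∔ 1) or W (x' ∔ -1), whose sign
    sequences are available by induction and imply the bounds coming from x'. *)
Lemma wclassT x : wclass x.
Proof.
elim/(well_founded_ind simpler_wf): x => x IH y S; split.
  move=> l [->|[q [x' [H ->]]]]; first exact: omega_gt0_ext S.
  apply: wclass_lopt; first exact: IH (proj1 H).
  by apply: simpler_eq_trans S; apply/omega_simpler/lopt_sig.
move=> r [q [x' [H ->]]]; apply: wclass_ropt; first exact: IH (proj1 H).
by apply: simpler_eq_trans S; apply/omega_simpler/ropt_sig.
Qed.

Lemma omega_plus x : W (x ∔ sig plus) = W x ∔ Ow (osucc (tauo x)).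
Proof. exact/omega_plus_good/wclassT. Qed.

Lemma omega_minus x : W (x ∔ sig minus) = W x ∔ neg (Ow (osucc (tauo x))).
Proof. exact/omega_minus_good/wclassT. Qed.

(** Continuity of W for ⊑. An option x' of a limit x is still followed by its sign in a proper
    initial segment of x, whose image then gives the bound coming from x'. *)
Lemma omega_limit x y : is_limit x -> x <> 0%S -> (forall x', x' ⊏ x -> W x' ⊑ y) -> W x ⊑ y.
Proof.
move=> L N H; apply: (cut_simpler (omega_map_cut x)).
  move=> l [->|[q [x' [K ->]]]].
    by apply: (@omega_gt0_ext 0%S); apply: H; split; [exact: simpler_0|move=> E; apply: N].
  by apply: wclass_lopt; [exact: wclassT|apply: H; apply: L; apply/lopt_sig].
move=> r [q [x' [K ->]]].
by apply: wclass_ropt; [exact: wclassT|apply: H; apply: L; apply/ropt_sig].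
Qed.

(** * Ordinal multiplication *)

Definition omul (a : Ord) : Ord -> Ord := wfrec olt_wf (onat 0) (fun rec b =>
  ossup (fun c => exists d, olt d b /\ olt c (oadd (rec d) a))).

Lemma omulP a b c : olt c (omul a b) <-> exists d, olt d b /\ olt c (oadd (omul a d) a).
Proof.
rewrite /omul wfrec_eq -/(omul a) ossupP.
  split=> [[e [[d [H K]] L]]|[d [H K]]].
    by exists d; split=> //; rewrite restr_belowE // in K; exact: ole_lt_trans K.
  exists c; split; last exact: ole_refl.
  by exists d; rewrite restr_belowE.
by apply: small_union => [|d _]; exact: small_below.
Qed.

Lemma omul0 a : omul a (onat 0) = onat 0.
Proof. by apply: ord_ext => c; rewrite omulP; split=> [[d [/olt_0]]|/olt_0]. Qed.

Lemma omul_le a b b' : ole b b' -> ole (omul a b) (omul a b').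
Proof.
move=> H; apply: ole_all => c /omulP [d [K L]]; apply/omulP; exists d; split=> //.
exact: olt_le_trans H.
Qed.

Lemma omul_succ a b : omul a (osucc b) = oadd (omul a b) a.
Proof.
apply: ord_ext => c; rewrite omulP; split=> [[d [/olt_osucc H K]]|H].
  by apply: olt_le_trans K _; apply/oadd_le_mono/omul_le.
by exists b; split=> //; exact: osucc_gt.
Qed.

Lemma omul_succ_le a b b' : olt b b' -> ole (oadd (omul a b) a) (omul a b').
Proof. by move=> /osucc_le H; rewrite -omul_succ; exact: omul_le. Qed.

Lemma oadd_le a a' b b' : ole a a' -> ole b b' -> ole (oadd a b) (oadd a' b').
Proof. by move=> H K; apply: ole_trans (oadd_le_mono _ H) _; apply/oadd_le_iff. Qed.

Lemma omul_le_mono a a' b : ole a a' -> ole (omul a b) (omul a' b).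
Proof.
move=> H; elim/(well_founded_ind olt_wf): b => b IH.
apply: ole_all => c /omulP [d [K L]]; apply/omulP; exists d; split=> //.
apply: olt_le_trans L _; apply: oadd_le => //; exact: IH.
Qed.

Lemma omul_add a b c : omul a (oadd b c) = oadd (omul a b) (omul a c).
Proof.
elim/(well_founded_ind olt_wf): c => c IH; apply: ord_ext => x; rewrite oaddP; split.
  move/omulP => [d [/oaddP [H|[e [He /ole_eqVlt H]]] K]].
    by left; apply: olt_le_trans K _; exact: omul_succ_le.
  have Kx : olt x (oadd (omul a (oadd b e)) a).
    by apply: olt_le_trans K _; apply/oadd_le_mono/omul_le; case: H => [->|/oltW //]; exact: ole_refl.
  rewrite IH // -oaddA in Kx; case/oaddP: Kx => [|[y [Hy Ky]]]; first by left.
  by right; exists y; split=> //; apply: olt_le_trans Hy _; exact: omul_succ_le.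
case=> [H|[y [/omulP [e [He Ky]] L]]].
  by apply: olt_le_trans H _; apply: omul_le; exact: oadd_le_l.
apply: ole_lt_trans L _; apply/omulP; exists (oadd b e); split; first exact: oadd_lt.
by rewrite IH // -oaddA; exact: oadd_lt.
Qed.

Lemma omulA a b c : omul a (omul b c) = omul (omul a b) c.
Proof.
elim/(well_founded_ind olt_wf): c => c IH; apply: ord_ext => x; rewrite !omulP; split.
  move=> [e [/omulP [d [Hd Kd]] H]]; exists d; split=> //.
  rewrite -IH // -omul_add; apply: olt_le_trans H _; exact: omul_succ_le.
move=> [d [Hd H]]; rewrite -IH // -omul_add in H.
case/omulP: H => e [He H]; exists e; split=> //; apply: olt_le_trans He _.
exact: omul_succ_le.
Qed.

Lemma omul1 a : omul a (onat 1) = a.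
Proof. by rewrite onatS omul_succ omul0 oadd_0l. Qed.

Lemma omul_1l b : omul (onat 1) b = b.
Proof.
elim/(well_founded_ind olt_wf): b => b IH; apply: ord_ext => c; rewrite omulP; split.
  move=> [d [H]]; rewrite IH // -osucc_oadd1 => /olt_osucc K; exact: ole_lt_trans H.
by move=> H; exists c; split=> //; rewrite IH // -osucc_oadd1; exact: osucc_gt.
Qed.

Lemma omuln_omul a n : omuln a n = omul a (onat n).
Proof. by elim: n => [|n IH]; rewrite ?omul0 // onatS omul_succ -IH. Qed.

Lemma oW_succ_omul a : oW (osucc a) = omul (oW a) oomega.
Proof.
apply: ord_ext => c; rewrite oW_succ omulP; split=> [[n H]|[d [/olt_omega [n ->] H]]].
  exists (onat n); split; first by apply/olt_omega; exists n.
  by rewrite -omuln_omul; apply: olt_le_trans H _; exact: oadd_le_l.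
by exists n.+1; rewrite /= omuln_omul.
Qed.

Lemma simpler_concat_ord x y g : x ⊑ y -> y ⊑ x ∔ of_ord g -> exists c, y = x ∔ of_ord c.
Proof.
move=> /simpler_ex [w ->] /simpler_concat /simpler_of_ord ->; by exists (len w).
Qed.

Lemma simpler_concat_neg x y g : x ⊑ y -> y ⊑ x ∔ neg (of_ord g) -> exists c, y = x ∔ neg (of_ord c).
Proof.
move=> /simpler_ex [w ->] /simpler_concat /simpler_neg; rewrite negK => /simpler_of_ord E.
by exists (len (neg w)); rewrite -E negK.
Qed.

Lemma is_limit0 : is_limit 0%S.
Proof.
move=> y s H; have := simpler_len_le H; rewrite len_concat_sig => K.
by have /olt_0 := olt_le_trans (osucc_gt _) K.
Qed.

Lemma is_limit_ord a : olimit a -> is_limit (of_ord a).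
Proof.
move=> L y s S; have Ey := simpler_of_ord (simpler_eq_trans (concat_simpler y (sig s)) S).
have Hs := simpler_of_ord S; split=> // E.
have [c Ec] : exists c, a = osucc c.
  by exists (len y); rewrite -(len_concat_sig y s) E.
by have := L c; rewrite Ec => /(_ (osucc_gt c)) /olt_irrefl.
Qed.

Lemma omega0S : W 0%S = of_ord (onat 1).
Proof. exact: omega0. Qed.

(** The appended w^(tau x + 1) signs 1 absorb the w^(tau x) counted before, and signs -1 are not
    counted. *)
Lemma tauo_omega x : tauo (W x) = oW (tauo x).
Proof.
elim/No_ind: x => [x s IH|x L IH].
  case: s; first by rewrite omega_minus tauo_minus tauo_concat IH tauo_neg_ord oadd0.
  by rewrite omega_plus tauo_concat IH tauo_plus tauo_ord oW_absorb //; apply/oW_lt/osucc_gt.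
case: (classic (x = 0%S)) => [->|N]; first by rewrite omega0S tauo0 oW0 tauo_ord.
apply: ord_ext => c; split.
  move/tauoP => [u [Hu <-]].
  have [x' [Sx Su]] : exists x', x' ⊏ x /\ u ⊏ W x'.
    apply: NNPP => K; have H : W x ⊑ u.
      apply: omega_limit => // x' Hx; case: (simpler_chain (proj2 (omega_simpler x' x) (simplerW Hx)) (simplerW (proj1 Hu))) => // /simpler_eqVlt [->|H]; first exact: simpler_refl.
      by case: K; exists x'.
    by case: (proj1 Hu) => S; case; exact: simpler_antisym.
  have : lopt u (W x').
    split=> //; have SS : W x' ⊑ W x by exact/omega_simpler/simplerW.
    move/(simpler_lt_iff (proj1 Hu)) : (proj2 Hu) => E; apply/(simpler_lt_iff Su).
    by rewrite -E -SS //; exact: simpler_len.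
  move/tauo_opt_lt; rewrite IH // => H; apply: olt_le_trans H _; exact/oW_le/tauo_le/simplerW.
move/oWP => [->|[b [n [/(tauo_limit _ L) [y [Sy Hb]] K]]]].
  have S : W 0%S ⊑ W x by exact/omega_simpler/simpler_0.
  by apply: olt_le_trans (tauo_le S); rewrite omega0S tauo_ord onatS; exact: osucc_gt.
have S : W y ⊑ W x by exact/omega_simpler/simplerW.
by apply: olt_le_trans (tauo_le S); rewrite IH //; apply: olt_trans K _; exact: omuln_lt_oW.
Qed.

Lemma concat_neq0 x y : y <> 0%S -> x ∔ y <> 0%S.
Proof.
move=> N E; have Ex : x = 0%S by apply: simpler_antisym (simpler_0 x); rewrite -E; exact: concat_simpler.
by apply: N; rewrite Ex concat_0l in E.
Qed.

(** Only the shape of the sign sequence is settled here; the ordinal c is recovered in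
    [omega_concat_ord] by counting signs 1 on both sides. *)
Lemma omega_concat_ord_ex x g : exists c, W (x ∔ of_ord g) = W x ∔ of_ord c.
Proof.
elim/(well_founded_ind olt_wf): g => g IH.
case: (ord_case g) => [[b E]|L].
  rewrite E; case: (IH b) => [|c Ec]; first by rewrite E; exact: osucc_gt.
  by rewrite of_ord_succ concatA omega_plus Ec -concatA -of_ord_add; eexists.
case: (classic (g = onat 0)) => [->|N]; first by exists (onat 0); rewrite !concat0.
apply: (@simpler_concat_ord _ _ (oW (oadd (tauo x) g))); first exact/omega_simpler/concat_simpler.
have N0 : x ∔ of_ord g <> 0%S.
  by apply: concat_neq0 => /of_ord_inj.
apply: omega_limit => //.
  by apply: limit_concat; [exact: is_limit_ord|move=> /of_ord_inj].
move=> x' S; case: (simpler_chain (simplerW S) (concat_simpler x (of_ord g))) => K.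
  by apply: simpler_eq_trans (concat_simpler _ _); exact/omega_simpler.
case: (simpler_ex K) => w E; rewrite E in S *; move/simpler_strict_concat: S => S.
have Ew := simpler_of_ord (simplerW S).
have Lw : olt (len w) g by have := simpler_len S.
rewrite Ew; case: (IH _ Lw) => c Ec; rewrite Ec; apply/simpler_concat/of_ord_simpler.
have := f_equal tauo Ec; rewrite tauo_concat tauo_omega tauo_concat !tauo_ord tauo_omega => Et.
apply: ole_trans (oadd_le_r (oW (tauo x)) c) _; rewrite -Et.
exact/oW_le/oadd_le_iff/oltW.
Qed.

Lemma omega_concat_ord x g : olt (onat 0) g ->
  W (x ∔ of_ord g) = W x ∔ Ow (oadd (tauo x) g).
Proof.
move=> g0; have [c E] := omega_concat_ord_ex x g; rewrite E; congr (_ ∔ of_ord _).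
apply: (@oadd_inj (oW (tauo x))).
have := f_equal tauo E; rewrite tauo_concat tauo_omega tauo_concat !tauo_ord tauo_omega => <-.
by rewrite oW_absorb //; apply: oW_lt; rewrite -{1}(oadd0 (tauo x)); exact: oadd_lt.
Qed.

Lemma omega_ord a : W (of_ord a) = Ow a.
Proof.
case: (classic (a = onat 0)) => [->|/opos H]; first by rewrite oW0; exact: omega0S.
have -> : of_ord a = 0%S ∔ of_ord a by rewrite concat_0l.
rewrite omega_concat_ord // tauo0 oadd_0l omega0S.
by rewrite -of_ord_add oW_absorb //; rewrite -oW0; exact: oW_lt.
Qed.

(** Counting signs 1 says nothing about this tail. As tau is constant along the signs -1, each of
    them appends the same number w^(tau x + 1) of signs -1. *)
Lemma omega_concat_neg x g :
  W (x ∔ neg (of_ord g)) = W x ∔ neg (of_ord (omul (oW (osucc (tauo x))) g)).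
Proof.
elim/(well_founded_ind olt_wf): g => g IH.
have N0 : neg (of_ord (onat 0)) = 0%S by exact: neg0.
case: (ord_case g) => [[b E]|L].
  rewrite E neg_ord_succ concatA omega_minus IH; last by rewrite E; exact: osucc_gt.
  by rewrite tauo_concat tauo_neg_ord oadd0 omul_succ of_ord_add neg_concat concatA.
case: (classic (g = onat 0)) => [->|N]; first by rewrite omul0 N0 !concat0.
set h := omul _ _.
have L2 : is_limit (x ∔ neg (of_ord g)).
  apply: limit_concat; last by move=> H; apply: N; apply: of_ord_inj; apply: neg_inj; rewrite N0; exact: H.
  move=> y s S; have := simpler_neg S; rewrite negK neg_concat.
  have -> : neg (sig s) = sig (opp_sign s) by case: s {S} => //=; rewrite negK.
  by move/(is_limit_ord L)/simpler_strict_neg; rewrite neg_concat negK; case: s {S}; rewrite //= negK.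
have NN : x ∔ neg (of_ord g) <> 0%S.
  by apply: concat_neq0 => H; apply: N; apply: of_ord_inj; apply: neg_inj; rewrite N0; exact: H.
have S1 : W (x ∔ neg (of_ord g)) ⊑ W x ∔ neg (of_ord h).
  apply: omega_limit => // x' S; case: (simpler_chain (simplerW S) (concat_simpler x (neg (of_ord g)))) => K.
    by apply: simpler_eq_trans (concat_simpler _ _); exact/omega_simpler.
  case: (simpler_ex K) => w E; rewrite E in S *; move/simpler_strict_concat: S => S.
  have Ew : neg w = of_ord (len w).
    by have := simpler_neg (simplerW S); rewrite negK => /simpler_of_ord.
  have Lw : olt (len w) g by have := simpler_len S.
  rewrite -(negK w) Ew IH //; apply/simpler_concat/simpler_neg/of_ord_simpler/omul_le/oltW.
  exact: Lw.
have [c Ec] := simpler_concat_neg (proj2 (omega_simpler _ _) (concat_simpler x (neg (of_ord g)))) S1.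
rewrite Ec; congr (_ ∔ neg (of_ord _)); apply: ole_antisym.
  by move: S1; rewrite Ec => /simpler_concat /simpler_neg; rewrite !negK => /of_ord_simpler.
apply: ole_all => d /omulP [e [He Hd]]; rewrite -omul_succ in Hd; apply: olt_le_trans Hd _.
have : W (x ∔ neg (of_ord (osucc e))) ⊑ W (x ∔ neg (of_ord g)).
  apply/omega_simpler/simpler_concat/simpler_neg/of_ord_simpler/oltW; exact: L.
rewrite Ec IH; last exact: L.
by move=> /simpler_concat /simpler_neg; rewrite !negK => /of_ord_simpler.
Qed.

(** * Epsilon numbers *)

(* [Enext t] is the least epsilon number above t, the limit of t + 1, w^(t + 1), ... *)
Fixpoint eN (t : Ord) (n : nat) : Ord := match n with O => osucc t | S n => oW (eN t n) end.

Definition Enext (t : Ord) : Ord := ossup (fun c => exists n, olt c (eN t n)).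

Lemma EnextP t c : olt c (Enext t) <-> exists n, olt c (eN t n).
Proof.
rewrite ossupP; last first.
  apply: (small_sub (Q := fun c => exists n : nat, True /\ olt c (eN t n))).
    by apply: small_union => [|n _]; [exact: small_nat|exact: small_below].
  by move=> d [n H]; exists n.
split=> [[d [[n H] L]]|[n H]]; first by exists n; exact: ole_lt_trans H.
by exists c; split; [exists n|exact: ole_refl].
Qed.

Lemma eN_gt t n : olt t (eN t n).
Proof. by elim: n => [|n IH]; [exact: osucc_gt|exact: olt_le_trans IH (oW_ge _)]. Qed.

Lemma Enext_gt t : olt t (Enext t).
Proof. by apply/EnextP; exists O; exact: osucc_gt. Qed.

Lemma Enext_fixed t : oW (Enext t) = Enext t.
Proof.
apply: ole_antisym (oW_ge _); apply: ole_all => c /oWP [->|[b [m [/EnextP [n H] K]]]].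
  exact: ole_lt_trans (ole_0 _) (Enext_gt t).
by apply/EnextP; exists n.+1; apply: olt_trans K _; exact: omuln_lt_oW.
Qed.

Lemma Enext_least t s : oW s = s -> olt t s -> ole (Enext t) s.
Proof.
move=> E H; apply: ole_all => c /EnextP [n K]; apply: olt_le_trans K _.
elim: n => [|n IH] /=; first exact/osucc_le.
by rewrite -E; exact: oW_le.
Qed.

(* [oT a] is the ordinal epsilon_(flat a): 0 at 0, and epsilon_g at 1 + g. *)
Definition oT : Ord -> Ord := wfrec olt_wf (onat 0) (fun rec a =>
  ossup (fun c => exists b, olt b a /\ olt c (Enext (rec b)))).

Lemma oTP a c : olt c (oT a) <-> exists b, olt b a /\ olt c (Enext (oT b)).
Proof.
rewrite /oT wfrec_eq -/oT ossupP.
  split=> [[e [[d [H K]] L]]|[d [H K]]].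
    by exists d; split=> //; rewrite restr_belowE // in K; exact: ole_lt_trans K.
  exists c; split; last exact: ole_refl.
  by exists d; rewrite restr_belowE.
by apply: small_union => [|d _]; exact: small_below.
Qed.

Lemma oT0 : oT (onat 0) = onat 0.
Proof. by apply: ole_0_eq; apply: ole_all => c /oTP [b [/olt_0]]. Qed.

Lemma oT_lt a b : olt b a -> olt (oT b) (oT a).
Proof. by move=> H; apply/oTP; exists b; split=> //; exact: Enext_gt. Qed.

Lemma oT_le a b : ole b a -> ole (oT b) (oT a).
Proof. by case/ole_eqVlt => [->|/oT_lt /oltW //]; exact: ole_refl. Qed.

Lemma oT_succ a : oT (osucc a) = Enext (oT a).
Proof.
apply: ord_ext => c; rewrite oTP; split=> [[b [/olt_osucc H K]]|H].
  apply: olt_le_trans K _; apply: Enext_least; first exact: Enext_fixed.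
  exact: ole_lt_trans (oT_le H) (Enext_gt _).
by exists a; split=> //; exact: osucc_gt.
Qed.

Lemma oT_fixed a : olt (onat 0) a -> oW (oT a) = oT a.
Proof.
move=> a0; apply: ole_antisym (oW_ge _); apply: ole_all => c /oWP [->|[b [m [/oTP [d [H L]] K]]]].
  by apply: ole_lt_trans (ole_0 _) (oT_lt a0).
by apply/oTP; exists d; split=> //; apply: olt_trans K _; rewrite -Enext_fixed; exact: omuln_lt_oW.
Qed.

Lemma oT_least a s : oW s = s -> (forall b, olt b a -> olt (oT b) s) -> ole (oT a) s.
Proof.
move=> E H; apply: ole_all => c /oTP [b [K L]]; apply: olt_le_trans L _.
by apply: Enext_least => //; exact: H.
Qed.

Lemma ord_1_add b : olt (onat 0) b -> exists g, b = oadd (onat 1) g.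
Proof. by move=> H; exists (osub b (onat 1)); rewrite oadd_osub // onatS; apply/osucc_le. Qed.

(** * Parametrised classes *)

Section Parametrises.
Variables (Xi : No -> No) (C : No -> Prop).
Hypothesis HX : parametrises Xi C.

Lemma par_in x : C (Xi x).
Proof. by case: HX => H _; apply/H; exists x. Qed.

Lemma par_ex y : C y -> exists x, y = Xi x.
Proof. by case: HX => H _ /H. Qed.

Lemma par_lt x y : (Xi x < Xi y) = (x < y).
Proof.
case: HX => _ [H _]; apply/idP/idP => K; apply/ltE; first by apply/H/ltE.
by apply/H/ltE.
Qed.

Lemma par_inj x y : Xi x = Xi y -> x = y.
Proof.
move=> E; case: (ltgtP x y) => // H; have := H; by rewrite -par_lt E ltxx.
Qed.

Lemma par_simpler x y : Xi x ⊑ Xi y <-> x ⊑ y.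
Proof.
case: HX => _ [_ H]; split=> /simpler_eqVlt [E|K].
- by rewrite (par_inj E); exact: simpler_refl.
- exact/simplerW/H.
- by rewrite E; exact: simpler_refl.
- exact/simplerW/H.
Qed.

(** Pulled back along the parametrisation, y lies between the options of x and hence prolongs x. *)
Lemma par_cut x y : C y -> (forall x', lopt x' x -> Xi x' < y) -> (forall x', ropt x' x -> y < Xi x') ->
  Xi x ⊑ y.
Proof.
move=> /par_ex [z ->] Hl Hr; apply/par_simpler.
by have [_] := is_cut_opts x; apply; split=> x' K; apply/ltE; rewrite -par_lt; [exact: Hl|exact: Hr].
Qed.

End Parametrises.

Lemma lopt_of_ord a b : olt a b -> lopt (of_ord a) (of_ord b).
Proof. by move/(lopt_concat_ord 0%S); rewrite !concat_0l. Qed.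

Lemma olt_of_ord a b : (of_ord a < of_ord b) <-> olt a b.
Proof.
split=> H; last exact/lopt_lt/lopt_of_ord.
case: (ole_or_olt b a) => // /ole_eqVlt [E|/lopt_of_ord /lopt_lt K]; first by rewrite E ltxx in H.
by have := lt_trans H K; rewrite ltxx.
Qed.

Lemma lopt_ordP x b : lopt x (of_ord b) -> olt (len x) b /\ x = of_ord (len x).
Proof. by case=> S _; split; [exact: simpler_len S|exact: simpler_of_ord (simplerW S)]. Qed.

Lemma ropt_ord x b : ~ ropt x (of_ord b).
Proof.
move=> [S]; have L := simpler_len S; rewrite (simpler_of_ord (simplerW S)) => /ltE /olt_of_ord K.
by have /olt_irrefl := olt_trans L K.
Qed.

(** * Parametrised epsilon numbers at ordinal arguments *)

Section Eps.
Variable eps : No -> No.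
Hypothesis heps : parametrises eps (fixed omega_map).

(** The candidate is a fixed point above the earlier values, so the value is an initial segment of
    an ordinal: it is itself an ordinal epsilon number, and [oT_least] rules out a smaller one. *)
Lemma eps_ord g : eps (of_ord g) = of_ord (oT (oadd (onat 1) g)).
Proof.
elim/(well_founded_ind olt_wf): g => g IH.
set N := oT _; have FN : oW N = N.
  by apply: oT_fixed; apply: olt_le_trans (oadd_le_l _ _); rewrite onatS; exact: osucc_gt.
have S : eps (of_ord g) ⊑ of_ord N.
  apply: (par_cut heps); first by rewrite /fixed omega_ord FN.
    move=> x' /lopt_ordP [L E]; rewrite E IH //; apply/olt_of_ord/oT_lt; exact: oadd_lt.
  by move=> x' /ropt_ord.
have := par_in heps (of_ord g); rewrite /fixed.
rewrite (simpler_of_ord S); move: (len _) (simpler_of_ord S) => s Es.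
rewrite omega_ord => /of_ord_inj Fs; congr of_ord; apply: ole_antisym.
  by move: S; rewrite Es => /of_ord_simpler.
have H0 : olt (oT (onat 0)) s by rewrite oT0 -Fs; exact: oW_gt0.
apply: oT_least => // b Hb; case: (classic (b = onat 0)) => [->//|/opos /ord_1_add [c E]].
rewrite E in Hb *; have {}Hb := proj1 (oadd_lt_iff _ _ _) Hb; apply/olt_of_ord.
by rewrite -IH // -Es (par_lt heps); apply/olt_of_ord.
Qed.

(** At tau x = 0 the conventions for -oo give 0, the value of [oT] at 0. Otherwise [flat] removes
    the leading 1 of tau x = 1 + g. *)
Lemma eps_ext_tau x : eps_ext eps (flat (tau x)) = of_ord (oT (tauo x)).
Proof.
rewrite tauE /flat; case: (classic (tauo x = onat 0)) => [->|/opos H].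
  rewrite oT0; case: excluded_middle_informative => //= /ltE; by rewrite ltxx.
case: excluded_middle_informative => [_|[]] /=; last exact/ltE/olt_of_ord.
have [g E] := ord_1_add H.
set w := epsilon _ _; have <- : of_ord g = w.
  apply: (@concat_inj (of_ord (onat 1))); rewrite -of_ord_add -E.
  by apply: (epsilon_spec (inhabits 0%S) (fun w => of_ord (tauo x) = 1%S ∔ w)); exists (of_ord g); rewrite -of_ord_add -E.
by rewrite eps_ord -E.
Qed.

End Eps.

(** * Transfinite concatenation *)

Section ConcatSum.
Variable f : Ord -> No.
Notation cs := (concat_sum f).

(** That the partial sums form a chain, so that [sup_simpler] is a supremum, comes from the
    induction hypothesis. *)
Lemma concat_sum_spec a : (forall b, olt b a -> cs b ∔ f b ⊑ cs a) /\
  forall t, (forall b, olt b a -> cs b ∔ f b ⊑ t) -> cs a ⊑ t.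
Proof.
elim/(well_founded_ind olt_wf): a => a IH.
have [] := @sup_simplerP (fun x => exists b, olt b a /\ x = cs b ∔ f b).
- by apply: (small_image (small_below a)) => x [b [H ->]]; exists b.
- have M b b' : olt b' a -> olt b b' -> cs b ∔ f b ⊑ cs b' ∔ f b'.
    by move=> L K; apply: simpler_eq_trans (proj1 (IH _ L) _ K) _; exact: concat_simpler.
  move=> x y [b [Hb ->]] [b' [Hb' ->]]; case: (olt_total b b') => [L|[->|L]].
  + by left; exact: M.
  + by left; exact: simpler_refl.
  + by right; exact: M.
rewrite -concat_sum_eq => H1 H2; split=> [b Hb|t Ht]; first by apply: H1; exists b.
by apply: H2 => x [b [Hb ->]]; exact: Ht.
Qed.

Lemma concat_sum_lt a b : olt b a -> cs b ∔ f b ⊑ cs a.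
Proof. exact: (proj1 (concat_sum_spec a)). Qed.

Lemma concat_sum_sup a t : (forall b, olt b a -> cs b ∔ f b ⊑ t) -> cs a ⊑ t.
Proof. exact: (proj2 (concat_sum_spec a)). Qed.

End ConcatSum.

Lemma concat_sum_ext f g a : (forall b, olt b a -> f b = g b) -> concat_sum f a = concat_sum g a.
Proof.
elim/(well_founded_ind olt_wf): a => a IH H.
have E b : olt b a -> concat_sum f b ∔ f b = concat_sum g b ∔ g b.
  by move=> L; rewrite H // IH // => c K; apply: H; exact: olt_trans L.
apply: simpler_antisym; apply: concat_sum_sup => b L; first by rewrite E //; exact: concat_sum_lt.
by rewrite -E //; exact: concat_sum_lt.
Qed.

Lemma restrict_sig x y s : x ∔ sig s ⊑ y -> restrict y (len x) = x /\ sgn y (len x) = Some s.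
Proof.
move=> S; split; first exact: restrict_len (simpler_eq_trans (concat_simpler x (sig s)) S).
rewrite S ?sgn_concat_sig // len_concat_sig; exact: osucc_gt.
Qed.

(** * Replacing signs by blocks *)

Section Csum.
Variable g : No -> sign -> No.

(* [g z s] is the block which replaces the sign [s] occurring after [z]. *)
Definition csum z := concat_sum (fun b =>
  match sgn z b with Some s => g (restrict z b) s | None => 0%S end) (len z).

(** A block depends only on the sequence up to its sign, so [csum z] is also a partial sum for every
    prolongation of z. *)
Lemma csum_prefix z y : z ⊑ y -> csum z = concat_sum (fun b =>
  match sgn y b with Some s => g (restrict y b) s | None => 0%S end) (len z).
Proof.
move=> S; apply: concat_sum_ext => b L; rewrite -(S b L).
case: (sgn y b) => // s; congr (g _ s); apply: No_ext => c /=.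
case: excluded_middle_informative => // K; apply/esym/S; exact: olt_trans L.
Qed.

Lemma csum_sig z y s : z ∔ sig s ⊑ y -> csum z ∔ g z s ⊑ csum y.
Proof.
move=> S; have [E1 E2] := restrict_sig S.
rewrite (@csum_prefix z y); last exact: simpler_eq_trans (concat_simpler z (sig s)) S.
have L : olt (len z) (len y).
  by apply: olt_le_trans (simpler_len_le S); rewrite len_concat_sig; exact: osucc_gt.
by have := @concat_sum_lt (fun b => match sgn y b with Some s => g (restrict y b) s | None => 0%S end) _ _ L; rewrite E1 E2.
Qed.

Lemma csum_sup z t : (forall y s, y ∔ sig s ⊑ z -> csum y ∔ g y s ⊑ t) -> csum z ⊑ t.
Proof.
move=> H; apply: concat_sum_sup => b L; pose y := restrict z b.
have Sy : y ⊏ z by exact: restrict_lt.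
have Ly : len y = b by apply/len_restrict/oltW.
have [s S] := simpler_next Sy; have [_ E2] := restrict_sig S.
rewrite Ly in E2; have := H y s S; by rewrite (csum_prefix (simplerW Sy)) Ly E2.
Qed.

Lemma csum_le z y : z ⊑ y -> csum z ⊑ csum y.
Proof. by move=> S; apply: csum_sup => x s K; apply/csum_sig/(simpler_eq_trans K). Qed.

Lemma csum_next z s : csum (z ∔ sig s) = csum z ∔ g z s.
Proof.
apply: simpler_antisym; last by apply: csum_sig; exact: simpler_refl.
apply: csum_sup => y t /sig_inj_simpler [/concat_sig_inj [-> ->]|S]; first exact: simpler_refl.
exact: simpler_eq_trans (csum_sig S) (concat_simpler _ _).
Qed.

Lemma csum0 : csum 0%S = 0%S.
Proof.
apply: simpler_antisym (simpler_0 _); apply: csum_sup => y s S.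
by have /simpler_len /olt_0 := is_limit0 S.
Qed.

(** Locates the end of x inside one block. For blocks of constant sign this describes the options of
    [csum z]. *)
Lemma csum_below z x : x ⊏ csum z ->
  exists y s, [/\ y ∔ sig s ⊑ z, csum y ⊑ x & x ⊏ csum y ∔ g y s].
Proof.
elim/(well_founded_ind simpler_wf): z => z IH Sx.
have [y [s [S N]]] : exists y s, y ∔ sig s ⊑ z /\ ~ csum y ∔ g y s ⊑ x.
  apply: NNPP => K; have : csum z ⊑ x.
    by apply: csum_sup => y s S; apply: NNPP => N; apply: K; exists y, s.
  by move=> S; case: Sx => S1; apply; exact: simpler_antisym.
have Sxy : x ⊏ csum y ∔ g y s.
  case: (simpler_chain (simplerW Sx) (csum_sig S)) => [/simpler_eqVlt [E|//]|//].
  by case: N; rewrite E; exact: simpler_refl.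
case: (simpler_chain (simplerW Sxy) (concat_simpler (csum y) (g y s))) => [/simpler_eqVlt [E|H]|H]; last by exists y, s.
  by exists y, s; split=> //; rewrite E; exact: simpler_refl.
have Sy : y ⊏ z by apply: simpler_lt_le S; exact: concat_sig_strict.
have [y' [s' [S1 S2 S3]]] := IH y Sy H; exists y', s'; split=> //.
exact: simpler_eq_trans S1 (simplerW Sy).
Qed.

Variables (p m : No -> Ord).
Hypothesis gp : forall z, g z plus = of_ord (p z).
Hypothesis gm : forall z, g z minus = neg (of_ord (m z)).

Lemma csum_plus y z : lopt y z -> csum y ∔ of_ord (p y) ⊑ csum z.
Proof. by move=> /lopt_sig /csum_sig; rewrite gp. Qed.

Lemma csum_minus y z : ropt y z -> csum y ∔ neg (of_ord (m y)) ⊑ csum z.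
Proof. by move=> /ropt_sig /csum_sig; rewrite gm. Qed.

Lemma csum_lopt x z : lopt x (csum z) ->
  exists y t, [/\ lopt y z, olt t (p y) & x = csum y ∔ of_ord t].
Proof.
move=> Hx; have [y [s [S1 S2 S3]]] := csum_below (proj1 Hx).
case: (simpler_ex S2) => w E; rewrite E in S3 Hx *; move/simpler_strict_concat: S3 => S3.
have Hs : csum y ∔ w ∔ sig plus ⊑ csum y ∔ g y s.
  have := simpler_next (proj2 (simpler_strict_concat (csum y) _ _) S3) => -[t St].
  have K := csum_sig S1; have [_ E1] := restrict_sig (simpler_eq_trans St K).
  by move/lopt_sig/restrict_sig: Hx => [_]; rewrite E1 => -[<-].
rewrite -concatA in Hs; move/simpler_concat: Hs => Hs.
case: s S1 S3 Hs => S1 S3 Hs.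
  have := simpler_neg Hs; rewrite gm negK neg_concat => /(@ropt_sig (neg w)) /ropt_ord [].
rewrite gp in S3; exists y, (len w); split; first exact/lopt_sig.
  exact: (simpler_len S3).
by rewrite -(simpler_of_ord (simplerW S3)).
Qed.

Lemma csum_ropt x z : ropt x (csum z) ->
  exists y t, [/\ ropt y z, olt t (m y) & x = csum y ∔ neg (of_ord t)].
Proof.
move=> Hx; have [y [s [S1 S2 S3]]] := csum_below (proj1 Hx).
case: (simpler_ex S2) => w E; rewrite E in S3 Hx *; move/simpler_strict_concat: S3 => S3.
have Hs : csum y ∔ w ∔ sig minus ⊑ csum y ∔ g y s.
  have := simpler_next (proj2 (simpler_strict_concat (csum y) _ _) S3) => -[t St].
  have K := csum_sig S1; have [_ E1] := restrict_sig (simpler_eq_trans St K).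
  by move/ropt_sig/restrict_sig: Hx => [_]; rewrite E1 => -[<-].
rewrite -concatA in Hs; move/simpler_concat: Hs => Hs.
case: s S1 S3 Hs => S1 S3 Hs; last first.
  by rewrite gp in Hs; case: (@ropt_ord w (p y)); apply/ropt_sig.
rewrite gm in S3; exists y, (len w); split; first exact/ropt_sig.
  exact: (simpler_len S3).
have := simpler_neg (simplerW S3); rewrite negK => /simpler_of_ord => Ew.
by rewrite -(negK w) Ew.
Qed.

End Csum.

Lemma lopt_ext x y z : lopt x y -> y ⊑ z -> lopt x z.
Proof. by move=> /lopt_sig H S; apply/lopt_sig; exact: simpler_eq_trans S. Qed.

Lemma ropt_ext x y z : ropt x y -> y ⊑ z -> ropt x z.
Proof. by move=> /ropt_sig H S; apply/ropt_sig; exact: simpler_eq_trans S. Qed.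

Lemma dot_mulE x y : x ⨰ y = csum (fun _ s => match s with plus => x | minus => neg x end) y.
Proof. by []. Qed.

Lemma dot_mul_ord a b : of_ord a ⨰ of_ord b = of_ord (omul a b).
Proof.
rewrite dot_mulE; set g := fun _ : No => _.
have gp z : g z plus = of_ord a by [].
elim/(well_founded_ind olt_wf): b => b IH.
have S : csum g (of_ord b) ⊑ of_ord (omul a b).
  apply: csum_sup => y s H; have Ey := simpler_of_ord (simpler_eq_trans (concat_simpler y (sig s)) H).
  have L : olt (len y) b.
    by apply: olt_le_trans (simpler_len_le H); rewrite len_concat_sig; exact: osucc_gt.
  case: s H => H; first by move/ropt_sig/ropt_ord: H.
  by rewrite Ey IH // -of_ord_add; apply/of_ord_simpler; exact: omul_succ_le.
rewrite (simpler_of_ord S); congr of_ord; apply: ole_antisym; first exact: (simpler_len_le S).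
apply: ole_all => c /omulP [d [Hd K]]; apply: olt_le_trans K _.
have := @csum_sig g _ _ _ (proj1 (lopt_sig _ _) (lopt_of_ord Hd)); rewrite IH // gp -of_ord_add.
exact: simpler_len_le.
Qed.

(** * Log-atomic numbers *)

Lemma lopt_concat x y u : lopt x (y ∔ u) -> lopt x y \/ exists u', lopt u' u /\ x = y ∔ u'.
Proof.
move/lopt_sig => H; case: (simpler_chain H (concat_simpler y u)) => [S|/simpler_eqVlt [E|S]].
- by left; apply/lopt_sig.
- by left; apply/lopt_sig; rewrite E; exact: simpler_refl.
move/strict_sig: S => /simpler_ex [u' E]; right; exists u'; split=> //; apply/lopt_sig.
by move: H; rewrite E -concatA => /simpler_concat.
Qed.

Lemma ropt_concat x y u : ropt x (y ∔ u) -> ropt x y \/ exists u', ropt u' u /\ x = y ∔ u'.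
Proof.
move/ropt_sig => H; case: (simpler_chain H (concat_simpler y u)) => [S|/simpler_eqVlt [E|S]].
- by left; apply/ropt_sig.
- by left; apply/ropt_sig; rewrite E; exact: simpler_refl.
move/strict_sig: S => /simpler_ex [u' E]; right; exists u'; split=> //; apply/ropt_sig.
by move: H; rewrite E -concatA => /simpler_concat.
Qed.

Lemma lopt_neg_iff x y : lopt (neg x) (neg y) <-> ropt x y.
Proof.
split=> [/lopt_sig /simpler_neg|/ropt_sig /simpler_neg]; rewrite neg_concat ?negK => H.
  by apply/ropt_sig.
by apply/lopt_sig.
Qed.

Lemma lopt_concat_neg_ord x y b : lopt x (y ∔ neg (of_ord b)) -> lopt x y.
Proof.
case/lopt_concat => // -[u [H _]]; exfalso.
by rewrite -(negK u) in H; move/lopt_neg_iff/ropt_ord: H.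
Qed.

Lemma ropt_concat_ord x y b : ropt x (y ∔ of_ord b) -> ropt x y.
Proof. by case/ropt_concat => // -[u [/ropt_ord]]. Qed.

Lemma lopt_concat_ordP x y b : lopt x (y ∔ of_ord b) -> lopt x y \/ exists c, olt c b /\ x = y ∔ of_ord c.
Proof.
case/lopt_concat => [|[u [/lopt_ordP [L ->] ->]]]; first by left.
by right; exists (len u).
Qed.

Lemma ropt_concat_negP x y b : ropt x (y ∔ neg (of_ord b)) ->
  ropt x y \/ exists c, olt c b /\ x = y ∔ neg (of_ord c).
Proof.
case/ropt_concat => [|[u [/lopt_neg_iff H ->]]]; first by left.
rewrite negK in H; case: (lopt_ordP H) => L E; right; exists (len (neg u)); split=> //.
by rewrite -E negK.
Qed.

Lemma concat_ord_le z a b : ole a b -> z ∔ of_ord a <= z ∔ of_ord b.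
Proof. by case/ole_eqVlt => [->//|/(lopt_concat_ord z) /lopt_lt /ltW]. Qed.

Lemma concat_neg_le z a b : ole a b -> z ∔ neg (of_ord b) <= z ∔ neg (of_ord a).
Proof. by case/ole_eqVlt => [->//|/(ropt_concat_neg z) /ropt_lt /ltW]. Qed.

Lemma omega_ropt_opt x y : ropt x y -> ropt (W x) (W y).
Proof.
move=> H; have S := ropt_lt H; rewrite -omega_mono in S; split; last exact/ltE.
split; first exact/omega_simpler/simplerW/(proj1 H).
by move=> E; rewrite E ltxx in S.
Qed.

Lemma arch_refl x : 0 <= x -> arch x x.
Proof. by exists 1%N; rewrite mul1r. Qed.

Lemma lt_gmap c x : 0 < x -> arch x (W c) -> c < gmap x.
Proof. by move=> x0 H; apply: (cut_ltl (gmap_cut x0)); left. Qed.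

Lemma lt_gmap_half u k x : W u / 2 ^+ k <= x -> u < gmap x.
Proof.
move=> H; have x0 : 0 < x by apply: lt_le_trans H; rewrite divr_gt0 ?omega_gt0 // exprn_gt0.
have [c A] := arch_class x0; apply: le_lt_trans (lt_gmap x0 A).
rewrite leNgt; apply/negP => L; have := natmul_bound (2 ^ k) A L.
by rewrite natrX mulrC -ltr_pdivlMr ?exprn_gt0 // ltNge H.
Qed.

(* [wmap a] will turn out to be rho at [omega ⨰ a]. *)
Definition wmap := csum (fun z s =>
  match s with plus => of_ord (oT (osucc (tauo z))) | minus => neg omega end).

(** After oT b signs 1, a block of oT (b + 1) of them makes oT (b + 1) in all, since an epsilon
    number absorbs smaller ordinals on its left; negative blocks do not count. The initial part x0
    lets the same count serve [wmap] (x0 = 0) and [Phi] (x0 = V a). *)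
Lemma tauo_csum g m t0 x0 z :
  (forall z, g z plus = of_ord (oT (osucc (oadd t0 (tauo z))))) ->
  (forall z, g z minus = neg (of_ord (m z))) ->
  tauo x0 = oT t0 -> tauo (x0 ∔ csum g z) = oT (oadd t0 (tauo z)).
Proof.
move=> gp gm E0; elim/(well_founded_ind simpler_wf): z => z IH.
apply: ord_ext => c; rewrite tauo_concat E0; split.
  case/oaddP => [H|[d [/tauoP [x [/(csum_lopt gp gm) [y [t [Hy Ht ->]]] <-]] H]]].
    by apply: olt_le_trans H _; exact/oT_le/oadd_le_l.
  apply: ole_lt_trans H _; rewrite tauo_concat tauo_ord oaddA -E0 -tauo_concat IH ?(proj1 Hy) //; last exact: (proj1 Hy).
  have L : olt (oadd t0 (tauo y)) (oadd t0 (tauo z)) by exact/oadd_lt/tauo_opt_lt.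
  apply: olt_le_trans (oT_le (proj2 (osucc_le _ _) L)).
  have F := oT_fixed (ole_lt_trans (ole_0 _) (osucc_gt (oadd t0 (tauo y)))).
  by rewrite -F; apply: oW_add_lt; rewrite F //; exact/oT_lt/osucc_gt.
move/oTP => [b [/oaddP [H|[d [/tauoP [y [Hy <-]] H]]] Hc]].
  by apply: olt_le_trans (oadd_le_l _ _); apply: olt_le_trans Hc _; rewrite -oT_succ; exact/oT_le/osucc_le.
apply: olt_le_trans (proj2 (oadd_le_iff _ _ _) (tauo_le (csum_plus gp Hy))).
rewrite tauo_concat tauo_ord oaddA -E0 -tauo_concat IH ?(proj1 Hy) //; last exact: (proj1 Hy).
apply: olt_le_trans Hc _; rewrite -oT_succ; apply: ole_trans (oadd_le_r _ _); apply: oT_le.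
exact/osucc_le/olt_osucc.
Qed.

Lemma tauo_wmap z : tauo (wmap z) = oT (tauo z).
Proof.
rewrite -(concat_0l (wmap z)) -(oadd_0l (tauo z)).
apply: (@tauo_csum _ (fun _ => oomega)) => //; last by rewrite tauo0 oT0.
by move=> y; rewrite oadd_0l.
Qed.

Lemma wmap_lopt x z : lopt x (wmap z) ->
  exists y t, [/\ lopt y z, olt t (oT (osucc (tauo y))) & x = wmap y ∔ of_ord t].
Proof. exact: (@csum_lopt _ (fun z => oT (osucc (tauo z))) (fun _ => oomega)). Qed.

Lemma wmap_ropt x z : ropt x (wmap z) ->
  exists y n, ropt y z /\ x = wmap y ∔ neg (of_ord (onat n)).
Proof.
move=> /(@csum_ropt _ (fun z => oT (osucc (tauo z))) (fun _ => oomega)) [//|//|y [t [H /olt_omega [n ->] E]]].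
by exists y, n.
Qed.

Lemma wmap_plus y z t : lopt y z -> olt t (oT (osucc (tauo y))) -> lopt (wmap y ∔ of_ord t) (wmap z).
Proof.
move=> H L; apply: lopt_ext (lopt_concat_ord _ L) _.
exact: (@csum_plus _ (fun z => oT (osucc (tauo z)))).
Qed.

Lemma wmap_minus y z n : ropt y z -> ropt (wmap y ∔ neg (of_ord (onat n))) (wmap z).
Proof.
move=> H; have L : olt (onat n) oomega by apply/olt_omega; exists n.
by apply: ropt_ext (ropt_concat_neg _ L) _; exact: (@csum_minus _ (fun _ => oomega)).
Qed.

(** Below the next epsilon number, b is dominated by w^(t + d) with d smaller than 1 + b. In
    [gmap_wmap_ord] this keeps the archimedean class of the argument strictly below the claimed
    value. *)
Lemma Enext_split t b : olt b (Enext t) -> b = onat 0 \/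
  exists d, [/\ olt (onat 0) d, olt d (oadd (onat 1) b) & ole b (oW (oadd t d))].
Proof.
move=> /EnextP [n Hn]; case: (classic (b = onat 0)) => [->|/opos b0]; first by left.
have {Hn} : ole b (eN t n.+1) by apply: ole_trans (oltW Hn) (oW_ge _).
right; elim: n H => [|n IH] H.
  exists (onat 1); split; first by rewrite onatS; exact: osucc_gt.
    by rewrite -{1}(oadd0 (onat 1)); exact: oadd_lt.
  by rewrite -osucc_oadd1.
case: (ole_or_olt b (eN t n.+1)) => [/IH //|L].
have E := @oadd_osub t (eN t n.+1) (oltW (eN_gt t n.+1)); exists (osub (eN t n.+1) t); split.
- apply: opos => E0; have := eN_gt t n.+1; by rewrite -E E0 oadd0 => /olt_irrefl.
- apply: ole_lt_trans (olt_le_trans L (oadd_le_r _ _)).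
  by rewrite -{2}E; exact: oadd_le_r.
- by rewrite E.
Qed.

(** * Gonshor's function around [wmap a] *)

Notation G u := (gmap (W u)).
Notation Wn u n := (u ∔ neg (of_ord (onat n))).

Definition gmap_wmap a := (forall n, G (Wn (wmap a) n.+1) = Wn (wmap a) n) /\
  (forall b, olt b (oT (osucc (tauo a))) ->
     gmap (W (wmap a) ∔ of_ord b) = wmap a ∔ of_ord (oadd (onat 1) b)).

Lemma oadd1_oW s : olt (onat 0) s -> oadd (onat 1) (oW s) = oW s.
Proof. by move=> H; rewrite -oW0 oW_absorb //; exact: oW_lt. Qed.

Lemma gmap_wmap_plus a t : gmap_wmap a -> olt (onat 0) t -> olt t (oT (osucc (tauo a))) ->
  olt (oW (oadd (oT (tauo a)) t)) (oT (osucc (tauo a))) /\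
  G (wmap a ∔ of_ord t) = wmap a ∔ of_ord (oW (oadd (oT (tauo a)) t)).
Proof.
move=> [_ H] t0 Ht; have F := oT_fixed (ole_lt_trans (ole_0 _) (osucc_gt (tauo a))).
have L : olt (oadd (oT (tauo a)) t) (oT (osucc (tauo a))).
  by rewrite -F; apply: oW_add_lt; rewrite F //; exact/oT_lt/osucc_gt.
have L2 : olt (oW (oadd (oT (tauo a)) t)) (oT (osucc (tauo a))) by rewrite -F; exact: oW_lt.
split=> //; rewrite omega_concat_ord // tauo_wmap H // oadd1_oW //.
exact: olt_le_trans t0 (oadd_le_r _ _).
Qed.

(** A left option v of [wmap a] ends inside a block whose length is an epsilon number. The function
    g carries the class of v no further than another point of the same block, which is again a left
    option. *)
Lemma gmap_wmap_low a x v (q : nat) : (forall b, b ⊏ a -> gmap_wmap b) -> lopt v (wmap a) ->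
  0 < x -> x <= q%:R * W v -> exists u, lopt u (wmap a) /\ gmap x < u.
Proof.
move=> IH /wmap_lopt [y [t [Hy Ht ->]]] x0 Hx.
have F := oT_fixed (ole_lt_trans (ole_0 _) (osucc_gt (tauo y))).
(* Passing from t to t + 1 absorbs the factor q and makes the length positive, as [gmap_wmap_plus]
   requires. *)
have Ht1 : olt (osucc t) (oT (osucc (tauo y))).
  rewrite osucc_oadd1 -F; apply: oW_add_lt; rewrite F //.
  rewrite -F -oW0; apply: oW_lt; exact: ole_lt_trans (ole_0 _) Ht.
have [L E] := gmap_wmap_plus (IH y (proj1 Hy)) (ole_lt_trans (ole_0 _) (osucc_gt t)) Ht1.
exists (wmap y ∔ of_ord (oW (oadd (oT (tauo y)) (osucc t)))); split; first exact: wmap_plus.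
rewrite -E; apply: gmap_lt => //; apply: le_lt_trans Hx _; apply: omega_lt.
exact/lopt_lt/lopt_concat_ord/osucc_gt.
Qed.

Lemma gmap_lower a b x v (q : nat) : (forall c, c ⊏ a -> gmap_wmap c) -> wmap a ⊑ b ->
  lopt v (wmap a) -> 0 < x -> x <= q%:R * W v -> gmap x < b.
Proof.
move=> IH S Hv x0 Hx; have [u [Hu L]] := gmap_wmap_low IH Hv x0 Hx.
by apply: lt_trans L _; exact/lopt_lt/(lopt_ext Hu).
Qed.

(** In the cut of g at W v the class of W v makes v a left option, and for k < n the right option
    [Wn (wmap a) k.+1] of v is sent by induction to [Wn (wmap a) k]. The simplest number that
    remains is [Wn (wmap a) n]. *)
Lemma gmap_wmap_minus a n : (forall c, c ⊏ a -> gmap_wmap c) -> G (Wn (wmap a) n.+1) = Wn (wmap a) n.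
Proof.
move=> IH; elim/ltn_ind: n => n IHn; set v := Wn _ n.+1; set t := Wn _ n.
have C := gmap_cut (omega_gt0 v).
have wv : wmap a ⊑ v by exact: concat_simpler.
have wt : wmap a ⊑ t by exact: concat_simpler.
have tv : ropt t v by apply: ropt_concat_neg; rewrite onatS; exact: osucc_gt.
have vG : v < G v by apply: lt_gmap; [exact: omega_gt0|exact/arch_refl/ltW/omega_gt0].
apply: simpler_antisym.
  apply: (cut_simpler C) => [l [A|[x [Hx [x0 ->]]]]|r [x [Hx ->]]].
  - by rewrite -(arch_omega A); exact: ropt_lt tv.
  - have [l0 [[E|[q [v' [/lopt_concat_neg_ord Hv E]]]] /leE K]] := is_cut_lopt (omega_map_cut v) Hx.
      by move: x0; rewrite ltNge -E K.
    by rewrite E in K; exact: (gmap_lower IH wt Hv x0 K).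
  - have [l0 [[k [v' [Hv ->]]] /leE K]] := is_cut_ropt (omega_map_cut v) Hx.
    apply: le_lt_trans (lt_gmap_half K).
    case: (ropt_concat_negP Hv) => [H|[c [Hc ->]]]; last by apply: concat_neg_le; apply/olt_osucc; rewrite -onatS.
    by apply/ltW/ropt_lt/(ropt_ext H).
have [_] := is_cut_opts t; apply; split=> [l /lopt_concat_neg_ord Hl|r Hr]; apply/ltE.
  by apply: lt_trans vG; exact/lopt_lt/(lopt_ext Hl).
suff [v' [Hv ->]] : exists v', ropt v' v /\ r = G v'.
  by apply: (cut_ltr C); exists (W v'); split=> //; exact: omega_ropt_opt.
case: (ropt_concat_negP Hr) => [/wmap_ropt [y [k [Hy ->]]]|[c [Hc ->]]].
  exists (Wn (wmap y) k.+1); split; first by apply: ropt_ext wv; exact: wmap_minus.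
  by case: (IH y (proj1 Hy)) => H _; rewrite H.
have [k E] : exists k, c = onat k.
  by apply/olt_omega; apply: olt_trans Hc _; apply/olt_omega; exists n.
rewrite E in Hc *; have kn : (k < n)%N.
  rewrite ltnNge; apply/negP => /subnK K; case: (@olt_irrefl (onat n)); apply: ole_lt_trans Hc.
  by rewrite -K; elim: (k - n)%N => [|m IHm]; [exact: ole_refl|rewrite addSn onatS; apply: ole_trans IHm (oltW (osucc_gt _))].
exists (Wn (wmap a) k.+1); split; last by rewrite IHn.
by apply: ropt_concat_neg; rewrite !onatS; exact/osucc_lt.
Qed.

(** The left options with c < b in place of b contribute [wmap a] followed by 1 + c signs, and the
    class of the argument contributes a number at least [wmap a], which accounts for the initial 1.
    That this class is not too large is where b below the next epsilon number is used. *)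
Lemma gmap_wmap_ord a b : (forall c, c ⊏ a -> gmap_wmap c) -> olt b (oT (osucc (tauo a))) ->
  gmap (W (wmap a) ∔ of_ord b) = wmap a ∔ of_ord (oadd (onat 1) b).
Proof.
move=> IH; elim/(well_founded_ind olt_wf): b => b IHb Hb.
set X := _ ∔ of_ord b; set t := _ ∔ _.
have WX : W (wmap a) ⊑ X by exact: concat_simpler.
have wt : wmap a ⊑ t by exact: concat_simpler.
have WX1 : W (wmap a) <= X.
  by rewrite -{1}(concat0 (W (wmap a))); apply: concat_ord_le; exact: ole_0.
have X0 : 0 < X by apply: lt_le_trans WX1; exact: omega_gt0.
have C := gmap_cut X0.
have IHb' c : olt c b -> gmap (W (wmap a) ∔ of_ord c) = wmap a ∔ of_ord (oadd (onat 1) c).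
  by move=> H; apply: IHb => //; exact: olt_trans Hb.
have [d [Hd dX]] : exists d, olt d (oadd (onat 1) b) /\ X <= W (wmap a ∔ of_ord d).
  have Hb' : olt b (Enext (tauo (wmap a))) by rewrite tauo_wmap -oT_succ.
  case: (Enext_split Hb') => [E|[d [d0 Hd K]]].
    exists (onat 0); rewrite /X E !concat0; split=> //.
    by rewrite oadd0 onatS; exact: osucc_gt.
  by exists d; split=> //; rewrite omega_concat_ord //; exact: concat_ord_le.
apply: simpler_antisym.
  apply: (cut_simpler C) => [l [A|[x [Hx [x0 ->]]]]|r [x [Hx ->]]].
  - rewrite ltNge; apply/negP => L.
    have dt : wmap a ∔ of_ord d < t by exact/lopt_lt/lopt_concat_ord.
    have [q [_ H]] := A; have := omega_lt q dt; rewrite ltNge => /negP; apply.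
    rewrite -(omega_le t) in L; apply: le_trans L _; apply: le_trans H _.
    by apply: ler_wpM2l; first exact: ler0n.
  - case: (lopt_concat_ordP Hx) => [{}Hx|[c [Hc E]]]; last first.
      by rewrite E IHb' //; exact/lopt_lt/lopt_concat_ord/oadd_lt.
    have [l0 [[E|[q [v' [Hv E]]]] /leE K]] := is_cut_lopt (omega_map_cut (wmap a)) Hx.
      by move: x0; rewrite ltNge -E K.
    by rewrite E in K; exact: (gmap_lower IH wt Hv x0 K).
  - have [l0 [[k [v' [Hv ->]]] /leE K]] := is_cut_ropt (omega_map_cut (wmap a)) (ropt_concat_ord Hx).
    apply: le_lt_trans (lt_gmap_half K).
    by apply/ltW/ropt_lt/(ropt_ext Hv).
have wG1 : wmap a < gmap X.
  have [c A] := arch_class X0; apply: le_lt_trans (lt_gmap X0 A).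
  have [q [H _]] := A; apply: (@omega_le_mult q); exact: le_trans H.
have [_] := is_cut_opts t; apply; split=> [l Hl|r /ropt_concat_ord Hr]; apply/ltE.
  case: (lopt_concat_ordP Hl) => [{}Hl|[c [Hc ->]]].
    by apply: lt_trans wG1; exact: lopt_lt.
  case: (classic (c = onat 0)) => [->|/opos /ord_1_add [c' E]]; first by rewrite concat0.
  rewrite E in Hc *; have {}Hc := proj1 (oadd_lt_iff _ _ _) Hc.
  rewrite -IHb' //; apply: gmap_lt; last exact/lopt_lt/lopt_concat_ord.
  apply: lt_le_trans (omega_gt0 (wmap a)) _.
  by rewrite -{1}(concat0 (W (wmap a))); apply: concat_ord_le; exact: ole_0.
move/wmap_ropt: Hr => [y [k [Hy ->]]].
have [H _] := IH y (proj1 Hy); rewrite -H.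
apply: (cut_ltr C); exists (W (Wn (wmap y) k.+1)); split=> //; apply: ropt_ext WX.
exact/omega_ropt_opt/wmap_minus.
Qed.

Lemma gmap_wmapT a : gmap_wmap a.
Proof.
elim/(well_founded_ind simpler_wf): a => a IH; split=> [n|b]; [exact: gmap_wmap_minus|exact: gmap_wmap_ord].
Qed.

Lemma log_exp (u : No) : log (E u) = u.
Proof.
apply: exp_inj; have H : exists y, E y = E u by exists u.
exact: (epsilon_spec (inhabits 0%S) (fun y => E y = E u) H).
Qed.

Lemma real_lt_omega r x : is_real r -> 0 < x -> (r < W x)%S.
Proof.
move=> /real_bounded [n H] x0; apply/ltE; apply: lt_trans H _.
by have := omega_lt n x0; rewrite omega0 mulr1.
Qed.

Lemma log_atomic_exp x : 0 < x -> log_atomic (E (W x)) <-> log_atomic (W x).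
Proof.
move=> x0; split=> [[_ H]|[_ H]]; split.
- by move=> r Hr; exact: real_lt_omega.
- by move=> n; have := H n.+1; rewrite PeanoNat.Nat.iter_succ_r log_exp.
- by move=> r Hr; rewrite exp_omega //; apply: real_lt_omega => //; exact: omega_gt0.
case=> [|n]; first by rewrite /= exp_omega //; eexists.
by rewrite PeanoNat.Nat.iter_succ_r log_exp.
Qed.

(* The range of rho. *)
Definition rho_class y := log_atomic (W (W y)).

Lemma rho_class_G y : rho_class (G y) <-> rho_class y.
Proof. by rewrite /rho_class -exp_omega ?omega_gt0 //; apply: log_atomic_exp; exact: omega_gt0. Qed.

(** The n-th iterated logarithm of W (W (y 0)) is W (W (y n)), a monomial. *)
Lemma rho_class_chain (y : nat -> No) : (forall n, G (y n.+1) = y n) -> rho_class (y O).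
Proof.
move=> H; split=> [r Hr|n]; first by apply: real_lt_omega => //; exact: omega_gt0.
suff -> : Nat.iter n log (W (W (y O))) = W (W (y n)) by eexists.
elim: n => [//|n IH]; rewrite [LHS]/= IH -H -exp_omega ?omega_gt0 //; exact: log_exp.
Qed.

Lemma omega_strict x y : W x ⊏ W y <-> x ⊏ y.
Proof.
split=> -[S N]; split; try exact/omega_simpler.
- by move=> E; apply: N; rewrite E.
- by move=> E; apply: N; exact: omega_inj.
Qed.

(* The (n+1)-st iterate of [y => gmap (W y)] at [wmap a] is [wmap a ∔ of_ord (th t n)]
   for t = tauo (wmap a). *)
Fixpoint th t n := match n with O => onat 1 | S m => oW (oadd t (th t m)) end.

Lemma th_gt0 t n : olt (onat 0) (th t n).
Proof. by case: n => [|n] /=; [rewrite onatS; exact: osucc_gt|exact: oW_gt0]. Qed.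

(** Identifies the iterates of [th] with the sequence converging to the epsilon number after t; they
    are therefore cofinal in the block of [wmap]. *)
Lemma th_eN t n : oadd t (th t n) = eN t n.
Proof.
elim: n => [|n IH] /=; first by rewrite osucc_oadd1.
rewrite IH oW_absorb //; apply: ole_lt_trans (oW_ge t) _; exact/oW_lt/eN_gt.
Qed.

Lemma th_lt a n : olt (th (oT (tauo a)) n) (oT (osucc (tauo a))).
Proof.
elim: n => [|n IH] /=; last by case: (gmap_wmap_plus (gmap_wmapT a) (th_gt0 _ n) IH).
have F := oT_fixed (ole_lt_trans (ole_0 _) (osucc_gt (tauo a))).
rewrite -oW0 -F; apply: oW_lt; exact: ole_lt_trans (ole_0 _) (oT_lt (osucc_gt _)).
Qed.

Definition Gn a n := match n with O => wmap a | S m => wmap a ∔ of_ord (th (oT (tauo a)) m) end.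

Lemma Gn_G a n : G (Gn a n) = Gn a n.+1.
Proof.
case: n => [|n] /=; last by case: (gmap_wmap_plus (gmap_wmapT a) (th_gt0 _ n) (th_lt a n)).
have [_ H] := gmap_wmapT a; have := H (onat 0); rewrite concat0 oadd0; apply.
exact: ole_lt_trans (ole_0 _) (oT_lt (osucc_gt _)).
Qed.

Lemma rho_class_minus a n : rho_class (Wn (wmap a) n).
Proof. apply: (@rho_class_chain (fun k => Wn (wmap a) (k + n)%N)) => k; exact: (proj1 (gmap_wmapT a)). Qed.

Lemma rho_class_Gn a n : rho_class (Gn a n).
Proof.
elim: n => [|n IH]; last by rewrite -Gn_G; apply/rho_class_G.
by have := rho_class_minus a 0; rewrite neg0 concat0.
Qed.

Lemma Gn_lt a n : Gn a n < Gn a n.+1.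
Proof.
elim: n => [|n IH]; last first.
  by have := @gmap_lt (W (Gn a n)) (W (Gn a n.+1)); rewrite !Gn_G omega_mono; apply => //; exact: omega_gt0.
by rewrite /= -{1}(concat0 (wmap a)); apply/lopt_lt/lopt_concat_ord; rewrite onatS; exact: osucc_gt.
Qed.

Lemma Gn_cofinal a t : olt t (oT (osucc (tauo a))) -> exists n, wmap a ∔ of_ord t < Gn a n.
Proof.
rewrite oT_succ => /EnextP [n H]; exists n.+2 => /=.
apply/lopt_lt/lopt_concat_ord; apply: olt_le_trans H _; rewrite th_eN; exact: oW_ge.
Qed.

Lemma Gn_lopt a z n : lopt a z -> lopt (Gn a n) (wmap z).
Proof.
move=> H; case: n => [|n]; last exact: wmap_plus (th_lt a n).
rewrite /= -(concat0 (wmap a)); apply: wmap_plus => //.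
exact: ole_lt_trans (ole_0 _) (oT_lt (osucc_gt _)).
Qed.

(** * Gaps in the range of rho *)

Section Rho.
Variable rho : No -> No.
Hypothesis hrho : parametrises (fun z => W (W (rho z))) log_atomic.

Lemma rho_par : parametrises rho rho_class.
Proof.
have [H1 [H2 H3]] := hrho; split; last split.
- move=> y; split=> [/H1 [x Hx]|[x ->]]; last by apply/H1; exists x.
  by exists x; apply/omega_inj/omega_inj.
- move=> x y; rewrite -(H2 x y); split=> /ltE H; apply/ltE; move: H; by rewrite !omega_mono.
- by move=> x y; rewrite -(H3 x y) !omega_strict.
Qed.

(** A logarithm turns a member of the range between two consecutive iterates into one between the
    preceding two. The descent ends with s < 1, whereas s > 0. *)
Lemma rho_class_gap a n t : rho_class (wmap a ∔ of_ord t) ->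
  olt (th (oT (tauo a)) n) t -> olt t (th (oT (tauo a)) n.+1) -> False.
Proof.
elim: n t => [|n IH] t Kt H1 H2.
(* Common to both cases: with t = 1 + b, the logarithm of the log-atomic number given by t is W X,
   so X = W v for some v in the range. Comparing sign sequences gives v = [wmap a ∔ of_ord s] and b
   = w^(oT (tau a) + s), and then t = b. *)
all: have t1 : olt (onat 1) t by
  [exact: H1|apply: ole_lt_trans H1; rewrite onatS; apply/osucc_le; exact: th_gt0].
all: have [b E] := ord_1_add (olt_trans (th_gt0 (oT (tauo a)) 0) t1).
all: have b0 : olt (onat 0) b by apply/(oadd_lt_iff (onat 1)); rewrite oadd0 -E.
all: have be : olt b (oT (osucc (tauo a))) by
  apply: ole_lt_trans (olt_trans H2 (th_lt a _)); rewrite E; exact: oadd_le_r.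
all: set X := W (wmap a) ∔ of_ord b.
all: have X0 : 0 < X by
  apply: lt_trans (omega_gt0 (wmap a)) _; rewrite -{1}(concat0 (W (wmap a))); exact/lopt_lt/lopt_concat_ord.
all: have : log_atomic (W X) by
  apply/(log_atomic_exp X0); rewrite exp_omega // (proj2 (gmap_wmapT a)) // -E.
all: move/(par_ex hrho) => [z /omega_inj EX].
all: have Kv : rho_class (rho z) by exact: (par_in rho_par).
all: move: (rho z) EX Kv => v EX Kv.
all: have Sv : v ⊑ wmap a ∔ of_ord b by
  apply/omega_simpler; rewrite -EX omega_concat_ord //; apply/simpler_concat/of_ord_simpler;
  apply: ole_trans (oadd_le_r (tauo (wmap a)) b) _; exact: oW_ge.
all: have Sw : wmap a ⊑ v by apply/omega_simpler; rewrite -EX; exact: concat_simpler.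
all: have [s Es] := simpler_concat_ord Sw Sv.
all: have s0 : olt (onat 0) s by
  apply: opos => s0; move: EX; rewrite Es s0 concat0 => /concat_eq_self /(@of_ord_inj b (onat 0)) b00;
  rewrite b00 in b0; exact: olt_irrefl b0.
all: have Eb : b = oW (oadd (oT (tauo a)) s) by
  apply: of_ord_inj; apply: (@concat_inj (W (wmap a))); rewrite -/X EX Es omega_concat_ord // tauo_wmap.
all: have Et : t = oW (oadd (oT (tauo a)) s) by
  rewrite E Eb oadd1_oW //; exact: olt_le_trans s0 (oadd_le_r _ _).
all: have Hs : forall k, olt t (th (oT (tauo a)) k.+1) -> olt s (th (oT (tauo a)) k) by
  move=> k /=; rewrite Et => K; apply/not_ole => L; apply: (@olt_irrefl (oW (oadd (oT (tauo a)) s)));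
  apply: olt_le_trans K _; exact/oW_le/oadd_le_iff.
  move/Hs: H2 => /=; rewrite onatS => /olt_osucc /ole_0_eq E0.
  by rewrite E0 in s0; exact: olt_irrefl s0.
apply: (IH s); [by rewrite -Es| |exact: Hs].
move: H1 => /=; rewrite Et => K; apply/not_ole => L; apply: (@olt_irrefl (oW (oadd (oT (tauo a)) s))).
by apply: ole_lt_trans K; exact/oW_le/oadd_le_iff.
Qed.

End Rho.

Lemma omega_dot_lopt x z : lopt x (omega ⨰ z) ->
  exists y n, lopt y z /\ x = omega ⨰ y ∔ of_ord (onat n).
Proof.
rewrite dot_mulE => /(@csum_lopt _ (fun _ => oomega) (fun _ => oomega)) [//|//|y [t [H /olt_omega [n ->] E]]].
by exists y, n.
Qed.

Lemma omega_dot_ropt x z : ropt x (omega ⨰ z) ->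
  exists y n, ropt y z /\ x = Wn (omega ⨰ y) n.
Proof.
rewrite dot_mulE => /(@csum_ropt _ (fun _ => oomega) (fun _ => oomega)) [//|//|y [t [H /olt_omega [n ->] E]]].
by exists y, n.
Qed.

Lemma onat_omega n : olt (onat n) oomega.
Proof. by apply/olt_omega; exists n. Qed.

Lemma omega_dot_plus y z n : lopt y z -> lopt (omega ⨰ y ∔ of_ord (onat n)) (omega ⨰ z).
Proof.
move=> H; apply: lopt_ext (lopt_concat_ord _ (onat_omega n)) _; rewrite !dot_mulE.
exact: (@csum_plus _ (fun _ => oomega)).
Qed.

Lemma omega_dot_minus y z n : ropt y z -> ropt (Wn (omega ⨰ y) n) (omega ⨰ z).
Proof.
move=> H; apply: ropt_ext (ropt_concat_neg _ (onat_omega n)) _; rewrite !dot_mulE.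
exact: (@csum_minus _ (fun _ => oomega)).
Qed.

Lemma onat_lt c n : olt c (onat n) -> exists k, (k < n)%N /\ c = onat k.
Proof.
elim: n c => [|n IH] c; first by move/olt_0.
rewrite onatS => /olt_osucc /ole_eqVlt [->|/IH [k [H ->]]]; first by exists n.
by exists k; split=> //; exact: leqW.
Qed.

Lemma onat_mono k n : (k < n)%N -> olt (onat k) (onat n).
Proof.
elim: n => // n IH; rewrite ltnS leq_eqVlt onatS => /orP [/eqP ->|/IH H]; first exact: osucc_gt.
exact: olt_trans H (osucc_gt _).
Qed.

(** * The values of rho around omega ⨰ a *)

Section RhoDot.
Variable rho : No -> No.
Hypothesis hrho : parametrises (fun z => W (W (rho z))) log_atomic.

Let rho_lt (x y : No) : (rho x < rho y) = (x < y) := par_lt (rho_par hrho) x y.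

(** The options of omega ⨰ z are the numbers omega ⨰ y ± n for options y of z, so the induction has
    to carry all these values along. *)
Definition rho_dotP a := (forall n, rho (Wn (omega ⨰ a) n) = Wn (wmap a) n) /\
  (forall n, rho (omega ⨰ a ∔ of_ord (onat n)) = Gn a n).

Lemma wmap_lopt_lt a x l : (forall b, b ⊏ a -> rho_dotP b) -> omega ⨰ a ⊑ x ->
  lopt l (wmap a) -> l < rho x.
Proof.
move=> IH S /wmap_lopt [y [t [Hy Ht ->]]]; have [n H] := Gn_cofinal Ht; apply: lt_trans H _.
rewrite -(proj2 (IH y (proj1 Hy))) rho_lt; apply: (lopt_lt (lopt_ext _ S)); exact: omega_dot_plus.
Qed.

Lemma wmap_ropt_lt a x r : (forall b, b ⊏ a -> rho_dotP b) -> omega ⨰ a ⊑ x ->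
  ropt r (wmap a) -> rho x < r.
Proof.
move=> IH S /wmap_ropt [y [n [Hy ->]]].
rewrite -(proj1 (IH y (proj1 Hy))) rho_lt; apply: (ropt_lt (ropt_ext _ S)); exact: omega_dot_minus.
Qed.

Lemma rho_lopt_lt a y x : (forall b, b ⊏ a -> rho_dotP b) -> wmap a ⊑ y ->
  lopt x (omega ⨰ a) -> rho x < y.
Proof.
move=> IH S /omega_dot_lopt [b [n [Hb ->]]]; rewrite (proj2 (IH b (proj1 Hb))).
by apply: (lopt_lt (lopt_ext _ S)); exact: Gn_lopt.
Qed.

Lemma rho_ropt_lt a y x : (forall b, b ⊏ a -> rho_dotP b) -> wmap a ⊑ y ->
  ropt x (omega ⨰ a) -> y < rho x.
Proof.
move=> IH S /omega_dot_ropt [b [n [Hb ->]]]; rewrite (proj1 (IH b (proj1 Hb))).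
by apply: (ropt_lt (ropt_ext _ S)); exact: wmap_minus.
Qed.

Lemma rho_dot_minus a n : (forall b, b ⊏ a -> rho_dotP b) -> rho (Wn (omega ⨰ a) n) = Wn (wmap a) n.
Proof.
move=> IH; elim/ltn_ind: n => n IHn.
have S1 := concat_simpler (omega ⨰ a) (neg (of_ord (onat n))).
have S2 := concat_simpler (wmap a) (neg (of_ord (onat n))).
apply: simpler_antisym.
  apply: (par_cut (rho_par hrho)); first exact: rho_class_minus.
    by move=> x /lopt_concat_neg_ord; exact: rho_lopt_lt.
  move=> x /ropt_concat_negP [|[c [/onat_lt [k [Hk ->]] ->]]]; first exact: rho_ropt_lt.
  by rewrite IHn //; exact/ropt_lt/ropt_concat_neg/onat_mono.
have [_] := is_cut_opts (Wn (wmap a) n); apply; split=> [l /lopt_concat_neg_ord|r /ropt_concat_negP [|[c [Hc E]]]].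
- by move=> H; apply/ltE; exact: wmap_lopt_lt H.
- by move=> H; apply/ltE; exact: wmap_ropt_lt H.
have [k [Hk Ek]] := onat_lt Hc; rewrite E Ek -IHn //; apply/ltE; rewrite rho_lt.
by apply/ropt_lt/ropt_concat_neg; rewrite -Ek.
Qed.

(** The iterate [Gn a n.+1] is in the range and above the previous values, so it prolongs the value
    sought, which in turn properly prolongs [Gn a n]. By [rho_class_gap] nothing of the range lies
    properly in between. *)
Lemma rho_dot_plus a n : (forall b, b ⊏ a -> rho_dotP b) -> rho (omega ⨰ a ∔ of_ord (onat n)) = Gn a n.
Proof.
move=> IH; elim/ltn_ind: n => -[|n] IHn.
  by have := rho_dot_minus 0 IH; rewrite neg0 !concat0.
have S2 := concat_simpler (wmap a) (of_ord (th (oT (tauo a)) n)).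
have S : rho (omega ⨰ a ∔ of_ord (onat n.+1)) ⊑ Gn a n.+1.
  apply: (par_cut (rho_par hrho)); first exact: rho_class_Gn.
    move=> x /lopt_concat_ordP [|[c [/onat_lt [k [Hk ->]] ->]]]; first exact: rho_lopt_lt.
    rewrite IHn //; elim: n k Hk {IHn S2} => [|n IHn] k; first by case: k => // _; exact: Gn_lt.
    rewrite ltnS leq_eqVlt => /orP [/eqP ->|/IHn H]; first exact: Gn_lt.
    exact: lt_trans H (Gn_lt _ _).
  by move=> x /ropt_concat_ord; exact: rho_ropt_lt.
have S1 : rho (omega ⨰ a ∔ of_ord (onat n)) ⊏ rho (omega ⨰ a ∔ of_ord (onat n.+1)).
  have [_ [_ H]] := rho_par hrho; apply/H/simpler_strict_concat/of_ord_lt; rewrite onatS; exact: osucc_gt.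
rewrite IHn // in S1.
have Sw : wmap a ⊑ Gn a n by case: (n) => [|m]; [exact: simpler_refl|exact: concat_simpler].
have [s E] := simpler_concat_ord (simpler_eq_trans Sw (simplerW S1)) S.
have K : rho_class (wmap a ∔ of_ord s) by rewrite -E; exact: (par_in (rho_par hrho)).
rewrite E in S S1 *; congr (_ ∔ of_ord _).
have Ls : ole s (th (oT (tauo a)) n) by move: S => /simpler_concat /of_ord_simpler.
apply: ole_antisym => //; apply/not_olt => L.
case: n L Ls S1 {IHn S2 S Sw E} => [|n] L _ S1.
  move: L S1; rewrite /= onatS => /olt_osucc /ole_0_eq ->; rewrite concat0 => -[_]; exact.
move/simpler_strict_concat/simpler_len: S1 => S1; exact: (rho_class_gap hrho K S1 L).
Qed.

Lemma rho_dot a : rho (omega ⨰ a) = wmap a.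
Proof.
have H : rho_dotP a.
  elim/(well_founded_ind simpler_wf): a => a IH.
  by split=> n; [exact: rho_dot_minus|exact: rho_dot_plus].
by have := proj1 H 0%N; rewrite neg0 !concat0.
Qed.

Lemma sigmaE a : sigma rho a = of_ord (oT (tauo a)).
Proof. by rewrite /sigma rho_dot tauE tauo_wmap. Qed.

End RhoDot.

(** * Fixed points of [Xi_V] *)

Fixpoint opn t n := match n with O => onat 1 | S m => omul (opn t m) t end.

Definition opw t := ossup (fun c => exists n, olt c (opn t n)).

Lemma opwP t c : olt c (opw t) <-> exists n, olt c (opn t n).
Proof.
rewrite ossupP; last first.
  apply: (small_sub (Q := fun c => exists n : nat, True /\ olt c (opn t n))).
    by apply: small_union => [|n _]; [exact: small_nat|exact: small_below].
  by move=> d [n H]; exists n.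
split=> [[d [[n H] L]]|[n H]]; first by exists n; exact: ole_lt_trans H.
by exists c; split; [exists n|exact: ole_refl].
Qed.

Lemma opn_le_opw t n : ole (opn t n) (opw t).
Proof. by apply: ole_all => c H; apply/opwP; exists n. Qed.

Lemma opnSl t n : omul t (opn t n) = opn t n.+1.
Proof. by elim: n => [|n IH]; [rewrite /= omul1 omul_1l|rewrite [in LHS]/= omulA IH]. Qed.

Lemma opw_gt0 t : olt (onat 0) (opw t).
Proof. by apply/opwP; exists O; rewrite /= onatS; exact: osucc_gt. Qed.

Lemma oW1 : oW (onat 1) = oomega.
Proof. by rewrite onatS oW_succ_omul oW0 omul_1l. Qed.

(** If w^t = t, then w^(t + 1) is t times omega and at most t t, so its product with t^n is at most
    t^(n + 2). *)
Lemma opw_fixed t : oW t = t -> omul (oW (osucc t)) (opw t) = opw t.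
Proof.
move=> F; have E : oW (osucc t) = omul t oomega by rewrite oW_succ_omul F.
have t0 : olt (onat 0) t by rewrite -F; exact: oW_gt0.
have wt : ole oomega t by rewrite -oW1 -F; apply: oW_le; rewrite onatS; exact/osucc_le.
apply: ole_antisym; last first.
  rewrite -{1}(omul_1l (opw t)); apply: omul_le_mono; rewrite onatS; apply/osucc_le; exact: oW_gt0.
apply: ole_all => c /omulP [d [/opwP [n Hd] Hc]]; apply/opwP; exists n.+2.
rewrite -omul_succ in Hc; apply: olt_le_trans Hc _.
apply: ole_trans (omul_le _ (proj2 (osucc_le _ _) Hd)) _.
by rewrite -!opnSl omulA; apply: omul_le_mono; rewrite E; exact: omul_le.
Qed.

(** From g >= 1 and w^(t + 1) >= t, each use of the equation raises the known lower bound t^n for g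
    by one factor t. *)
Lemma opw_least t g : oW t = t -> olt (onat 0) g -> omul (oW (osucc t)) g = g -> ole (opw t) g.
Proof.
move=> F g0 Eg; have H n : ole (opn t n) g.
  elim: n => [|n IH]; first by rewrite /= onatS; exact/osucc_le.
  rewrite -opnSl -Eg; apply: ole_trans (omul_le _ IH) _; apply: omul_le_mono.
  by rewrite -{1}F; apply: oW_le; exact/oltW/osucc_gt.
by apply: ole_all => c /opwP [n K]; exact: olt_le_trans K (H n).
Qed.

Transparent dot_pow.

Lemma dot_pow_succ x b : dot_pow x (osucc b) = dot_pow x b ⨰ x.
Proof.
rewrite [LHS]wfrec_eq; case: excluded_middle_informative => [h|[]]; last by exists b.
case: constructive_indefinite_description => c /= /osucc_inj <-.
by rewrite restr_belowE //; exact: osucc_gt.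
Qed.

Lemma dot_pow0 x : dot_pow x (onat 0) = of_ord (onat 1).
Proof.
rewrite [LHS]wfrec_eq; case: excluded_middle_informative => [h|_].
  by case: h => c E; case: (@olt_0 c); rewrite E; exact: osucc_gt.
by case: excluded_middle_informative.
Qed.

Lemma dot_pow_onat t n : dot_pow (of_ord t) (onat n) = of_ord (opn t n).
Proof. by elim: n => [|n IH]; rewrite ?dot_pow0 // onatS dot_pow_succ IH dot_mul_ord. Qed.

Lemma dot_pow_omega t : dot_pow (of_ord t) oomega = of_ord (opw t).
Proof.
rewrite [LHS]wfrec_eq; case: excluded_middle_informative => [h|_].
  case: h => c E; have /olt_omega [n En] : olt c oomega by rewrite E; exact: osucc_gt.
  by have := onat_omega n.+1; rewrite onatS -En -E => /olt_irrefl.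
case: excluded_middle_informative => [E|_].
  by have := onat_omega 0; rewrite E => /olt_irrefl.
apply: sup_simpler_eq => [x [b [/[dup] Hb /olt_omega [n En] ->]]|y H].
  rewrite restr_belowE // En -/(dot_pow _ _) dot_pow_onat; apply/of_ord_simpler; exact: opn_le_opw.
rewrite -(concat_0l (of_ord _)); apply: ord_tail; first exact: simpler_0.
move=> c /opwP [n K]; rewrite concat_0l.
have S : of_ord (opn t n) ⊑ y.
  by apply: H; exists (onat n); split; [exact: onat_omega|rewrite restr_belowE -/(dot_pow _ _) ?dot_pow_onat //; exact: onat_omega].
exact/lopt_lt/lopt_ext/S/lopt_of_ord.
Qed.

(** * The number V a *)

Section Final.
Variables (eps rho : No -> No) (a : No).
Hypothesis heps : parametrises eps (fixed omega_map).
Hypothesis hrho : parametrises (fun z => omega_map (omega_map (rho z))) log_atomic.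
Variable Xi : No -> No.
Hypothesis hXi : parametrises Xi (fixed (Xi_V rho a)).

Notation F := (Xi_V rho a).
Let del := oW (osucc (oT (tauo a))).
Let D := of_ord del ∔ neg (of_ord (omul (omul del oomega) del)).

Lemma Xi_VE z : F z = D ∔ W z.
Proof.
rewrite /Xi_V /delta sigmaE // -[1%S]/(sig plus) -of_ord_succ omega_ord -/del.
by rewrite -[omega]/(of_ord oomega) !dot_mul_ord.
Qed.

Lemma Xi_V_le x y : F x ⊑ F y <-> x ⊑ y.
Proof. by rewrite !Xi_VE simpler_concat omega_simpler. Qed.

(** The map F is a fixed prefix followed by W, which is continuous at limits. If a chain is
    interleaved with its images, continuity gives F S ⊑ S and monotony gives S ⊑ F S. It serves both
    the iterates of 0 and the limit stages of the induction for [Xi]. *)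
Lemma Xi_V_fix_sup (C : No -> Prop) S :
  (forall x, C x -> x ⊑ S) -> (forall t, (forall x, C x -> x ⊑ t) -> S ⊑ t) ->
  (exists x, C x) -> (forall x, C x -> exists y, [/\ C y, x ⊏ y, F x ⊑ y & x ⊑ F y]) -> F S = S.
Proof.
move=> H1 H2 [c0 Hc0] H3; apply: simpler_antisym; last first.
  apply: H2 => x /H3 [y [Cy _ _ S1]]; apply: simpler_eq_trans S1 _; exact/Xi_V_le/H1.
have cof x : x ⊏ S -> exists c, C c /\ x ⊏ c.
  move=> Hx; apply: NNPP => N; have : S ⊑ x.
    apply: H2 => c Cc; case: (simpler_chain (H1 _ Cc) (simplerW Hx)) => // /simpler_eqVlt [->|K]; first exact: simpler_refl.
    by case: N; exists c.
  by case: Hx => K N1 K2; apply: N1; exact: simpler_antisym K K2.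
have [c1 [Cc1 c01 Fc1 _]] := H3 _ Hc0.
have [u Eu] : exists u, S = D ∔ u.
  apply: simpler_ex; apply: simpler_eq_trans (H1 _ Cc1); apply: simpler_eq_trans Fc1.
  by rewrite Xi_VE; exact: concat_simpler.
rewrite Xi_VE [X in _ ⊑ X]Eu; apply/simpler_concat; apply: omega_limit.
- move=> y s Hs; split=> // E.
  have [c [Cc yc]] : exists c, C c /\ y ⊏ c by apply: cof; rewrite -E; exact: concat_sig_strict.
  have [c' [Cc' cc' _ _]] := H3 _ Cc.
  have cS : c ⊏ y ∔ sig s by rewrite E; apply: simpler_lt_le cc' (H1 _ Cc').
  move/strict_sig: cS => K; case: yc => K' N; apply: N; exact: simpler_antisym.
- move=> E; have := simpler_len (simpler_lt_le c01 (H1 _ Cc1)); rewrite E; exact: olt_0.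
move=> x /cof [c [Cc xc]]; have [c' [Cc' _ Fc' _]] := H3 _ Cc.
apply: simpler_eq_trans (proj2 (omega_simpler _ _) (simplerW xc)) _.
have := simpler_eq_trans Fc' (H1 _ Cc'); rewrite Xi_VE Eu; exact: (proj1 (simpler_concat _ _ _)).
Qed.

Notation v n := (Nat.iter n F 0%S).

Lemma v_le n : v n ⊏ v n.+1.
Proof.
elim: n => [|n [S N]]; last first.
  split; first exact/Xi_V_le.
  move=> /= E; apply: N; apply: simpler_antisym => //; apply/Xi_V_le; rewrite /= in E *.
  by rewrite -E; exact: simpler_refl.
split; first exact: simpler_0.
rewrite /= Xi_VE => /esym; apply: concat_neq0; rewrite omega0S => /(@of_ord_inj (onat 1) (onat 0)) E.
by have := osucc_gt (onat 0); rewrite -onatS E => /olt_irrefl.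
Qed.

Lemma V_sup : (forall n, v n ⊑ V rho a) /\ forall t, (forall n, v n ⊑ t) -> V rho a ⊑ t.
Proof.
have M n m : (n <= m)%N -> v n ⊑ v m.
  elim: m => [|m IH]; first by rewrite leqn0 => /eqP ->; exact: simpler_refl.
  rewrite leq_eqVlt => /orP [/eqP ->|/IH H]; first exact: simpler_refl.
  exact: simpler_eq_trans H (simplerW (v_le m)).
have [] := @sup_simplerP (fun x => exists n : nat, x = v n).
- by apply: (small_image small_nat) => x [n ->]; exists n.
- move=> x y [n ->] [m ->]; case: (leqP n m) => [|/ltnW] H; [left|right]; exact: M.
move=> H1 H2; split=> [n|t Ht]; first by apply: H1; exists n.
by apply: H2 => x [n ->].
Qed.

Lemma V_fixed : F (V rho a) = V rho a.
Proof.
have [H1 H2] := V_sup.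
apply: (@Xi_V_fix_sup (fun x => exists n, x = v n)).
- by move=> x [n ->].
- by move=> t Ht; apply: H2 => n; apply: Ht; exists n.
- by exists (v 0), 0%N.
move=> x [n ->]; exists (v n.+1); split; [by exists n.+1|exact: v_le|exact: simpler_refl|].
exact/simplerW/(simpler_lt_le (v_le n))/simplerW/(v_le n.+1).
Qed.

Lemma V_le_fixed x : F x = x -> V rho a ⊑ x.
Proof.
move=> E; apply: (proj2 V_sup); elim=> [|n IH]; first exact: simpler_0.
by rewrite /= -E; exact/Xi_V_le.
Qed.

Lemma tauo_Xi_V z : tauo (F z) = oadd del (oW (tauo z)).
Proof. by rewrite Xi_VE !tauo_concat tauo_ord tauo_neg_ord oadd0 tauo_omega. Qed.

(** T = tau (V a) satisfies T = del + w^T, which makes it an epsilon number above oT (tau a).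
    Conversely every iterate of 0 has fewer signs 1 than the next epsilon number. *)
Lemma tauo_V : tauo (V rho a) = oT (tauo (a ∔ sig plus)).
Proof.
rewrite tauo_plus; have Fx := oT_fixed (ole_lt_trans (ole_0 _) (osucc_gt (tauo a))).
have E := f_equal tauo V_fixed; rewrite tauo_Xi_V in E; apply: ole_antisym.
  have tv n : olt (tauo (v n)) (oT (osucc (tauo a))).
    elim: n => [|n IH]; first by rewrite tauo0; exact: ole_lt_trans (ole_0 _) (oT_lt (osucc_gt _)).
    rewrite tauo_Xi_V -Fx; apply: oW_add_lt; apply: oW_lt => //.
    rewrite osucc_oadd1 -Fx; apply: oW_add_lt; rewrite Fx; first exact/oT_lt/osucc_gt.
    by rewrite -Fx -oW0; apply: oW_lt; exact: ole_lt_trans (ole_0 _) (oT_lt (osucc_gt _)).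
  apply: ole_all => c /tauoP [x [Hx <-]].
  have [n Hn] : exists n, x ⊏ v n.
    apply: NNPP => N; have : V rho a ⊑ x.
      apply: (proj2 V_sup) => n; case: (simpler_chain (proj1 V_sup n) (simplerW (proj1 Hx))) => // /simpler_eqVlt [->|K]; first exact: simpler_refl.
      by case: N; exists n.
    by case: (proj1 Hx) => K N1 K2; apply: N1; exact: simpler_antisym K K2.
  exact: ole_lt_trans (tauo_le (simplerW Hn)) (tv n).
rewrite oT_succ; apply: Enext_least.
  by apply: ole_antisym (oW_ge _); rewrite -{2}E; exact: oadd_le_r.
rewrite -E; apply: olt_le_trans (oadd_le_l _ _); apply: olt_le_trans (oW_ge _).
exact: osucc_gt.
Qed.

(** * Comparison of Xi with Phi *)

Notation t0 := (tauo (a ∔ sig plus)).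
Let P z := oT (osucc (oadd t0 (tauo z))).
Let M z := opw (oT (oadd t0 (tauo z))).
Notation f z := (V rho a ∔ Phi eps a z).

Lemma phi_plus z : phi eps a z plus = of_ord (P z).
Proof.
rewrite /phi eps_ext_tau // -[1%S]/(sig plus) tauo_plus tauo_concat //.
Qed.

Lemma phi_minus z : phi eps a z minus = neg (of_ord (M z)).
Proof.
by rewrite /phi eps_ext_tau // -[1%S]/(sig plus) tauo_concat dot_pow_omega.
Qed.

Lemma PhiE z : Phi eps a z = csum (phi eps a) z.
Proof. by []. Qed.

Lemma f_next z s : f (z ∔ sig s) = f z ∔ phi eps a z s.
Proof. by rewrite !PhiE csum_next concatA. Qed.

Lemma tauo_f z : tauo (f z) = oT (oadd t0 (tauo z)).
Proof. exact: (@tauo_csum (phi eps a) M t0 _ z phi_plus phi_minus tauo_V). Qed.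

Lemma f_le x y : x ⊑ y -> f x ⊑ f y.
Proof. by move=> H; apply/simpler_concat; rewrite !PhiE; exact: csum_le. Qed.

Lemma f0 : f 0%S = V rho a.
Proof. by rewrite PhiE csum0 concat0. Qed.

Lemma f_limit z t : is_limit z -> z <> 0%S -> (forall y, y ⊏ z -> f y ⊑ t) -> f z ⊑ t.
Proof.
move=> L N H; have Vt : V rho a ⊑ t.
  by rewrite -f0; apply: H; split; [exact: simpler_0|move=> E; apply: N].
case: (simpler_ex Vt) => u E; rewrite E; apply/simpler_concat; rewrite PhiE; apply: csum_sup => y s /L S.
by rewrite -csum_next -PhiE; apply/(simpler_concat (V rho a)); rewrite -E; exact: H.
Qed.

Let t0_gt0 z : olt (onat 0) (oadd t0 (tauo z)).
Proof. apply: olt_le_trans (oadd_le_l _ _); rewrite tauo_plus; exact: ole_lt_trans (ole_0 _) (osucc_gt _). Qed.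

Let Xi_fixed z : F (Xi z) = Xi z := par_in hXi z.

Lemma Xi_lopt x y : lopt x y -> lopt (Xi x) (Xi y).
Proof. by have [_ [H1 H2]] := hXi; case=> S L; split; [apply/H2|apply/H1]. Qed.

Lemma Xi_ropt x y : ropt x y -> ropt (Xi x) (Xi y).
Proof. by have [_ [H1 H2]] := hXi; case=> S L; split; [apply/H2|apply/H1]. Qed.

(** P z absorbs T = tau (Xi z), so [Xi z] followed by P z signs 1 is fixed. Hence [Xi (z ∔ 1)] is
    [Xi z] followed by some g > 0 with g = w^(T + g), an epsilon number above T and so at least P
    z. *)
Lemma Xi_plus z : Xi z = f z -> Xi (z ∔ sig plus) = f (z ∔ sig plus).
Proof.
move=> IH; rewrite f_next phi_plus -IH.
have Et : tauo (Xi z) = oT (oadd t0 (tauo z)) by rewrite IH tauo_f.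
have FP : oW (P z) = P z by apply: oT_fixed; exact: ole_lt_trans (ole_0 _) (osucc_gt _).
have P0 : olt (onat 0) (P z) by apply: ole_lt_trans (ole_0 _) (oT_lt (osucc_gt _)).
have FX g : olt (onat 0) g -> F (Xi z ∔ of_ord g) = Xi z ∔ of_ord (oW (oadd (tauo (Xi z)) g)).
  by move=> g0; rewrite Xi_VE omega_concat_ord // concatA -Xi_VE Xi_fixed.
have SX := concat_simpler (Xi z) (of_ord (P z)).
have S : Xi (z ∔ sig plus) ⊑ Xi z ∔ of_ord (P z).
  apply: (par_cut hXi).
  - rewrite /fixed FX // Et -{1}FP oW_absorb ?FP //; exact/oT_lt/osucc_gt.
  - have K : lopt (Xi z) (Xi z ∔ of_ord (P z)) by rewrite -{1}(concat0 (Xi z)); exact: lopt_concat_ord.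
    by move=> x /lopt_concat_plus [->|/Xi_lopt H]; apply: lopt_lt => //; exact: lopt_ext H SX.
  - by move=> x /ropt_concat_plus /Xi_ropt H; apply: ropt_lt; exact: ropt_ext H SX.
have S2 : Xi z ⊏ Xi (z ∔ sig plus) by have [_ [_ H]] := hXi; apply/H; exact: concat_sig_strict.
have [g E] := simpler_concat_ord (simplerW S2) S.
have g0 : olt (onat 0) g by apply: opos => g0; case: S2 => _; apply; rewrite E g0 concat0.
have := Xi_fixed (z ∔ sig plus); rewrite E FX // => /concat_inj /of_ord_inj Eg.
congr (_ ∔ of_ord _); apply: ole_antisym; first by move: S; rewrite E => /simpler_concat /of_ord_simpler.
rewrite /P oT_succ -Et; apply: Enext_least.
  by apply: ole_antisym (oW_ge _); rewrite -{2}Eg; apply: oW_le; exact: oadd_le_r.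
rewrite -Eg; apply: olt_le_trans (oW_ge _); rewrite -{1}(oadd0 (tauo (Xi z))); exact: oadd_lt.
Qed.

(** As in [Xi_plus], with the equation g = w^(T + 1) g: [opw_fixed] shows that the candidate is
    fixed, [opw_least] that no shorter tail is possible. *)
Lemma Xi_minus z : Xi z = f z -> Xi (z ∔ sig minus) = f (z ∔ sig minus).
Proof.
move=> IH; rewrite f_next phi_minus -IH.
have Et : tauo (Xi z) = oT (oadd t0 (tauo z)) by rewrite IH tauo_f.
have FT : oW (tauo (Xi z)) = tauo (Xi z) by rewrite Et; exact: oT_fixed.
have EM : M z = opw (tauo (Xi z)) by rewrite Et.
have FX g : F (Xi z ∔ neg (of_ord g)) = Xi z ∔ neg (of_ord (omul (oW (osucc (tauo (Xi z)))) g)).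
  by rewrite Xi_VE omega_concat_neg concatA -Xi_VE Xi_fixed.
have SX := concat_simpler (Xi z) (neg (of_ord (M z))).
have S : Xi (z ∔ sig minus) ⊑ Xi z ∔ neg (of_ord (M z)).
  apply: (par_cut hXi).
  - by rewrite /fixed FX EM opw_fixed.
  - by move=> x /lopt_concat_minus /Xi_lopt H; apply: lopt_lt; exact: lopt_ext H SX.
  - have K : ropt (Xi z) (Xi z ∔ neg (of_ord (M z))).
      by rewrite -{1}(concat0 (Xi z)) -neg0; apply: ropt_concat_neg; rewrite EM; exact: opw_gt0.
    by move=> x /ropt_concat_minus [->|/Xi_ropt H]; apply: ropt_lt => //; exact: ropt_ext H SX.
have S2 : Xi z ⊏ Xi (z ∔ sig minus) by have [_ [_ H]] := hXi; apply/H; exact: concat_sig_strict.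
have [g E] := simpler_concat_neg (simplerW S2) S.
have g0 : olt (onat 0) g.
  by apply: opos => g0; case: S2 => _; apply; rewrite E g0 [neg _]neg0 concat0.
have := Xi_fixed (z ∔ sig minus); rewrite E FX => /concat_inj /neg_inj /of_ord_inj Eg.
congr (_ ∔ neg (of_ord _)); apply: ole_antisym.
  by move: S; rewrite E => /simpler_concat /simpler_neg; rewrite !negK => /of_ord_simpler.
by rewrite EM; apply: opw_least.
Qed.

(** At z = 0 this is the minimality of V a. Otherwise f z is the supremum of earlier fixed values
    and so is fixed itself. It lies beyond the image of an option x because it prolongs the value at
    x ∔ 1 or x ∔ -1, which is still an initial segment of the limit z. *)
Lemma Xi_limit z : is_limit z -> (forall y, y ⊏ z -> Xi y = f y) -> Xi z = f z.
Proof.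
move=> L IH; case: (classic (z = 0%S)) => [->|N].
  rewrite f0; apply: simpler_antisym; last by apply: V_le_fixed; exact: Xi_fixed.
  by apply: (par_cut hXi); [exact: V_fixed| |] => x [/simpler_len /olt_0].
have Lp y s : y ∔ sig s ⊑ z -> Xi (y ∔ sig s) = f (y ∔ sig s) by move/L; exact: IH.
apply: simpler_antisym; last first.
  by apply: f_limit => // y Hy; rewrite -IH //; apply/(par_simpler hXi)/simplerW.
apply: (par_cut hXi).
- apply: (@Xi_V_fix_sup (fun x => exists y, y ⊏ z /\ x = f y)).
  + by move=> x [y [Hy ->]]; exact/f_le/simplerW.
  + by move=> t Ht; apply: f_limit => // y Hy; apply: Ht; exists y.
  + exists (f 0%S), 0%S; split=> //; split; first exact: simpler_0.
    by move=> E; apply: N.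
  move=> x [y [Hy ->]]; have [s Hs] := simpler_next Hy.
  have K : f y ⊏ f (y ∔ sig s).
    by rewrite -Lp // -IH //; have [_ [_ H]] := hXi; apply/H; exact: concat_sig_strict.
  exists (f (y ∔ sig s)); split=> //; first by exists (y ∔ sig s); split=> //; exact: L.
    by rewrite -IH // Xi_fixed IH //; exact: simplerW.
  by rewrite -Lp // Xi_fixed Lp //; exact: simplerW.
- move=> x /lopt_sig Hx; apply: lopt_lt; apply: lopt_ext (Xi_lopt (lopt_sig_plus x)) _.
  by rewrite Lp //; exact: f_le.
- move=> x /ropt_sig Hx; apply: ropt_lt; apply: ropt_ext (Xi_ropt (ropt_sig_minus x)) _.
  by rewrite Lp //; exact: f_le.
Qed.

Lemma Xi_eq z : Xi z = f z.
Proof.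
elim/No_ind: z => [z [] IH|z L IH]; [exact: Xi_minus|exact: Xi_plus|exact: Xi_limit].
Qed.

End Final.

Bind Scope surreal_scope with No.
Local Close Scope ring_scope.
Local Open Scope surreal_scope.

Theorem mainTheorem12
  (eps : No -> No) (heps : parametrises eps (fixed omega_map))
  (rho : No -> No)
  (hrho : parametrises (fun z => omega_map (omega_map (rho z))) log_atomic)
  (a : No)
  (Xi : No -> No) (hXi : parametrises Xi (fixed (Xi_V rho a)))
  (z : No) :
  Xi z = V rho a ∔ Phi eps a z.
Proof. exact: (Xi_eq heps hrho hXi z). Qed.
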